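(* Let $N \in \mathbb{N}$ and $\ell \in \{0,\ldots,N-1\}$. Set $n = \lfloor \frac{N}{2} \rfloor$ and $\alpha_0 = N \bmod 2 \in \{0,1\}$. Let $\underline{\mathbf{u}}_1,\ldots,\underline{\mathbf{u}}_{n+\alpha_0}$ be a sequence of primary $1$-pulses (defined in the context; all for the same parameters $\zeta,f,\varepsilon$, possibly with different angles $\theta_0$). For each $\mathbf{k} \in \mathbb{N}^n$, denote by $\underline{\mathbf{u}}_{\mathbf{k},\ell}$ the associated $N$-pulse solution (defined in the context) of the Lugiato-Lefever system $$\mathbf{u}_t = J (- \mathbf{u}_{xx} + \zeta \mathbf{u} - |\mathbf{u}|^2\mathbf{u} ) + \varepsilon (-\mathbf{u} + \mathbf{F}). \qquad (\mathrm{S})$$ The following assertions hold. (i) If $\underline{\mathbf{u}}_1,\ldots,\underline{\mathbf{u}}_{n+\alpha_0}$ are spectrally stable solutions of (S), then there exists a constant $k_0 \in \mathbb{N}$ such that, whenever $\mathbf{k} = (k_1,\ldots,k_n) \in \mathbb{N}^n$ satisfies $\min\{k_1,\ldots,k_n\} \geq k_0$, the $N$-pulse solution $\underline{\mathbf{u}}_{\mathbf{k},\ell}$ of (S) is spectrally stable if $\ell = N-1$ and spectrally unstable if $\ell \neq N-1$. (ii) If there exists $i \in \{1,\ldots,n+\alpha_0\}$ such that $\underline{\mathbf{u}}_i$ is a spectrally unstable solution of (S), then there exists a constant $k_0 \in \mathbb{N}$ such that, whenever $\mathbf{k} = (k_1,\ldots,k_n) \in \mathbb{N}^n$ satisfies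 $\min\{k_1,\ldots,k_n\} \geq k_0$, the $N$-pulse solution $\underline{\mathbf{u}}_{\mathbf{k},\ell}$ of (S) is spectrally unstable.
   Context: Setting. Let $\zeta,f>0$, $\varepsilon>0$, $J = \begin{pmatrix} 0 & 1 \\ -1 & 0\end{pmatrix}$, $\mathbf{F} = (f,0)^\top$, $\mathbf{u}=(\mathbf{u}_1,\mathbf{u}_2)^\top \in \mathbb{R}^2$. Stationary solutions of (S) correspond, via $U = (\mathbf{u}_1,\mathbf{u}_2,\mathbf{u}_1',\mathbf{u}_2')^\top$, to solutions of $U' = F(U;\varepsilon)$ with $$F(U;\varepsilon) = \begin{pmatrix} U_3 \\ U_4 \\ \zeta U_1 + \varepsilon U_2 -(U_1^2 + U_2^2) U_1 \\ \zeta U_2 - \varepsilon U_1 -(U_1^2 + U_2^2) U_2 + \varepsilon f\end{pmatrix}.$$ For bounded $\underline{\mathbf{u}} \colon \mathbb{R}\to\mathbb{R}^2$ put $$L(\underline{\mathbf{u}})= - \partial_x^2 +\zeta - \begin{pmatrix} 3 \underline{\mathbf{u}}_1^2 + \underline{\mathbf{u}}_2 ^2 & 2 \underline{\mathbf{u}}_1 \underline{\mathbf{u}}_2 \\ 2 \underline{\mathbf{u}}_1 \underline{\mathbf{u}}_2 & \underline{\mathbf{u}}_1^2 + 3\underline{\mathbf{u}}_2 ^2\end{pmatrix}, \qquad \mathcal{L}(\underline{\mathbf{u}}) = JL(\underline{\mathbf{u}}),$$ operators on $L^2(\mathbb{R})$ ($\mathbb{C}^2$-valued) with domain $H^2(\mathbb{R})$;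 the linearization of (S) about $\underline{\mathbf{u}}$ is $\mathcal{L}(\underline{\mathbf{u}})-\varepsilon$. A stationary solution $\underline{\mathbf{u}}$ with $\underline{\mathbf{u}}(x)\to\mathbf{u}_\infty$ as $x\to\pm\infty$ is spectrally stable if there is $\tau>0$ with $\sigma(\mathcal{L}(\underline{\mathbf{u}})-\varepsilon) \subset \{\operatorname{Re}\lambda \leq -\tau\} \cup \{0\}$ and $0$ is an algebraically simple eigenvalue; a bounded stationary solution is spectrally unstable if $\sigma(\mathcal{L}(\underline{\mathbf{u}})-\varepsilon)$ contains some $\lambda$ with $\operatorname{Re}\lambda>0$. A homoclinic solution $\underline{U}$ of $U'=F(U;\varepsilon)$ is nondegenerate if every bounded solution of $U' = \partial_U F(\underline{U}(x);\varepsilon) U$ is a scalar multiple of $\underline{U}'$. An equilibrium $U_\infty$ is a saddle-focus if $\partial_UF(U_\infty;\varepsilon)$ has the four eigenvalues $\pm\alpha\pm\mathrm{i}\beta$ with $\alpha,\beta>0$. Primary $1$-pulses. Suppose $\zeta,f>0$ and $\theta_0\in\mathbb{R}$ obey $\pi^2f^2 > 8\zeta$, $\pi f\cos\theta_0 = 2\sqrt{2\zeta}$, $\sin\theta_0\neq0$. By a known theorem there exist $C_*,\varepsilon_*>0$ such that for all $\varepsilon\in(0,\varepsilon_* )$ there are $\mathbf{u}_{\infty,\varepsilon}\in\mathbb{R}^2$ and an even smooth stationary solution $\underline{\mathbf{u}}_\varepsilon\colon\mathbb{R}\to\mathbb{R}^2$ of (S) with $\|\underline{\mathbf{u}}_\varepsilon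 - \boldsymbol{\phi}_{\theta_0}\|_{L^\infty}\le C_*\varepsilon$, $|\mathbf{u}_{\infty,\varepsilon}| \leq C_*\varepsilon$, $\underline{\mathbf{u}}_\varepsilon - \mathbf{u}_{\infty,\varepsilon} \in H^2(\mathbb{R})$, where $\boldsymbol{\phi}_{\theta}(x) = \sqrt{2\zeta}\operatorname{sech}(\sqrt{\zeta}x)(\cos\theta,\sin\theta)^\top$; $\underline{\mathbf{u}}_\varepsilon$ is spectrally stable if $\sin\theta_0>0$ and spectrally unstable if $\sin\theta_0<0$, and in both cases $\ker(\mathcal{L}(\underline{\mathbf{u}}_\varepsilon)-\varepsilon)=\operatorname{span}\{\underline{\mathbf{u}}_\varepsilon'\}$. For each such $\theta_0$ fix such a family; its members are called the primary $1$-pulses. The threshold $\varepsilon_*$ is taken small enough that, for $\varepsilon\in(0,\varepsilon_* )$, $(\underline{\mathbf{u}}_\varepsilon,\underline{\mathbf{u}}_\varepsilon')^\top$ is a nondegenerate homoclinic to a saddle-focus equilibrium; $\varepsilon$ lies below the thresholds of all angles involved. $N$-pulse solutions. With $N,\ell,n,\alpha_0$ and primary $1$-pulses $\underline{\mathbf{u}}_1,\ldots,\underline{\mathbf{u}}_{n+\alpha_0}$ (common end state $\mathbf{u}_\infty$) as in the claim, the following existence result is available: there are constants $\delta_0,C_0>0$ such that for each $\mathbf{k}\in\mathbb{N}^n$ there are distances $T_{i,\ell}^{k_i}>0$, with $\{T_{i,\ell}^k\}_k$ increasing to $\infty$ for each $i$, and an even smooth stationary solution $\underline{\mathbf{u}}_{\mathbf{k},\ell}$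 of (S) such that for all $x\in\mathbb{R}$ $$\Big|\underline{\mathbf{u}}_{\mathbf{k},\ell}(x) - \mathbf{u}_\infty - \alpha_0 (\underline{\mathbf{u}}_{n+\alpha_0}(x) - \mathbf{u}_\infty) - \sum_{i = 1}^n \big(\underline{\mathbf{u}}_i(x - s_i) + \underline{\mathbf{u}}_i(x + s_i) - 2\mathbf{u}_\infty\big) \Big| \leq \frac{C_0}{\min\{k_1,\ldots,k_n\}},\quad s_i = T_{1,\ell}^{k_1}+\ldots+T_{i,\ell}^{k_i};$$ the spectrum of $\mathcal{L}(\underline{\mathbf{u}}_{\mathbf{k},\ell})-\varepsilon$ in $B_{\delta_0}(0)$ consists of $N$ eigenvalues counted with algebraic multiplicity, namely $\ell$ with negative real part, $N-1-\ell$ with positive real part, and the algebraically simple eigenvalue $0$; and $(\underline{\mathbf{u}}_{\mathbf{k},\ell},\underline{\mathbf{u}}_{\mathbf{k},\ell}')^\top$ is a nondegenerate homoclinic solution of $U'=F(U;\varepsilon)$ to a saddle-focus equilibrium. Fix such a family; its members are the associated $N$-pulse solutions. Conventions: $\mathbb{N}=\{1,2,\dots\}$; for $n=0$ the minimum over the empty set is $+\infty$. *)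

(* Defs.v *)
From HB Require Import structures.
From mathcomp Require Import all_boot all_order all_algebra.
From mathcomp Require Import complex.
From mathcomp Require Import all_classical all_reals all_analysis.

Set Implicit Arguments.
Unset Strict Implicit.
Unset Printing Implicit Defensive.

Import Order.TTheory GRing.Theory Num.Theory.
Import numFieldNormedType.Exports.

Local Open Scope classical_set_scope.
Local Open Scope ring_scope.

Section Vectors.
Variable K : pzRingType.

Definition cv2 (a b : K) : 'cV[K]_2 := \col_(i < 2) [:: a; b]`_i.

Definition mx2 (a b c d : K) : 'M[K]_2 :=
  \matrix_(i < 2, j < 2) (nth [::] [:: [:: a; b]; [:: c; d]] i)`_j.

Definition Jmx : 'M[K]_2 := mx2 0 1 (-1) 0.
End Vectors.
Arguments Jmx {K}.

Section ODE.
Variable R : realType.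
Implicit Types (zeta f eps : R) (u : R -> 'cV[R]_2).

(* The library norm on matrices is the sup norm; this is the Euclidean one. *)
Definition enorm m (v : 'cV[R]_m) : R := Num.sqrt (\sum_i v i 0 ^+ 2).

Definition forcing f : 'cV[R]_2 := cv2 f 0.

Definition smooth u := forall n x, derivable (derive1n n u) x 1.

Definition even_fun u := forall x, u (- x) = u x.

Definition tends_to m (U : R -> 'cV[R]_m.+1) (Uinf : 'cV[R]_m.+1) :=
  U x @[x --> +oo] --> Uinf /\ U x @[x --> -oo] --> Uinf.

(* u_t = 0 in u_t = J (- u_xx + zeta u - |u|^2 u) + eps (- u + F). *)
Definition stationary zeta f eps u :=
  [/\ forall x, derivable u x 1, forall x, derivable (derive1 u) x 1 &
      forall x, Jmx *m (- derive1n 2 u x + zeta *: u x - enorm (u x) ^+ 2 *: u x)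
                + eps *: (- u x + forcing f) = 0].

(* Components are numbered from 0: U 0 0, ..., U 3 0 are U_1, ..., U_4. *)
Definition vfield zeta f eps (U : 'cV[R]_4) : 'cV[R]_4 :=
  \col_(i < 4)
   [:: U 2 0;
       U 3 0;
       zeta * U 0 0 + eps * U 1 0 - (U 0 0 ^+ 2 + U 1 0 ^+ 2) * U 0 0;
       zeta * U 1 0 - eps * U 0 0 - (U 0 0 ^+ 2 + U 1 0 ^+ 2) * U 1 0
         + eps * f]`_i.

(* The library's [jacobian] acts on row vectors; this is its column version. *)
Definition jac (G : 'cV[R]_4 -> 'cV[R]_4) (U : 'cV[R]_4) : 'M[R]_4 :=
  \matrix_(i < 4, j < 4) ('D_(delta_mx j 0) G U) i 0.

Definition phase u (x : R) : 'cV[R]_4 := col_mx (u x) (derive1 u x).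

Definition homoclinic zeta f eps (U : R -> 'cV[R]_4) (Uinf : 'cV[R]_4) :=
  [/\ vfield zeta f eps Uinf = 0,
      forall x : R, is_derive x 1 U (vfield zeta f eps (U x)),
      tends_to U Uinf &
      exists x, U x != Uinf].

Definition nondegenerate_solution zeta f eps (U : R -> 'cV[R]_4) :=
  forall V : R -> 'cV[R]_4,
    (forall x : R, is_derive x 1 V (jac (vfield zeta f eps) (U x) *m V x)) ->
    [bounded V x | x in [set: R]] ->
    exists c : R, forall x, V x = c *: derive1 U x.

Definition saddle_focus zeta f eps (Uinf : 'cV[R]_4) :=
  vfield zeta f eps Uinf = 0 /\
  exists a b : R, [/\ 0 < a, 0 < b &
    forall z : R[i],
      eigenvalue (map_mx (real_complex R) (jac (vfield zeta f eps) Uinf)) z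
      = (z \in [:: Complex a b; Complex a (- b);
                   Complex (- a) b; Complex (- a) (- b)])].

Definition nondegenerate_saddle_focus_homoclinic zeta f eps u :=
  exists Uinf, [/\ homoclinic zeta f eps (phase u) Uinf,
                   nondegenerate_solution zeta f eps (phase u) &
                   saddle_focus zeta f eps Uinf].

End ODE.

(* Elements of L^2(R; C^2) are represented by measurable functions,           *)
(* identified when equal almost everywhere. An (unbounded) operator on L^2 is *)
(* given by its graph: [A w v] means w \in D(A) and A w = v, and graphs are   *)
(* invariant under changing the representatives.                              *)
Section Operators.
Variable R : realType.
Local Notation C := R[i].
Local Notation mu := (@lebesgue_measure R).
Implicit Types (w v g : R -> 'cV[C]_2) (A : (R -> 'cV[C]_2) -> (R -> 'cV[C]_2) -> Prop).

Definition aeeq w v := {ae mu, forall x, w x = v x}.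

Definition cnorm (z : 'cV[C]_2) : R :=
  Num.sqrt (\sum_i (complex.Re (z i 0) ^+ 2 + complex.Im (z i 0) ^+ 2)).

Definition L2norm w : \bar R := 'N[mu]_2%:E[EFin \o (fun x => cnorm (w x))]%E.

Definition inL2 w :=
  (forall i, measurable_fun [set: R] (fun x => complex.Re (w x i 0)) /\
             measurable_fun [set: R] (fun x => complex.Im (w x i 0)))
  /\ (L2norm w < +oo)%E.

Definition test_fun (phi : R -> R) :=
  [/\ forall x, derivable phi x 1, continuous (derive1 phi) &
      exists M, forall x, M < `|x| -> phi x = 0].

(* v is the weak derivative of w; real C^1_c test functions suffice, applied   *)
(* to the real and imaginary parts of each component.                         *)
Definition weak_derivative w v :=
  forall phi, test_fun phi -> forall i,
    (\int[mu]_x (derive1 phi x * complex.Re (w x i 0)) =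
       - \int[mu]_x (phi x * complex.Re (v x i 0)))%R /\
    (\int[mu]_x (derive1 phi x * complex.Im (w x i 0)) =
       - \int[mu]_x (phi x * complex.Im (v x i 0)))%R.

(* w \in H^2(R) with second weak derivative w2. *)
Definition H2_deriv2 w w2 :=
  exists w1, [/\ inL2 w, inL2 w1, inL2 w2,
                 weak_derivative w w1 & weak_derivative w1 w2].

Definition inH2 w := exists w2, H2_deriv2 w w2.

Definition resolvent_set A (z : C) :=
  (forall w v, A w v -> aeeq v (fun x => z *: w x) -> aeeq w (fun=> 0)) /\
  exists c : R, forall g, inL2 g ->
    exists w v, [/\ A w v, aeeq (fun x => v x - z *: w x) g &
                    (L2norm w <= c%:E * L2norm g)%E].

Definition spectrum A (z : C) := ~ resolvent_set A z.

Fixpoint in_ker_pow A (z : C) (k : nat) w : Prop :=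
  if k is k'.+1
  then exists v, A w v /\ in_ker_pow A z k' (fun x => v x - z *: w x)
  else aeeq w (fun=> 0).

Definition generalized_eigenvector A (z : C) w := exists k, in_ker_pow A z k w.

(* The generalized eigenspace of A at z has dimension m. *)
Definition alg_mult A (z : C) (m : nat) :=
  exists b : 'I_m -> R -> 'cV[C]_2,
    [/\ forall i, generalized_eigenvector A z (b i),
        forall c : 'I_m -> C,
          aeeq (fun x => \sum_i c i *: b i x) (fun=> 0) -> forall i, c i = 0 &
        forall w, generalized_eigenvector A z w ->
          exists c : 'I_m -> C, aeeq w (fun x => \sum_i c i *: b i x)].

Definition simple_eigenvalue A (z : C) := alg_mult A z 1.

End Operators.

Section LugiatoLefever.
Variable R : realType.
Local Notation C := R[i].
Local Notation mu := (@lebesgue_measure R).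
Implicit Types (zeta f eps theta : R) (u : R -> 'cV[R]_2).
Implicit Types (w v : R -> 'cV[C]_2).

Definition cplx (m n : nat) (M : 'M[R]_(m, n)) : 'M[C]_(m, n) :=
  map_mx (real_complex R) M.

Definition potential (a : 'cV[R]_2) : 'M[R]_2 :=
  mx2 (3 * a 0 0 ^+ 2 + a 1 0 ^+ 2) (2 * a 0 0 * a 1 0)
      (2 * a 0 0 * a 1 0) (a 0 0 ^+ 2 + 3 * a 1 0 ^+ 2).

(* L(u) w, where w2 is the second derivative of w. *)
Definition Lop zeta u w w2 (x : R) : 'cV[C]_2 :=
  - w2 x + real_complex R zeta *: w x - cplx (potential (u x)) *m w x.

(* The graph of J L(u) - eps on L^2(R; C^2), with domain H^2(R; C^2). *)
Definition linearization zeta eps u w v :=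
  exists w2, [/\ H2_deriv2 w w2, inL2 v &
    aeeq v (fun x => Jmx *m Lop zeta u w w2 x - real_complex R eps *: w x)].

Definition spectrally_stable zeta f eps u :=
  [/\ stationary zeta f eps u,
      exists uinf, tends_to u uinf,
      exists tau : R, 0 < tau /\
        forall z, spectrum (linearization zeta eps u) z ->
          complex.Re z <= - tau \/ z = 0 &
      simple_eigenvalue (linearization zeta eps u) 0].

Definition spectrally_unstable zeta f eps u :=
  [/\ stationary zeta f eps u,
      [bounded u x | x in [set: R]] &
      exists z, spectrum (linearization zeta eps u) z /\ 0 < complex.Re z].

Definition sech (x : R) : R := 2 / (expR x + expR (- x)).

Definition soliton zeta theta (x : R) : 'cV[R]_2 :=
  (Num.sqrt (2 * zeta) * sech (Num.sqrt zeta * x)) *: cv2 (cos theta) (sin theta).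

Definition admissible_angle zeta f theta :=
  [/\ 8 * zeta < pi ^+ 2 * f ^+ 2,
      pi * f * cos theta = 2 * Num.sqrt (2 * zeta) &
      sin theta != 0].

(* A family eps |-> u eps of primary 1-pulses with angle theta, end states    *)
(* uinf eps, and constants Cst and epsst.                                     *)
Definition primary_family zeta f theta (Cst epsst : R) (uinf : R -> 'cV[R]_2)
    (u : R -> R -> 'cV[R]_2) :=
  0 < Cst /\ 0 < epsst /\ forall eps, 0 < eps < epsst ->
    [/\ [/\ even_fun (u eps), smooth (u eps) & stationary zeta f eps (u eps)],
        [/\ ('N[mu]_+oo[EFin \o (fun x => enorm (u eps x - soliton zeta theta x)%R)]
               <= (Cst * eps)%:E)%E,
            enorm (uinf eps) <= Cst * eps &
            inH2 (fun x => cplx (u eps x - uinf eps))],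
        (0 < sin theta -> spectrally_stable zeta f eps (u eps)) /\
        (sin theta < 0 -> spectrally_unstable zeta f eps (u eps)),
        forall w, inL2 w ->
          (linearization zeta eps (u eps) w (fun=> 0) <->
           exists c : C, aeeq w (fun x => c *: cplx (derive1 (u eps) x))) &
        nondegenerate_saddle_focus_homoclinic zeta f eps (u eps)].

(* The minimum of k_1, ..., k_n in [\bar R], equal to +oo if n = 0. *)
Definition kmin n (k : 'I_n -> nat) : \bar R :=
  (\big[Order.min/+oo]_(i < n) (k i)%:R%:E)%E.

(* s_i = T_1^{k_1} + ... + T_i^{k_i}. *)
Definition pulse_shift n (T : 'I_n -> nat -> R) (k : 'I_n -> nat) (i : 'I_n) : R :=
  \sum_(j < n | (j <= i)%N) T j (k j).

(* The superposition of the pulses p; the pulses p (lshift _ i) with i < n    *)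
(* are placed at +- s_i, and the sum over j < a0 (with a0 = 0 or 1) is        *)
(* alpha_0 times the central pulse, the last one of the sequence p.           *)
Definition superposition n a0 (p : 'I_(n + a0) -> R -> 'cV[R]_2)
    (uinf : 'cV[R]_2) (s : 'I_n -> R) (x : R) : 'cV[R]_2 :=
  uinf + \sum_(j < a0) (p (rshift n j) x - uinf)
  + \sum_(i < n) (p (lshift a0 i) (x - s i) + p (lshift a0 i) (x + s i)
                  - 2 *: uinf).

(* The spectrum of A in B_delta(0) consists of N eigenvalues counted with     *)
(* algebraic multiplicity (listed in s with repetition): l with negative real *)
(* part, N - 1 - l with positive real part, and the simple eigenvalue 0.      *)
Definition small_spectrum (A : (R -> 'cV[C]_2) -> (R -> 'cV[C]_2) -> Prop)
    (delta : R) (N l : nat) :=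
  exists s : seq C,
    [/\ forall z, z \in s <-> spectrum A z /\ `|z| < real_complex R delta,
        forall z, z \in s -> alg_mult A z (count_mem z s),
        size s = N,
        count (fun z => complex.Re z < 0) s = l /\
        count (fun z => 0 < complex.Re z) s = (N - 1 - l)%N &
        count_mem 0 s = 1%N].

Definition Npulse_family zeta f eps (N l n a0 : nat)
    (p : 'I_(n + a0) -> R -> 'cV[R]_2) (uinf : 'cV[R]_2) (delta0 C0 : R)
    (T : 'I_n -> nat -> R) (u : ('I_n -> nat) -> R -> 'cV[R]_2) :=
  [/\ 0 < delta0, 0 < C0,
      forall i, [/\ forall k, (0 < k)%N -> 0 < T i k,
                    forall k k', (0 < k <= k')%N -> T i k <= T i k' &
                    T i k @[k --> \oo] --> +oo] &
      forall k : 'I_n -> nat, (forall i, (0 < k i)%N) ->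
        [/\ [/\ even_fun (u k), smooth (u k) & stationary zeta f eps (u k)],
            forall x, ((enorm (u k x - superposition p uinf (pulse_shift T k) x))%:E
                         <= C0%:E / kmin k)%E,
            small_spectrum (linearization zeta eps (u k)) delta0 N l &
            nondegenerate_saddle_focus_homoclinic zeta f eps (u k)]].

End LugiatoLefever.

(* Main.v *)
Require Import Defs.
From HB Require Import structures.
From mathcomp Require Import all_boot all_order all_algebra.
From mathcomp Require Import complex.
From mathcomp Require Import all_classical all_reals all_analysis.
From mathcomp Require Import measurable_realfun.
From mathcomp Require Import ring lra.

(* The saddle-focus condition forces |u_oo|^2 < eps, and J L(u) - eps is a     *)
(* skew-adjoint operator plus a zeroth-order term whose symmetric part is at   *)
(* most |u(x)|^2 - eps. Hence to the right of some line Re z = -g the operator *)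
(* is a relatively compact perturbation of a boundedly invertible one, and the *)
(* spectrum there consists of eigenvalues, isolated since none lie far right.  *)
(* To see this concretely, write w = (1 - d^2/dx^2)^(-1) g; the equation       *)
(* becomes a bounded one for g, and sampling w at finitely many points reduces *)
(* it to a finite determinant.                                                 *)
(* If z0 is in the resolvent set of all pulses, slowly varying cutoffs around  *)
(* the pulses give a lower bound for the N-pulse operators near z0 that is     *)
(* uniform in k. Large imaginary parts are excluded by diagonalizing J, so in  *)
(* the stable case only the given eigenvalues near 0 remain. If a pulse has an *)
(* unstable eigenvalue z0, the uniform bound holds on a ring around z0; were   *)
(* the N-pulse stable, the maximum principle for the norm of the resolvent     *)
(* would carry the bound to z0, against the shifted eigenfunction, which is an *)
(* approximate eigenfunction of the N-pulse operator.                          *)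

Set Implicit Arguments.
Unset Strict Implicit.
Unset Printing Implicit Defensive.

Import Order.TTheory GRing.Theory Num.Theory.
Import numFieldNormedType.Exports.

Local Open Scope classical_set_scope.
Local Open Scope ring_scope.

(** Every $w$ in $H^2$ is $(1-\partial_x^2)^{-1}g$ with $g=w-w''$ in $L^2$, and in the variable $g$
    the equation $(\mathcal L(u)-\varepsilon-z)w=y$ reads $Jg+(m-J)w-zw=y$, where
    $m=J(\zeta-\text{potential})-\varepsilon$. This is the bounded operator [opT m z], and $z$ lies
    in the resolvent set exactly if [regular] holds ([regular_res], [res_regular]).

    One operator. Pairing with $w$ removes $Jg$, so only the symmetric part of $m$ counts, which is
    at most $|u(x)|^2-\varepsilon$; far out this is negative by [saddle_small]. Subtracting a
    compactly supported potential makes the operator invertible ([dissip], [dissip_onto]), and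
    sampling turns the subtracted part into a finite-rank one up to a small error. The question
    becomes whether a finite determinant, analytic in $z$, vanishes: to the right of a line
    $\operatorname{Re}z=-g$ injectivity implies invertibility ([inj_regular]), and singular points
    are isolated ([inj_punctured]), because there are none with large real part. Large imaginary
    parts are handled by a multiplier adapted to the eigenspaces of $J$ ([hf_inj]).

    All $N$-pulses at once. If $z_0$ is regular for every pulse, wide cutoffs around the pulses and
    on the background transfer the lower bounds to the $N$-pulse, uniformly in its indices and for
    $z$ near $z_0$ ([localize], [family_LB]). In the stable case compactness and the two a priori
    bounds leave only a small ball around $0$ ([family_regular]), where the spectrum is given by
    hypothesis: $\ell$, $1$ and $N-1-\ell$ exhaust the $N$ eigenvalues, so $\ell=N-1$ gives
    stability, and otherwise an unstable eigenvalue is at hand.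

    If some pulse is unstable, take $z_s$ with positive real part in its spectrum. All pulses are
    regular on a small ring around $z_s$, hence the $N$-pulses satisfy a uniform lower bound there.
    If an $N$-pulse had no spectrum in the right half-plane, subharmonicity of the norm of its
    resolvent would carry this bound to $z_s$ ([max_principle]); but the eigenfunction of the pulse,
    shifted and cut off, violates it ([approx_eigen]). This is [family_unstable]. *)

(** * Real square-integrable functions on the line: integrals, inner product, norm *)

Section RealL2.
Variable R : realType.
Local Notation mu := (@lebesgue_measure R).
Implicit Types f g h : R -> R.

Definition integ f := mu.-integrable [set: R] (EFin \o f).
Definition L2 f := measurable_fun [set: R] f /\ integ (fun x => f x ^+ 2).
Definition ip f g : R := \int[mu]_x (f x * g x).

Lemma aeS (P Q : R -> Prop) : (forall x, P x -> Q x) ->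
  {ae mu, forall x, P x} -> {ae mu, forall x, Q x}.
Proof. by move=> PQ; apply: filterS; first exact: (ae_filter_ringOfSetsType mu). Qed.

Lemma aeS2 (P Q S : R -> Prop) : (forall x, P x -> Q x -> S x) ->
  {ae mu, forall x, P x} -> {ae mu, forall x, Q x} -> {ae mu, forall x, S x}.
Proof. by move=> PQ; apply: filterS2; first exact: (ae_filter_ringOfSetsType mu). Qed.

Lemma integ_le f g : measurable_fun [set: R] f -> integ g ->
  (forall x, `|f x| <= g x) -> integ f.
Proof.
move=> mf ig fg; apply: (le_integrable _ _ _ ig) => //.
  exact/measurable_EFinP.
by move=> x _ /=; rewrite lee_fin (le_trans (fg x))// ler_norm.
Qed.

Lemma integD f g : integ f -> integ g -> integ (fun x => f x + g x).
Proof. by move=> hf hg; exact: (integrableD _ hf hg). Qed.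

Lemma integZ c f : integ f -> integ (fun x => c * f x).
Proof. by move=> hf; exact: (integrableZl measurableT c hf). Qed.

Lemma integN f : integ f -> integ (fun x => - f x).
Proof. by move=> hf; exact: (integrableN hf). Qed.

Lemma integB f g : integ f -> integ g -> integ (fun x => f x - g x).
Proof. by move=> hf hg; apply: integD => //; exact: integN. Qed.

Lemma integ_measurable f : integ f -> measurable_fun [set: R] f.
Proof. by move=> /measurable_int /measurable_EFinP. Qed.

Lemma integ0 : integ (fun=> 0).
Proof. exact: integrable0. Qed.

Lemma int_le f g : integ f -> integ g -> (forall x, f x <= g x) ->
  \int[mu]_x f x <= \int[mu]_x g x.
Proof. by move=> hf hg fg; apply: le_Rintegral. Qed.

Lemma intD f g : integ f -> integ g ->
  \int[mu]_x (f x + g x) = \int[mu]_x f x + \int[mu]_x g x.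
Proof. by move=> hf hg; rewrite RintegralD. Qed.

Lemma intB f g : integ f -> integ g ->
  \int[mu]_x (f x - g x) = \int[mu]_x f x - \int[mu]_x g x.
Proof. by move=> hf hg; rewrite RintegralB. Qed.

Lemma intZ c f : integ f -> \int[mu]_x (c * f x) = c * \int[mu]_x f x.
Proof. by move=> hf; rewrite RintegralZl. Qed.

Lemma intN f : integ f -> \int[mu]_x (- f x) = - \int[mu]_x f x.
Proof.
move=> hf; rewrite -mulN1r -intZ//; apply: eq_Rintegral => x _.
by rewrite mulN1r.
Qed.

Lemma int_ge0 f : (forall x, 0 <= f x) -> 0 <= \int[mu]_x f x.
Proof. by move=> f0; apply: Rintegral_ge0. Qed.

Lemma int_norm f : integ f -> `|\int[mu]_x f x| <= \int[mu]_x `|f x|.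
Proof. by move=> hf; apply: le_normr_Rintegral. Qed.

Lemma integ_norm f : integ f -> integ (fun x => `|f x|).
Proof. by move=> hf; apply: (integrable_norm hf). Qed.

Lemma int_EFin f : integ f -> (\int[mu]_x (f x)%:E)%E = (\int[mu]_x f x)%:E.
Proof. by move=> hf; rewrite /Rintegral fineK//; apply: integrable_fin_num. Qed.

Lemma eq_int f g : f =1 g -> \int[mu]_x f x = \int[mu]_x g x.
Proof. by move=> fg; apply: eq_Rintegral => x _; exact: fg. Qed.

Lemma integ_lt f : measurable_fun [set: R] f -> (forall x, 0 <= f x) ->
  (\int[mu]_x (f x)%:E < +oo)%E -> integ f.
Proof.
move=> mf f0 foo; apply/integrableP; split; first exact/measurable_EFinP.
by under eq_integral => x _ do rewrite /= ger0_norm//.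
Qed.

Lemma int_eq0_ae f : integ f -> (forall x, 0 <= f x) -> \int[mu]_x f x = 0 ->
  {ae mu, forall x, f x = 0}.
Proof.
move=> hf f0 f00.
have h : (\int[mu]_x `|(f x)%:E| = 0)%E.
  under eq_integral => x _ do rewrite /= ger0_norm//.
  by rewrite int_EFin// f00.
have [H _] := ae_eq_integral_abs mu measurableT (measurable_int mu hf).
by apply: aeS (H h) => x /(_ I) [].
Qed.

Lemma ae_eq_int f g : measurable_fun [set: R] f -> measurable_fun [set: R] g ->
  {ae mu, forall x, f x = g x} -> \int[mu]_x f x = \int[mu]_x g x.
Proof.
move=> mf mg fg; rewrite /Rintegral; congr fine.
apply: ae_eq_integral => //; [exact/measurable_EFinP|exact/measurable_EFinP|].
by apply: aeS fg => x /= ->.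
Qed.

Lemma ae_eq_integ f g : measurable_fun [set: R] g ->
  {ae mu, forall x, f x = g x} -> integ f -> integ g.
Proof.
move=> mg fg hf; have /integrableP[mf foo] := hf.
apply/integrableP; split; first exact/measurable_EFinP.
rewrite (_ : (\int[mu]_x `|_|)%E = (\int[mu]_x `|(EFin \o f) x|)%E)//.
apply: ae_eq_integral => //.
- by do 2 apply: measurableT_comp => //.
- by apply: measurableT_comp => //; exact: measurable_int hf.
- by apply: aeS fg => x /= ->.
Qed.

Lemma L2_measurable f : L2 f -> measurable_fun [set: R] f.
Proof. by case. Qed.

Lemma L2_mul f g : L2 f -> L2 g -> integ (fun x => f x * g x).
Proof.
move=> [mf hf] [mg hg].
apply: (@integ_le _ (fun x => f x ^+ 2 + g x ^+ 2)).
- exact: measurable_funM.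
- exact: integD.
- move=> x; rewrite ler_norml; apply/andP; split.
    by have := sqr_ge0 (f x + g x); have := sqr_ge0 (f x); have := sqr_ge0 (g x); nra.
  by have := sqr_ge0 (f x - g x); have := sqr_ge0 (f x); have := sqr_ge0 (g x); nra.
Qed.

Lemma L2_bounded_mul (b : R -> R) f (B : R) : measurable_fun [set: R] b ->
  (forall x, `|b x| <= B) -> L2 f -> L2 (fun x => b x * f x).
Proof.
move=> mb bB [mf hf]; split; first exact: measurable_funM.
apply: (@integ_le _ (fun x => B ^+ 2 * f x ^+ 2)).
- by apply: measurable_funX; exact: measurable_funM.
- exact: integZ.
- move=> x; rewrite ger0_norm ?sqr_ge0// exprMn.
  rewrite ler_wpM2r ?sqr_ge0// -[leLHS]real_normK ?num_real//.
  have h := bB x; have h0 := normr_ge0 (b x); rewrite ler_pXn2r// nnegrE.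
  exact: le_trans h0 h.
Qed.

Lemma L2Z c f : L2 f -> L2 (fun x => c * f x).
Proof. by apply: (@L2_bounded_mul (fun=> c) f `|c|). Qed.

Lemma L2D f g : L2 f -> L2 g -> L2 (fun x => f x + g x).
Proof.
move=> hf hg; have [mf f2] := hf; have [mg g2] := hg.
split; first exact: measurable_funD.
apply: (@integ_le _ (fun x => f x ^+ 2 + g x ^+ 2 + 2 * (f x * g x))).
- by apply: measurable_funX; exact: measurable_funD.
- by apply: integD; [exact: integD|apply: integZ; exact: L2_mul].
- by move=> x; rewrite ger0_norm ?sqr_ge0//; nra.
Qed.

Lemma L2N f : L2 f -> L2 (fun x => - f x).
Proof.
move=> hf; have := L2Z (-1) hf; congr L2; apply/funext => x; exact: mulN1r.
Qed.

Lemma L2B f g : L2 f -> L2 g -> L2 (fun x => f x - g x).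
Proof. by move=> hf hg; apply: L2D => //; exact: L2N. Qed.

Lemma L2_0 : L2 (fun=> 0).
Proof. by split => //; rewrite expr0n/=; exact: integ0. Qed.

Lemma L2_norm f : L2 f -> L2 (fun x => `|f x|).
Proof.
move=> [mf hf]; split; first exact: measurableT_comp.
by under eq_fun => x do rewrite real_normK ?num_real//.
Qed.

Lemma L2_ae f g : measurable_fun [set: R] g ->
  {ae mu, forall x, f x = g x} -> L2 f -> L2 g.
Proof.
move=> mg fg [mf hf]; split => //; apply: (ae_eq_integ _ _ hf).
  exact: measurable_funX.
by apply: aeS fg => x ->.
Qed.

Lemma ipC f g : ip f g = ip g f.
Proof. by apply: eq_int => x; rewrite mulrC. Qed.

Lemma ipDl f g h : L2 f -> L2 g -> L2 h ->
  ip (fun x => f x + g x) h = ip f h + ip g h.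
Proof.
move=> hf hg hh; rewrite /ip -intD; do ?exact: L2_mul.
by apply: eq_int => x; rewrite mulrDl.
Qed.

Lemma ipZl c f h : L2 f -> L2 h -> ip (fun x => c * f x) h = c * ip f h.
Proof.
move=> hf hh; rewrite /ip -intZ; do ?exact: L2_mul.
by apply: eq_int => x; rewrite mulrA.
Qed.

Lemma ipNl f h : L2 f -> L2 h -> ip (fun x => - f x) h = - ip f h.
Proof.
move=> hf hh; rewrite -mulN1r -ipZl//.
by apply: eq_int => x; rewrite mulN1r.
Qed.

Lemma ipBl f g h : L2 f -> L2 g -> L2 h ->
  ip (fun x => f x - g x) h = ip f h - ip g h.
Proof.
move=> hf hg hh; rewrite ipDl//; last exact: L2N.
by rewrite ipNl.
Qed.

Lemma ipDr f g h : L2 f -> L2 g -> L2 h ->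
  ip h (fun x => f x + g x) = ip h f + ip h g.
Proof. by move=> *; rewrite ipC ipDl// !(ipC h). Qed.

Lemma ipZr c f h : L2 f -> L2 h -> ip h (fun x => c * f x) = c * ip h f.
Proof. by move=> *; rewrite ipC ipZl// (ipC h). Qed.

Lemma ipNr f h : L2 f -> L2 h -> ip h (fun x => - f x) = - ip h f.
Proof. by move=> *; rewrite ipC ipNl// (ipC h). Qed.

Lemma ipBr f g h : L2 f -> L2 g -> L2 h ->
  ip h (fun x => f x - g x) = ip h f - ip h g.
Proof. by move=> *; rewrite ipC ipBl// !(ipC h). Qed.

Lemma ip_ge0 f : 0 <= ip f f.
Proof. by apply: int_ge0 => x; rewrite -expr2 sqr_ge0. Qed.

Lemma ip_eq0 f : L2 f -> ip f f = 0 -> {ae mu, forall x, f x = 0}.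
Proof.
move=> hf h0.
have h1 x : 0 <= f x * f x by rewrite -expr2 sqr_ge0.
have := int_eq0_ae (L2_mul hf hf) h1 h0.
by apply: aeS => x /eqP; rewrite mulf_eq0 orbb => /eqP.
Qed.

Lemma ae_eq_ip f f' g g' : L2 f -> L2 f' -> L2 g -> L2 g' ->
  {ae mu, forall x, f x = f' x} -> {ae mu, forall x, g x = g' x} ->
  ip f g = ip f' g'.
Proof.
move=> [mf _] [mf' _] [mg _] [mg' _] ff gg.
by apply: ae_eq_int; [exact: measurable_funM|exact: measurable_funM|];
  apply: aeS2 ff gg => x -> ->.
Qed.

(** A nonnegative quadratic form has nonpositive discriminant. It is stated for bare numbers so that
    the scalar and the vector inner product share it. *)
Lemma CS_disc (A B X : R) : 0 <= A -> 0 <= B ->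
  (forall a b, 0 <= a ^+ 2 * A - 2 * a * b * X + b ^+ 2 * B) -> X ^+ 2 <= A * B.
Proof.
move=> A0 B0 key; have [Bz|Bp] := eqVneq B 0.
  have [->|pn] := eqVneq X 0; first by rewrite expr0n/= mulr_ge0.
  (* With [B = 0] the form is affine in [b], and this [b] gives it the value $-1$. *)
  have := key 1 ((A + 1) / (2 * X)).
  rewrite Bz !mulr0 addr0 expr1n !mul1r.
  by rewrite (_ : 2 * 1 * _ * _ = A + 1); [lra|field].
have := key B X.
have B1 : 0 < B by rewrite lt_neqAle eq_sym Bp.
rewrite (_ : _ + _ = B * (A * B - X ^+ 2)); last by ring.
by rewrite pmulr_rge0// subr_ge0.
Qed.

Lemma ip_CS f g : L2 f -> L2 g -> ip f g ^+ 2 <= ip f f * ip g g.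
Proof.
move=> hf hg; apply: CS_disc; [exact: ip_ge0|exact: ip_ge0|] => a b.
have := ip_ge0 (fun x => a * f x - b * g x).
have ? := L2Z a hf; have ? := L2Z b hg.
rewrite ipBl//; last exact: L2B.
rewrite !ipBr// !ipZl// !ipZr// (ipC g f).
by move=> h; apply: le_trans h _; rewrite le_eqVlt; apply/orP; left; apply/eqP; ring.
Qed.

Definition nm f := Num.sqrt (ip f f).

Lemma nm_ge0 f : 0 <= nm f. Proof. exact: sqrtr_ge0. Qed.

Lemma nm_sqr f : nm f ^+ 2 = ip f f.
Proof. by rewrite sqr_sqrtr// ip_ge0. Qed.

Lemma ip_CSn f g : L2 f -> L2 g -> `|ip f g| <= nm f * nm g.
Proof.
move=> hf hg; rewrite -(@ler_pXn2r _ 2)// ?nnegrE ?mulr_ge0 ?nm_ge0//.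
by rewrite real_normK ?num_real// exprMn !nm_sqr ip_CS.
Qed.

Lemma nm_le f g : L2 f -> L2 g -> (forall x, `|f x| <= `|g x|) -> nm f <= nm g.
Proof.
move=> hf hg fg; apply: ler_wsqrtr; apply: int_le; do ?exact: L2_mul.
move=> x; rewrite -!expr2 -[leLHS]real_normK ?num_real// -[leRHS]real_normK ?num_real//.
by rewrite ler_pXn2r// nnegrE.
Qed.

End RealL2.

(** * Integral operators with doubly stochastic kernels *)

Section Kernel.
Variable R : realType.
Local Notation mu := (@lebesgue_measure R).
Implicit Types f g h : R -> R.

(** The bound by 1 puts every row in $L^2$; the two normalisations make the integral operator a
    contraction of $L^2$, one through Jensen and the other through Tonelli. *)
Record markov_kernel (k : R * R -> R) : Prop := MarkovKernel {
  mk_meas : measurable_fun [set: R * R] k;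
  mk_ge0 : forall z, 0 <= k z;
  mk_le1 : forall z, k z <= 1;
  mk_int1 : forall x, (\int[mu]_y (k (x, y))%:E = 1)%E;
  mk_int2 : forall y, (\int[mu]_x (k (x, y))%:E = 1)%E }.

Definition ktr (k : R * R -> R) (z : R * R) := k (z.2, z.1).

Lemma markov_tr k : markov_kernel k -> markov_kernel (ktr k).
Proof.
case=> m0 g0 l1 i1 i2; split=> //.
- apply: (measurableT_comp m0); apply/measurable_fun_pairP; split.
    exact: measurable_snd.
  exact: measurable_fst.
- by move=> z; exact: g0.
- by move=> z; exact: l1.
Qed.

Definition kop (k : R * R -> R) f (x : R) : R := \int[mu]_y (k (x, y) * f y).

Section Op.
Variables (k : R * R -> R) (kk : markov_kernel k).

Let mk x : measurable_fun [set: R] (fun y => k (x, y)).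
Proof. by apply: (measurableT_comp (mk_meas kk)); exact: measurable_pair1. Qed.

Lemma kernel_integ x : integ (fun y => k (x, y)).
Proof.
apply: integ_lt => //; first by move=> y; exact: (mk_ge0 kk).
by rewrite (mk_int1 kk) ltry.
Qed.

Lemma kernel_int x : \int[mu]_y k (x, y) = 1.
Proof. by rewrite /Rintegral (mk_int1 kk). Qed.

Lemma kernel_L2 x : L2 (fun y => k (x, y)).
Proof.
split => //; apply: (@integ_le _ _ (fun y => k (x, y))).
- exact: measurable_funX.
- exact: kernel_integ.
- move=> y; rewrite ger0_norm ?sqr_ge0// expr2 ler_piMl//.
    exact: (mk_ge0 kk).
  exact: (mk_le1 kk).
Qed.

Lemma kop_integ1 h x : integ h -> integ (fun y => k (x, y) * h y).
Proof.
move=> hh; apply: (@integ_le _ _ (fun y => `|h y|)).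
- by apply: measurable_funM => //; exact: integ_measurable.
- exact: integ_norm.
- move=> y; rewrite normrM ger0_norm ?(mk_ge0 kk)// ler_piMl//.
  exact: (mk_le1 kk).
Qed.

Lemma kop_integ f x : L2 f -> integ (fun y => k (x, y) * f y).
Proof. by move=> hf; apply: L2_mul => //; exact: kernel_L2. Qed.

Lemma kopD f g x : L2 f -> L2 g ->
  kop k (fun y => f y + g y) x = kop k f x + kop k g x.
Proof.
move=> hf hg; rewrite /kop -intD; do ?exact: kop_integ.
by apply: eq_int => y; rewrite mulrDr.
Qed.

Lemma kopZ c f x : L2 f -> kop k (fun y => c * f y) x = c * kop k f x.
Proof.
move=> hf; rewrite /kop -intZ; do ?exact: kop_integ.
by apply: eq_int => y; rewrite mulrCA.
Qed.

Lemma kopN f x : L2 f -> kop k (fun y => - f y) x = - kop k f x.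
Proof.
move=> hf; rewrite -mulN1r -kopZ//.
by apply: eq_int => y; rewrite mulN1r.
Qed.

Lemma kopB f g x : L2 f -> L2 g ->
  kop k (fun y => f y - g y) x = kop k f x - kop k g x.
Proof. by move=> hf hg; rewrite kopD ?kopN//; exact: L2N. Qed.

Lemma kop_ae f g x : L2 f -> L2 g -> {ae mu, forall y, f y = g y} ->
  kop k f x = kop k g x.
Proof.
move=> [mf _] [mg _] fg; apply: ae_eq_int; [exact: measurable_funM..|].
by apply: aeS fg => y ->.
Qed.

Lemma kop_sup f x : L2 f -> `|kop k f x| <= nm f.
Proof.
move=> hf; apply: le_trans (ip_CSn (kernel_L2 x) hf) _.
rewrite ler_piMl ?nm_ge0// /nm -[leRHS]sqrtr1 ler_wsqrtr//.
rewrite -(kernel_int x); apply: int_le.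
- by apply: L2_mul; exact: kernel_L2.
- exact: kernel_integ.
- move=> y; rewrite ler_piMl//; first exact: (mk_ge0 kk).
  exact: (mk_le1 kk).
Qed.

(** Jensen's inequality: the row at [x] is a probability density and [s] the mean of [f], so the
    variance $\int k(x,y)(f(y)-s)^2\,dy$ is nonnegative. *)
Lemma kop_sqr_le f x : L2 f -> kop k f x ^+ 2 <= kop k (fun y => f y ^+ 2) x.
Proof.
move=> hf; set s := kop k f x.
have i2 : integ (fun y => k (x, y) * f y ^+ 2) by apply: kop_integ1; case: hf.
have i1 := kop_integ x hf; have i0 := kernel_integ x.
have : 0 <= \int[mu]_y (k (x, y) * (f y - s) ^+ 2).
  by apply: int_ge0 => y; rewrite mulr_ge0 ?sqr_ge0// (mk_ge0 kk).
rewrite (@eq_int _ _ (fun y => (k (x, y) * f y ^+ 2 - 2 * s * (k (x, y) * f y))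
   + s ^+ 2 * k (x, y))); last by move=> y; ring.
rewrite intD; [|apply: integB => //; exact: integZ|exact: integZ].
rewrite intB; [|done|exact: integZ].
rewrite !intZ// kernel_int -/(kop k f x) -/s -/(kop k (fun y => f y ^+ 2) x).
by nra.
Qed.

Let m2 f : measurable_fun [set: R] f ->
  measurable_fun [set: R * R] (fun z => k z * f z.2).
Proof.
move=> mf; apply: measurable_funM; first exact: (mk_meas kk).
by apply: (measurableT_comp mf); exact: measurable_snd.
Qed.

Let kop_meas_ge0 f : L2 f -> (forall x, 0 <= f x) ->
  measurable_fun [set: R] (kop k f).
Proof.
move=> hf f0; have [mf _] := hf.
have : measurable_fun [set: R] (fun x => \int[mu]_y (k (x, y) * f y)%:E)%E.
  apply: (@measurable_fun_fubini_tonelli_F _ _ _ _ R mu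
    (fun z => (k z * f z.2)%:E)).
  - by apply/measurable_EFinP; exact: m2.
  - by move=> z; rewrite lee_fin mulr_ge0// (mk_ge0 kk).
by move=> h; apply: (measurableT_comp (fine_measurable measurableT) h).
Qed.

Lemma kop_measurable f : L2 f -> measurable_fun [set: R] (kop k f).
Proof.
move=> hf; have ha := L2_norm hf.
(* Tonelli gives measurability for nonnegative integrands only, so [f] is split as the difference of
   $|f|+f$ and $|f|$. *)
have hp : L2 (fun x => `|f x| + f x) by exact: L2D.
have : measurable_fun [set: R]
    (fun x => kop k (fun x => `|f x| + f x) x - kop k (fun x => `|f x|) x).
  apply: measurable_funB.
    apply: kop_meas_ge0 => // x; have := ler_norm (- f x); rewrite normrN; lra.
  by apply: kop_meas_ge0.
apply: eq_measurable_fun => x _.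
by rewrite kopD// addrC addKr.
Qed.

Lemma kop_tonelli h : integ h -> (forall x, 0 <= h x) ->
  (\int[mu]_x \int[mu]_y (k (x, y) * h y)%:E = (\int[mu]_x h x)%:E)%E.
Proof.
move=> hh h0; have mh := integ_measurable hh.
rewrite (@fubini_tonelli _ _ _ _ R mu mu (fun z => (k z * h z.2)%:E)); last 2 first.
- by apply/measurable_EFinP; exact: m2.
- by move=> z; rewrite lee_fin mulr_ge0// (mk_ge0 kk).
rewrite -int_EFin//; apply: eq_integral => y _ /=.
under eq_integral => x _ do rewrite mulrC EFinM.
rewrite ge0_integralZl ?lee_fin//; first by rewrite (mk_int2 kk) mule1.
- apply/measurable_EFinP; apply: (measurableT_comp (mk_meas kk)).
  exact: measurable_pair2.
- by move=> x _; rewrite lee_fin (mk_ge0 kk).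
Qed.

(** Jensen's inequality integrated in [x]; exchanging the integrals leaves the columns, which have
    integral 1. *)
Lemma kop_L2 f : L2 f -> L2 (kop k f) /\ ip (kop k f) (kop k f) <= ip f f.
Proof.
move=> hf; have [mf f2] := hf.
have mK := kop_measurable hf.
have le : (\int[mu]_x (kop k f x ^+ 2)%:E <= (\int[mu]_x (f x ^+ 2))%:E)%E.
  rewrite -kop_tonelli//; last by move=> x; exact: sqr_ge0.
  apply: ge0_le_integral => //.
  - by move=> x _; rewrite lee_fin sqr_ge0.
  - by apply/measurable_EFinP; exact: measurable_funX.
  - apply: (@measurable_fun_fubini_tonelli_F _ _ _ _ R mu
      (fun z => (k z * f z.2 ^+ 2)%:E)).
    + apply/measurable_EFinP.
      exact: (m2 (f := fun y => f y ^+ 2) (measurable_funX 2 mf)).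
    + by move=> z; rewrite lee_fin mulr_ge0 ?sqr_ge0// (mk_ge0 kk).
  - move=> x _; rewrite int_EFin; last exact: kop_integ1.
    by rewrite lee_fin; exact: kop_sqr_le.
have i2 : integ (fun x => kop k f x ^+ 2).
  apply: integ_lt; first exact: measurable_funX.
    by move=> x; exact: sqr_ge0.
  by apply: le_lt_trans le _; rewrite ltry.
split; first by split.
rewrite /ip -lee_fin; apply: le_trans le.
rewrite -int_EFin; last by under eq_fun do rewrite -expr2.
by rewrite le_eqVlt; apply/orP; left; apply/eqP; apply: eq_integral.
Qed.

End Op.

(** Fubini for $k(x,y)f(y)g(x)$, which is integrable because $|f(y)g(x)|\le f(y)^2+g(x)^2$ and $k$
    has rows and columns of integral 1. *)
Lemma kop_adj k f g : markov_kernel k -> L2 f -> L2 g ->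
  ip (kop k f) g = ip f (kop (ktr k) g).
Proof.
move=> kk hf hg; have [mf f2] := hf; have [mg g2] := hg.
have kt := markov_tr kk.
pose F z : R := k z * f z.2 * g z.1.
have mF : measurable_fun [set: R * R] (EFin \o F).
  apply/measurable_EFinP; apply: measurable_funM; last first.
    by apply: (measurableT_comp mg); exact: measurable_fst.
  apply: measurable_funM; first exact: (mk_meas kk).
  by apply: (measurableT_comp mf); exact: measurable_snd.
have iF : (mu \x mu)%E.-integrable [set: R * R] (EFin \o F).
  apply/integrable12ltyP => //.
  have m1 : measurable_fun [set: R * R] (fun z => (k z * f z.2 ^+ 2)%:E).
    apply/measurable_EFinP; apply: measurable_funM; first exact: (mk_meas kk).
    by apply: (measurableT_comp (measurable_funX 2 mf)); exact: measurable_snd.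
  have m2 : measurable_fun [set: R * R] (fun z => (k z * g z.1 ^+ 2)%:E).
    apply/measurable_EFinP; apply: measurable_funM; first exact: (mk_meas kk).
    by apply: (measurableT_comp (measurable_funX 2 mg)); exact: measurable_fst.
  apply: (@le_lt_trans _ _ (\int[mu]_x (\int[mu]_y (k (x, y) * f y ^+ 2)%:E
      + (g x ^+ 2)%:E)))%E.
    apply: ge0_le_integral => //.
    - by move=> x _; apply: integral_ge0.
    - apply: (@measurable_fun_fubini_tonelli_F _ _ _ _ R mu
        (fun z => `|(F z)%:E|%E)) => //; exact: measurableT_comp.
    - apply: emeasurable_funD.
        apply: (@measurable_fun_fubini_tonelli_F _ _ _ _ R mu
          (fun z => (k z * f z.2 ^+ 2)%:E)) => //.
        by move=> z; rewrite lee_fin mulr_ge0 ?sqr_ge0// (mk_ge0 kk).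
      by apply/measurable_EFinP; exact: measurable_funX.
    - move=> x _.
      have -> : ((g x ^+ 2)%:E = \int[mu]_y (k (x, y) * g x ^+ 2)%:E)%E.
        under eq_integral => y _ do rewrite mulrC EFinM.
        rewrite ge0_integralZl ?lee_fin ?sqr_ge0//.
        + by rewrite (mk_int1 kk) mule1.
        + apply/measurable_EFinP; apply: (measurableT_comp (mk_meas kk)).
          exact: measurable_pair1.
        + by move=> y _; rewrite lee_fin (mk_ge0 kk).
      have mx : measurable_fun [set: R] (fun y => k (x, y)).
        by apply: (measurableT_comp (mk_meas kk)); exact: measurable_pair1.
      rewrite -ge0_integralD//.
      + apply: ge0_le_integral => //.
        * apply: measurableT_comp => //; apply/measurable_EFinP; rewrite /F /=.
          apply: measurable_funM; last exact: measurable_cst.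
          exact: measurable_funM.
        * under eq_fun do rewrite -EFinD; apply/measurable_EFinP.
          apply: measurable_funD; apply: measurable_funM => //.
          exact: measurable_funX.
        * move=> y _; rewrite /= -EFinD lee_fin /F /= !normrM.
          rewrite ger0_norm ?(mk_ge0 kk)// -mulrDr -mulrA ler_wpM2l ?(mk_ge0 kk)//.
          rewrite -(real_normK (num_real (f y))) -(real_normK (num_real (g x))).
          by have := sqr_ge0 (`|f y| - `|g x|); have := sqr_ge0 (`|f y| + `|g x|); nra.
      + by move=> y _; rewrite lee_fin mulr_ge0 ?sqr_ge0// (mk_ge0 kk).
      + apply/measurable_EFinP; apply: measurable_funM => //; exact: measurable_funX.
      + by move=> y _; rewrite lee_fin mulr_ge0 ?sqr_ge0// (mk_ge0 kk).
      + by apply/measurable_EFinP; apply: measurable_funM.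
  rewrite ge0_integralD//.
  - rewrite kop_tonelli//; last by move=> x; exact: sqr_ge0.
    by rewrite int_EFin// -EFinD ltry.
  - by move=> x _; apply: integral_ge0 => y _; rewrite lee_fin mulr_ge0 ?sqr_ge0// (mk_ge0 kk).
  - apply: (@measurable_fun_fubini_tonelli_F _ _ _ _ R mu
      (fun z => (k z * f z.2 ^+ 2)%:E)) => //.
    by move=> z; rewrite lee_fin mulr_ge0 ?sqr_ge0// (mk_ge0 kk).
  - by move=> x _; rewrite lee_fin sqr_ge0.
  - by apply/measurable_EFinP; exact: measurable_funX.
have := Fubini iF; rewrite /ip => FF.
have -> : \int[mu]_x (kop k f x * g x) = fine (\int[mu]_x \int[mu]_y (EFin \o F) (x, y))%E.
  rewrite /Rintegral; congr fine; apply: eq_integral => x _.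
  rewrite mulrC /kop -intZ; last exact: kop_integ.
  rewrite -int_EFin; last by apply: integZ; exact: kop_integ.
  by apply: eq_integral => y _; rewrite /F /= mulrC.
have -> : \int[mu]_x (f x * kop (ktr k) g x)
    = fine (\int[mu]_y \int[mu]_x (EFin \o F) (x, y))%E.
  rewrite /Rintegral; congr fine; apply: eq_integral => y _.
  rewrite /kop -intZ; last exact: kop_integ.
  rewrite -int_EFin; last by apply: integZ; exact: kop_integ.
  by apply: eq_integral => x _; rewrite /F /= /ktr /= mulrA (mulrC (f y)).
by congr fine.
Qed.

End Kernel.

(** * Substitutions that preserve Lebesgue measure: translations and reflection *)

Section MeasurePreserving.
Variable R : realType.
Local Notation mu := (@lebesgue_measure R).
Implicit Types f g h : R -> R.

Section Phi.
Variables (phi : R -> R) (mphi : measurable_fun [set: R] phi).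
Hypothesis ocP : forall a b : R, a < b ->
  mu (phi @^-1` `]a, b]) = (b - a)%:E.

Let mphi' : @measurable_fun _ _ (measurableTypeR R) (measurableTypeR R) setT phi := mphi.
Let m2 : {measure set (measurableTypeR R) -> \bar R} :=
  measure_function_pushforward__canonical__measure_function_Measure mu mphi'.

(** The push-forward of Lebesgue measure along [phi] agrees with it on half-open intervals, and
    these determine it. *)
Lemma mpres_measure A : measurable A -> mu (phi @^-1` A) = mu A.
Proof.
move=> mA; apply/esym; rewrite -[RHS]/(m2 A).
apply: (@lebesgue_measure_unique R m2) => // X /ocitvP[->|[x xlt ->]].
  by rewrite !measure0.
rewrite [RHS]ocP// lebesgue_measure_itv/= lte_fin xlt.
by rewrite EFinB.
Qed.

Let ge0_mpres (f : R -> \bar R) : measurable_fun [set: R] f ->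
  (forall x, (0 <= f x)%E) -> (\int[mu]_x f (phi x) = \int[mu]_x f x)%E.
Proof.
move=> mf f0.
have := @ge0_integral_pushforward _ _ (measurableTypeR R) (measurableTypeR R)
  R phi mphi' mu setT f measurableT mf (fun x _ => f0 x).
rewrite preimage_setT => <-.
apply: eq_measure_integral => A mA _; exact: mpres_measure.
Qed.

Lemma mpres_integral (f : R -> \bar R) : measurable_fun [set: R] f ->
  (\int[mu]_x f (phi x) = \int[mu]_x f x)%E.
Proof.
move=> mf; rewrite integralE [in RHS]integralE.
rewrite -(ge0_mpres (measurable_funepos mf))//.
rewrite -(ge0_mpres (measurable_funeneg mf))//.
by congr (_ - _)%E; apply: eq_integral => x _; rewrite ?funeposE ?funenegE.
Qed.

Lemma mpres_int f : measurable_fun [set: R] f ->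
  \int[mu]_x f (phi x) = \int[mu]_x f x.
Proof.
move=> mf; rewrite /Rintegral -(@mpres_integral (EFin \o f))//.
exact/measurable_EFinP.
Qed.

Lemma mpres_integ f : integ f -> integ (fun x => f (phi x)).
Proof.
move=> hf; have mf := integ_measurable hf; have /integrableP[_ fo] := hf.
apply/integrableP; split.
  by apply/measurable_EFinP; apply: measurableT_comp.
rewrite (@mpres_integral (fun x => `|(f x)%:E|%E))//.
by apply: measurableT_comp => //; exact/measurable_EFinP.
Qed.

Lemma mpres_L2 f : L2 f -> L2 (fun x => f (phi x)).
Proof.
move=> [mf hf]; split; first exact: measurableT_comp.
exact: (mpres_integ hf).
Qed.

Lemma mpres_ip f g : L2 f -> L2 g ->
  ip (fun x => f (phi x)) (fun x => g (phi x)) = ip f g.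
Proof.
move=> [mf _] [mg _]; rewrite /ip -(@mpres_int (fun x => f x * g x))//.
exact: measurable_funM.
Qed.

Lemma mpres_ae (Q : R -> Prop) : {ae mu, forall x, Q x} ->
  {ae mu, forall x, Q (phi x)}.
Proof.
move=> [A [mA A0 QA]]; exists (phi @^-1` A); split.
- by rewrite -[X in measurable X]setTI; exact: mphi.
- by rewrite mpres_measure.
- by move=> x /= h; apply: QA.
Qed.

End Phi.

Lemma shift_measurable (c : R) : measurable_fun [set: R] (fun x : R => x + c).
Proof. exact: measurable_funD. Qed.

Lemma shift_oc (c a b : R) : a < b ->
  mu ((fun x : R => x + c) @^-1` `]a, b]) = (b - a)%:E.
Proof.
move=> ab; rewrite (_ : _ @^-1` _ = `]a - c, b - c]%classic).
  rewrite lebesgue_measure_itv/= lte_fin ltrD2r ab.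
  by rewrite -EFinB; congr _%:E; ring.
by apply/seteqP; split=> x /=; rewrite !in_itv/=; lra.
Qed.

Lemma opp_measurable : measurable_fun [set: R] (fun x : R => - x).
Proof. exact: measurable_funN. Qed.

Lemma opp_oc (a b : R) : a < b ->
  mu ((fun x : R => - x) @^-1` `]a, b]) = (b - a)%:E.
Proof.
move=> ab; rewrite (_ : _ @^-1` _ = `[- b, - a[%classic).
  rewrite lebesgue_measure_itv/= lte_fin ltrN2 ab.
  by rewrite -EFinB; congr _%:E; ring.
by apply/seteqP; split=> x /=; rewrite !in_itv/=; lra.
Qed.

End MeasurePreserving.

(** * Derivation rules for real functions *)

Section RealDerive.
Variable R : realType.
Implicit Types (f g : R -> R) (x df dg : R).

Lemma derD f g x df dg : is_derive x 1 f df -> is_derive x 1 g dg ->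
  is_derive x 1 (fun y => f y + g y) (df + dg).
Proof. exact: is_deriveD. Qed.

Lemma derN f x df : is_derive x 1 f df -> is_derive x 1 (fun y => - f y) (- df).
Proof. exact: is_deriveN. Qed.

Lemma derB f g x df dg : is_derive x 1 f df -> is_derive x 1 g dg ->
  is_derive x 1 (fun y => f y - g y) (df - dg).
Proof. exact: is_deriveB. Qed.

Lemma derM f g x df dg : is_derive x 1 f df -> is_derive x 1 g dg ->
  is_derive x 1 (fun y => f y * g y) (df * g x + f x * dg).
Proof.
move=> hf hg; have h := is_deriveM hf hg.
apply: (is_derive_eq h).
by rewrite /GRing.scale /= addrC mulrC.
Qed.

Lemma derZ c f x df : is_derive x 1 f df -> is_derive x 1 (fun y => c * f y) (c * df).
Proof. exact: is_deriveZ. Qed.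

Lemma der_cst (c : R) x : is_derive x 1 (fun=> c) 0.
Proof. exact: is_derive_cst. Qed.

Lemma der_id x : is_derive x 1 (fun y : R => y) 1.
Proof. exact: is_derive_id. Qed.

Lemma der_comp f g x df dg : is_derive (g x) 1 f df -> is_derive x 1 g dg ->
  is_derive x 1 (fun y => f (g y)) (df * dg).
Proof. exact: is_derive1_comp. Qed.

Lemma der_expR f x df : is_derive x 1 f df ->
  is_derive x 1 (fun y => expR (f y)) (expR (f x) * df).
Proof. by apply: der_comp; exact: is_derive_expR. Qed.

Lemma der_continuous f : (forall x, exists d, is_derive x 1 f d) -> continuous f.
Proof.
move=> h x; apply: differentiable_continuous; apply/derivable1_diffP.
by have [d hd] := h x; exact: ex_derive.
Qed.

Lemma der_derive1 f x df : is_derive x 1 f df -> derive1 f x = df.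
Proof. by move=> h; rewrite derive1E; exact: derive_val. Qed.

End RealDerive.

(** * The exponential kernel *)

Section ExpKernel.
Variable R : realType.
Local Notation mu := (@lebesgue_measure R).

(** The operator with this kernel is $(1+\partial_x)^{-1}$, and the one with its transpose is
    $(1-\partial_x)^{-1}$. *)
Definition expk (z : R * R) : R := expR (z.2 - z.1) * (z.2 <= z.1)%R%:R.

Lemma expk_meas : measurable_fun [set: R * R] expk.
Proof.
apply: measurable_funM.
  apply: measurableT_comp => //; apply: measurable_funB.
    exact: measurable_snd.
  exact: measurable_fst.
rewrite (_ : (fun z : R * R => _) = \1_[set z : R * R | z.2 <= z.1]).
  apply: measurable_indic.
  rewrite (_ : [set z : R * R | _] = (fun z : R * R => z.2 <= z.1) @^-1` [set true]).
    have h : measurable_fun [set: R * R] (fun z : R * R => z.2 <= z.1).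
      by apply: measurable_fun_ler; [exact: measurable_snd|exact: measurable_fst].
    by rewrite -[X in measurable X]setTI; exact: h.
  by apply/seteqP; split => z.
apply/funext => z; rewrite indicE; congr (nat_of_bool _)%:R.
by apply/idP/idP; rewrite inE.
Qed.

Lemma expk_integral2 (y : R) : (\int[mu]_x (expk (x, y))%:E = 1)%E.
Proof.
have -> : (\int[mu]_x (expk (x, y))%:E = \int[mu]_(x in `[y, +oo[) (expR (y - x))%:E)%E.
  rewrite [RHS]integral_mkcond; apply: eq_integral => x _.
  rewrite patchE /expk /= mem_setE in_itv/= andbT.
  by case: (y <= x); rewrite ?mulr1 ?mulr0.
pose F (x : R) := - (expR y * expR (- x)).
have d (x : R) : is_derive x 1 F (expR (y - x)).
  apply: (is_derive_eq (derN (derZ (expR y) (der_expR (derN (der_id x)))))).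
  by rewrite mulrN1 mulrN opprK expRD.
have cF : continuous F by apply: der_continuous => x; eexists; exact: d.
rewrite (@ge0_continuous_FTC2y R (fun x => expR (y - x)) F y 0).
- by rewrite /F expRN mulfV ?gt_eqF ?expR_gt0// EFinN oppeK add0e.
- by move=> x _; exact: expR_ge0.
- apply: continuous_subspaceT => x.
  apply: continuous_comp; last exact: continuous_expR.
  by apply: cvgB; [exact: cvg_cst|exact: cvg_id].
- rewrite -oppr0 -(mulr0 (expR y)); apply: cvgN; apply: cvgMr; exact: cvgr_expR.
- by move=> x _; exact: ex_derive.
- by apply: cvg_at_right_filter; exact: cF.
- by move=> x _; rewrite derive1E; exact: derive_val.
Qed.

Lemma expk_integral1 (x : R) : (\int[mu]_y (expk (x, y))%:E = 1)%E.
Proof.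
rewrite -(expk_integral2 (- x)).
rewrite -[RHS](mpres_integral (@opp_measurable R) (@opp_oc R)).
  apply: eq_integral => y _; rewrite /expk /=; congr (expR _ * _%:R)%:E.
    by rewrite opprK addrC.
  by rewrite lerN2.
apply/measurable_EFinP; apply: measurableT_comp; first exact: expk_meas.
exact: measurable_pair2.
Qed.

Lemma expk_markov : markov_kernel expk.
Proof.
split; [exact: expk_meas| | |exact: expk_integral1|exact: expk_integral2].
- by move=> z; rewrite mulr_ge0// expR_ge0.
- move=> z; rewrite /expk; case: (leP z.2 z.1) => h; last by rewrite mulr0.
  by rewrite mulr1 expR_le1 subr_le0.
Qed.

End ExpKernel.

(** * Weak derivatives of square-integrable functions *)

Section Weak.
Variable R : realType.
Local Notation mu := (@lebesgue_measure R).
Implicit Types f g h phi : R -> R.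
Local Notation expk := (@expk R).

Definition cc f := continuous f /\ exists M : R, forall x, M < `|x| -> f x = 0.

Lemma cc_integ f : cc f -> integ f.
Proof.
move=> [cf [M hM]].
have : mu.-integrable `[- M, M] (EFin \o f).
  apply: continuous_compact_integrable; first exact: segment_compact.
  exact: continuous_subspaceT.
move/integrable_mkcond => /(_ (measurable_itv _)).
rewrite restrict_EFin /integ; congr integrable; congr (EFin \o _).
apply/funext => x; rewrite patchE; case: ifPn => //.
rewrite mem_setE in_itv/= => h; rewrite hM//.
by rewrite ltNge ler_norml.
Qed.

Lemma ccM f g : cc f -> continuous g -> cc (fun x => g x * f x).
Proof.
move=> [cf [M hM]] cg; split; first by move=> x; apply: cvgM; [exact: cg|exact: cf].
by exists M => x /hM ->; rewrite mulr0.
Qed.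

Lemma cc_L2 f : cc f -> L2 f.
Proof.
move=> hf; have [cf _] := hf; split; first exact: continuous_measurable_fun.
rewrite (_ : (fun x => f x ^+ 2) = (fun x => f x * f x))//.
by apply: cc_integ; exact: ccM.
Qed.

Lemma cc_shift f (c : R) : cc f -> cc (fun x => f (x + c)).
Proof.
move=> [cf [M hM]]; split.
  move=> x; apply: continuous_comp; last exact: cf.
  by apply: cvgD; [exact: cvg_id|exact: cvg_cst].
exists (M + `|c|) => x h; apply: hM.
by have := ler_normD (x + c) (- c); rewrite addrK normrN; lra.
Qed.

Lemma test_cc phi : test_fun phi -> cc phi.
Proof.
case=> d _ [M hM]; split; last by exists M.
by apply: der_continuous => x; exists (derive1 phi x);
  rewrite derive1E; exact/derivableP.
Qed.

Lemma test_der phi (x : R) : test_fun phi -> is_derive x 1 phi (derive1 phi x).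
Proof. by case=> d _ _; rewrite derive1E; exact/derivableP. Qed.

Lemma test_cc_der phi : test_fun phi -> cc (derive1 phi).
Proof.
case=> d c [M hM]; split => //; exists M => x hx.
apply: der_derive1; apply: (near_eq_is_derive _ (der_cst 0 x)).
have h : \forall y \near x, M < `|y|.
  exact: (@cvgr_norm_gt _ _ _ (nbhs x) _ id x (@cvg_id _ (nbhs x)) _ hx).
near=> y; rewrite hM//; near: y; exact: h.
Unshelve. all: by end_near. Qed.

Lemma is_test phi (d : R -> R) : (forall x : R, is_derive x 1 phi (d x)) -> continuous d ->
  (exists M, forall x, M < `|x| -> phi x = 0) -> test_fun phi.
Proof.
move=> h cd hM.
have e : derive1 phi = d by apply/funext => x; exact: der_derive1.
by split; [move=> x; apply: ex_derive; exact: h|rewrite e|exact: hM].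
Qed.

(** Integration by parts: $e^{y-x}\phi(y)$ is a primitive of $e^{y-x}(\phi'+\phi)(y)$, vanishes far
    to the left and equals $\phi(x)$ at $y=x$. *)
Lemma expk_test phi (x : R) : test_fun phi ->
  kop expk (derive1 phi) x = phi x - kop expk phi x.
Proof.
move=> tp; have [cp [M hM]] := test_cc tp; have [cd [M' hM']] := test_cc_der tp.
apply/eqP; rewrite eq_sym subr_eq eq_sym -kopD; [|exact: expk_markov|
  exact: cc_L2 (test_cc_der tp)|exact: cc_L2 (test_cc tp)].
apply/eqP.
(* A point to the left of [x] and of both supports, where the integral may start. *)
pose a := - (`|M| + `|M'| + `|x|) - 1.
have ax : a < x by have := ler_norm (- x); rewrite normrN /a; have := normr_ge0 M; have := normr_ge0 M'; lra.
have az y : y <= a -> phi y = 0 /\ derive1 phi y = 0.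
  move=> ya; have := ler_norm (- y); rewrite normrN => h1.
  have := ler_norm M; have := ler_norm M'; have := normr_ge0 x; have := normr_ge0 M; have := normr_ge0 M'.
  by move=> *; split; [apply: hM|apply: hM']; move: ya; rewrite /a; lra.
pose F y := expR (y - x) * phi y.
have dF (y : R) : is_derive y 1 F (expR (y - x) * (derive1 phi y + phi y)).
  apply: (is_derive_eq (derM (der_expR (derB (der_id y) (der_cst x y))) (test_der y tp))).
  by rewrite subr0 mulr1 addrC mulrDr.
rewrite /kop.
transitivity (\int[mu]_(y in `[a, x]) (expR (y - x) * (derive1 phi y + phi y))).
  rewrite [RHS]Rintegral_mkcond; apply: eq_int => y; rewrite patchE /expk /=.
  rewrite mem_setE in_itv/=; case: (leP y x) => yx; rewrite ?mulr0 ?andbF ?mul0r ?andbT//.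
  rewrite mulr1; case: (leP a y) => // /ltW /az [-> ->]; by rewrite addr0 mulr0.
rewrite /Rintegral (@continuous_FTC2 _ _ F)//.
- by rewrite -EFinB /= /F subrr expR0 mul1r (proj1 (az a (lexx a))) mulr0 subr0.
- apply: continuous_subspaceT => y.
  apply: cvgM; last by apply: cvgD; [exact: cd|exact: cp].
  apply: continuous_comp; last exact: continuous_expR.
  by apply: cvgB; [exact: cvg_id|exact: cvg_cst].
- have cF : continuous F by apply: der_continuous => y; eexists; exact: dF.
  split; first by move=> y _; apply: ex_derive; exact: dF.
    by apply: cvg_at_right_filter; exact: cF.
  by apply: cvg_at_left_filter; exact: cF.
- by move=> y _; apply: der_derive1.
Qed.

(** Reflection exchanges the kernel with its transpose, so that facts about the latter need no
    second integration by parts. *)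
Lemma kop_tr_opp f x : measurable_fun [set: R] f ->
  kop (ktr expk) f x = kop expk (fun y => f (- y)) (- x).
Proof.
move=> mf; rewrite /kop.
rewrite -[RHS](mpres_int (@opp_measurable R) (@opp_oc R)).
  by apply: eq_int => y; rewrite /ktr /expk /= !opprK lerN2 [- y + x]addrC.
apply: measurable_funM.
  by apply: (measurableT_comp (@expk_meas R)); exact: measurable_pair1.
exact: measurableT_comp.
Qed.

Lemma test_opp phi : test_fun phi -> test_fun (fun x => phi (- x)) /\
  derive1 (fun x => phi (- x)) = (fun x => - derive1 phi (- x)).
Proof.
move=> tp; have [d c [M hM]] := tp.
have h (x : R) : is_derive x 1 (fun x => phi (- x)) (- derive1 phi (- x)).
  apply: (is_derive_eq (der_comp (test_der (- x) tp) (derN (der_id x)))).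
  by rewrite mulrN1.
split; last by apply/funext => x; exact: der_derive1.
apply: is_test h _ _.
  move=> x; apply: cvgN; apply: continuous_comp; last exact: c.
  exact: opp_continuous.
by exists M => x hx; apply: hM; rewrite normrN.
Qed.

Lemma expk_tr_test phi (x : R) : test_fun phi ->
  kop (ktr expk) (derive1 phi) x = kop (ktr expk) phi x - phi x.
Proof.
move=> tp; have [to de] := test_opp tp.
have mp := L2_measurable (cc_L2 (test_cc tp)).
have md := L2_measurable (cc_L2 (test_cc_der tp)).
rewrite !kop_tr_opp//.
have := expk_test (- x) to; rewrite de opprK kopN; last 2 first.
- exact: expk_markov.
- apply: (mpres_L2 (@opp_measurable R) (@opp_oc R)).
  exact: (cc_L2 (test_cc_der tp)).
by move=> h; apply: oppr_inj; rewrite h opprB.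
Qed.

Definition wd f g := forall phi, test_fun phi -> ip (derive1 phi) f = - ip phi g.

(** By adjunction the kernel moves to the test function, where the classical derivative is known
    from [expk_tr_test]. *)
Lemma wd_K f : L2 f -> wd (kop expk f) (fun x => f x - kop expk f x).
Proof.
move=> hf phi tp; have hp := cc_L2 (test_cc tp); have hd := cc_L2 (test_cc_der tp).
have mk := @expk_markov R; have [hk _] := kop_L2 mk hf.
rewrite ipC kop_adj// ipBr//.
have -> : kop (ktr expk) (derive1 phi) = (fun x => kop (ktr expk) phi x - phi x).
  by apply/funext => x; exact: expk_tr_test.
have [hkt _] := kop_L2 (markov_tr mk) hp.
by rewrite ipBr// -kop_adj// opprB (ipC phi f) (ipC phi (kop _ _)).
Qed.

Lemma wd_Kt f : L2 f -> wd (kop (ktr expk) f) (fun x => kop (ktr expk) f x - f x).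
Proof.
move=> hf phi tp; have hp := cc_L2 (test_cc tp); have hd := cc_L2 (test_cc_der tp).
have mk := @expk_markov R; have mt := markov_tr mk; have [hk _] := kop_L2 mt hf.
rewrite ipC kop_adj// ipBr//.
have -> : ktr (ktr expk) = expk by apply/funext => -[].
have -> : kop expk (derive1 phi) = (fun x => phi x - kop expk phi x).
  by apply/funext => x; exact: expk_test.
have [hkt _] := kop_L2 mk hp.
by rewrite ipBr// (ipC f (kop _ _)) kop_adj// (ipC phi f) opprB.
Qed.

Lemma wdD f f1 g g1 : L2 f -> L2 f1 -> L2 g -> L2 g1 -> wd f f1 -> wd g g1 ->
  wd (fun x => f x + g x) (fun x => f1 x + g1 x).
Proof.
move=> hf hf1 hg hg1 wf wg phi tp.
have hp := cc_L2 (test_cc tp); have hd := cc_L2 (test_cc_der tp).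
by rewrite !ipDr// wf// wg// opprD.
Qed.

Lemma wdZ c f f1 : L2 f -> L2 f1 -> wd f f1 ->
  wd (fun x => c * f x) (fun x => c * f1 x).
Proof.
move=> hf hf1 wf phi tp.
have hp := cc_L2 (test_cc tp); have hd := cc_L2 (test_cc_der tp).
by rewrite !ipZr// wf// mulrN.
Qed.

Lemma wdB f f1 g g1 : L2 f -> L2 f1 -> L2 g -> L2 g1 -> wd f f1 -> wd g g1 ->
  wd (fun x => f x - g x) (fun x => f1 x - g1 x).
Proof.
move=> hf hf1 hg hg1 wf wg phi tp.
have hp := cc_L2 (test_cc tp); have hd := cc_L2 (test_cc_der tp).
by rewrite !ipBr// wf// wg// opprB opprK addrC.
Qed.

Lemma wd_ae f f1 g g1 : L2 f -> L2 f1 -> L2 g -> L2 g1 ->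
  {ae mu, forall x, f x = g x} -> {ae mu, forall x, f1 x = g1 x} ->
  wd f f1 -> wd g g1.
Proof.
move=> hf hf1 hg hg1 e e1 wf phi tp.
have hp := cc_L2 (test_cc tp); have hd := cc_L2 (test_cc_der tp).
have rr (h : R -> R) : {ae mu, forall x, h x = h x} by exact: aeW.
by rewrite -(@ae_eq_ip _ (derive1 phi) (derive1 phi) f g)// wf// (@ae_eq_ip _ phi phi f1 g1).
Qed.

Lemma wd_shift f f1 (c : R) : L2 f -> L2 f1 -> wd f f1 ->
  wd (fun x => f (x + c)) (fun x => f1 (x + c)).
Proof.
move=> hf hf1 wf phi tp.
have hp := cc_L2 (test_cc tp); have hd := cc_L2 (test_cc_der tp).
have h (x : R) : is_derive x 1 (fun x => phi (x - c)) (derive1 phi (x - c)).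
  apply: (is_derive_eq (@der_comp _ phi (fun y => y - c) x _ _ (test_der (x - c) tp)
    (derB (der_id x) (der_cst c x)))).
  by rewrite subr0 mulr1.
have ts : test_fun (fun x => phi (x - c)).
  apply: is_test h _ _; first by case: (cc_shift (- c) (test_cc_der tp)).
  by case: (cc_shift (- c) (test_cc tp)).
have sm := @shift_measurable R c; have so := @shift_oc R c.
have := wf _ ts.
rewrite (_ : derive1 _ = (fun x => derive1 phi (x - c))); last first.
  by apply/funext => x; exact: der_derive1.
rewrite -(mpres_ip sm so)//; last first.
  exact: (cc_L2 (cc_shift (- c) (test_cc_der tp))).
rewrite -[in RHS](mpres_ip sm so)//; last first.
  exact: (cc_L2 (cc_shift (- c) (test_cc tp))).
by under eq_fun do rewrite addrK; under [X in _ = - ip X _]eq_fun do rewrite addrK.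
Qed.

(** Leibniz rule: the product of [chi] with a test function is again a test function, to which the
    weak derivative of [f] is applied. *)
Lemma wd_mul (chi chi1 : R -> R) f f1 (B : R) :
  (forall x : R, is_derive x 1 chi (chi1 x)) -> continuous chi1 ->
  (forall x, `|chi x| <= B) -> (forall x, `|chi1 x| <= B) ->
  L2 f -> L2 f1 -> wd f f1 ->
  wd (fun x => chi x * f x) (fun x => chi1 x * f x + chi x * f1 x).
Proof.
move=> dc c1 bc b1 hf hf1 wf phi tp.
have c0 : continuous chi by apply: der_continuous => x; eexists; exact: dc.
have hp := cc_L2 (test_cc tp); have hd := cc_L2 (test_cc_der tp).
have h (x : R) : is_derive x 1 (fun x => chi x * phi x)
    (chi1 x * phi x + chi x * derive1 phi x) by exact: derM (dc x) (test_der x tp).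
have [cp _] := test_cc tp; have [cd _] := test_cc_der tp.
have ts : test_fun (fun x => chi x * phi x).
  apply: is_test h _ _; last by case: (ccM (test_cc tp) c0).
  by move=> x; apply: cvgD; apply: cvgM; [exact: c1|exact: cp|exact: c0|exact: cd].
have m0 := continuous_measurable_fun c0; have m1 := continuous_measurable_fun c1.
have := wf _ ts.
rewrite (_ : derive1 _ = (fun x => chi1 x * phi x + chi x * derive1 phi x)); last first.
  by apply/funext => x; exact: der_derive1.
have L p (hp' : L2 p) : L2 (fun x => chi x * p x) := L2_bounded_mul m0 bc hp'.
have L1 p (hp' : L2 p) : L2 (fun x => chi1 x * p x) := L2_bounded_mul m1 b1 hp'.
rewrite ipDl ?ipDr//; try by [exact: L|exact: L1].
have e1 p q : ip (fun x => chi1 x * p x) q = ip p (fun x => chi1 x * q x).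
  by apply: eq_int => x; rewrite mulrCA mulrA.
have e0 p q : ip (fun x => chi x * p x) q = ip p (fun x => chi x * q x).
  by apply: eq_int => x; rewrite mulrCA mulrA.
by rewrite !e1 !e0 => hh; rewrite opprD -hh addKr.
Qed.

End Weak.

(** * Density of compactly supported continuous functions; the equation $e'=-e$ in $L^2$ *)

Section Uniqueness.
Variable R : realType.
Local Notation mu := (@lebesgue_measure R).
Implicit Types f g h phi : R -> R.
Local Notation expk := (@expk R).

Lemma cont_comp f g : continuous f -> continuous g -> continuous (fun x => f (g x)).
Proof. by move=> cf cg x; exact: (continuous_comp (cg x) (cf (g x))). Qed.

Lemma contB f g : continuous f -> continuous g -> continuous (fun x => f x - g x).
Proof. by move=> cf cg x; apply: cvgB; [exact: cf|exact: cg]. Qed.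

Lemma contD f g : continuous f -> continuous g -> continuous (fun x => f x + g x).
Proof. by move=> cf cg x; apply: cvgD; [exact: cf|exact: cg]. Qed.

Lemma contM f g : continuous f -> continuous g -> continuous (fun x => f x * g x).
Proof. by move=> cf cg x; apply: cvgM; [exact: cf|exact: cg]. Qed.

Lemma cont_cst (c : R) : continuous (fun _ : R => c).
Proof. by move=> x; exact: cvg_cst. Qed.

Lemma cont_id : continuous (fun x : R => x).
Proof. by move=> x; exact: cvg_id. Qed.

Lemma cont_norm : continuous (fun x : R => `|x|).
Proof. by move=> x; exact: norm_continuous. Qed.

(** A ramp from 0 to 1, written with absolute values so that its continuity is immediate. *)
Definition clamp (t : R) : R := (`|t| - `|t - 1| + 1) / 2.

Lemma clamp_le0 t : t <= 0 -> clamp t = 0.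
Proof.
move=> h; rewrite /clamp ler0_norm// ler0_norm; last by lra.
by rewrite (_ : _ + 1 = 0) ?mul0r//; ring.
Qed.

Lemma clamp_ge1 t : 1 <= t -> clamp t = 1.
Proof.
move=> h; rewrite /clamp ger0_norm ?ger0_norm; [|lra..].
by rewrite (_ : _ + 1 = 2) ?divff//; ring.
Qed.

Lemma clamp_itv t : 0 <= clamp t <= 1.
Proof.
rewrite /clamp; have := ler_normD t 1; have := ler_normD (t - 1) 1.
have := ler_normB t 1; have := ler_normD (1 - t) t; rewrite subrK distrC normr1.
by rewrite subrK; lra.
Qed.

Lemma clamp_continuous : continuous clamp.
Proof.
apply: contM; last exact: cont_cst.
apply: contD; last exact: cont_cst; apply: contB; first exact: cont_norm.
by apply: cont_comp; [exact: cont_norm|apply: contB; [exact: cont_id|exact: cont_cst]].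
Qed.

Lemma int_indic_itv (a b : R) : a <= b ->
  integ (\1_`[a, b] : R -> R) /\ \int[mu]_x (\1_`[a, b] x : R) = b - a.
Proof.
move=> ab.
have h : (\int[mu]_x (\1_`[a, b] x : R)%:E = (b - a)%:E)%E.
  rewrite integral_indic// setIT; rewrite [LHS]lebesgue_measure_itv/= lte_fin -EFinB.
  by move: ab; rewrite le_eqVlt => /orP[/eqP->|->//]; rewrite ltxx subrr.
split; last by rewrite /Rintegral h.
apply: integ_lt; first exact: measurable_indic.
  by move=> x; rewrite indicE.
by rewrite h ltry.
Qed.

(** Testing against ramps that approximate the indicator of a half-line shows that all indefinite
    integrals of [c n] times [e] vanish, where [c n] is a cutoff at radius about [n]; Lebesgue
    differentiation then gives the claim. *)
Lemma cc_dense e : L2 e -> (forall f, cc f -> ip f e = 0) ->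
  {ae mu, forall x, e x = 0}.
Proof.
move=> he h0; have [me _] := he.
pose c (n : nat) (t : R) := clamp (n.+1%:R - `|t|).
have cn n : cc (c n).
  split.
    apply: cont_comp; first exact: clamp_continuous.
    by apply: contB; [exact: cont_cst|exact: cont_norm].
  by exists n.+1%:R => x hx; rewrite /c clamp_le0//; lra.
have fi n : integ (fun t => c n t * e t) by apply: L2_mul => //; exact: cc_L2.
have F0 n x : \int[mu]_(t in `]-oo, x]) (c n t * e t) = 0.
  apply/eqP; rewrite -normr_le0; apply/ler_addgt0Pr => eps eps0; rewrite add0r.
  pose d := eps / (nm e + 1).
  have d0 : 0 < d by rewrite divr_gt0// ltr_wpDl// nm_ge0.
  (* A ramp over an interval of length $d^2$: it differs from the indicator by a function of $L^2$
     norm at most $d$, and $d$ is chosen so that Cauchy-Schwarz leaves at most [eps]. *)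
  pose g (t : R) := clamp ((x - t) / d ^+ 2).
  have d2 : 0 < d ^+ 2 by rewrite exprn_gt0.
  have gc : cc (fun t => g t * c n t).
    apply: ccM => //; apply: cont_comp; first exact: clamp_continuous.
    apply: contM; last exact: cont_cst.
    by apply: contB; [exact: cont_cst|exact: cont_id].
  pose r (t : R) : R := (\1_(`]-oo, x] : set R) t - g t) * c n t.
  have mi : measurable_fun [set: R] (\1_(`]-oo, x] : set R) : R -> R).
    exact: measurable_indic.
  have hr : L2 r.
    rewrite (_ : r = fun t => \1_(`]-oo, x] : set R) t * c n t - g t * c n t); last first.
      by apply/funext => t; rewrite /r mulrBl.
    apply: L2B; last exact: cc_L2.
    apply: (@L2_bounded_mul _ _ _ 1) => //; last exact: cc_L2.
    by move=> t; rewrite indicE; case: (_ \in _); rewrite ?normr1 ?normr0.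
  have -> : \int[mu]_(t in `]-oo, x]) (c n t * e t) = ip r e.
    rewrite -[RHS]addr0 -[X in _ + X](h0 _ gc).
    rewrite Rintegral_mkcond /ip -intD; last 2 first.
    - exact: L2_mul.
    - by apply: L2_mul => //; exact: cc_L2.
    apply: eq_int => t; rewrite patchE /r indicE.
    by case: (t \in _) => /=; [ring|rewrite -[LHS]/(0 : R); ring].
  apply: le_trans (ip_CSn hr he) _.
  have [ii iv] := @int_indic_itv (x - d ^+ 2) x (ltac:(lra)).
  have : nm r <= d.
    rewrite -(@ler_pXn2r _ 2)// ?nnegrE ?nm_ge0 ?(ltW d0)// nm_sqr.
    rewrite (_ : d ^+ 2 = x - (x - d ^+ 2)); last by ring.
    rewrite -iv; apply: int_le => //; first exact: L2_mul.
    move=> t; rewrite -expr2 /r exprMn.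
    have /andP[c0 c1] := clamp_itv (n.+1%:R - `|t|).
    have /andP[g0 g1] := clamp_itv ((x - t) / d ^+ 2).
    rewrite !indicE !mem_setE !in_itv/=.
    have [tx|tx] /= := lerP t x; last first.
      rewrite /g clamp_le0; first by rewrite subrr expr0n/= mul0r andbF.
      by rewrite pmulr_lle0 ?invr_gt0//; lra.
    rewrite andbT; have [ta|ta] /= := lerP (x - d ^+ 2) t; last first.
      rewrite /g clamp_ge1; first by rewrite subrr expr0n/= mul0r.
      by rewrite ler_pdivlMr//; lra.
    rewrite mulr_ile1 ?sqr_ge0//.
      by rewrite exprn_ile1// /g; lra.
    by rewrite exprn_ile1.
  move=> hd; apply: le_trans (ler_wpM2r (nm_ge0 e) hd) _.
  rewrite /d mulrAC ler_pdivrMr ?ltr_wpDl ?nm_ge0// ler_wpM2l ?(ltW eps0)//.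
  by rewrite lerDl.
have A n : {ae mu, forall x, c n x * e x = 0}.
  have H1 y : mu.-integrable `]-oo, y] (EFin \o (fun t => c n t * e t)).
    by apply: integrableS (fi n).
  have H2 : locally_integrable [set: R] (fun t => c n t * e t).
    by apply: open_integrable_locally; [exact: openT|exact: (fi n)].
  have := FTC1Ny H1 H2.
  apply: aeS => x [_ <-].
  rewrite (_ : (fun _ => _) = fun=> 0); last by apply/funext => y; exact: F0.
  by apply: der_derive1; exact: der_cst.
have : mu.-negligible (\bigcup_n [set x | ~ (c n x * e x = 0)]).
  by apply: negligible_bigcup => n; exact: A.
apply: negligibleS => x /= ex.
exists (Num.truncn `|x|).+1 => // /eqP; rewrite mulf_eq0 => /orP[|/eqP//].
rewrite /c clamp_ge1 ?oner_eq0//.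
have := truncnS_gt `|x|; rewrite -!natr1; lra.
Qed.

(** Formally $e$ is a multiple of $e^{-x}$, which is not square integrable. Weakly, the equation
    forces $\langle f_0,e\rangle=e^{-L}\langle f_0(\cdot+L),e\rangle$ for continuous compactly
    supported $f_0$, and the right side tends to 0 as $L\to\infty$. *)
Lemma wd_uniq e : L2 e -> wd e (fun x => - e x) -> {ae mu, forall x, e x = 0}.
Proof.
move=> he we; apply: cc_dense => // f0 hf0.
pose b (x : R) := expR (- x) * f0 x.
have eN : continuous (fun x : R => expR (- x)).
  by apply: cont_comp; [exact: continuous_expR|exact: opp_continuous].
have cb : cc b by exact: ccM.
have key L : ip f0 e = expR (- L) * ip (fun x => f0 (x + L)) e.
  (* This function has integral 0, so its primitive [F] has compact support and $e^xF$ is a test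
     function; inserted into the equation it leaves $\langle e^x\psi,e\rangle=0$. *)
  pose psi x := b x - b (x + L).
  have ib := cc_integ cb; have ibL := cc_integ (cc_shift L cb).
  have ipsi : integ psi by exact: integB.
  have cpsi : continuous psi.
    by move=> x; apply: cvgB; [case: cb => + _; exact|case: (cc_shift L cb) => + _; exact].
  pose F x := \int[mu]_(t in `]-oo, x]) psi t.
  have dF (x : R) : is_derive x 1 F (psi x).
    have H1 : x < x + 1 by rewrite ltrDl.
    have H2 : mu.-integrable `]-oo, x + 1] (EFin \o psi) by exact: integrableS ipsi.
    have [||] := @continuous_FTC1 R psi -oo%O x (x + 1) H1 H2; [by rewrite ltNyr|exact: cpsi|].
    by move=> d <-; rewrite derive1E; exact/derivableP.
  have [M hM] : exists M, forall x, M < `|x| -> psi x = 0.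
    have [_ [M1 h1]] := cb; have [_ [M2 h2]] := cc_shift L cb.
    exists (Num.max M1 M2) => x; rewrite gt_max => /andP[l1 l2].
    by rewrite /psi h1// h2// subrr.
  have F0 x : M < `|x| -> F x = 0.
    move=> hx; rewrite /F Rintegral_mkcond; have [x0|x0] := lerP 0 x.
      rewrite (_ : \int[mu]_t _ = \int[mu]_t psi t); last first.
        apply: eq_int => t; rewrite patchE mem_setE in_itv/=.
        have [//|tx] := lerP t x; rewrite hM//.
        move: hx; rewrite !ger0_norm//; lra.
      rewrite intB//.
      rewrite (mpres_int (@shift_measurable R L) (@shift_oc R L)) ?subrr//.
      exact: integ_measurable.
    rewrite (_ : \int[mu]_t _ = \int[mu]_t (fun=> 0) t); last first.
      apply: eq_int => t; rewrite patchE mem_setE in_itv/=.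
      have [tx|//] := lerP t x; rewrite hM//.
      move: hx; rewrite !ltr0_norm//; lra.
    by rewrite /Rintegral integral0.
  have tF : test_fun (fun x => expR x * F x).
    apply: (@is_test _ _ (fun x => expR x * F x + expR x * psi x)).
    - move=> x; apply: (is_derive_eq (derM (is_derive_expR x) (dF x))) => //.
    - have cF : continuous F by apply: der_continuous => x; eexists; exact: dF.
      move=> x; apply: cvgD; apply: cvgM.
      + exact: continuous_expR.
      + exact: cF.
      + exact: continuous_expR.
      + exact: cpsi.
    - by exists M => x /F0 ->; rewrite mulr0.
  have := we _ tF.
  have LF := cc_L2 (test_cc tF).
  have Lpsi : L2 (fun x => expR x * psi x).
    apply: cc_L2; split; last by exists M => x /hM ->; rewrite mulr0.
    by move=> x; apply: cvgM; [exact: continuous_expR|exact: cpsi].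
  rewrite (_ : derive1 _ = (fun x => expR x * F x + expR x * psi x)); last first.
    apply/funext => x; apply: der_derive1.
    by apply: (is_derive_eq (derM (is_derive_expR x) (dF x))).
  rewrite ipDl// ipNr// opprK => hh.
  have {hh} : ip (fun x => expR x * psi x) e = 0 by lra.
  have LL := cc_L2 (cc_shift L hf0).
  rewrite (_ : (fun x => expR x * psi x)
      = (fun x => f0 x - expR (- L) * f0 (x + L))); last first.
    apply/funext => x; rewrite /psi /b mulrBr !mulrA -!expRD subrr expR0 mul1r.
    by rewrite opprD addrA subrr add0r.
  rewrite ipBl//; [|exact: cc_L2|exact: L2Z].
  by rewrite ipZl// => /eqP; rewrite subr_eq0 => /eqP.
apply/eqP; rewrite -normr_le0.
have B L : `|ip f0 e| <= expR (- L) * (nm f0 * nm e).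
  rewrite (key L) normrM ger0_norm ?expR_ge0// ler_wpM2l ?expR_ge0//.
  have LL := cc_L2 (cc_shift L hf0).
  apply: le_trans (ip_CSn LL he) _.
  by rewrite /nm (mpres_ip (@shift_measurable R L) (@shift_oc R L))//; exact: cc_L2.
have : (expR (- L) * (nm f0 * nm e)) @[L --> +oo] --> 0 * (nm f0 * nm e).
  by apply: cvgMl; exact: cvgr_expR.
rewrite mul0r => hl.
by apply: (ler_cvg_to (cvg_cst _) hl); near=> L; exact: B.
Unshelve. all: by end_near. Qed.

End Uniqueness.

(** * The Green operator $(1-\partial_x^2)^{-1}$ and the space $H^2$ *)

Section Green.
Variable R : realType.
Local Notation mu := (@lebesgue_measure R).
Implicit Types f g h phi : R -> R.
Local Notation expk := (@expk R).

Lemma wd_opp f g : L2 f -> L2 g -> wd f g ->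
  wd (fun x => f (- x)) (fun x => - g (- x)).
Proof.
move=> hf hg wf phi tp; have [to de] := test_opp tp.
have om := @opp_measurable R; have oc := @opp_oc R.
have hp := cc_L2 (test_cc tp); have hd := cc_L2 (test_cc_der tp).
have Lo h : L2 h -> L2 (fun x => h (- x)) by move=> ?; exact: (mpres_L2 om oc).
have := wf _ to; rewrite de ipNl//; last exact: Lo.
rewrite -(mpres_ip om oc)//; last exact: Lo.
rewrite -[in RHS](mpres_ip om oc)//; last exact: Lo.
under eq_fun do rewrite opprK.
under [X in _ = - ip X _]eq_fun do rewrite opprK.
by move=> /oppr_inj ->; rewrite ipNr ?opprK//; exact: Lo.
Qed.

Lemma wd_uniqP e : L2 e -> wd e e -> {ae mu, forall x, e x = 0}.
Proof.
move=> he we; have om := @opp_measurable R; have oc := @opp_oc R.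
have := wd_uniq (mpres_L2 om oc he) (wd_opp he he we).
move=> /(mpres_ae om oc); apply: aeS => x /=; by rewrite opprK.
Qed.

Definition h2 f f1 f2 := [/\ L2 f, L2 f1, L2 f2, wd f f1 & wd f1 f2].

Definition Kt g := kop (ktr expk) g.
(** The factorisation $(1-\partial_x^2)^{-1}=(1+\partial_x)^{-1}(1-\partial_x)^{-1}$. The result is
    a function with values at every point, not a class modulo null sets. *)
Definition G g := kop expk (Kt g).

Let mk := @expk_markov R.
Let mt := markov_tr mk.

Lemma Kt_L2 g : L2 g -> L2 (Kt g). Proof. by move=> /(kop_L2 mt)[]. Qed.
Lemma G_L2 g : L2 g -> L2 (G g).
Proof. by move=> /Kt_L2 /(kop_L2 mk)[]. Qed.

Lemma h2_G g : L2 g -> h2 (G g) (fun x => Kt g x - G g x) (fun x => G g x - g x).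
Proof.
move=> hg; have hK := Kt_L2 hg; have hG := G_L2 hg.
split => //; [exact: L2B|exact: L2B|exact: wd_K|].
have := wdB hK (L2B hK hg) hG (L2B hK hG) (wd_Kt hg) (wd_K hK).
apply: wd_ae; [exact: L2B|do 2 apply: L2B => //|exact: L2B|exact: L2B|exact: aeW|].
by apply: aeW => x /=; rewrite -/(Kt g) -/(G g); ring.
Qed.

Lemma h2B f f1 f2 g g1 g2 : h2 f f1 f2 -> h2 g g1 g2 ->
  h2 (fun x => f x - g x) (fun x => f1 x - g1 x) (fun x => f2 x - g2 x).
Proof.
by case=> ? ? ? ? ? [? ? ? ? ?]; split; first [exact: L2B|exact: wdB].
Qed.

(** The equation $f=f''$ factorises: $e=f'-f$ satisfies $e'=-e$, hence vanishes, and then $f'=f$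
    forces $f=0$ as well. *)
Lemma h2_uniq f f1 f2 : h2 f f1 f2 -> {ae mu, forall x, f x = f2 x} ->
  {ae mu, forall x, f x = 0} /\ {ae mu, forall x, f1 x = 0}.
Proof.
case=> hf h1 h2' w1 w2 e.
have he : L2 (fun x => f1 x - f x) by exact: L2B.
have hn : L2 (fun x => - (f1 x - f x)) by exact: L2N.
have we : wd (fun x => f1 x - f x) (fun x => - (f1 x - f x)).
  have := wdB h1 h2' hf h1 w2 w1; apply: wd_ae => //; first exact: L2B.
    exact: aeW.
  by apply: aeS e => x ->; ring.
have e1 := wd_uniq he we.
have e0 : {ae mu, forall x, f x = 0}.
  apply: wd_uniqP => //; apply: (wd_ae hf h1 hf hf _ _ w1); first exact: aeW.
  by apply: aeS e1 => x /eqP; rewrite subr_eq0 => /eqP.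
by split => //; apply: aeS2 e0 e1 => x ->; rewrite subr0.
Qed.

(** Both sides have the same image under $1-\partial_x^2$, so [h2_uniq] applies to their difference.
    This makes $H^2$ the range of [G]. *)
Lemma h2_rep f f1 f2 : h2 f f1 f2 ->
  {ae mu, forall x, f x = G (fun y => f y - f2 y) x} /\
  {ae mu, forall x, f1 x = Kt (fun y => f y - f2 y) x - G (fun y => f y - f2 y) x}.
Proof.
move=> hh; have [hf h1 h2' _ _] := hh.
set g := fun y => f y - f2 y; have hg : L2 g by exact: L2B.
have [|e0 e1] := h2_uniq (h2B hh (h2_G hg)).
  by apply: aeW => x; rewrite /g; ring.
by split; [apply: aeS e0|apply: aeS e1] => x /eqP; rewrite subr_eq0 => /eqP.
Qed.

Lemma G_sym f g : L2 f -> L2 g -> ip (G f) g = ip f (G g).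
Proof.
move=> hf hg; have kf := Kt_L2 hf; have kg := Kt_L2 hg.
rewrite /G kop_adj// [RHS]ipC kop_adj// (ipC (Kt g)); congr ip.
Qed.

Lemma Kt_nm g : L2 g -> ip (Kt g) (Kt g) <= ip g g.
Proof. by move=> /(kop_L2 mt)[]. Qed.

Lemma G_nm g : L2 g -> ip (G g) (G g) <= ip g g.
Proof.
by move=> hg; apply: le_trans (Kt_nm hg); case: (kop_L2 mk (Kt_L2 hg)).
Qed.

(** One has $\langle g,Gg\rangle=\|K^tg\|^2$, and $Gg=K(K^tg)$ with $K$ a contraction. *)
Lemma G_pos g : L2 g -> ip (G g) (G g) <= ip g (G g).
Proof.
move=> hg; have hk := Kt_L2 hg.
have -> : ip g (G g) = ip (Kt g) (Kt g) by rewrite ipC [G g]/(kop _ _) kop_adj.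
by case: (kop_L2 mk hk).
Qed.

Lemma Kt_ae f g : L2 f -> L2 g -> {ae mu, forall x, f x = g x} -> Kt f = Kt g.
Proof. by move=> hf hg e; apply/funext => x; exact: kop_ae. Qed.

Lemma G_ae f g : L2 f -> L2 g -> {ae mu, forall x, f x = g x} -> G f = G g.
Proof. by move=> hf hg e; rewrite /G (Kt_ae hf hg e). Qed.

Lemma GD f g : L2 f -> L2 g -> G (fun x => f x + g x) = (fun x => G f x + G g x).
Proof.
move=> hf hg; apply/funext => x; rewrite /G.
have -> : Kt (fun x => f x + g x) = (fun x => Kt f x + Kt g x).
  by apply/funext => y; exact: kopD.
by apply: kopD => //; exact: Kt_L2.
Qed.

Lemma GZ c f : L2 f -> G (fun x => c * f x) = (fun x => c * G f x).
Proof.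
move=> hf; apply/funext => x; rewrite /G.
have -> : Kt (fun x => c * f x) = (fun x => c * Kt f x).
  by apply/funext => y; exact: kopZ.
by apply: kopZ => //; exact: Kt_L2.
Qed.

Lemma G_sup g x : L2 g -> `|G g x| <= nm g.
Proof.
move=> hg; apply: le_trans (kop_sup mk x (Kt_L2 hg)) _.
by apply: ler_wsqrtr; exact: Kt_nm.
Qed.

(** Cauchy-Schwarz reduces the claim to $\int|k(z,y)-k(x,y)|^2dy\le 2(z-x)$ for the exponential
    kernel. *)
Lemma G_hoelder g x z : L2 g -> x <= z ->
  (G g z - G g x) ^+ 2 <= 2 * (z - x) * ip g g.
Proof.
move=> hg xz; have hk := Kt_L2 hg.
pose d y := expk (z, y) - expk (x, y).
have hd : L2 d by apply: L2B; exact: (kernel_L2 mk).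
have -> : G g z - G g x = ip d (Kt g).
  rewrite ipBl//; exact: (kernel_L2 mk).
apply: le_trans (ip_CS hd hk) _.
apply: ler_pM; [exact: ip_ge0|exact: ip_ge0| |exact: Kt_nm].
pose E := expR (x - z); have E1 : E <= 1 by rewrite /E expR_le1; lra.
have E0 : 0 <= E by exact: expR_ge0.
have EE : 1 - E <= z - x by have := expR_ge1Dx (x - z); rewrite -/E; lra.
have i1 := kernel_integ mk.
apply: (@le_trans _ _ (\int[mu]_y ((expk (z, y) - E * expk (x, y)) + (1 - E) * expk (x, y)))).
  apply: int_le; first exact: L2_mul.
    apply: integD; last exact: integZ.
    by apply: integB => //; exact: integZ.
  move=> y; rewrite -expr2.
  have zy0 := mk_ge0 mk (z, y); have xy0 := mk_ge0 mk (x, y).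
  have zy1 := mk_le1 mk (z, y); have xy1 := mk_le1 mk (x, y).
  (* Hence the difference of the rows is at most $(k_z-Ek_x)+(1-E)k_x$ in absolute value, and this
     has integral $2(1-E)\le2(z-x)$. *)
  have k : E * expk (x, y) <= expk (z, y).
    rewrite /expk /=; have [yx|yx] := lerP y x; last by rewrite !mulr0 mulr_ge0// expR_ge0.
    rewrite (le_trans yx xz) !mulr1 /E -expRD ler_expR; lra.
  rewrite /d.
  apply: (@le_trans _ _ `|expk (z, y) - expk (x, y)|).
    rewrite -[leLHS]real_normK ?num_real// expr2 ler_piMl// ler_norml; lra.
  by rewrite ler_norml; nra.
rewrite intD; [|by apply: integB => //; exact: integZ|exact: integZ].
rewrite intB//; last exact: integZ.
by rewrite !intZ// !(kernel_int mk) !mulr1; lra.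
Qed.

End Green.

(** * Completeness of $L^2$ for geometrically convergent series *)

Section Completeness.
Variable R : realType.
Local Notation mu := (@lebesgue_measure R).

Lemma geo_lim (a : nat -> R) (A : R) : (forall n, `|a n| <= A * (1/2) ^+ n) ->
  cvgn (series a) /\
  forall p, `|limn (series a) - \sum_(i < p) a i| <= 2 * A * (1/2) ^+ p.
Proof.
move=> ha.
have A0 : 0 <= A by have := ha 0%N; rewrite expr0 mulr1; apply: le_trans.
have half : `|(1/2 : R)| < 1 by rewrite ger0_norm; lra.
have ca : cvgn (series a).
  apply: normed_cvg; apply: (@series_le_cvg _ _ (geometric A (1/2))).
  - by move=> n; exact: normr_ge0.
  - by move=> n; apply: mulr_ge0 => //; rewrite exprn_ge0//; lra.
  - exact: ha.
  - exact: is_cvg_geometric_series.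
split=> // p.
have key n : (p <= n)%N -> `|series a n - \sum_(i < p) a i| <= 2 * A * (1/2) ^+ p.
  move=> pn; rewrite /series /= (big_cat_nat _ pn)//= big_mkord addrAC subrr add0r.
  apply: le_trans (ler_norm_sum _ _ _) _.
  have : forall m, \sum_(p <= i < p + m) `|a i| <= 2 * A * ((1/2) ^+ p - (1/2) ^+ (p + m)).
    elim=> [|m ih]; first by rewrite addn0 big_geq// subrr mulr0.
    rewrite addnS big_nat_recr/= ?leq_addr//.
    apply: le_trans (lerD ih (ha _)) _.
    rewrite exprS le_eqVlt; apply/orP; left; apply/eqP; by field.
  move/(_ (n - p)%N); rewrite subnKC// => h; apply: le_trans h _.
  rewrite ler_wpM2l//; first by rewrite mulr_ge0.
  by rewrite gerBl exprn_ge0//; lra.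
have lc : `|series a n - \sum_(i < p) a i| @[n --> \oo] --> `|limn (series a) - \sum_(i < p) a i|.
  by apply: cvg_norm; apply: cvgB; [exact: ca|exact: cvg_cst].
by apply: (cvgr_to_le lc); exists p => // n /= pn; exact: key.
Qed.

(** The weighted sum $H=\sum_n4^nf_n^2$ has integral at most $2C$, so it is finite almost
    everywhere; there $|f_n|\le2^{-n}\sqrt H$, which gives pointwise convergence with an integrable
    bound for the squared remainder. *)
Lemma L2_complete (f : nat -> R -> R) (C : R) : 
  (forall n, L2 (f n)) -> (forall n, ip (f n) (f n) <= C * (1/16) ^+ n) ->
  exists F, L2 F /\ forall p,
    ip (fun x => F x - \sum_(i < p) f i x) (fun x => F x - \sum_(i < p) f i x)
      <= 8 * C * (1/4) ^+ p.
Proof.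
move=> hf hC.
have C0 : 0 <= C by have := hC 0%N; rewrite expr0 mulr1; apply: le_trans; exact: ip_ge0.
pose u n x : \bar R := (4 ^+ n * f n x ^+ 2)%:E.
have u0 n x : (0 <= u n x)%E by rewrite lee_fin mulr_ge0 ?sqr_ge0 ?exprn_ge0.
have mu_ n : measurable_fun [set: R] (u n).
  apply/measurable_EFinP; apply: measurable_funM => //.
  by apply: measurable_funX; case: (hf n).
pose H x : \bar R := (\sum_(n <oo) u n x)%E.
have H0 x : (0 <= H x)%E by apply: nneseries_ge0.
have mH : measurable_fun [set: R] H.
  exact: (@ge0_emeasurable_sum _ _ _ _ u xpredT).
have iH : (\int[mu]_x H x <= (2 * C)%:E)%E.
  rewrite integral_nneseries//.
  apply: lime_le; first by apply: is_cvg_nneseries => n _ _; apply: integral_ge0.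
  apply: nearW => m.
  apply: (@le_trans _ _ (\sum_(0 <= i < m) (C * (1/4) ^+ i)%:E)%E).
    apply: lee_sum => i _.
    rewrite (int_EFin (integZ (4 ^+ i) (proj2 (hf i)))) intZ; last by case: (hf i).
    rewrite lee_fin; apply: (@le_trans _ _ (4 ^+ i * (C * (1/16) ^+ i))).
      by rewrite ler_wpM2l ?exprn_ge0//; exact: hC.
    rewrite mulrCA -exprMn le_eqVlt; apply/orP; left; apply/eqP.
    by congr (_ * _ ^+ _); field.
  rewrite sumEFin lee_fin -big_distrr/= mulrC ler_wpM2r//.
  suff -> : \sum_(0 <= i < m) (1 / 4 : R) ^+ i = 4/3 * (1 - (1/4) ^+ m).
    by have : 0 <= (1/4 : R) ^+ m by [rewrite exprn_ge0//; lra]; lra.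
  elim: m => [|m ih]; first by rewrite big_geq// expr0; ring.
  by rewrite big_nat_recr//= ih exprS; field.
have HI : mu.-integrable [set: R] H.
  apply/integrableP; split => //.
  under eq_integral => x _ do rewrite gee0_abs//.
  by apply: le_lt_trans iH _; rewrite ltry.
pose N := [set x | H x \is a fin_num].
have mN : measurable N by rewrite -[N]setTI; exact: emeasurable_fin_num.
have aeN : {ae mu, forall x, N x}.
  by have := integrable_ae measurableT HI; apply: aeS => x; apply.
have mN1 : measurable_fun [set: R] (\1_N : R -> R) by exact: measurable_indic.
(* The terms are set to 0 where [H] is infinite, so that the series converges at every point. *)
pose g n x : R := f n x * \1_N x.
have mg n : measurable_fun [set: R] (g n).
  by apply: measurable_funM; [case: (hf n)|exact: measurable_indic].
have Lg n : L2 (g n).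
  rewrite (_ : g n = (fun x => \1_N x * f n x)); last first.
    by apply/funext => x; rewrite /g mulrC.
  apply: (@L2_bounded_mul _ _ _ 1) => //.
  by move=> x; rewrite indicE; case: (_ \in _); rewrite ?normr1 ?normr0.
pose h x : R := fine (H x) * \1_N x.
have h0 x : 0 <= h x by rewrite mulr_ge0 ?fine_ge0.
have gb x n : `|g n x| <= Num.sqrt (h x) * (1/2) ^+ n.
  have p2 : 0 <= (1/2 : R) ^+ n by rewrite exprn_ge0//; lra.
  rewrite -(@ler_pXn2r _ 2)// ?nnegrE ?mulr_ge0 ?sqrtr_ge0//.
  rewrite real_normK ?num_real// (exprMn _ (Num.sqrt _)) sqr_sqrtr// /g /h indicE.
  case: (boolP (x \in N)) => xN; rewrite ?mulr0 ?mulr1 ?mul0r ?expr0n//=.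
  have : (u n x <= H x)%E.
    have := @nneseries_lim_ge R (u^~ x) xpredT 0 n.+1 (fun n _ _ => u0 n x).
    apply: le_trans; rewrite big_nat_recr//=; apply: leeDr.
    exact: sume_ge0.
  rewrite inE in xN; rewrite -(fineK xN) lee_fin => ux.
  have -> : ((1/2 : R) ^+ n) ^+ 2 = (1/4) ^+ n.
    by rewrite -exprM mulnC exprM; congr (_ ^+ _); field.
  have p4 : 0 <= (1/4 : R) ^+ n by rewrite exprn_ge0//; lra.
  have := ler_wpM2r p4 ux; rewrite mulrAC -exprMn.
  by rewrite (_ : 4 * (1/4) = 1 :> R) ?expr1n ?mul1r//; field.
have gl x := geo_lim (gb x).
pose F x := limn (series (g ^~ x)).
have mF : measurable_fun [set: R] F.
  apply: (@measurable_fun_cvg _ _ _ _ (fun n x => series (g ^~ x) n)).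
    move=> m; rewrite /series /=; exact: measurable_sum.
  by move=> x _; case: (gl x).
have mh : measurable_fun [set: R] h.
  apply: measurable_funM; last exact: measurable_indic.
  exact: (measurableT_comp (fine_measurable measurableT) mH).
have ih : integ h /\ \int[mu]_x h x <= 2 * C.
  have e : (\int[mu]_x (h x)%:E = \int[mu]_x H x)%E.
    apply: ae_eq_integral => //; first exact/measurable_EFinP.
    apply: aeS aeN => x xN _; rewrite /h indicE mem_set//= mulr1 fineK//.
  have ih : integ h by apply: integ_lt => //; rewrite e; apply: le_lt_trans iH _; rewrite ltry.
  by split => //; rewrite -lee_fin -int_EFin// e.
have [ih1 ih2] := ih.
have Fb p x : (F x - \sum_(i < p) g i x) ^+ 2 <= 4 * (1/4) ^+ p * h x.
  have [_ /(_ p)] := gl x; rewrite -/(F x) => le1.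
  rewrite -[leLHS]real_normK ?num_real//.
  have p2 : 0 <= (1/2 : R) ^+ p by rewrite exprn_ge0//; lra.
  apply: (@le_trans _ _ ((2 * Num.sqrt (h x) * (1 / 2) ^+ p) ^+ 2)).
    by rewrite ler_pXn2r// nnegrE ?mulr_ge0 ?sqrtr_ge0.
  have : ((1/2 : R) ^+ p) ^+ 2 = (1/4) ^+ p.
    by rewrite -exprM mulnC exprM; congr (_ ^+ _); field.
  set q := (1/2) ^+ p => qe; rewrite -qe [leLHS]exprMn (exprMn _ 2) sqr_sqrtr//.
  by rewrite le_eqVlt; apply/orP; left; apply/eqP; ring.
have Lr p : L2 (fun x => F x - \sum_(i < p) g i x).
  have mr : measurable_fun [set: R] (fun x => F x - \sum_(i < p) g i x).
    apply: measurable_funB => //; exact: measurable_sum.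
  split => //; apply: (integ_le _ (integZ (4 * (1/4) ^+ p) ih1)).
    exact: measurable_funX.
  by move=> x; rewrite ger0_norm ?sqr_ge0//; exact: Fb.
exists F; split.
  have := Lr 0%N; congr L2; apply/funext => x; by rewrite big_ord0 subr0.
move=> p; set r := (fun x => F x - _).
have Ls : L2 (fun x => \sum_(i < p) f i x).
  elim: p {r} => [|p ihp]; first by under eq_fun do rewrite big_ord0; exact: L2_0.
  by under eq_fun do rewrite big_ord_recr/=; exact: L2D.
have LF : L2 F by have := Lr 0%N; congr L2; apply/funext => x; rewrite big_ord0 subr0.
have Lrr : L2 r by exact: L2B.
have er : {ae mu, forall x, r x = F x - \sum_(i < p) g i x}.
  apply: aeS aeN => x xN; rewrite /r; congr (_ - _); apply: eq_bigr => i _.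
  by rewrite /g indicE mem_set// mulr1.
rewrite (ae_eq_ip Lrr (Lr p) Lrr (Lr p) er er).
apply: (@le_trans _ _ (\int[mu]_x (4 * (1/4) ^+ p * h x))).
  apply: int_le; [exact: L2_mul|exact: integZ|].
  by move=> x; rewrite -expr2; exact: Fb.
rewrite intZ//; have p4 : 0 <= (1/4 : R) ^+ p by rewrite exprn_ge0//; lra.
nra.
Qed.

End Completeness.

(** * Linear operators on a complete seminormed complex space *)

Section LinearOps.
Variable R : realType.
Local Notation C := R[i].
Local Notation normc := (@Normc.normc R).

Lemma normc_ge0 (z : C) : 0 <= normc z.
Proof. by case: z => a b; exact: sqrtr_ge0. Qed.

Lemma normc_real (a : R) : normc (real_complex R a) = `|a|.
Proof. by rewrite /Normc.normc /= expr0n/= addr0 sqrtr_sqr. Qed.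

Lemma normcX (z : C) n : normc (z ^+ n) = normc z ^+ n.
Proof. by elim: n => [|n ih]; rewrite ?expr0 ?Normc.normc1// !exprS Normc.normcM ih. Qed.

Lemma normcB (x y : C) : normc (x - y) <= normc x + normc y.
Proof. by apply: le_trans (le_normcD _ _) _; rewrite normcN. Qed.

Lemma normc_sum (I : Type) (s : seq I) (F : I -> C) :
  normc (\sum_(i <- s) F i) <= \sum_(i <- s) normc (F i).
Proof.
elim: s => [|i s ih]; first by rewrite !big_nil Normc.normc0.
by rewrite !big_cons; apply: le_trans (le_normcD _ _) _; rewrite lerD2l.
Qed.

Variables (H : lmodType C) (N : H -> R).

(** Only a seminorm: in the application the elements are functions, and [N (x - y) = 0] is equality
    almost everywhere. Injectivity and surjectivity below are meant modulo this relation. *)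
Record seminorm : Prop := Seminorm {
  snD : forall x y, N (x + y) <= N x + N y;
  snZ : forall a x, N (a *: x) = normc a * N x }.

(** The two rates are those of [L2_complete] after taking square roots: terms of size $4^{-n}$ leave
    remainders of size $2^{-p}$. *)
Definition scomplete := forall (f : nat -> H) (B : R),
  (forall n, N (f n) <= B * (1/4) ^+ n) ->
  exists F K, forall p, N (F - \sum_(i < p) f i) <= K * (1/2) ^+ p.

Definition lin (T : H -> H) := forall a x y, T (a *: x + y) = a *: T x + T y.
Definition linf (l : H -> C) := forall a x y, l (a *: x + y) = a * l x + l y.
Definition bdd (T : H -> H) (K : R) := forall x, N (T x) <= K * N x.
Definition below (T : H -> H) (c : R) := forall x, c * N x <= N (T x).
Definition onto (T : H -> H) := forall g, exists x, N (T x - g) = 0.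
Definition inj0 (T : H -> H) := forall x, N (T x) = 0 -> N x = 0.

Hypothesis sn : seminorm.

Lemma sn0 : N 0 = 0.
Proof. by rewrite -(scale0r 0) (snZ sn) Normc.normc0 mul0r. Qed.

Lemma snN x : N (- x) = N x.
Proof. by rewrite -scaleN1r (snZ sn) normcN Normc.normc1 mul1r. Qed.

Lemma sn_ge0 x : 0 <= N x.
Proof. by have := snD sn x (- x); rewrite subrr sn0 snN; lra. Qed.

Lemma snB x y : N (x - y) <= N x + N y.
Proof. by apply: le_trans (snD sn _ _) _; rewrite snN. Qed.

Lemma sn_swap x y : N (x - y) = N (y - x).
Proof. by rewrite -snN opprB. Qed.

Lemma sn_tri y x z : N (x - z) <= N (x - y) + N (y - z).
Proof. by apply: le_trans (snD sn _ _); rewrite addrA subrK. Qed.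

Lemma sn_eq x y : N (x - y) = 0 -> N x = N y.
Proof.
move=> h; apply/eqP; rewrite eq_le.
have := snD sn (x - y) y; have := snD sn (y - x) x.
by rewrite !subrK -sn_swap h !add0r => -> ->.
Qed.

Lemma sn_eq0 x : N x <= 0 -> N x = 0.
Proof. by move=> h; apply/eqP; rewrite eq_le h sn_ge0. Qed.

Lemma eqn_refl x : N (x - x) = 0. Proof. by rewrite subrr sn0. Qed.

Lemma eqn_trans y x z : N (x - y) = 0 -> N (y - z) = 0 -> N (x - z) = 0.
Proof.
move=> h1 h2; apply: sn_eq0; apply: le_trans (sn_tri y _ _) _.
by rewrite h1 h2 addr0.
Qed.

Lemma eqnD x x' y y' : N (x - x') = 0 -> N (y - y') = 0 ->
  N ((x + y) - (x' + y')) = 0.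
Proof.
move=> h1 h2; apply: sn_eq0; rewrite opprD addrACA.
by apply: le_trans (snD sn _ _) _; rewrite h1 h2 addr0.
Qed.

Lemma eqnB x x' y y' : N (x - x') = 0 -> N (y - y') = 0 ->
  N ((x - y) - (x' - y')) = 0.
Proof.
by move=> h1 h2; apply: eqnD => //; rewrite -opprD snN.
Qed.

Lemma eqnZ a x x' : N (x - x') = 0 -> N (a *: x - a *: x') = 0.
Proof. by move=> h; rewrite -scalerBr (snZ sn) h mulr0. Qed.

Lemma sn_sum (I : Type) (s : seq I) (F : I -> H) :
  N (\sum_(i <- s) F i) <= \sum_(i <- s) N (F i).
Proof.
elim: s => [|i s ih]; first by rewrite !big_nil sn0.
by rewrite !big_cons; apply: le_trans (snD sn _ _) _; rewrite lerD2l.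
Qed.

Lemma geo0 (a B : R) : (forall p, a <= B * (1/2) ^+ p) -> a <= 0.
Proof.
move=> h; have hc : (fun p : nat => B * (1/2) ^+ p) @ \oo --> 0.
  by apply: (@cvg_geometric R B (1/2)); rewrite ger0_norm; lra.
by apply: (ler_cvg_to (cvg_cst a) hc); apply: nearW => p; exact: h.
Qed.

Section Lin.
Variables (T : H -> H) (lT : lin T).
Lemma linD x y : T (x + y) = T x + T y.
Proof. by rewrite -{1}(scale1r x) lT scale1r. Qed.
Lemma linT0 : T 0 = 0.
Proof. by apply: (addrI (T 0)); rewrite -linD !addr0. Qed.
Lemma linZ a x : T (a *: x) = a *: T x.
Proof. by rewrite -[a *: x]addr0 lT linT0 addr0. Qed.
Lemma linN x : T (- x) = - T x.
Proof. by rewrite -scaleN1r linZ scaleN1r. Qed.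
Lemma linB x y : T (x - y) = T x - T y.
Proof. by rewrite linD linN. Qed.
Lemma lin_sum (I : Type) (s : seq I) (F : I -> H) :
  T (\sum_(i <- s) F i) = \sum_(i <- s) T (F i).
Proof.
by elim: s => [|i s ih]; rewrite ?big_nil ?linT0// !big_cons linD ih.
Qed.
End Lin.

Section Linf.
Variables (l : H -> C) (ll : linf l).
Lemma linfD x y : l (x + y) = l x + l y.
Proof. by rewrite -{1}(scale1r x) ll mul1r. Qed.
Lemma linf0 : l 0 = 0.
Proof. by apply: (addrI (l 0)); rewrite -linfD !addr0. Qed.
Lemma linfZ a x : l (a *: x) = a * l x.
Proof. by rewrite -[a *: x]addr0 ll linf0 addr0. Qed.
Lemma linfB x y : l (x - y) = l x - l y.
Proof. by rewrite linfD -scaleN1r linfZ mulN1r. Qed.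
Lemma linf_sum (I : Type) (s : seq I) (F : I -> H) :
  l (\sum_(i <- s) F i) = \sum_(i <- s) l (F i).
Proof.
by elim: s => [|i s ih]; rewrite ?big_nil ?linf0// !big_cons linfD ih.
Qed.
Lemma linf_eq L x y : (forall x, normc (l x) <= L * N x) -> N (x - y) = 0 -> l x = l y.
Proof.
move=> hL h; apply/eqP; rewrite -subr_eq0 -linfB; apply/eqP/Normc.eq0_normc.
by apply/eqP; rewrite eq_le normc_ge0 andbT; have := hL (x - y); rewrite h mulr0.
Qed.
End Linf.

Lemma lin_add S T : lin S -> lin T -> lin (fun x => S x + T x).
Proof. by move=> lS lT a x y; rewrite lS lT scalerDr addrACA. Qed.

Lemma lin_scale a T : lin T -> lin (fun x => a *: T x).
Proof. by move=> lT b x y; rewrite lT scalerDr !scalerA mulrC. Qed.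

Lemma bdd_add S T K L : bdd S K -> bdd T L -> bdd (fun x => S x + T x) (K + L).
Proof.
move=> hS hT x; apply: le_trans (snD sn _ _) _.
by rewrite mulrDl; apply: lerD.
Qed.

Lemma bdd_scale a T K : bdd T K -> bdd (fun x => a *: T x) (normc a * K).
Proof. by move=> hT x; rewrite (snZ sn) -mulrA ler_wpM2l ?normc_ge0. Qed.

Lemma below_inj T c : 0 < c -> below T c -> inj0 T.
Proof.
move=> c0 b x h; apply: sn_eq0; have := b x; rewrite h.
by rewrite pmulr_rle0.
Qed.

Lemma below_sol T c g x : 0 < c -> below T c -> N (T x - g) = 0 -> N x <= N g / c.
Proof. by move=> c0 b h; rewrite ler_pdivlMr// mulrC -(sn_eq h). Qed.

Hypothesis sc : scomplete.

(** Neumann series run on the residual: solving $Tx_n=r_n$ leaves the residual $-Sx_n$ of $T+S$,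
    smaller by a factor 4, which is the rate asked for by [scomplete]. *)
Lemma neumann T S K c : lin T -> lin S -> bdd T K -> 0 < c -> below T c ->
  onto T -> bdd S (c / 4) -> onto (fun x => T x + S x).
Proof.
move=> lT lS bT c0 be ont bS g.
have [s hs] := choice ont.
have ns y : N (s y) <= N y / c := below_sol c0 be (hs y).
pose r n := iter n (fun y => - S (s y)) g.
have nr n : N (r n) <= N g * (1/4) ^+ n.
  elim: n => [|n ih]; first by rewrite expr0 mulr1.
  rewrite /r iterS -/(r n) snN; apply: le_trans (bS _) _.
  rewrite exprS mulrCA -mulrA.
  have := ns (r n); rewrite ler_pdivlMr// => h; nra.
pose x n := s (r n).
have nx n : N (x n) <= N g / c * (1/4) ^+ n.
  apply: le_trans (ns _) _; rewrite mulrAC ler_wpM2r ?invr_ge0 ?(ltW c0)//.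
have [F [K' hF]] := sc nx.
exists F; pose A y := T y + S y.
have lA : lin A by exact: lin_add.
have bA : bdd A (K + c / 4) by exact: bdd_add.
have rS p : r p.+1 = - S (x p) by [].
have part p : A (\sum_(i < p) x i) - (g - r p) = \sum_(i < p) (T (x i) - r i).
  elim: p => [|p ih].
    by rewrite !big_ord0 (linT0 lA) /r /= !subrr.
  rewrite !big_ord_recr/= -ih (linD lA) -(subrKA (r p) g (- r p.+1)) opprD addrACA; congr (_ + _).
  by rewrite rS opprK /A opprD addrACA subrr addr0.
apply: sn_eq0; apply: (@geo0 _ (`|K + c/4| * `|K'| + N g)) => p.
set SS := \sum_(i < p) x i.
have p2 : 0 <= (1/2 : R) ^+ p by rewrite exprn_ge0//; lra.
have p42 : (1/4 : R) ^+ p <= (1/2) ^+ p by apply: lerXn2r; rewrite ?nnegrE; lra.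
apply: le_trans (sn_tri (A SS) _ _) _; rewrite mulrDl; apply: lerD.
  rewrite -(linB lA); apply: le_trans (bA _) _.
  have h1 := hF p; have h2 := sn_ge0 (F - SS); rewrite -mulrA.
  apply: (@le_trans _ _ (`|K + c/4| * N (F - SS))).
    by rewrite ler_wpM2r// ler_norm.
  rewrite ler_wpM2l//; apply: le_trans h1 _; rewrite ler_wpM2r// ler_norm//.
apply: le_trans (sn_tri (g - r p) _ _) _.
rewrite part (_ : g - r p - g = - r p); last by rewrite addrAC subrr add0r.
rewrite snN; apply: le_trans (lerD (sn_sum _ _) (nr p)) _.
rewrite big1 ?add0r; last by move=> i _; exact: hs.
by rewrite ler_wpM2l// sn_ge0.
Qed.

(* The method of continuity. *)
Lemma continuation T S K L c : lin T -> lin S -> bdd T K -> bdd S L -> 0 < c ->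
  (forall t : R, 0 <= t <= 1 -> below (fun x => T x + real_complex R t *: S x) c) ->
  onto T -> onto (fun x => T x + S x).
Proof.
move=> lT lS bT bS c0 be ont.
(* So many steps that each increment $S/m$ is small enough for [neumann]. *)
pose m := (Num.truncn (4 * `|L| / c)).+1.
have m0 : 0 < m%:R :> R by rewrite ltr0n.
have mL : `|L| / m%:R <= c / 4.
  have := truncnS_gt (4 * `|L| / c); rewrite -/m ltr_pdivrMr// => h.
  by rewrite ler_pdivrMr//; lra.
have step j : (j <= m)%N -> onto (fun x => T x + real_complex R (j%:R / m%:R) *: S x).
  elim: j => [_|j ih jm].
    move=> g; have [x hx] := ont g; exists x.
    by rewrite mul0r (_ : real_complex R 0 = 0)// scale0r addr0.
  have {}ih := ih (ltnW jm).
  pose Tj x := T x + real_complex R (j%:R / m%:R) *: S x.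
  have jm1 : 0 <= (j%:R / m%:R : R) <= 1.
    by rewrite divr_ge0//= ler_pdivrMr// mul1r ler_nat ltnW.
  have lTj : lin Tj by apply: lin_add => //; exact: lin_scale.
  have bTj := bdd_add bT (bdd_scale (real_complex R (j%:R / m%:R)) bS).
  have lSj := lin_scale (real_complex R (1 / m%:R)) lS.
  have := @neumann Tj (fun x => real_complex R (1 / m%:R) *: S x) _ c lTj lSj bTj c0
    (be _ jm1) ih.
  have bSj : bdd (fun x => real_complex R (1 / m%:R) *: S x) (c / 4).
    move=> x; rewrite (snZ sn) normc_real ger0_norm; last by rewrite divr_ge0.
    have h := bS x; have h0 := sn_ge0 x.
    apply: (@le_trans _ _ (1 / m%:R * (`|L| * N x))).
      rewrite ler_wpM2l ?divr_ge0//; apply: le_trans h _; rewrite ler_wpM2r// ler_norm//.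
    by rewrite mulrA; apply: ler_wpM2r => //; rewrite mul1r mulrC.
  move=> /(_ bSj) h g; have [x hx] := h g; exists x; rewrite -hx; congr N; congr (_ - _).
  rewrite /Tj -addrA -scalerDl -rmorphD -mulrDl natr1//.
have := step m (leqnn m); rewrite divff ?gt_eqF// => h g.
by have [x hx] := h g; exists x; rewrite -hx (_ : real_complex R 1 = 1)// scale1r.
Qed.

End LinearOps.

(** * Analytic functions of one complex variable near 0, and their zeros *)

Section Analytic.
Variable R : realType.
Local Notation C := R[i].
Local Notation normc := (@Normc.normc R).
Implicit Types f g : C -> C.

(* Convergent power series at 0, described by their successive remainders
   [fs n z = a_n + a_(n+1) z + ...]; no series has to be summed. *)
Definition an f := exists (fs : nat -> C -> C) (r B : R), [/\ 0 < r, 1 <= B,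
  forall z, fs 0%N z = f z &
  forall n z, normc z < r ->
    fs n z = fs n 0 + z * fs n.+1 z /\ normc (fs n z) <= B ^+ n.+1].

Lemma an_cst c : an (fun=> c).
Proof.
exists (fun n z => if n is 0 then c else 0), 1, (1 + normc c).
have h : 1 <= 1 + normc c by have := normc_ge0 c; lra.
split => // -[|n] z _; split; rewrite ?mulr0 ?addr0//.
  by rewrite expr1; lra.
by rewrite Normc.normc0 exprn_ge0//; lra.
Qed.

Lemma an_add f g : an f -> an g -> an (fun z => f z + g z).
Proof.
move=> [fs [r [B [r0 B1 f0 hf]]]] [gs [r' [B' [r0' B1' g0 hg]]]].
exists (fun n z => fs n z + gs n z), (Num.min r r'), (B + B'); split.
- by rewrite lt_min r0 r0'.
- lra.
- by move=> z; rewrite f0 g0.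
move=> n z; rewrite lt_min => /andP[h h'].
have [ef bf] := hf n z h; have [eg bg] := hg n z h'; split.
  by rewrite {1}ef {1}eg mulrDr addrACA.
apply: le_trans (le_normcD _ _) _; apply: le_trans (lerD bf bg) _.
rewrite exprS [B' ^+ n.+1]exprS exprS mulrDl.
have l1 : B ^+ n <= (B + B') ^+ n by apply: lerXn2r; rewrite ?nnegrE; lra.
have l2 : B' ^+ n <= (B + B') ^+ n by apply: lerXn2r; rewrite ?nnegrE; lra.
apply: lerD; apply: ler_wpM2l => //; lra.
Qed.

(** The remainders of a product are $f_n(z)g_0(z)+\sum_{i<n}f_i(0)g_{n-i}(z)$. These are $n+1$ terms
    of size at most $B^{n+2}$, and $(n+1)B^{n+2}\le(2B^2)^{n+1}$. *)
Lemma an_mul f g : an f -> an g -> an (fun z => f z * g z).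
Proof.
move=> [fs [r [B0 [r0 B1 f0 hf]]]] [gs [r' [B0' [r0' B1' g0 hg]]]].
pose B := B0 + B0'.
pose h n z := fs n z * gs 0%N z + \sum_(i < n) fs i 0 * gs (n - i)%N z.
have B11 : 1 <= B by rewrite /B; lra.
have nn : normc 0 < Num.min r r' by rewrite Normc.normc0 lt_min r0 r0'.
have bF n z : normc z < Num.min r r' -> normc (fs n z) <= B ^+ n.+1.
  rewrite lt_min => /andP[l1 l2]; have [_ b] := hf n z l1; apply: le_trans b _.
  by apply: lerXn2r; rewrite ?nnegrE /B; lra.
have bG n z : normc z < Num.min r r' -> normc (gs n z) <= B ^+ n.+1.
  rewrite lt_min => /andP[l1 l2]; have [_ b] := hg n z l2; apply: le_trans b _.
  by apply: lerXn2r; rewrite ?nnegrE /B; lra.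
exists h, (Num.min r r'), (2 * B ^+ 2); split.
- by rewrite lt_min r0 r0'.
- have : 1 <= B ^+ 2 by rewrite exprn_ege1. lra.
- by move=> z; rewrite /h big_ord0 addr0 f0 g0.
move=> n z hz; have := hz; rewrite lt_min => /andP[zr zr']; split.
  rewrite /h big_ord_recr /= subSn// subnn.
  have [ef _] := hf n z zr; have [eg _] := hg 0%N z zr'.
  have -> : \sum_(i < n) fs i 0 * gs (n - i)%N z
     = \sum_(i < n) fs i 0 * gs (n - i)%N 0
       + z * \sum_(i < n) fs i 0 * gs (n.+1 - i)%N z.
    rewrite mulr_sumr -big_split/=; apply: eq_bigr => i _.
    have [e _] := hg (n - i)%N z zr'.
    by rewrite {1}e mulrDr -subSn ?(ltnW (ltn_ord i))//; congr (_ + _); rewrite mulrCA.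
  by rewrite ef eg; ring.
rewrite /h; apply: le_trans (le_normcD _ _) _.
apply: (@le_trans _ _ (B ^+ n.+2 + \sum_(i < n) B ^+ n.+2)).
  apply: lerD.
    rewrite Normc.normcM.
    have := ler_pM (normc_ge0 _) (normc_ge0 _) (bF n z hz) (bG 0%N z hz).
    by rewrite expr1 -exprSr.
  apply: le_trans (normc_sum _ _) _; apply: ler_sum => i _.
  rewrite Normc.normcM.
  apply: (@le_trans _ _ (B ^+ i.+1 * B ^+ (n - i).+1)).
    exact: ler_pM (normc_ge0 _) (normc_ge0 _) (bF i 0 nn) (bG (n - i)%N z hz).
  by rewrite -exprD addSn addnS subnKC// ltnW.
rewrite big_const iter_addr_0 cardT size_enum_ord -mulrS -[leLHS]mulr_natl.
rewrite exprMn -exprM; apply: ler_pM; rewrite ?exprn_ge0 ?(le_trans ler01 B11)//.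
  by rewrite -natrX ler_nat ltnW// ltn_expl.
by apply: ler_weXn2l => //; rewrite mul2n -addnn addSn addnS !ltnS leq_addr.
Qed.

Lemma an_sum (I : Type) (s : seq I) (F : I -> C -> C) :
  (forall i, an (F i)) -> an (fun z => \sum_(i <- s) F i z).
Proof.
move=> h; elim: s => [|i s ih].
  by under eq_fun do rewrite big_nil; exact: an_cst.
by under eq_fun do rewrite big_cons; exact: an_add.
Qed.

Lemma an_prod (I : Type) (s : seq I) (F : I -> C -> C) :
  (forall i, an (F i)) -> an (fun z => \prod_(i <- s) F i z).
Proof.
move=> h; elim: s => [|i s ih].
  by under eq_fun do rewrite big_nil; exact: an_cst.
by under eq_fun do rewrite big_cons; exact: an_mul.
Qed.

Lemma an_det m (M : C -> 'M[C]_m) : (forall i j, an (fun z => M z i j)) ->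
  an (fun z => \det (M z)).
Proof.
move=> h; rewrite /determinant; apply: an_sum => s.
by apply: an_mul; [exact: an_cst|apply: an_prod => i; exact: h].
Qed.

(** If some coefficient is nonzero, the first such one dominates near 0. Otherwise $f(z)=z^pf_p(z)$
    for every $p$, which is at most $B\,2^{-p}$ for $|z|<1/(2B)$. *)
Lemma an_dichotomy f : an f ->
  (exists2 rho, 0 < rho & forall z, 0 < normc z < rho -> f z <> 0) \/
  (exists2 rho, 0 < rho & forall z, normc z < rho -> f z = 0).
Proof.
move=> [fs [r [B [r0 B1 f0 hf]]]].
have B0 : 0 < B by lra.
have expand p : (forall i, (i < p)%N -> fs i 0 = 0) ->
    forall z, normc z < r -> f z = z ^+ p * fs p z.
  elim: p => [_ z _|p ih h z zr]; first by rewrite expr0 mul1r f0.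
  rewrite ih// => [|i ip]; last by apply: h; rewrite ltnW.
  by have [-> _] := hf p z zr; rewrite h// add0r mulrA exprSr.
have [[p hp]|hall] := pselect (exists p, fs p 0 != 0); last first.
  right; exists (Num.min r (1 / (2 * B))).
    by rewrite lt_min r0 divr_gt0// mulr_gt0.
  move=> z; rewrite lt_min => /andP[zr zB]; apply: Normc.eq0_normc.
  apply/eqP; rewrite eq_le normc_ge0 andbT; apply: (@geo0 _ _ B) => p.
  rewrite (expand p)//; last first.
    by move=> i _; apply/eqP/negP => /negP e; apply: hall; exists i.
  have [_ b] := hf p z zr; rewrite Normc.normcM normcX.
  apply: (@le_trans _ _ ((1 / (2 * B)) ^+ p * B ^+ p.+1)).
    apply: ler_pM => //; rewrite ?exprn_ge0 ?normc_ge0//.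
    by apply: lerXn2r; rewrite ?nnegrE ?normc_ge0 ?divr_ge0 ?mulr_ge0 ?(ltW B0) ?(ltW zB).
  rewrite exprSr mulrA -exprMn (_ : 1 / (2 * B) * B = 1/2); last by field; rewrite gt_eqF.
  by rewrite mulrC.
left; have hex : exists p, fs p 0 != 0 by exists p.
case: (ex_minnP hex) => {hp}p hp pmin.
pose A := normc (fs p 0).
have A0 : 0 < A.
  rewrite lt_neqAle normc_ge0 andbT eq_sym; apply: contraNneq hp => h.
  by rewrite (Normc.eq0_normc h).
have Bp : 0 < B ^+ p.+2 by rewrite exprn_gt0.
exists (Num.min r (A / B ^+ p.+2)); first by rewrite lt_min r0 divr_gt0.
move=> z /andP[z0]; rewrite lt_min => /andP[zr zA] fz.
have p0 i : (i < p)%N -> fs i 0 = 0.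
  by move=> ip; apply/eqP/negP => /negP e; have := pmin _ e; rewrite leqNgt ip.
have := expand p p0 z zr; rewrite fz.
move/esym/eqP; rewrite mulf_eq0 expf_eq0 => /orP[/andP[_ /eqP e]|/eqP e].
  by move: z0; rewrite e Normc.normc0 ltxx.
have [e2 _] := hf p z zr; have [_ b] := hf p.+1 z zr.
have : A <= normc z * B ^+ p.+2.
  have -> : A = normc (z * fs p.+1 z).
    have -> : z * fs p.+1 z = - fs p 0 by apply/eqP; rewrite -addr_eq0 addrC -e2 e.
    by rewrite normcN.
  by rewrite Normc.normcM ler_wpM2l ?normc_ge0.
by move: zA; rewrite ltr_pdivlMr// => h1 h2; have := lt_le_trans h1 h2; rewrite ltxx.
Qed.

End Analytic.

(** * Finite-rank perturbations of invertible operators *)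

Section FiniteRank.
Variable R : realType.
Local Notation C := R[i].
Local Notation normc := (@Normc.normc R).
Variables (H : lmodType C) (N : H -> R).
Hypothesis sn : seminorm N.
Variables (m : nat) (psi : 'I_m -> H) (l : 'I_m -> H -> C) (L : R).
Hypothesis ll : forall i, linf (l i).
Hypothesis bl : forall i x, normc (l i x) <= L * N x.

Let leq i x y : N (x - y) = 0 -> l i x = l i y.
Proof. exact: (linf_eq (ll i) (bl i)). Qed.

Section OneOperator.
Variables (E : H -> H) (c : R) (S : H -> H).
Hypothesis lE : lin E.
Hypothesis c0 : 0 < c.
Hypothesis bE : below N E c.
Hypothesis hS : forall g, N (E (S g) - g) = 0.

Definition frA x := E x + \sum_i l i x *: psi i.
(** With [S] an inverse of [E], this is the matrix of $v\mapsto
    v+\big(l_i(E^{-1}\sum_jv_j\psi_j)\big)_i$; its determinant decides whether [frA] is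
    invertible. *)
Definition frM : 'M[C]_m := \matrix_(i, j) ((i == j)%:R + l i (S (psi j))).

Lemma frA_lin : lin frA.
Proof.
apply: lin_add => // a x y; rewrite scaler_sumr -big_split/=.
by apply: eq_bigr => i _; rewrite ll scalerDl scalerA.
Qed.

Let frS x y : N (E x - y) = 0 -> N (x - S y) = 0.
Proof.
move=> h; apply: (below_inj sn c0 bE); rewrite (linB lE); apply: (sn_eq0 sn).
by apply: le_trans (sn_tri sn y _ _) _; rewrite h add0r (sn_swap sn) hS.
Qed.

Let sumE (v : 'I_m -> C) : N (E (\sum_j v j *: S (psi j)) - \sum_j v j *: psi j) = 0.
Proof.
apply: (sn_eq0 sn); rewrite (lin_sum lE) -sumrB; apply: le_trans (sn_sum sn _ _) _.
rewrite big1// => j _; rewrite (linZ lE) -scalerBr (snZ sn).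
by rewrite hS mulr0.
Qed.

(** A kernel vector $v$ of the matrix yields the kernel element $x=-\sum_jv_jS\psi_j$ of [frA],
    which is nonzero because $l_i(x)=v_i$. *)
Lemma frM_sing : \det frM = 0 -> ~ inj0 N frA.
Proof.
move=> d0 inj.
have /eqP/det0P[v v0] : \det frM^T = 0 by rewrite det_tr.
move=> vM; pose x := - \sum_j v 0 j *: S (psi j).
have lx i : l i x = v 0 i.
  rewrite /x -sub0r (linfB (ll i)) (linf0 (ll i)) sub0r (linf_sum (ll i)).
  have := congr1 (fun w : 'rV_m => w 0 i) vM; rewrite !mxE => e.
  have : \sum_j v 0 j * ((i == j)%:R + l i (S (psi j))) = 0.
    by rewrite -[RHS]e; apply: eq_bigr => j _; rewrite !mxE.
  under eq_bigr do rewrite mulrDr.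
  rewrite big_split/= (bigD1 i)//= eqxx mulr1 big1 ?addr0; last first.
    by move=> j; rewrite eq_sym => /negbTE ->; rewrite mulr0.
  move=> /eqP; rewrite addr_eq0 => /eqP ->; congr (- _).
  by apply: eq_bigr => j _; rewrite (linfZ (ll i)).
have : N (frA x) = 0.
  rewrite /frA; under eq_bigr do rewrite lx.
  by rewrite /x (linN lE) addrC (sn_swap sn) sumE.
move/inj => nx; case/negP: v0; apply/eqP/rowP => i; rewrite mxE -lx.
by rewrite -(linf0 (ll i)); apply: leq; rewrite subr0.
Qed.

Let mulM (v : 'cV[C]_m) i :
  (frM *m v) i 0 = v i 0 + \sum_j v j 0 * l i (S (psi j)).
Proof.
rewrite mxE; under eq_bigr do rewrite mxE mulrDl mulrC.
rewrite big_split/= (bigD1 i)//= eqxx mulr1 big1 ?addr0; last first.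
  by move=> j; rewrite eq_sym => /negbTE ->; rewrite mulr0.
by congr (_ + _); apply: eq_bigr => j _; rewrite mulrC.
Qed.

(** The solution of $\mathtt{frA}\,x=g$ is $Sg-\sum_jv_jS\psi_j$, where $v$ solves the matrix
    equation with right side $(l_i(Sg))_i$; the constant [D] bounds it in terms of $g$. *)
Lemma frM_reg : \det frM <> 0 ->
  [/\ inj0 N frA, onto N frA & exists2 c', 0 < c' & below N frA c'].
Proof.
move=> /eqP d0; have uM : frM \in unitmx by rewrite unitmxE unitfE.
have lsum (v : 'I_m -> C) i : l i (\sum_j v j *: S (psi j)) = \sum_j v j * l i (S (psi j)).
  by rewrite (linf_sum (ll i)); apply: eq_bigr => j _; rewrite (linfZ (ll i)).
have inj : inj0 N frA.
  move=> x hx; set Sg := \sum_j l j x *: S (psi j).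
  have ex : N (x - - Sg) = 0.
    apply: (below_inj sn c0 bE); rewrite opprK (linD lE).
    rewrite (_ : _ + _ = frA x + (E Sg - \sum_j l j x *: psi j)).
      by apply: (sn_eq0 sn); apply: le_trans (snD sn _ _) _; rewrite hx sumE addr0.
    by rewrite /frA addrA addrAC addrK.
  pose v : 'cV[C]_m := \col_i l i x.
  have v0 : frM *m v = 0.
    apply/matrixP => i j; rewrite ord1 mulM !mxE.
    rewrite (leq i ex) -sub0r (linfB (ll i)) (linf0 (ll i)) sub0r lsum.
    rewrite [X in _ + X](_ : _ = \sum_j l j x * l i (S (psi j))) ?addNr//.
    by apply: eq_bigr => k _; rewrite mxE.
  have {}v0 : v = 0 by rewrite -(mulKmx uM v) v0 mulmx0.
  have lx j : l j x = 0 by have := congr1 (fun w : 'cV_m => w j 0) v0; rewrite !mxE.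
  move: ex; rewrite /Sg; under eq_bigr do rewrite lx scale0r.
  by rewrite big1// oppr0 subr0.
pose D : R := c^-1 + \sum_j (\sum_i normc (invmx frM j i) * (`|L| * c^-1)) * N (S (psi j)).
have D0 : 0 < D.
  rewrite ltr_wpDr ?invr_gt0//; apply: sumr_ge0 => j _.
  rewrite mulr_ge0 ?(sn_ge0 sn)//; apply: sumr_ge0 => i _.
  by rewrite mulr_ge0 ?normc_ge0// mulr_ge0// invr_ge0 ltW.
have sol g : exists2 x, N (frA x - g) = 0 & N x <= D * N g.
  pose b : 'cV[C]_m := \col_i l i (S g).
  pose v := invmx frM *m b.
  have Mv : frM *m v = b by rewrite mulKVmx.
  set Sg := \sum_j v j 0 *: S (psi j).
  have lx i : l i (S g - Sg) = v i 0.
    have := congr1 (fun w : 'cV_m => w i 0) Mv; rewrite mulM [in RHS]mxE => e.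
    by rewrite (linfB (ll i)) lsum -e addrK.
  have nS : N (S g) <= N g / c := below_sol sn c0 bE (hS g).
  exists (S g - Sg).
    rewrite /frA; under eq_bigr do rewrite lx.
    rewrite (linB lE) -[g in _ - g](subrK (\sum_j v j 0 *: psi j)).
    by apply: (eqnD sn); [apply: (eqnB sn); [exact: hS|exact: (sumE (fun j => v j 0))]|exact: eqn_refl].
  apply: le_trans (snB sn _ _) _; rewrite /D mulrDl; apply: lerD; first by rewrite mulrC.
  apply: le_trans (sn_sum sn _ _) _; rewrite mulr_suml; apply: ler_sum => j _.
  rewrite (snZ sn) mulrAC ler_wpM2r ?(sn_ge0 sn)//.
  rewrite mxE; apply: le_trans (normc_sum _ _) _; rewrite mulr_suml; apply: ler_sum => i _.
  rewrite Normc.normcM -!mulrA ler_wpM2l ?normc_ge0// mxE.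
  apply: le_trans (bl i _) _; apply: (@le_trans _ _ (`|L| * N (S g))).
    by rewrite ler_wpM2r ?(sn_ge0 sn)// ler_norm.
  by rewrite ler_wpM2l// mulrC.
split => //.
  by move=> g; have [x hx _] := sol g; exists x.
exists D^-1; first by rewrite invr_gt0.
move=> y; rewrite mulrC ler_pdivrMr// mulrC.
have [x hx nx] := sol (frA y).
rewrite (_ : N y = N x)//; apply: (sn_eq sn); rewrite (sn_swap sn); apply: inj.
by rewrite (linB frA_lin).
Qed.

End OneOperator.

Section Family.
Variables (E0 G : H -> H) (K r c : R).
Hypotheses (lE0 : lin E0) (lG : lin G) (bG : bdd N G K).
Hypotheses (r0 : 0 < r) (c0 : 0 < c).
Hypothesis hE : forall z, normc z < r ->
  below N (fun x => E0 x - z *: G x) c /\ onto N (fun x => E0 x - z *: G x).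

(** The determinant of [frM] is analytic in $z$: by the resolvent identity $S_zg=S_0g+zS_zGS_0g$,
    the functions $l_i(S_zy_n)$ with $y_n=(GS_0)^n\psi_j$ are the successive remainders that [an]
    asks for. The claim is then [an_dichotomy]. *)
Lemma fredholm_dichotomy :
  (exists2 rho, 0 < rho & forall z, 0 < normc z < rho ->
     inj0 N (frA (fun x => E0 x - z *: G x))) \/
  (exists2 rho, 0 < rho & forall z, normc z < rho ->
     ~ inj0 N (frA (fun x => E0 x - z *: G x))).
Proof.
pose E z x := E0 x - z *: G x.
have lE z : lin (E z).
  by rewrite /E; under [fun x => _]eq_fun do rewrite -scaleNr; apply: lin_add => //; exact: lin_scale.
have exS : forall z, exists S : H -> H, normc z < r -> forall g, N (E z (S g) - g) = 0.
  move=> z; have [zr|zr] := ltP (normc z) r; last by exists id.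
  by have [_ /choice[S hS]] := hE zr; exists S => _.
have [S hS] := choice exS.
have bE z : normc z < r -> below N (E z) c by move=> /hE[].
have nS z g : normc z < r -> N (S z g) <= N g / c.
  by move=> zr; apply: (below_sol sn c0 (bE z zr)); exact: hS.
have n0 : normc 0 < r by rewrite Normc.normc0.
have resolvent z g : normc z < r -> N (S z g - (S 0 g + z *: S z (G (S 0 g)))) = 0.
  move=> zr; apply: (below_inj sn c0 (bE z zr)).
  rewrite (linB (lE z)) (linD (lE z)) (linZ (lE z)).
  set y := S 0 g; set w := S z (G y).
  apply: (eqn_trans sn (hS z zr g)); rewrite (sn_swap sn).
  have e1 : N (z *: E z w - z *: G y) = 0 by apply: (eqnZ sn); exact: hS.
  apply: (eqn_trans sn (eqnD sn (eqn_refl sn (E z y)) e1)).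
  by rewrite {1}/E subrK; have := hS 0 n0 g; rewrite {1}/E scale0r subr0.
pose M z := frM (S z).
have fr z : normc z < r -> (\det (M z) = 0 -> ~ inj0 N (frA (E z))) /\
    (\det (M z) <> 0 -> inj0 N (frA (E z))).
  move=> zr; split.
    by apply: (frM_sing (lE z) (hS z zr)).
  by case/(frM_reg (lE z) c0 (bE z zr) (hS z zr)).
have nlr y i z : normc z < r -> normc (l i (S z y)) <= `|L| * (N y / c).
  move=> zr; apply: le_trans (bl i _) _; apply: (@le_trans _ _ (`|L| * N (S z y))).
    by rewrite ler_wpM2r ?(sn_ge0 sn)// ler_norm.
  by rewrite ler_wpM2l//; exact: nS.
have anM : an (fun z => \det (M z)).
  apply: an_det => i j.
  rewrite (_ : (fun z => _) = (fun z => (i == j)%:R + l i (S z (psi j)))); last first.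
    by apply/funext => z; rewrite mxE.
  apply: an_add; first exact: an_cst.
  pose y n := iter n (fun x => G (S 0 x)) (psi j).
  pose B := 1 + `|L| / c * N (psi j) + `|K| / c.
  have t1 : 0 <= `|L| / c * N (psi j).
    by rewrite mulr_ge0 ?(sn_ge0 sn)// divr_ge0// ltW.
  have t2 : 0 <= `|K| / c by rewrite divr_ge0// ltW.
  exists (fun n z => l i (S z (y n))), r, B; split => //; first by rewrite /B; lra.
  move=> n z zr; split.
    have e := resolvent z (y n) zr.
    by rewrite (leq i e) (linfD (ll i)) (linfZ (ll i)) [y n.+1]/y iterS.
  have ny k : N (y k) <= (`|K| / c) ^+ k * N (psi j).
    elim: k => [|k ih]; first by rewrite expr0 mul1r.
    rewrite [y _]iterS -/(y k); apply: le_trans (bG _) _.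
    apply: (@le_trans _ _ (`|K| * (N (y k) / c))).
      apply: (@le_trans _ _ (`|K| * N (S 0 (y k)))).
        by rewrite ler_wpM2r ?(sn_ge0 sn)// ler_norm.
      by rewrite ler_wpM2l//; exact: nS.
    rewrite exprS [leRHS](_ : _ = `|K| * ((`|K| / c) ^+ k * N (psi j) / c)); last by ring.
    by rewrite ler_wpM2l// ler_wpM2r// invr_ge0 ltW.
  apply: le_trans (nlr _ _ _ zr) _.
  apply: (@le_trans _ _ (`|L| / c * N (psi j) * (`|K| / c) ^+ n)).
    rewrite [leRHS](_ : _ = `|L| * ((`|K| / c) ^+ n * N (psi j) / c)); last by ring.
    by rewrite ler_wpM2l// ler_wpM2r// invr_ge0 ltW.
  rewrite exprS; apply: ler_pM => //; first by rewrite exprn_ge0.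
    by rewrite /B; lra.
  by apply: lerXn2r; rewrite ?nnegrE// /B; lra.
have [[rho rho0 h]|[rho rho0 h]] := an_dichotomy anM; [left|right];
  exists (Num.min r rho); rewrite ?lt_min ?r0 ?rho0// => z.
  move=> /andP[z0]; rewrite lt_min => /andP[zr zrho].
  by apply: (fr z zr).2; apply: h; rewrite z0.
by rewrite lt_min => /andP[zr zrho]; apply: (fr z zr).1; exact: h.
Qed.

End Family.
End FiniteRank.

(** * Square-integrable functions with values in $\mathbb C^2$ *)

Section VectorL2.
Variable R : realType.
Local Notation C := R[i].
Local Notation normc := (@Normc.normc R).
Local Notation mu := (@lebesgue_measure R).
Local Notation V := (R -> 'cV[C]_2).
Implicit Types w v : V.

Definition part (b : bool) (z : C) : R := if b then complex.Re z else complex.Im z.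
Definition cmp b w (i : 'I_2) : R -> R := fun x => part b (w x i 0).

Lemma partD b z y : part b (z + y) = part b z + part b y.
Proof. by case: b; case: z; case: y. Qed.
Lemma partN b z : part b (- z) = - part b z.
Proof. by case: b; case: z. Qed.
Lemma partB b z y : part b (z - y) = part b z - part b y.
Proof. by rewrite partD partN. Qed.
Lemma part_real b (a : R) z : part b (real_complex R a * z) = a * part b z.
Proof. by case: b; case: z => x y /=; rewrite ?mul0r ?subr0 ?addr0. Qed.
Lemma partM b z y : part b (z * y) =
  complex.Re z * part b y + (if b then - complex.Im z else complex.Im z) * part (~~ b) y.
Proof. by case: b; case: z => a c; case: y => x t /=; rewrite ?mulNr// addrC. Qed.

Lemma cmpD b w v i : cmp b (fun x => w x + v x) i = (fun x => cmp b w i x + cmp b v i x).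
Proof. by apply/funext => x; rewrite /cmp mxE partD. Qed.
Lemma cmpN b w i : cmp b (fun x => - w x) i = (fun x => - cmp b w i x).
Proof. by apply/funext => x; rewrite /cmp mxE partN. Qed.
Lemma cmpB b w v i : cmp b (fun x => w x - v x) i = (fun x => cmp b w i x - cmp b v i x).
Proof. by rewrite cmpD cmpN. Qed.
Lemma cmpZ b z w i : cmp b (fun x => z *: w x) i = (fun x =>
  complex.Re z * cmp b w i x +
  (if b then - complex.Im z else complex.Im z) * cmp (~~ b) w i x).
Proof. by apply/funext => x; rewrite /cmp mxE partM. Qed.

(** The real part of the Hermitian product. Only real parts of pairings are needed, and skew-adjoint
    terms then drop out. *)
Definition rip (p q : 'cV[C]_2) : R :=
  \sum_i (part true (p i 0) * part true (q i 0) + part false (p i 0) * part false (q i 0)).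

Lemma rip_ge0 p : 0 <= rip p p.
Proof. by apply: sumr_ge0 => i _; rewrite addr_ge0// -expr2 sqr_ge0. Qed.

Lemma cnorm_rip p : cnorm p = Num.sqrt (rip p p).
Proof. by congr Num.sqrt; apply: eq_bigr => i _; rewrite !expr2. Qed.

Definition VL2 w := forall b i, L2 (cmp b w i).
Definition IP w v : R := \int[mu]_x rip (w x) (v x).

Lemma rip_integ w v : VL2 w -> VL2 v -> integ (fun x => rip (w x) (v x)).
Proof.
move=> hw hv; rewrite /rip; under eq_fun do rewrite !big_ord_recl big_ord0 addr0.
have h b i : integ (fun x => part b (w x i 0) * part b (v x i 0)).
  exact: L2_mul (hw b i) (hv b i).
by apply: integD; apply: integD; exact: h.
Qed.

Lemma IP_cmp w v : VL2 w -> VL2 v ->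
  IP w v = \sum_i (ip (cmp true w i) (cmp true v i) + ip (cmp false w i) (cmp false v i)).
Proof.
move=> hw hv.
have h b i : integ (fun x => part b (w x i 0) * part b (v x i 0)).
  exact: L2_mul (hw b i) (hv b i).
rewrite /IP /rip; under eq_Rintegral do rewrite !big_ord_recl big_ord0 addr0.
rewrite !big_ord_recl big_ord0 addr0 !intD//; by [apply: integD|apply: h|].
Qed.

Lemma VL2D w v : VL2 w -> VL2 v -> VL2 (fun x => w x + v x).
Proof. by move=> hw hv b i; rewrite cmpD; exact: L2D. Qed.

Lemma VL2N w : VL2 w -> VL2 (fun x => - w x).
Proof. by move=> hw b i; rewrite cmpN; exact: L2N. Qed.

Lemma VL2B w v : VL2 w -> VL2 v -> VL2 (fun x => w x - v x).
Proof. by move=> hw hv; apply: VL2D => //; exact: VL2N. Qed.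

Lemma VL2Z z w : VL2 w -> VL2 (fun x => z *: w x).
Proof. by move=> hw b i; rewrite cmpZ; apply: L2D; exact: L2Z. Qed.

Lemma VL20 : VL2 (fun=> 0).
Proof.
move=> b i; rewrite (_ : cmp _ _ _ = fun=> 0); first exact: L2_0.
by apply/funext => x; rewrite /cmp mxE; case: b.
Qed.

Lemma VL2_ae w v : (forall b i, measurable_fun [set: R] (cmp b v i)) ->
  aeeq w v -> VL2 w -> VL2 v.
Proof.
move=> mv wv hw b i; apply: L2_ae (hw b i) => //.
by apply: aeS wv => x; rewrite /cmp => ->.
Qed.

Lemma IP_ae w w' v v' : VL2 w -> VL2 w' -> VL2 v -> VL2 v' ->
  aeeq w w' -> aeeq v v' -> IP w v = IP w' v'.
Proof.
move=> hw hw' hv hv' e e'.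
have h (f g : V) : VL2 f -> VL2 g -> measurable_fun [set: R] (fun x => rip (f x) (g x)).
  by move=> hf hg; exact: integ_measurable (rip_integ hf hg).
by apply: ae_eq_int; [exact: h|exact: h|]; apply: aeS2 e e' => x -> ->.
Qed.

Lemma ripC p q : rip p q = rip q p.
Proof. by apply: eq_bigr => i _; rewrite mulrC [X in _ + X = _]mulrC. Qed.
Lemma ripDl p p' q : rip (p + p') q = rip p q + rip p' q.
Proof. by rewrite -big_split/=; apply: eq_bigr => i _; rewrite mxE !partD; ring. Qed.
Lemma ripNl p q : rip (- p) q = - rip p q.
Proof. by rewrite -sumrN; apply: eq_bigr => i _; rewrite mxE !partN; ring. Qed.
Lemma ripBl p p' q : rip (p - p') q = rip p q - rip p' q.
Proof. by rewrite ripDl ripNl. Qed.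
Lemma ripDr p p' q : rip q (p + p') = rip q p + rip q p'.
Proof. by rewrite ripC ripDl !(ripC q). Qed.
Lemma ripNr p q : rip p (- q) = - rip p q.
Proof. by rewrite ripC ripNl ripC. Qed.
Lemma ripBr p p' q : rip q (p - p') = rip q p - rip q p'.
Proof. by rewrite ripDr ripNr. Qed.
Lemma ripZr (a : R) p q : rip (real_complex R a *: p) q = a * rip p q.
Proof. by rewrite /rip mulr_sumr; apply: eq_bigr => i _; rewrite mxE !part_real; ring. Qed.
Lemma ripZ z p : rip (z *: p) (z *: p) = normc z ^+ 2 * rip p p.
Proof.
rewrite /rip mulr_sumr; apply: eq_bigr => i _; rewrite mxE !partM /=.
rewrite (_ : normc z ^+ 2 = complex.Re z ^+ 2 + complex.Im z ^+ 2); first by ring.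
by case: z => a b; rewrite sqr_sqrtr// addr_ge0// sqr_ge0.
Qed.
(* Multiplication by an imaginary scalar is skew for the real inner product. *)
Lemma ripZ_Re z p : rip (z *: p) p = complex.Re z * rip p p.
Proof. by rewrite /rip mulr_sumr; apply: eq_bigr => i _; rewrite mxE !partM /=; ring. Qed.

Lemma IPC w v : IP w v = IP v w.
Proof. by apply: eq_int => x; rewrite ripC. Qed.
Lemma IPDl w w' v : VL2 w -> VL2 w' -> VL2 v ->
  IP (fun x => w x + w' x) v = IP w v + IP w' v.
Proof.
move=> hw hw' hv; rewrite /IP -intD; try exact: rip_integ.
by apply: eq_int => x; rewrite ripDl.
Qed.
Lemma IPNl w v : VL2 w -> VL2 v -> IP (fun x => - w x) v = - IP w v.
Proof.
move=> hw hv; rewrite /IP -intN; try exact: rip_integ.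
by apply: eq_int => x; rewrite ripNl.
Qed.
Lemma IPBl w w' v : VL2 w -> VL2 w' -> VL2 v ->
  IP (fun x => w x - w' x) v = IP w v - IP w' v.
Proof. by move=> *; rewrite IPDl ?IPNl//; exact: VL2N. Qed.
Lemma IPDr w w' v : VL2 w -> VL2 w' -> VL2 v ->
  IP v (fun x => w x + w' x) = IP v w + IP v w'.
Proof. by move=> *; rewrite IPC IPDl// !(IPC v). Qed.
Lemma IPBr w w' v : VL2 w -> VL2 w' -> VL2 v ->
  IP v (fun x => w x - w' x) = IP v w - IP v w'.
Proof. by move=> *; rewrite IPC IPBl// !(IPC v). Qed.
Lemma IPZr (a : R) w v : VL2 w -> VL2 v ->
  IP (fun x => real_complex R a *: w x) v = a * IP w v.
Proof.
move=> hw hv; rewrite /IP -intZ; try exact: rip_integ.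
by apply: eq_int => x; rewrite ripZr.
Qed.
Lemma IPZ z w : VL2 w ->
  IP (fun x => z *: w x) (fun x => z *: w x) = normc z ^+ 2 * IP w w.
Proof.
move=> hw; rewrite /IP -intZ; try exact: rip_integ.
by apply: eq_int => x; rewrite ripZ.
Qed.
Lemma IPZ_Re z w : VL2 w -> IP (fun x => z *: w x) w = complex.Re z * IP w w.
Proof.
move=> hw; rewrite /IP -intZ; try exact: rip_integ.
by apply: eq_int => x; rewrite ripZ_Re.
Qed.

Lemma IP_ge0 w : 0 <= IP w w.
Proof. by apply: int_ge0 => x; exact: rip_ge0. Qed.

Definition N2 w : R := Num.sqrt (IP w w).
Lemma N2_ge0 w : 0 <= N2 w. Proof. exact: sqrtr_ge0. Qed.
Lemma N2_sqr w : N2 w ^+ 2 = IP w w. Proof. by rewrite sqr_sqrtr// IP_ge0. Qed.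

Lemma IP_CS w v : VL2 w -> VL2 v -> `|IP w v| <= N2 w * N2 v.
Proof.
move=> hw hv; rewrite -(@ler_pXn2r _ 2)// ?nnegrE ?mulr_ge0 ?N2_ge0//.
rewrite real_normK ?num_real// exprMn !N2_sqr.
apply: CS_disc; [exact: IP_ge0|exact: IP_ge0|] => a b.
pose wa x := real_complex R a *: w x; pose vb x := real_complex R b *: v x.
have hwa : VL2 wa by exact: VL2Z.
have hvb : VL2 vb by exact: VL2Z.
have := IP_ge0 (fun x => wa x - vb x).
have e1 f : VL2 f -> IP wa f = a * IP w f by exact: IPZr.
have e2 f : VL2 f -> IP vb f = b * IP v f by exact: IPZr.
rewrite IPBl//; last exact: VL2B.
rewrite !IPBr// !e1// !e2// !(IPC _ wa) !(IPC _ vb) !e1// !e2// (IPC v w).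
by move=> h; apply: le_trans h _; rewrite le_eqVlt; apply/orP; left; apply/eqP; ring.
Qed.

Lemma N2D w v : VL2 w -> VL2 v -> N2 (fun x => w x + v x) <= N2 w + N2 v.
Proof.
move=> hw hv; rewrite -(@ler_pXn2r _ 2)// ?nnegrE ?addr_ge0 ?N2_ge0//.
have hh := VL2D hw hv.
rewrite sqrrD !N2_sqr IPDl// !IPDr// (IPC v w).
have := IP_CS hw hv; have := ler_norm (IP w v); lra.
Qed.

Lemma N2Z z w : VL2 w -> N2 (fun x => z *: w x) = normc z * N2 w.
Proof.
move=> hw; rewrite /N2 IPZ// sqrtrM ?sqr_ge0// sqrtr_sqr ger0_norm//.
by case: z => a b; exact: sqrtr_ge0.
Qed.

Lemma rip_eq0 p : rip p p = 0 -> p = 0.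
Proof.
move=> /eqP; rewrite psumr_eq0; last first.
  by move=> i _; rewrite addr_ge0// -expr2 sqr_ge0.
move=> /allP h; apply/matrixP => i j; rewrite ord1 mxE.
have := h i (mem_index_enum i); rewrite /= paddr_eq0 -?expr2 ?sqr_ge0// !sqrf_eq0.
by case: (p i 0) => a b /= /andP[/eqP -> /eqP ->].
Qed.

Lemma N2_eq0 w : VL2 w -> N2 w = 0 -> aeeq w (fun=> 0).
Proof.
move=> hw n0; have : IP w w = 0 by rewrite -N2_sqr n0 expr0n.
move/(int_eq0_ae (rip_integ hw hw) (fun x => rip_ge0 (w x))).
by apply: aeS => x; exact: rip_eq0.
Qed.

Lemma N2_ae w v : VL2 w -> VL2 v -> aeeq w v -> N2 w = N2 v.
Proof. by move=> hw hv e; rewrite /N2 (IP_ae hw hv hw hv). Qed.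

Lemma N2_0 : N2 (fun=> 0) = 0.
Proof.
rewrite /N2 /IP (_ : \int[mu]_x _ = 0) ?sqrtr0//.
have -> : (fun x : R => rip 0 0) = (fun=> 0).
  by apply/funext => x; apply: big1 => i _; rewrite mxE !mulr0 addr0.
by rewrite /Rintegral integral0.
Qed.

Lemma N2_le w v : VL2 w -> VL2 v ->
  (forall x, rip (w x) (w x) <= rip (v x) (v x)) -> N2 w <= N2 v.
Proof.
by move=> hw hv h; apply: ler_wsqrtr; apply: int_le => //; exact: rip_integ.
Qed.

Let L2normE0 w : L2norm w = ((\int[mu]_x (rip (w x) (w x))%:E) `^ 2^-1)%E.
Proof.
rewrite /L2norm unlock; congr (_ `^ _)%E; apply: eq_integral => x _ /=.
rewrite cnorm_rip ger0_norm ?sqrtr_ge0//.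
by rewrite powR_mulrn ?sqrtr_ge0// sqr_sqrtr// rip_ge0.
Qed.

Lemma L2normE w : VL2 w -> L2norm w = (N2 w)%:E.
Proof.
move=> hw; rewrite L2normE0 int_EFin; last exact: rip_integ.
by rewrite poweR_EFin powR12_sqrt//; exact: IP_ge0.
Qed.

Lemma inL2P w : inL2 w <-> VL2 w.
Proof.
split=> [[mw no]|hw]; last first.
  split; last by rewrite L2normE// ltry.
  by move=> i; split; [case: (hw true i)|case: (hw false i)].
have mc b i : measurable_fun [set: R] (cmp b w i) by case: b; case: (mw i).
have mr : measurable_fun [set: R] (fun x => rip (w x) (w x)).
  rewrite /rip; apply: measurable_sum => i.
  by apply: measurable_funD; apply: measurable_funM; exact: mc.
have ir : integ (fun x => rip (w x) (w x)).
  apply: integ_lt => //; first by move=> x; exact: rip_ge0.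
  by move: no; rewrite L2normE0; apply: lty_poweRy.
move=> b i; split; first exact: mc.
apply: (integ_le _ ir); first by apply: measurable_funX; exact: mc.
move=> x; rewrite ger0_norm ?sqr_ge0// /rip (bigD1 i)//=.
rewrite -[leLHS]addr0 lerD//.
  by rewrite -!expr2; case: b; rewrite ?lerDl ?lerDr sqr_ge0.
by apply: sumr_ge0 => j _; rewrite addr_ge0// -expr2 sqr_ge0.
Qed.

End VectorL2.

(** * The complex vector space of square-integrable functions and its seminorm *)

Section HilbertType.
Variable R : realType.
Local Notation C := R[i].
Local Notation V := (R -> 'cV[C]_2).

Definition l2pred : {pred V} := [pred w | `[< VL2 w >]].

Lemma l2pred_submod : submod_closed l2pred.
Proof.
split; first by apply/asboolP; exact: VL20.
move=> a w v /asboolP hw /asboolP hv; apply/asboolP.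
by apply: VL2D => //; exact: VL2Z.
Qed.

HB.instance Definition _ := GRing.isSubmodClosed.Build C V l2pred l2pred_submod.

Record l2sub := L2sub { l2subval :> V; _ : l2subval \in l2pred }.

HB.instance Definition _ := [isSub for l2subval].
HB.instance Definition _ := [Choice of l2sub by <:].
HB.instance Definition _ := [SubChoice_isSubLmodule of l2sub by <:].

(** The elements are functions and not classes, so that point values, as needed for sampling, keep
    their meaning. *)
Record l2model := L2Model {
  l2car : lmodType C;
  l2val : l2car -> V;
  l2P : forall w, VL2 (l2val w);
  l2D : forall w v, l2val (w + v) = (fun x => l2val w x + l2val v x);
  l2Z : forall a w, l2val (a *: w) = (fun x => a *: l2val w x);
  l2inj : injective l2val;
  toH : V -> l2car;
  toHK : forall w, VL2 w -> l2val (toH w) = w }.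

(* Sealed by Qed, which stops unification from unfolding the subtype structure. *)
Lemma l2_model : l2model.
Proof.
apply: (@L2Model l2sub l2subval _ _ _ _ (fun w => insubd (0 : l2sub) w)).
- by case=> w /= /asboolP.
- by [].
- by [].
- exact: val_inj.
move=> w hw; have hp : w \in l2pred by apply/asboolP.
by rewrite -[LHS]/(\val (insubd (0 : l2sub) w)) val_insubd hp.
Qed.

Definition l2 : Type := l2car l2_model.
HB.instance Definition _ := GRing.Lmodule.copy l2 (l2car l2_model).
Definition l2fun (w : l2) : V := l2val w.
Definition l2of (w : V) : l2 := toH l2_model w.

End HilbertType.

Coercion l2fun : l2 >-> Funclass.

Section HilbertTheory.
Variable R : realType.
Local Notation C := R[i].
Local Notation normc := (@Normc.normc R).
Local Notation V := (R -> 'cV[C]_2).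
Local Notation l2 := (l2 R).
Implicit Types w v : l2.

Lemma hP w : VL2 w. Proof. exact: l2P. Qed.
Lemma hofK (w : V) : VL2 w -> l2of w = w :> V. Proof. exact: toHK. Qed.
Lemma hD w v : (w + v : l2) = (fun x => w x + v x) :> V. Proof. exact: l2D. Qed.
Lemma hZ a w : (a *: w : l2) = (fun x => a *: w x) :> V. Proof. exact: l2Z. Qed.
Lemma hN w : (- w : l2) = (fun x => - w x) :> V.
Proof. by rewrite -scaleN1r hZ; apply/funext => x; rewrite scaleN1r. Qed.
Lemma hB w v : (w - v : l2) = (fun x => w x - v x) :> V.
Proof. by rewrite hD hN. Qed.
Lemma h0 : (0 : l2) = (fun=> 0) :> V.
Proof. by rewrite -(scale0r 0) hZ; apply/funext => x; rewrite scale0r. Qed.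
Lemma hext w v : (forall x, w x = v x) -> w = v.
Proof. by move=> h; apply: l2inj; apply/funext. Qed.

(* The norm and the operators below are sealed too: comparing two of their
   values by conversion would unfold the integrals that define them. *)
Lemma NH_def : {N : l2 -> R | forall w, N w = N2 w}.
Proof. by exists (fun w => N2 w). Qed.

Definition NH : l2 -> R := projT1 NH_def.
Lemma NHE w : NH w = N2 w. Proof. exact: (projT2 NH_def). Qed.

Lemma NH_seminorm : seminorm NH.
Proof.
split=> [w v|a w].
- by rewrite !NHE hD; apply: N2D; exact: hP.
- by rewrite !NHE hZ; apply: N2Z; exact: hP.
Qed.

Lemma NH_eqP w v : NH (w - v) = 0 <-> aeeq w v.
Proof.
split=> [|h].
  rewrite NHE => /(N2_eq0 (hP _)); apply: aeS => x; rewrite hB => /eqP.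
  by rewrite subr_eq0 => /eqP.
rewrite -(N2_0 R) NHE; apply: N2_ae; [exact: hP|exact: VL20|].
by apply: aeS h => x; rewrite hB => ->; rewrite subrr.
Qed.

Lemma NH0P w : NH w = 0 <-> aeeq w (fun=> 0).
Proof. by rewrite -{1}[w]subr0 NH_eqP h0. Qed.

Lemma NH_complete : scomplete NH.
Proof.
move=> f0 B hf0; pose f : nat -> l2 := f0.
have hf n : NH (f n) <= B * (1/4) ^+ n := hf0 n.
have cB b i n : ip (cmp b (f n) i) (cmp b (f n) i) <= B ^+ 2 * (1/16) ^+ n.
  apply: (@le_trans _ _ (NH (f n) ^+ 2)).
    rewrite NHE N2_sqr; apply: int_le; [exact: L2_mul (hP _ _ _) (hP _ _ _)|exact: rip_integ (hP _) (hP _)|].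
    move=> x; rewrite /rip (bigD1 i)//= -[leLHS]addr0 lerD//.
      by rewrite /cmp -!expr2; case: b; rewrite ?lerDl ?lerDr sqr_ge0.
    by apply: sumr_ge0 => j _; rewrite addr_ge0// -expr2 sqr_ge0.
  rewrite (_ : 1/16 = (1/4) ^+ 2 :> R); last by field.
  have n0 : 0 <= NH (f n) by rewrite NHE; exact: N2_ge0.
  have h := hf n; have e : B ^+ 2 * ((1/4) ^+ 2) ^+ n = (B * (1/4) ^+ n) ^+ 2.
    by rewrite -exprM mulnC exprM -exprMn.
  by rewrite e ler_pXn2r// nnegrE (le_trans n0 h).
have ex b i := L2_complete (fun n => hP (f n) b i) (cB b i).
pose F b i := projT1 (cid (ex b i)).
have hF b i : L2 (F b i) by rewrite /F; case: cid => ? [].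
have tF b i p : ip (fun x => F b i x - \sum_(k < p) cmp b (f k) i x)
  (fun x => F b i x - \sum_(k < p) cmp b (f k) i x) <= 8 * B ^+ 2 * (1/4) ^+ p.
  by rewrite /F; case: cid => ? [].
pose W : V := fun x => \col_i Complex (F true i x) (F false i x).
have cW b i : cmp b W i = F b i by apply/funext => x; rewrite /cmp mxE; case: b.
have hW : VL2 W by move=> b i; rewrite cW.
(* Four real components, each with a remainder of squared norm at most $8B^24^{-p}$. *)
exists (l2of W : l2), (Num.sqrt (32 * B ^+ 2)) => p; rewrite -/f.
have cS b i : cmp b (\sum_(k < p) f k : l2) i = (fun x => \sum_(k < p) cmp b (f k) i x).
  elim: p => [|p ih].
    by apply/funext => x; rewrite !big_ord0 h0 /cmp mxE; case: b.
  by rewrite big_ord_recr hD cmpD ih; apply/funext => x; rewrite big_ord_recr.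
have B0 : 0 <= 32 * B ^+ 2 by rewrite mulr_ge0 ?sqr_ge0.
have p2 : 0 <= (1/2 : R) ^+ p by rewrite exprn_ge0//; lra.
rewrite -(@ler_pXn2r _ 2)// ?nnegrE ?NHE ?N2_ge0 ?mulr_ge0 ?sqrtr_ge0//.
rewrite [leRHS]exprMn [X in _ <= X * _]sqr_sqrtr//.
have -> : ((1/2 : R) ^+ p) ^+ 2 = (1/4) ^+ p.
  by rewrite -exprM mulnC exprM; congr (_ ^+ _); field.
rewrite N2_sqr IP_cmp; try exact: hP.
rewrite hB hofK// !big_ord_recl big_ord0 addr0 !cmpB !cW !cS.
have := tF true ord0 p; have := tF true (lift ord0 ord0) p.
have := tF false ord0 p; have := tF false (lift ord0 ord0) p.
lra.
Qed.

Lemma IPH_CS w v : `|IP w v| <= NH w * NH v.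
Proof. by rewrite !NHE; apply: IP_CS; exact: hP. Qed.

End HilbertTheory.

(** * Multiplication operators, the Green operator and $J$ on vector-valued functions *)

Section Operators.
Variable R : realType.
Local Notation C := R[i].
Local Notation V := (R -> 'cV[C]_2).
Local Notation l2 := (l2 R).
Local Notation cC := (@cplx R).

(* A real matrix acts separately on real and imaginary parts. *)
Definition mulV (M : R -> 'M[R]_2) (w : V) : V := fun x => cplx (M x) *m w x.

Definition bmx (M : R -> 'M[R]_2) (B : R) :=
  (forall i j, measurable_fun [set: R] (fun x => M x i j)) /\
  forall x i j, `|M x i j| <= B.

Lemma cmp_mulV b M w i : cmp b (mulV M w) i = (fun x => \sum_j M x i j * cmp b w j x).
Proof.
apply/funext => x; rewrite /cmp /mulV mxE.
have ps (I : finType) (F : I -> C) : part b (\sum_j F j) = \sum_j part b (F j).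
  apply: (big_morph (part b) (@partD R b)); by case: b.
by rewrite ps; apply: eq_bigr => j _; rewrite mxE part_real.
Qed.

Lemma VL2_mulV M B w : bmx M B -> VL2 w -> VL2 (mulV M w).
Proof.
move=> [mM bM] hw b i; rewrite cmp_mulV.
under eq_fun do rewrite !big_ord_recl big_ord0 addr0.
by apply: L2D; apply: (@L2_bounded_mul _ _ _ B) => //; exact: hw.
Qed.

Lemma rip_mulmx (M : 'M[R]_2) B (p : 'cV[C]_2) : (forall i j, `|M i j| <= B) ->
  rip (cplx M *m p) (cplx M *m p) <= (2 * B) ^+ 2 * rip p p.
Proof.
move=> hM; have B0 : 0 <= B := le_trans (normr_ge0 _) (hM ord0 ord0).
have key (m1 m2 a c : R) : `|m1| <= B -> `|m2| <= B ->
    (m1 * a + m2 * c) ^+ 2 <= 2 * B ^+ 2 * (a ^+ 2 + c ^+ 2).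
  move=> h1 h2; have q m : `|m| <= B -> m ^+ 2 <= B ^+ 2.
    by move=> h; rewrite -[leLHS]real_normK ?num_real// ler_pXn2r// nnegrE.
  have := q _ h1; have := q _ h2; have := sqr_ge0 (m1 * a - m2 * c).
  have := sqr_ge0 a; have := sqr_ge0 c; nra.
have e b i : part b ((cplx M *m p) i 0) = M i ord0 * part b (p ord0 0)
    + M i (lift ord0 ord0) * part b (p (lift ord0 ord0) 0).
  by rewrite mxE !big_ord_recl big_ord0 addr0 partD !mxE !part_real.
rewrite /rip !big_ord_recl !big_ord0 !addr0 !e -!expr2.
have k1 := key _ _ (part true (p ord0 0)) (part true (p (lift ord0 ord0) 0)).
have k2 := key _ _ (part false (p ord0 0)) (part false (p (lift ord0 ord0) 0)).
have := k1 _ _ (hM ord0 ord0) (hM ord0 (lift ord0 ord0)).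
have := k2 _ _ (hM ord0 ord0) (hM ord0 (lift ord0 ord0)).
have := k1 _ _ (hM (lift ord0 ord0) ord0) (hM (lift ord0 ord0) (lift ord0 ord0)).
have := k2 _ _ (hM (lift ord0 ord0) ord0) (hM (lift ord0 ord0) (lift ord0 ord0)).
rewrite exprMn; lra.
Qed.

Lemma N2_mulV M B w : bmx M B -> VL2 w -> N2 (mulV M w) <= 2 * B * N2 w.
Proof.
move=> [mM bM] hw; have B0 : 0 <= B := le_trans (normr_ge0 _) (bM 0 ord0 ord0).
rewrite (_ : 2 * B * N2 w = N2 (fun x => real_complex R (2 * B) *: w x)); last first.
  by rewrite N2Z// normc_real ger0_norm// mulr_ge0.
apply: N2_le; [exact: (@VL2_mulV _ B)|exact: VL2Z|].
move=> x; rewrite ripZ normc_real real_normK ?num_real//.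
by apply: rip_mulmx => i j; exact: bM.
Qed.

Local Opaque G ip.

Definition GV (w : V) : V := fun x => \col_i Complex (G (cmp true w i) x) (G (cmp false w i) x).

Lemma cmp_GV b w i : cmp b (GV w) i = G (cmp b w i).
Proof. by apply/funext => x; rewrite /cmp mxE; case: b. Qed.

Lemma VL2_GV w : VL2 w -> VL2 (GV w).
Proof. by move=> hw b i; rewrite cmp_GV; exact: G_L2. Qed.

Lemma GV_nm w : VL2 w -> N2 (GV w) <= N2 w.
Proof.
move=> hw; apply: ler_wsqrtr; have hG := VL2_GV hw.
rewrite !IP_cmp//; apply: ler_sum => i _; rewrite !cmp_GV.
by apply: lerD; exact: G_nm.
Qed.

Lemma GVD w v : VL2 w -> VL2 v -> GV (fun x => w x + v x) = (fun x => GV w x + GV v x).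
Proof.
move=> hw hv; apply/funext => x; apply/matrixP => i j; rewrite !mxE.
by rewrite !cmpD (GD (hw true i) (hv true i)) (GD (hw false i) (hv false i)).
Qed.

Lemma GVZ z w : VL2 w -> GV (fun x => z *: w x) = (fun x => z *: GV w x).
Proof.
move=> hw; apply/funext => x; apply/matrixP => i j; rewrite !mxE.
have e b := GD (L2Z (complex.Re z) (hw b i))
  (L2Z (if b then - complex.Im z else complex.Im z) (hw (~~ b) i)).
rewrite !cmpZ !e (GZ _ (hw true i)) (GZ _ (hw false i)) (GZ _ (hw true i)) (GZ _ (hw false i)).
by clear e; case: z => a b /=; congr Complex; rewrite mulNr.
Qed.

Lemma GV_sym w v : VL2 w -> VL2 v -> IP (GV w) v = IP w (GV v).
Proof.
move=> hw hv; have hGw := VL2_GV hw; have hGv := VL2_GV hv.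
rewrite [LHS](IP_cmp hGw hv) [RHS](IP_cmp hw hGv); apply: eq_bigr => i _.
have e b : ip (cmp b (GV w) i) (cmp b v i) = ip (cmp b w i) (cmp b (GV v) i).
  by rewrite (cmp_GV b w i) (cmp_GV b v i); exact: G_sym (hw b i) (hv b i).
exact: (f_equal2 +%R (e true) (e false)).
Qed.

Definition JV (w : V) : V := fun x => Jmx *m w x.

Lemma JV_comp w x : JV w x = cv2 (w x 1 0) (- w x 0 0).
Proof.
apply/matrixP => i j; rewrite ord1 !mxE !big_ord_recl big_ord0 addr0 !mxE/=.
rewrite (_ : lift ord0 ord0 = 1); last exact: val_inj.
by case: i => [[|[|//]] hi] /=; rewrite ?mul0r ?mul1r ?mulN1r ?add0r ?addr0.
Qed.

Lemma cmp_JV b w i : cmp b (JV w) i =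
  (fun x => if i == 0 then cmp b w 1 x else - cmp b w 0 x).
Proof.
apply/funext => x; rewrite /cmp JV_comp mxE.
by case: i => [[|[|//]] hi] /=; rewrite ?partN.
Qed.

Lemma VL2_JV w : VL2 w -> VL2 (JV w).
Proof. by move=> hw b i; rewrite cmp_JV; case: (i == 0); [exact: hw|apply: L2N; exact: hw]. Qed.

Lemma rip2 (p q : 'cV[C]_2) : rip p q =
  (part true (p 0 0) * part true (q 0 0) + part false (p 0 0) * part false (q 0 0)) +
  (part true (p 1 0) * part true (q 1 0) + part false (p 1 0) * part false (q 1 0)).
Proof.
rewrite /rip !big_ord_recl big_ord0 addr0.
by rewrite (_ : lift ord0 ord0 = 1); last exact: val_inj.
Qed.

Lemma ReN (z : C) : complex.Re (- z) = - complex.Re z. Proof. by case: z. Qed.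
Lemma ImN (z : C) : complex.Im (- z) = - complex.Im z. Proof. by case: z. Qed.

Lemma rip_J (p q : 'cV[C]_2) : rip (Jmx *m p) (Jmx *m q) = rip p q.
Proof.
have e r : Jmx *m r = JV (fun=> r) 0 by [].
by rewrite !e !JV_comp !rip2 !mxE /= ?ReN ?ImN; ring.
Qed.

Lemma N2_JV w : N2 (JV w) = N2 w.
Proof. by congr Num.sqrt; apply: eq_int => x; exact: rip_J. Qed.

Lemma IP_cmp2 (w v : V) : VL2 w -> VL2 v ->
  IP w v = (ip (cmp true w 0) (cmp true v 0) + ip (cmp false w 0) (cmp false v 0)) +
           (ip (cmp true w 1) (cmp true v 1) + ip (cmp false w 1) (cmp false v 1)).
Proof.
move=> hw hv; rewrite (IP_cmp hw hv) !big_ord_recl big_ord0 addr0.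
by rewrite (_ : lift ord0 ord0 = 1); last exact: val_inj.
Qed.

(** The Green operator is symmetric and acts alike on both components, while $J$ exchanges them with
    opposite signs. *)
Lemma IP_J_G w : VL2 w -> IP (JV w) (GV w) = 0.
Proof.
move=> hw; have hJ := VL2_JV hw; have hG := VL2_GV hw.
have e b : ip (cmp b w 0) (G (cmp b w 1)) = ip (cmp b w 1) (G (cmp b w 0)).
  by rewrite -(G_sym (hw b 0) (hw b 1)) ipC.
have n b : ip (cmp b (JV w) 1) (cmp b (GV w) 1) = - ip (cmp b w 1) (G (cmp b w 0)).
  by rewrite cmp_GV -e cmp_JV /=; exact: (ipNl (hw b 0) (G_L2 (hw b 1))).
have p b : ip (cmp b (JV w) 0) (cmp b (GV w) 0) = ip (cmp b w 1) (G (cmp b w 0)).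
  by rewrite cmp_GV cmp_JV.
apply: etrans (IP_cmp2 hJ hG) _.
apply: etrans (f_equal2 +%R (f_equal2 +%R (p true) (p false)) (f_equal2 +%R (n true) (n false))) _.
by rewrite -opprD subrr.
Qed.

Lemma rip_J0 (p : 'cV[C]_2) : rip (Jmx *m p) p = 0.
Proof.
have e r : Jmx *m r = JV (fun=> r) 0 by [].
by rewrite !e !JV_comp !rip2 !mxE /= ?ReN ?ImN; ring.
Qed.

End Operators.

(** * The bounded form of the operator and the dissipative lower bound *)

Section Dissipative.
Variable R : realType.
Local Notation C := R[i].
Local Notation normc := (@Normc.normc R).
Local Notation mu := (@lebesgue_measure R).
Local Notation V := (R -> 'cV[C]_2).
Local Notation l2 := (l2 R).
Local Notation NH := (@NH R).
Let sn := @NH_seminorm R.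

Lemma JH_def : {T : l2 -> l2 | forall g, T g = JV g :> V}.
Proof. by exists (fun g => l2of (JV g)) => g; apply: hofK; apply: VL2_JV; exact: hP. Qed.
Lemma GH_def : {T : l2 -> l2 | forall g, T g = GV g :> V}.
Proof. by exists (fun g => l2of (GV g)) => g; apply: hofK; apply: VL2_GV; exact: hP. Qed.
Lemma MH_def (M : R -> 'M[R]_2) :
  {T : l2 -> l2 | forall B, bmx M B -> forall g, T g = mulV M g :> V}.
Proof.
exists (fun g => l2of (mulV M g)) => B h g.
by apply: hofK; apply: (VL2_mulV h); exact: hP.
Qed.

Definition JH : l2 -> l2 := projT1 JH_def.
Definition GH : l2 -> l2 := projT1 GH_def.
Definition MH M : l2 -> l2 := projT1 (MH_def M).

Lemma JHE g : JH g = JV g :> V. Proof. exact: (projT2 JH_def). Qed.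
Lemma GHE g : GH g = GV g :> V. Proof. exact: (projT2 GH_def). Qed.
Lemma MHE M B g : bmx M B -> MH M g = mulV M g :> V.
Proof. by move=> h; exact: (projT2 (MH_def M) B h g). Qed.

Lemma JH_lin : lin JH.
Proof.
move=> a g h; apply: hext => x; rewrite JHE; rewrite [in RHS]hD; rewrite [in RHS]hZ; rewrite !JHE /JV hD hZ.
by rewrite mulmxDr scalemxAr.
Qed.

Lemma GH_lin : lin GH.
Proof.
move=> a g h; apply: hext => x; rewrite GHE; rewrite [in RHS]hD; rewrite [in RHS]hZ; rewrite !GHE hD hZ.
by rewrite (GVD (VL2Z a (hP g)) (hP h)) (GVZ a (hP g)).
Qed.

Lemma MH_lin M B : bmx M B -> lin (MH M).
Proof.
move=> hM a g h; apply: hext => x; rewrite (MHE _ hM); rewrite [in RHS]hD; rewrite [in RHS]hZ; rewrite !(MHE _ hM) /mulV hD hZ.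
by rewrite mulmxDr scalemxAr.
Qed.

Lemma lin_comp (S T : l2 -> l2) : lin S -> lin T -> lin (fun x => S (T x)).
Proof. by move=> lS lT a x y; rewrite lT lS. Qed.

Lemma JH_nm g : NH (JH g) = NH g.
Proof. by rewrite !NHE JHE N2_JV. Qed.

Lemma GH_bdd : bdd NH GH 1.
Proof. by move=> g; rewrite mul1r !NHE GHE; apply: GV_nm; exact: hP. Qed.

Lemma MH_bdd M B : bmx M B -> bdd NH (MH M) (2 * B).
Proof. by move=> h g; rewrite !NHE (MHE _ h); apply: N2_mulV => //; exact: hP. Qed.

Lemma JH_onto : onto NH JH.
Proof.
move=> g; exists (- JH g); rewrite (linN JH_lin).
suff -> : JH (JH g) = - g by rewrite opprK subrr; exact: (sn0 sn).
apply: hext => x; rewrite hN JHE JV_comp JHE JV_comp.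
apply/matrixP => i j; rewrite ord1 !mxE.
by case: i => [[|[|//]] hi] /=; congr (- l2fun g x _ _); exact: val_inj.
Qed.

(** For $w=Gg$ this is $Jg+(m-z)w$: the second-order operator composed with $(1-\partial_x^2)^{-1}$,
    hence bounded. *)
Definition opM (m : R -> 'M[R]_2) (z : C) (g : l2) : l2 :=
  JH g + MH m (GH g) - z *: GH g.

Lemma opM_lin m B z : bmx m B -> lin (opM m z).
Proof.
move=> h; rewrite /opM; under eq_fun do rewrite -scaleNr.
apply: lin_add; last by apply: lin_scale; exact: GH_lin.
apply: lin_add; first exact: JH_lin.
by apply: lin_comp; [exact: MH_lin h|exact: GH_lin].
Qed.

Lemma opM_bdd m B z : bmx m B -> bdd NH (opM m z) (1 + 2 * B + normc z).
Proof.
move=> h g; have B0 : 0 <= B := le_trans (normr_ge0 _) (h.2 0 ord0 ord0).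
have n1 := GH_bdd g; rewrite mul1r in n1.
have n2 := MH_bdd h (GH g); have g0 := sn_ge0 sn g.
rewrite /opM; apply: le_trans (snB sn _ _) _; rewrite (snZ sn) mulrDl; apply: lerD.
  apply: le_trans (snD sn _ _) _; rewrite JH_nm mulrDl mul1r lerD2l.
  by apply: le_trans n2 _; rewrite ler_wpM2l// mulr_ge0.
by rewrite ler_wpM2l ?normc_ge0.
Qed.

Lemma IP_opM m B z g : bmx m B ->
  IP (opM m z g) (GH g) = \int[mu]_x (rip (cplx (m x) *m GH g x) (GH g x))
    - complex.Re z * IP (GH g) (GH g).
Proof.
move=> h; have hG : VL2 (GH g) := hP _; have hg := hP g.
rewrite /opM hB IPBl; [|exact: hP..].
rewrite hD IPDl; [|exact: hP..].
rewrite hZ IPZ_Re// JHE [X in IP (JV _) X]GHE IP_J_G// add0r.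
by rewrite (MHE _ h).
Qed.

(* Pairing with [GH g] kills the skew-adjoint principal part. *)
Lemma dissip m B z gam K : bmx m B -> 0 < gam -> 2 * B + normc z <= K ->
  (forall x p, rip (cplx (m x) *m p) p - complex.Re z * rip p p <= - gam * rip p p) ->
  below NH (opM m z) (1 + K / gam)^-1.
Proof.
move=> h gam0 hK hm g; have B0 : 0 <= B := le_trans (normr_ge0 _) (h.2 0 ord0 ord0).
have K0 : 0 <= K by apply: le_trans hK; rewrite addr_ge0 ?normc_ge0// mulr_ge0.
set y := opM m z g; set w := GH g.
have hw : VL2 w := hP _.
have w0 : 0 <= NH w := sn_ge0 sn _; have y0 : 0 <= NH y := sn_ge0 sn _.
have e : IP y w <= - gam * NH w ^+ 2.
  have im : integ (fun x => rip (cplx (m x) *m w x) (w x)).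
    exact: (rip_integ (VL2_mulV h hw) hw).
  have iw := rip_integ hw hw.
  rewrite (IP_opM _ _ h) NHE N2_sqr /IP -!intZ// -intB//; last exact: integZ.
  apply: int_le => [||x]; [by apply: integB => //; exact: integZ|exact: integZ|].
  exact: hm.
have nw : gam * NH w <= NH y.
  have := IPH_CS y w; rewrite ler_norml => /andP[cs _].
  have [->|wn] := eqVneq (NH w) 0; first by rewrite mulr0.
  have wp : 0 < NH w by rewrite lt_neqAle eq_sym wn.
  rewrite -(ler_pM2r wp) -mulrA -expr2; lra.
(* As $J$ is an isometry, $g$ is recovered from $y$ and $w$; with $\gamma\|w\|\le\|y\|$ this
   produces the constant $(1+K/\gamma)^{-1}$. *)
have ng : NH g <= NH y + K * NH w.
  rewrite -JH_nm (_ : JH g = y - (MH m w - z *: w)); last first.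
    by rewrite /y /opM -/w -(addrA (JH g)) addrK.
  apply: le_trans (snB sn _ _) _; rewrite lerD2l.
  apply: le_trans (snB sn _ _) _; rewrite (snZ sn).
  have := MH_bdd h w; have := ler_wpM2r w0 hK; lra.
have d0 : 0 < 1 + K / gam by rewrite ltr_wpDr// divr_ge0// ltW.
rewrite mulrC ler_pdivrMr//; apply: le_trans ng _.
rewrite mulrDr mulr1 lerD2l mulrCA ler_wpM2l//.
by rewrite ler_pdivlMr// mulrC.
Qed.

End Dissipative.

(** * Approximation of a compactly supported potential term by a finite-rank operator *)

Section Sampling.
Variable R : realType.
Local Notation C := R[i].
Local Notation normc := (@Normc.normc R).
Local Notation mu := (@lebesgue_measure R).
Local Notation V := (R -> 'cV[C]_2).
Local Notation l2 := (l2 R).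
Local Notation NH := (@NH R).
Let sn := @NH_seminorm R.

Lemma normc_part (z : C) : normc z <= `|part true z| + `|part false z|.
Proof.
case: z => a b /=.
rewrite -(@ler_pXn2r _ 2)// ?nnegrE ?sqrtr_ge0 ?addr_ge0//.
rewrite sqr_sqrtr ?addr_ge0 ?sqr_ge0// sqrrD !real_normK ?num_real//.
by rewrite addrAC lerDl mulrn_wge0// mulr_ge0.
Qed.

Lemma ip_cmp_le b (w : V) i : VL2 w -> ip (cmp b w i) (cmp b w i) <= IP w w.
Proof.
move=> hw; apply: int_le; [exact: L2_mul (hw _ _) (hw _ _)|exact: rip_integ|].
move=> x; rewrite /rip (bigD1 i)//= -[leLHS]addr0 lerD//.
  by rewrite /cmp -!expr2; case: b; rewrite ?lerDl ?lerDr sqr_ge0.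
by apply: sumr_ge0 => j _; rewrite addr_ge0// -expr2 sqr_ge0.
Qed.

Lemma GV_point (g : l2) x i : normc (GV g x i 0) <= 2 * NH g.
Proof.
apply: le_trans (normc_part _) _.
have h b : `|part b (GV g x i 0)| <= NH g.
  have -> : part b (GV g x i 0) = G (cmp b g i) x by rewrite -cmp_GV.
  apply: le_trans (G_sup x (hP g b i)) _; rewrite NHE; apply: ler_wsqrtr.
  exact: ip_cmp_le (hP g).
by have := h true; have := h false; lra.
Qed.

Lemma GV_hoelder (g : l2) x z : x <= z ->
  rip (GV g z - GV g x) (GV g z - GV g x) <= 2 * (z - x) * NH g ^+ 2.
Proof.
move=> xz; rewrite NHE N2_sqr (IP_cmp (hP g) (hP g)) /rip mulr_sumr.
apply: ler_sum => i _; rewrite mulrDr -!expr2; apply: lerD.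
  have -> : part true ((GV g z - GV g x) i 0) = G (cmp true g i) z - G (cmp true g i) x.
    by rewrite -cmp_GV /cmp -partB !mxE.
  exact: G_hoelder (hP g true i) xz.
have -> : part false ((GV g z - GV g x) i 0) = G (cmp false g i) z - G (cmp false g i) x.
  by rewrite -cmp_GV /cmp -partB !mxE.
exact: G_hoelder (hP g false i) xz.
Qed.

Lemma hsum (I : Type) (s : seq I) (F : I -> l2) x :
  (\sum_(i <- s) F i : l2) x = \sum_(i <- s) F i x.
Proof.
by elim: s => [|i s ih]; rewrite ?big_nil ?h0// !big_cons hD ih.
Qed.

Variables (mB : R -> 'M[R]_2) (B a : R).
Hypotheses (bB : bmx mB B) (a0 : 0 < a) (suppB : forall x, a < `|x| -> mB x = 0).
Variable n : nat.

Let h := 2 * a / n.+1%:R.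
Let pt (j : nat) := - a + j%:R * h.
Let ind (j : nat) (x : R) : R := ((pt j <= x) && (x < pt j + h))%:R.

Let h_gt0 : 0 < h.
Proof. by rewrite divr_gt0 ?ltr0n// mulr_gt0. Qed.

Let ind_itv j : ind j = \1_(`[pt j, (pt j + h)[ : set R).
Proof.
apply/funext => x; rewrite indicE /ind; congr (nat_of_bool _)%:R.
by rewrite mem_setE in_itv.
Qed.

Let ind_L2 j : L2 (ind j).
Proof.
have m : measurable_fun [set: R] (ind j).
  by rewrite ind_itv; exact: measurable_indic.
split => //.
have [i _] := @int_indic_itv R (pt j) (pt j + h) (ltac:(by rewrite lerDl ltW)).
apply: (integ_le _ i); first exact: measurable_funX.
move=> x; rewrite indicE mem_setE in_itv/= /ind.
case: (pt j <= x) => /=; last by rewrite expr0n normr0.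
by case: ltP => [/ltW ->|_]; rewrite ?expr1n ?normr1 ?expr0n ?normr0.
Qed.

Let ix (x : R) : nat := Num.truncn ((x + a) / h).

(** The right end point $x=a$ falls into cell [n.+1], which is why there are [n.+2] cells. *)
Let ixP x : `|x| <= a -> [/\ (ix x < n.+2)%N, pt (ix x) <= x & x < pt (ix x) + h].
Proof.
rewrite ler_norml => /andP[xa ax].
have y0 : 0 <= (x + a) / h by rewrite divr_ge0 ?(ltW h_gt0)//; lra.
have := Num.Theory.truncn_itv y0; rewrite -/(ix x) => /andP[l1 l2].
rewrite ler_pdivlMr// in l1; rewrite ltr_pdivrMr// -natr1 mulrDl mul1r in l2.
split; [|by rewrite /pt; lra|by rewrite /pt; lra].
rewrite ltnS -(ler_nat R) -(ler_pM2r h_gt0); apply: le_trans l1 _.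
by rewrite /h mulrCA mulfV ?pnatr_eq0// mulr1; lra.
Qed.

Let pt_lt j k : (j < k)%N -> pt j + h <= pt k.
Proof.
rewrite -(ler_nat R) -natr1 => jk.
by have := ler_wpM2r (ltW h_gt0) jk; rewrite /pt; lra.
Qed.

Let ind_ix x j : `|x| <= a -> ind j x = (j == ix x)%:R.
Proof.
move=> xa; have [_ l1 l2] := ixP xa; rewrite /ind.
case: (ltngtP j (ix x)) => [ji|ij|->]; last by rewrite l1 l2.
  rewrite [x < _]ltNge (_ : pt j + h <= x) ?andbF//.
  by apply: le_trans l1; exact: pt_lt.
rewrite (_ : pt j <= x = false)//; apply/negbTE; rewrite -ltNge.
by apply: lt_le_trans l2 _; exact: pt_lt.
Qed.

Let T : finType := ('I_n.+2 * 'I_2)%type.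
Let psiV (t : T) : V := fun x => real_complex R (ind t.1 x) *: (cplx (mB x) *m delta_mx t.2 0).

Let psiV_L2 t : VL2 (psiV t).
Proof.
move=> b i.
have -> : cmp b (psiV t) i = (fun x => (if b then mB x i t.2 else 0) * ind t.1 x).
  apply/funext => x; rewrite /cmp /psiV mxE part_real mulrC; congr (_ * _).
  rewrite mxE (bigD1 t.2)//= big1 ?addr0; last first.
    by move=> j jt; rewrite !mxE (negbTE jt) mulr0.
  by rewrite !mxE !eqxx mulr1; case: b.
apply: (@L2_bounded_mul _ _ _ B) => //.
  by case: b; [exact: bB.1|exact: measurable_cst].
by move=> x; case: b; [exact: bB.2|rewrite normr0 (le_trans (normr_ge0 _) (bB.2 0 ord0 ord0))].
Qed.

Definition smp_psi (i : 'I_#|T|) : l2 := l2of (psiV (enum_val i)).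
(** Point evaluation of $Gg$, a bounded functional of $g$ by [GV_point]. *)
Definition smp_l (i : 'I_#|T|) (g : l2) : C := GH g (pt (enum_val i).1) (enum_val i).2 0.

Lemma smp_linf i : linf (smp_l i).
Proof. by move=> c g k; rewrite /smp_l GH_lin hD hZ !mxE. Qed.

Lemma smp_bound i g : normc (smp_l i g) <= 2 * NH g.
Proof. by rewrite /smp_l GHE; exact: GV_point. Qed.

Let sumE (g : l2) x : (\sum_i smp_l i g *: smp_psi i : l2) x =
  if `|x| <= a then cplx (mB x) *m GV g (pt (ix x)) else 0.
Proof.
have -> : (\sum_i smp_l i g *: smp_psi i : l2) x =
    \sum_(t : T) (GV g (pt t.1) t.2 0) *: psiV t x.
  rewrite (reindex (@enum_val T T))/=; last exact/onW_bij/enum_val_bij.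
  rewrite hsum; apply: eq_bigr => i _.
  by rewrite hZ /smp_psi hofK; [rewrite /smp_l GHE|exact: psiV_L2].
rewrite -(pair_bigA _ (fun (j : 'I_n.+2) (k : 'I_2) => GV g (pt j) k 0 *: psiV (j, k) x))/=.
case: (leP `|x| a) => xa; last first.
  apply: big1 => j _; apply: big1 => k _.
  by rewrite /psiV suppB// /cplx map_mx0 mul0mx !scaler0.
have [l0 _ _] := ixP xa.
rewrite (bigD1 (Ordinal l0))//= [X in _ + X]big1 ?addr0; last first.
  move=> j jx; apply: big1 => k _.
  rewrite /psiV/= ind_ix// (_ : (nat_of_ord j == ix x) = false) ?rmorph0 ?scale0r ?scaler0//.
  by apply: negbTE; exact: jx.
have {2}-> : GV g (pt (ix x)) = \sum_k GV g (pt (ix x)) k 0 *: delta_mx k 0.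
  rewrite {1}[GV g (pt (ix x))]matrix_sum_delta; apply: eq_bigr => k _.
  by rewrite big_ord1.
rewrite mulmx_sumr; apply: eq_bigr => k _.
by rewrite /psiV/= ind_ix// eqxx rmorph1 scale1r scalemxAr.
Qed.

(** Within a cell of length $h$ the Hölder bound gives $|m_B(x)(w(x)-w(x_j))|^2\le8B^2h\|g\|^2$;
    this is integrated over an interval of length $2a$, with $h=2a/(n+1)$. *)
Lemma smp_err g : NH (MH mB (GH g) - \sum_i smp_l i g *: smp_psi i) <=
  Num.sqrt (32 * B ^+ 2 * a ^+ 2 / n.+1%:R) * NH g.
Proof.
have B0 : 0 <= B := le_trans (normr_ge0 _) (bB.2 0 ord0 ord0).
pose d : l2 := MH mB (GH g) - \sum_i smp_l i g *: smp_psi i.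
have dE x : d x = if `|x| <= a then cplx (mB x) *m (GV g x - GV g (pt (ix x))) else 0.
  rewrite /d hB sumE (MHE _ bB) /mulV GHE; case: ifPn => xa.
    by rewrite mulmxBr.
  by rewrite suppB 1?ltNge// /cplx map_mx0 mul0mx subr0.
pose K := 8 * B ^+ 2 * h * NH g ^+ 2.
have K0 : 0 <= K.
  by rewrite /K mulr_ge0 ?sqr_ge0// mulr_ge0 ?(ltW h_gt0)// mulr_ge0 ?sqr_ge0.
have bd x : rip (d x) (d x) <= K * \1_(`[- a, a] : set R) x.
  rewrite dE indicE mem_setE in_itv/= -ler_norml; case: ifPn => xa; last first.
    by rewrite /rip big1 ?mulr0// => i _; rewrite !mxE /part/= !mulr0 addr0.
  have [_ l1 l2] := ixP xa; rewrite mulr1.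
  apply: le_trans (rip_mulmx _ (bB.2 x)) _.
  apply: le_trans (ler_wpM2l (sqr_ge0 _) (GV_hoelder g l1)) _.
  rewrite (_ : (2 * B) ^+ 2 * _ = 8 * B ^+ 2 * NH g ^+ 2 * (x - pt (ix x))); last by ring.
  rewrite (_ : K = 8 * B ^+ 2 * NH g ^+ 2 * h); last by rewrite /K mulrAC.
  apply: ler_wpM2l; first by rewrite mulr_ge0 ?sqr_ge0// mulr_ge0 ?sqr_ge0.
  by rewrite lerBlDl ltW.
have -> : MH mB (GH g) - \sum_i smp_l i g *: smp_psi i = d by [].
have H : IP d d <= K * (2 * a).
  have aa : - a <= a by apply: le_trans (ltW a0); rewrite oppr_le0 ltW.
  have [ii iv] := int_indic_itv aa.
  rewrite (_ : 2 * a = a - - a); last by ring.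
  rewrite -iv -intZ//; apply: int_le bd; first exact: rip_integ (hP _) (hP _).
  exact: integZ.
rewrite -(@ler_pXn2r _ 2)// ?nnegrE ?mulr_ge0 ?sqrtr_ge0 ?(sn_ge0 sn)//.
rewrite exprMn sqr_sqrtr; last by rewrite divr_ge0 ?ler0n// mulr_ge0 ?sqr_ge0// mulr_ge0 ?sqr_ge0.
rewrite {1}NHE N2_sqr; apply: le_trans H _; rewrite /K /h.
rewrite le_eqVlt; apply/orP; left; apply/eqP.
by field; rewrite addrC natr1 pnatr_eq0.
Qed.

End Sampling.

(** * The Fredholm alternative and isolation of singular points *)

Section Fredholm.
Variable R : realType.
Local Notation C := R[i].
Local Notation normc := (@Normc.normc R).
Local Notation l2 := (l2 R).
Local Notation NH := (@NH R).
Local Notation rc := (real_complex R).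
Local Notation JH := (@JH R).
Local Notation GH := (@GH R).
Let sn := @NH_seminorm R.
Let sc := @NH_complete R.

(* The rank-m perturbation is the sampled version of [MH mB \o GH]. *)
Lemma sampling (mB : R -> 'M[R]_2) (B a del : R) : bmx mB B -> 0 < a ->
  (forall x, a < `|x| -> mB x = 0) -> 0 < del ->
  exists m (psi : 'I_m -> l2) (l : 'I_m -> l2 -> C),
    [/\ forall i, linf (l i), forall i g, normc (l i g) <= 2 * NH g &
        bdd NH (fun g => MH mB (GH g) - \sum_i l i g *: psi i) del].
Proof.
move=> bB a0 supp d0.
pose X := 32 * B ^+ 2 * a ^+ 2; pose n := Num.truncn (X / del ^+ 2).
exists _, (@smp_psi R mB a n), (@smp_l R a n); split.
- exact: smp_linf.
- exact: smp_bound.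
- move=> g; apply: le_trans (smp_err bB a0 supp n g) _.
  rewrite ler_wpM2r ?(sn_ge0 sn)// -[leRHS]ger0_norm ?(ltW d0)// -sqrtr_sqr.
  apply: ler_wsqrtr; rewrite ler_pdivrMr ?ltr0n// [leRHS]mulrC -ler_pdivrMr ?exprn_gt0//.
  exact/ltW/Num.Theory.truncnS_gt.
Qed.

Lemma complexE (z : C) : z = Complex (complex.Re z) (complex.Im z).
Proof. by case: z. Qed.

Lemma Re_normc (z : C) : `|complex.Re z| <= normc z.
Proof.
case: z => a b /=; rewrite -sqrtr_sqr; apply: ler_wsqrtr.
by rewrite lerDl sqr_ge0.
Qed.

Lemma ReB (z y : C) : complex.Re (z - y) = complex.Re z - complex.Re y.
Proof. by case: z; case: y. Qed.

Lemma ReD (z y : C) : complex.Re (z + y) = complex.Re z + complex.Re y.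
Proof. by case: z; case: y. Qed.

(** The starting point of later continuations, itself reached from $J$: by orthogonality
    $\|Jg-tGg\|^2=\|g\|^2+t^2\|Gg\|^2$. *)
Lemma JG_onto : onto NH (fun g : l2 => JH g - GH g).
Proof.
have -> : (fun g : l2 => JH g - GH g) = (fun g => JH g + (-1) *: GH g).
  by apply/funext => g; rewrite scaleN1r.
refine (@continuation R _ NH sn sc JH (fun g => (-1) *: GH g) 1 (normc (-1) * 1) 1 _ _ _ _ _ _ _).
- exact: JH_lin.
- by apply: lin_scale; exact: GH_lin.
- by move=> g; rewrite JH_nm mul1r.
- by apply: (bdd_scale sn); exact: GH_bdd.
- exact: ltr01.
- move=> t /andP[t0 _] g; rewrite mul1r.
  rewrite !NHE; apply: ler_wsqrtr; rewrite scalerA; set s := rc t * -1.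
  have hs : VL2 (fun x => s *: GH g x) := VL2Z s (hP _).
  have jg : IP (JH g) (GH g) = 0 by rewrite JHE GHE; apply: IP_J_G; exact: hP.
  have sE : s = rc (- t) by rewrite /s rmorphN mulrN1.
  have q2 : IP (fun x => s *: GH g x) (JH g) = 0.
    by rewrite sE IPZr; [rewrite IPC jg mulr0|exact: hP|exact: hP].
  have q1 : IP (JH g) (fun x => s *: GH g x) = 0 by rewrite IPC.
  have hj : VL2 (JH g) := hP _.
  rewrite hD hZ (IPDl hj hs (VL2D hj hs)) (IPDr hj hs hj) (IPDr hj hs hs).
  rewrite q1 q2 addr0 add0r -!N2_sqr -!NHE JH_nm lerDl.
  exact: sqr_ge0.
- exact: JH_onto.
Qed.

(** Continuation from $J-G$, the case of potential 0 and spectral parameter 1, along the potentials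
    $tm$ and the parameters $1-t+tz$. The operators stay dissipative with rate $\min(\gamma,1)$. *)
Lemma dissip_onto m B z gam : bmx m B -> 0 < gam ->
  (forall x p, rip (cplx (m x) *m p) p - complex.Re z * rip p p <= - gam * rip p p) ->
  onto NH (opM m z).
Proof.
move=> bm g0 hm; have B0 : 0 <= B := le_trans (normr_ge0 _) (bm.2 0 ord0 ord0).
pose g1 := Num.min gam 1; have g10 : 0 < g1 by rewrite lt_min g0 ltr01.
pose K := 2 * B + normc z + 1.
have K0 : 0 <= K by rewrite !addr_ge0 ?normc_ge0// mulr_ge0.
have lS : lin (fun g : l2 => MH m (GH g) + (1 - z) *: GH g).
  by apply: lin_add; [apply: lin_comp (MH_lin bm) (@GH_lin R)|apply: lin_scale; exact: GH_lin].
have -> : opM m z = (fun g => (JH g - GH g) + (MH m (GH g) + (1 - z) *: GH g)).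
  apply/funext => g; rewrite /opM scalerBl scale1r addrACA; congr (_ + _).
  by rewrite [RHS]addrA addNr add0r.
have dz t : 0 <= t <= 1 -> opM (fun x => t *: m x) (1 - rc t + rc t * z) =
    (fun g => (JH g - GH g) + rc t *: (MH m (GH g) + (1 - z) *: GH g)).
  move=> t01; apply/funext => g; rewrite /opM.
  have bt : bmx (fun x => t *: m x) B.
    split=> [i j|x i j].
      under eq_fun do rewrite mxE.
      by apply: measurable_funM => //; exact: bm.1.
    rewrite mxE normrM; move/andP: t01 => [t0 t1]; rewrite ger0_norm//.
    by have := bm.2 x i j; have := normr_ge0 (m x i j); nra.
  have -> : MH (fun x => t *: m x) (GH g) = rc t *: MH m (GH g).
    apply: hext => x; rewrite hZ (MHE _ bt) (MHE _ bm) /mulV /cplx.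
    by rewrite map_mxZ -scalemxAl.
  rewrite -!addrA; congr (_ + _); rewrite scalerDr scalerA [RHS]addrCA; congr (_ + _).
  by rewrite -scaleNr -[- GH g]scaleN1r -scalerDl; congr (_ *: _); ring.
refine (@continuation R _ NH sn sc (fun g => JH g - GH g) _ 2 (2 * B + normc (1 - z)) (1 + K / g1)^-1 _ _ _ _ _ _ _).
- have -> : (fun g : l2 => JH g - GH g) = (fun g => JH g + (-1) *: GH g).
    by apply/funext => g; rewrite scaleN1r.
  by apply: lin_add; [exact: JH_lin|apply: lin_scale; exact: GH_lin].
- exact: lS.
- move=> g; apply: le_trans (snB sn _ _) _; rewrite JH_nm.
  by have := GH_bdd g; lra.
- move=> g; have := GH_bdd g; rewrite mul1r => Gg; rewrite mulrDl.
  apply: le_trans (snD sn _ _) _; rewrite (snZ sn); apply: lerD.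
    by apply: le_trans (MH_bdd bm _) _; rewrite ler_wpM2l// mulr_ge0.
  by rewrite ler_wpM2l ?normc_ge0.
- by rewrite invr_gt0 ltr_wpDr// divr_ge0// ltW.
- move=> t t01; rewrite -dz//; apply: (@dissip R _ B) => //.
  + split=> [i j|x i j].
      under eq_fun do rewrite mxE.
      by apply: measurable_funM => //; exact: bm.1.
    rewrite mxE normrM; move/andP: t01 => [t0 t1]; rewrite ger0_norm//.
    by have := bm.2 x i j; have := normr_ge0 (m x i j); nra.
  + rewrite /K -[leRHS]addrA lerD2l.
    have := le_normcD (1 - rc t) (rc t * z).
    have -> : 1 - rc t = rc (1 - t) by rewrite rmorphB rmorph1.
    rewrite Normc.normcM !normc_real; move/andP: t01 => [t0 t1].
    rewrite !ger0_norm ?subr_ge0//.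
    have := normc_ge0 z; have := t1; nra.
  + move=> x p.
    have -> : cplx (t *: m x) *m p = rc t *: (cplx (m x) *m p).
      by rewrite /cplx map_mxZ -scalemxAl.
    rewrite ripZr.
    have -> : complex.Re (1 - rc t + rc t * z) = 1 - t + t * complex.Re z.
      by case: z {dz lS hm K K0} => zr zi /=; rewrite mul0r subr0.
    have := hm x p; have := rip_ge0 p; move/andP: t01 => [t0 t1] p0 h.
    have g11 : g1 <= 1 by rewrite /g1 ge_min lexx orbT.
    have g12 : g1 <= gam by rewrite /g1 ge_min lexx.
    have := ler_wpM2l t0 h.
    have := mulr_ge0 (mulr_ge0 t0 p0) (ltac:(lra) : 0 <= gam - g1).
    have := mulr_ge0 (mulr_ge0 (ltac:(lra) : 0 <= 1 - t) p0) (ltac:(lra) : 0 <= 1 - g1).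
    lra.
- exact: JG_onto.
Qed.

Lemma opM_shift m z z' g : opM m (z + z') g = opM m z g - z' *: GH g.
Proof. by rewrite /opM scalerDl opprD addrA. Qed.

Section Alternative.
Variables (mA mD mB : R -> 'M[R]_2) (B a gam : R).
Hypotheses (bA : bmx mA B) (bD : bmx mD B) (bB : bmx mB B) (a0 : 0 < a).
Hypothesis supp : forall x, a < `|x| -> mB x = 0.
Hypothesis mE : forall x, mA x = mD x + mB x.
Hypothesis diss : forall x p, rip (cplx (mD x) *m p) p <= - gam * rip p p.

(** The operator is split into a dissipative part, the error of the sampling, and a finite-rank
    part. The first two together form [E0], which is invertible with uniform bounds for parameters
    near [z0] because the error is at most a quarter of the lower bound. *)
Lemma fred_setup z0 : - gam < complex.Re z0 ->
  exists m (psi : 'I_m -> l2) (l : 'I_m -> l2 -> C) (E0 : l2 -> l2) (r c : R),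
    [/\ [/\ 0 < r, 0 < c & lin E0],
        forall i, linf (l i), forall i g, normc (l i g) <= 2 * NH g,
        forall z, normc z < r -> below NH (fun x => E0 x - z *: GH x) c /\
          onto NH (fun x => E0 x - z *: GH x) &
        forall z g, opM mA (z0 + z) g = frA psi l (fun x => E0 x - z *: GH x) g].
Proof.
(* Half the distance to the line $\operatorname{Re}z=-\gamma$: on the disc of this radius the
   dissipation rate is still at least $r$. *)
move=> hz; pose r := (gam + complex.Re z0) / 2.
have r0 : 0 < r by rewrite /r; lra.
have B0 : 0 <= B := le_trans (normr_ge0 _) (bB.2 0 ord0 ord0).
pose K := 2 * B + normc z0 + r.
have K0 : 0 <= K by rewrite !addr_ge0 ?normc_ge0 ?(ltW r0)// mulr_ge0.
pose c := (1 + K / r)^-1.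
have c0 : 0 < c by rewrite invr_gt0 ltr_wpDr// divr_ge0// ltW.
have [m [psi [l [ll bl err]]]] := sampling bB a0 supp (divr_gt0 c0 (ltr0n R 4) : 0 < c / 4).
pose F (g : l2) : l2 := MH mB (GH g) - \sum_i l i g *: psi i.
have lF : lin F.
  rewrite /F => b x y; rewrite GH_lin (MH_lin bB).
  have -> : \sum_i l i (b *: x + y) *: psi i =
      b *: (\sum_i l i x *: psi i) + \sum_i l i y *: psi i.
    rewrite scaler_sumr -big_split/=; apply: eq_bigr => i _.
    by rewrite ll scalerDl scalerA.
  by rewrite scalerBr addrACA opprD.
pose E0 g := opM mD z0 g + F g.
exists m, psi, l, E0, r, (c / 2); split => //.
- split => //; first by rewrite divr_gt0.
  by apply: lin_add => //; exact: opM_lin bD.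
- move=> z zr.
  have hd x p : rip (cplx (mD x) *m p) p - complex.Re (z0 + z) * rip p p <= - r * rip p p.
    have := diss x p; have p0 := rip_ge0 p.
    have h : complex.Re (z0 + z) >= r - gam.
      have := le_lt_trans (Re_normc z) zr; rewrite ltr_norml ReD /r => /andP[]; lra.
    by have := ler_wpM2r p0 h; lra.
  have be : below NH (opM mD (z0 + z)) c.
    apply: (dissip bD r0 _ hd); rewrite /K -addrA lerD2l.
    by apply: le_trans (le_normcD _ _) _; rewrite lerD2l ltW.
  have -> : (fun x => E0 x - z *: GH x) = (fun x => opM mD (z0 + z) x + F x).
    by apply/funext => g; rewrite /E0 opM_shift addrAC.
  split.
    move=> g; have := be g; have := err g; rewrite -/(F g) => e1 e2.
    have := snB sn (opM mD (z0 + z) g + F g) (F g); rewrite addrK.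
    have := mulr_ge0 (ltW c0) (sn_ge0 sn g); lra.
  apply: (neumann sn sc _ lF (opM_bdd (z0 + z) bD) c0 be) => //.
    exact: opM_lin bD.
  exact: dissip_onto bD r0 hd.
- move=> z g; rewrite /frA /E0 /F opM_shift [RHS]addrAC; congr (_ - _).
  rewrite -[RHS]addrA subrK /opM -!addrA; congr (_ + _).
  rewrite (_ : MH mA (GH g) = MH mD (GH g) + MH mB (GH g)); last first.
    apply: hext => x; rewrite hD (MHE _ bA) (MHE _ bD) (MHE _ bB) /mulV mE.
    by rewrite /cplx map_mxD mulmxDl.
  by rewrite addrAC -addrA.
Qed.

(** Index zero in finite dimensions: injectivity makes the determinant of [frM] nonzero, and
    [frM_reg] then gives the rest. *)
Lemma fred_reg z : - gam < complex.Re z -> inj0 NH (opM mA z) ->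
  onto NH (opM mA z) /\ exists2 c, 0 < c & below NH (opM mA z) c.
Proof.
move=> hz inj; have [m [psi [l [E0 [r [c [[r0 c0 lE] ll bl hE AE]]]]]]] := fred_setup hz.
have [|be ont] := hE 0; first by rewrite Normc.normc0.
have [S hS] := choice ont.
have lE0 : lin (fun x => E0 x - 0 *: GH x).
  by move=> b x y; rewrite !scale0r !subr0 lE.
have AF : opM mA z = frA psi l (fun x => E0 x - 0 *: GH x).
  by apply/funext => g; rewrite -AE addr0.
have d0 : \det (frM psi l S) <> 0.
  by move=> d0; apply: (frM_sing sn ll bl lE0 hS d0); rewrite -AF.
by have [_ o b] := frM_reg sn ll bl lE0 c0 be hS d0; rewrite AF.
Qed.

Lemma fred_alt z0 : - gam < complex.Re z0 -> exists2 rho, 0 < rho &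
  (forall z, 0 < normc (z - z0) < rho -> inj0 NH (opM mA z)) \/
  (forall z, normc (z - z0) < rho -> ~ inj0 NH (opM mA z)).
Proof.
move=> hz; have [m [psi [l [E0 [r [c [[r0 c0 lE] ll bl hE AE]]]]]]] := fred_setup hz.
have AF z : opM mA z = frA psi l (fun x => E0 x - (z - z0) *: GH x).
  by apply/funext => g; rewrite -AE addrC subrK.
have [[rho rho0 h]|[rho rho0 h]] :=
  fredholm_dichotomy sn psi ll bl lE (@GH_lin R) (@GH_bdd R) r0 c0 hE;
  exists rho => //; [left|right] => z /h; rewrite -AF//.
Qed.

Variable M0 : R.
Hypothesis big : forall x p, rip (cplx (mA x) *m p) p <= M0 * rip p p.

Lemma fred_right z : M0 < complex.Re z -> inj0 NH (opM mA z).
Proof.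
move=> hz; have d0 : 0 < complex.Re z - M0 by rewrite subr_gt0.
have B0 : 0 <= B := le_trans (normr_ge0 _) (bB.2 0 ord0 ord0).
apply: (@below_inj R _ NH sn _ (1 + (2 * B + normc z) / (complex.Re z - M0))^-1).
  by rewrite invr_gt0 ltr_wpDr// divr_ge0 ?(ltW d0)// addr_ge0 ?normc_ge0// mulr_ge0.
apply: (dissip bA d0 (lexx _)) => x p.
have := big x p; lra.
Qed.

(* Along the horizontal half-line through [z0], being everywhere singular near
   a point is an open and closed condition that fails far to the right. *)
Lemma fred_punctured z0 : - gam < complex.Re z0 -> exists2 rho, 0 < rho &
  forall z, 0 < normc (z - z0) < rho -> inj0 NH (opM mA z).
Proof.
move=> hz; have [rho rho0 [h|h]] := fred_alt hz; first by exists rho.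
exfalso.
pose S := [set t : R | 0 <= t /\ exists2 r, 0 < r &
  forall z, normc (z - (z0 + rc t)) < r -> ~ inj0 NH (opM mA z)].
have S0 : S 0 by split => //; exists rho => // z; rewrite rmorph0 addr0; exact: h.
have Sub t : S t -> t <= `|M0 - complex.Re z0| + 1.
  move=> [t0 [r r0 hr]]; rewrite leNgt; apply/negP => ht.
  apply: (hr (z0 + rc t)); first by rewrite subrr Normc.normc0.
  apply: fred_right; rewrite ReD/=; have := ler_norm (M0 - complex.Re z0); lra.
have hsS : has_sup S by split; [exists 0|exists (`|M0 - complex.Re z0| + 1) => t /Sub].
set s := sup S; have s0 : 0 <= s by apply: (ub_le_sup hsS.2).
have hzs : - gam < complex.Re (z0 + rc s) by rewrite ReD/=; lra.
have [r r0 hr] := fred_alt hzs.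
have nrm (t t' : R) : normc (z0 + rc t - (z0 + rc t')) = `|t - t'|.
  by rewrite opprD addrACA subrr add0r -rmorphB normc_real.
have [t St ht] := sup_adherent r0 hsS.
have ht' : 0 < r - (s - t) by move: ht; rewrite -/s; lra.
have ts : t <= s by apply: (ub_le_sup hsS.2).
case: hr => hr; last first.
  suff : S (s + r / 2) by move=> /(ub_le_sup hsS.2); rewrite -/s; lra.
  split; first lra.
  exists (r / 2) => [|z hzr]; first lra.
  apply: hr; rewrite (_ : z - (z0 + rc s) = (z - (z0 + rc (s + r / 2))) + rc (r / 2)).
    apply: le_lt_trans (le_normcD _ _) _; rewrite normc_real ger0_norm; lra.
  by rewrite rmorphD; ring.
have [t0 [r1 r10 h1]] := St.
pose d := Num.min r1 (r - (s - t)) / 2.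
have d0 : 0 < d by rewrite divr_gt0// lt_min r10.
have d1 : d < r1 by have : Num.min r1 (r - (s - t)) <= r1 by [rewrite ge_min lexx]; rewrite /d; lra.
have d2 : d < r - (s - t).
  by have : Num.min r1 (r - (s - t)) <= r - (s - t) by [rewrite ge_min lexx orbT]; rewrite /d; lra.
(* The vertical offset keeps this point away from [z0 + rc s] even if [t = s]. It lies in the
   singular disc around [z0 + rc t] and in the regular punctured disc around [z0 + rc s]. *)
pose z := z0 + rc t + Complex 0 d.
apply: (h1 z).
  rewrite /z [_ + Complex 0 d]addrC addrK /Normc.normc /= expr0n/= add0r sqrtr_sqr gtr0_norm//.
apply: hr.
have -> : z - (z0 + rc s) = Complex (t - s) d.
  have -> : z - (z0 + rc s) = rc (t - s) + Complex 0 d by rewrite /z rmorphB; ring.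
  by apply/eqP; rewrite eq_complex/= addr0 add0r !eqxx.
apply/andP; split.
  rewrite /Normc.normc sqrtr_gt0 ltr_wpDl ?sqr_ge0// exprn_gt0//.
have -> : Complex (t - s) d = rc (t - s) + Complex 0 d.
  by apply/eqP; rewrite eq_complex/= addr0 add0r !eqxx.
apply: le_lt_trans (le_normcD _ _) _; rewrite normc_real.
have -> : normc (Complex 0 d) = d by rewrite /Normc.normc expr0n/= add0r sqrtr_sqr gtr0_norm.
rewrite distrC ger0_norm; lra.
Qed.

End Alternative.
End Fredholm.

(** * From the unbounded linearization to the bounded operator *)

Section Link.
Variable R : realType.
Local Notation C := R[i].
Local Notation normc := (@Normc.normc R).
Local Notation mu := (@lebesgue_measure R).
Local Notation V := (R -> 'cV[C]_2).
Local Notation l2 := (l2 R).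
Local Notation NH := (@NH R).
Local Notation rc := (real_complex R).
Local Notation JH := (@JH R).
Local Notation GH := (@GH R).
Let sn := @NH_seminorm R.

Definition H2v (w w1 w2 : V) := forall b i, h2 (cmp b w i) (cmp b w1 i) (cmp b w2 i).

Lemma H2vP w w2 : H2_deriv2 w w2 <-> exists w1, H2v w w1 w2.
Proof.
split=> [[w1 [h0 h1 h2 d1 d2]]|[w1 h]]; exists w1.
  move/inL2P: h0 => h0; move/inL2P: h1 => h1; move/inL2P: h2 => h2.
  move=> b i; split=> // phi tphi.
    by have [e1 e2] := d1 _ tphi i; case: b; [exact: e1|exact: e2].
  by have [e1 e2] := d2 _ tphi i; case: b; [exact: e1|exact: e2].
split; first (by apply/inL2P => b i; case: (h b i));
  first (by apply/inL2P => b i; case: (h b i)); first by apply/inL2P => b i; case: (h b i).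
  move=> phi tphi i; have [_ _ _ e1 _] := h true i; have [_ _ _ e2 _] := h false i.
  by split; [exact: e1|exact: e2].
move=> phi tphi i; have [_ _ _ _ e1] := h true i; have [_ _ _ _ e2] := h false i.
by split; [exact: e1|exact: e2].
Qed.

Lemma aeeq_cmp (w v : V) :
  (forall b i, {ae mu, forall x, cmp b w i x = cmp b v i x}) -> aeeq w v.
Proof.
move=> h; have := aeS2 (fun x a b => conj a b) (h true 0) (h false 0).
have := aeS2 (fun x a b => conj a b) (h true 1) (h false 1).
apply: aeS2 => x [a1 b1] [a0 b0]; apply/matrixP => i j; rewrite ord1 {j}.
have cE (z y : C) : part true z = part true y -> part false z = part false y -> z = y.
  by case: z => ? ?; case: y => ? ? /= -> ->.
by case: i => [[|[|//]] hi]; [rewrite (_ : Ordinal hi = 0)|rewrite (_ : Ordinal hi = 1)];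
  try exact: val_inj; exact: cE.
Qed.

(** The derivative of $Gg$: since $G=KK^t$ and $(Kh)'=h-Kh$, it is $K^tg-Gg$ in every component. *)
Definition D1 (g : V) : V := fun x => \col_i
  Complex (Kt (cmp true g i) x - G (cmp true g i) x)
          (Kt (cmp false g i) x - G (cmp false g i) x).

Lemma cmp_D1 b g i : cmp b (D1 g) i = (fun x => Kt (cmp b g i) x - G (cmp b g i) x).
Proof. by apply/funext => x; rewrite /cmp mxE; case: b. Qed.

Lemma H2v_GH (g : l2) : H2v (GH g) (D1 g) (fun x => GH g x - g x).
Proof.
move=> b i; rewrite cmp_D1 cmpB GHE cmp_GV.
by apply: h2_G; exact: hP.
Qed.

Lemma H2v_VL2 w w1 w2 : H2v w w1 w2 -> [/\ VL2 w, VL2 w1 & VL2 w2].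
Proof. by move=> h; split => b i; case: (h b i). Qed.

Lemma H2v_rep w w1 w2 : H2v w w1 w2 -> let g := l2of (fun x => w x - w2 x) in
  aeeq w (GH g) /\ aeeq w1 (D1 g).
Proof.
move=> h g; have [h0 h1 h2] := H2v_VL2 h.
have gE : g = (fun x => w x - w2 x) :> V by apply: hofK; exact: VL2B.
split; apply: aeeq_cmp => b i; have [r0 r1] := h2_rep (h b i).
  by rewrite GHE cmp_GV gE cmpB.
by rewrite cmp_D1 gE cmpB.
Qed.

Lemma D1_nm (g : l2) : N2 (D1 g) <= 2 * NH g.
Proof.
have gP := hP g; have [_ h1 _] := H2v_VL2 (H2v_GH g).
rewrite NHE -(@ler_pXn2r _ 2)// ?nnegrE ?mulr_ge0 ?N2_ge0//.
rewrite exprMn !N2_sqr (IP_cmp h1 h1) (IP_cmp gP gP) mulr_sumr.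
have ar (kk kg gk gg y : R) : 0 <= kk + kg + (gk + gg) -> kk <= y -> gg <= y ->
    kk - kg - (gk - gg) <= 2 ^+ 2 * y by lra.
have k b i : ip (cmp b (D1 g) i) (cmp b (D1 g) i) <= 2 ^+ 2 * ip (cmp b g i) (cmp b g i).
  have L := gP b i; have LK := Kt_L2 L; have LG := G_L2 L.
  have q : ip (fun x => Kt (cmp b g i) x + G (cmp b g i) x)
              (fun x => Kt (cmp b g i) x + G (cmp b g i) x) >= 0 by exact: ip_ge0.
  rewrite ipDl// in q; last exact: L2D.
  rewrite !ipDr// in q.
  rewrite cmp_D1 ipBl//; last exact: L2B.
  rewrite !ipBr//; exact: ar q (Kt_nm L) (G_nm L).
by apply: ler_sum => i _; rewrite mulrDr; apply: lerD; exact: k.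
Qed.

Definition opL (m : R -> 'M[R]_2) (z : C) (w w2 : V) : V := fun x =>
  - (Jmx *m w2 x) + cplx (m x) *m w x - z *: w x.

(** From $w''=w-g$ one gets $-Jw''=Jg-Jw$, whence the shift of the potential by $J$. *)
Definition opT (m : R -> 'M[R]_2) := @opM R (fun x => m x - Jmx).

Lemma cplxJ : @cplx R 2 2 Jmx = Jmx.
Proof.
apply/matrixP => i j; rewrite !mxE.
by case: i => [[|[|//]] ?]; case: j => [[|[|//]] ?] /=; rewrite ?rmorph0 ?rmorph1 ?rmorphN1.
Qed.

Lemma bmxJ (m : R -> 'M[R]_2) (B : R) : bmx m B -> bmx (fun x => m x - Jmx) (B + 1).
Proof.
move=> [mm mb]; split=> [i j|x i j].
  under eq_fun do rewrite mxE; apply: measurable_funD => //; exact: measurable_cst.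
rewrite mxE; apply: le_trans (ler_normD _ _) _; apply: lerD => //.
rewrite !mxE normrN; case: i => [[|[|//]] ?]; case: j => [[|[|//]] ?] /=;
  by rewrite ?normr0 ?normrN1 ?normr1.
Qed.

Lemma opT_E m B z (g : l2) x : bmx m B ->
  opT m z g x = opL m z (GH g) (fun x => GH g x - g x) x.
Proof.
move=> bm; rewrite /opT /opM /opL hB hD hZ (MHE _ (bmxJ bm)) JHE /JV /mulV.
have -> : cplx (m x - Jmx) = cplx (m x) - Jmx by rewrite -[X in _ = _ - X]cplxJ; exact: map_mxB.
rewrite mulmxBl mulmxBr opprB; congr (_ - _).
by rewrite addrA addrAC.
Qed.

Lemma VL2_opL m B z w w1 w2 : bmx m B -> H2v w w1 w2 -> VL2 (opL m z w w2).
Proof.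
move=> bm /H2v_VL2[h0 h1 h2]; apply: VL2B; last exact: VL2Z.
apply: VL2D; last exact: VL2_mulV bm _.
by apply: VL2N; exact: VL2_JV.
Qed.

Lemma opL_opT m B z w w1 w2 : bmx m B -> H2v w w1 w2 ->
  aeeq (opL m z w w2) (opT m z (l2of (fun x => w x - w2 x))).
Proof.
move=> bm h; have [h0 h1 h2] := H2v_VL2 h.
have [e _] := H2v_rep h; apply: aeS e => x e.
rewrite (opT_E _ _ _ bm) /opL -e; congr (- (_ *m _) + _ - _).
by rewrite hofK; [rewrite opprB addrC subrK|exact: VL2B].
Qed.

Lemma N2_opL m B z w w1 w2 : bmx m B -> H2v w w1 w2 ->
  N2 (opL m z w w2) = NH (opT m z (l2of (fun x => w x - w2 x))) /\
  N2 w = NH (GH (l2of (fun x => w x - w2 x))).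
Proof.
move=> bm h; have [h0 h1 h2] := H2v_VL2 h; rewrite !NHE; split; apply: N2_ae.
- exact: VL2_opL bm h.
- exact: hP.
- exact: opL_opT bm h.
- by [].
- exact: hP.
- exact: (H2v_rep h).1.
Qed.

Section Resolvent.
Variables (zeta eps : R) (u : R -> 'cV[R]_2).

(** This is $J(\zeta-\text{potential})-\varepsilon$ multiplied out, see [mpotE]. *)
Definition mpot (a : 'cV[R]_2) : 'M[R]_2 :=
  mx2 (- 2 * a 0 0 * a 1 0 - eps) (zeta - a 0 0 ^+ 2 - 3 * a 1 0 ^+ 2)
      (- zeta + 3 * a 0 0 ^+ 2 + a 1 0 ^+ 2) (2 * a 0 0 * a 1 0 - eps).

Let m x := mpot (u x).
Variable B : R.
Hypothesis bm : bmx m B.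
Local Notation A := (linearization zeta eps u).

Lemma mpotE a : Jmx *m (zeta%:M - potential a) - eps%:M = mpot a.
Proof.
apply/matrixP => i j; rewrite !mxE big_ord_recl big_ord1 !mxE.
by case: i => [[|[|//]] ?]; case: j => [[|[|//]] ?] /=; rewrite ?mulr1n ?mulr0n; ring.
Qed.

Lemma LopE w w2 x : Jmx *m Lop zeta u w w2 x - rc eps *: w x = opL m 0 w w2 x.
Proof.
rewrite /Lop /opL scale0r subr0 -addrA mulmxDr mulmxN -addrA; congr (_ + _).
rewrite /m -mpotE /cplx map_mxB map_mxM map_mxB !map_scalar_mx -!/(cplx _) cplxJ.
by rewrite mulmxBl -mulmxA mulmxBl !mul_scalar_mx.
Qed.

Lemma lin_GH (g : l2) : A (GH g) (opT m 0 g).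
Proof.
exists (fun x => GH g x - g x); split.
- by apply/H2vP; exists (D1 g); exact: H2v_GH.
- by apply/inL2P; exact: hP.
- by apply: nearW => x; rewrite LopE (opT_E _ _ _ bm).
Qed.

Lemma lin_rep w v : A w v -> exists g : l2, [/\ VL2 w, VL2 v, aeeq w (GH g) & aeeq v (opT m 0 g)].
Proof.
move=> [w2 [/H2vP[w1 h] /inL2P Lv e]]; exists (l2of (fun x => w x - w2 x)); split => //.
- by have [] := H2v_VL2 h.
- exact: (H2v_rep h).1.
- have := opL_opT 0 bm h; apply: aeS2 e => x -> <-.
  by rewrite LopE.
Qed.

(** The lower bound is in terms of $w=Gg$ and not of $g$, so that it is exactly a bound for the
    resolvent. *)
Definition regular (z : C) := [/\ inj0 NH (opT m z), onto NH (opT m z) &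
  exists2 c, 0 < c & forall g, c * NH (GH g) <= NH (opT m z g)].

Lemma opT_sub z z' g : opT m (z + z') g = opT m z g - z' *: GH g.
Proof. exact: opM_shift. Qed.

Lemma opT0 z g : opT m z g = opT m 0 g - z *: GH g.
Proof. by rewrite -opT_sub add0r. Qed.

Lemma opT_lin z : lin (opT m z).
Proof. exact: opM_lin (bmxJ bm). Qed.

(** The term $Jg$, of the same norm as $g$, is a combination of [opT m z g] and bounded images of
    $Gg$. *)
Lemma opT_ker z g : NH (opT m z g) = 0 -> NH (GH g) = 0 -> NH g = 0.
Proof.
move=> h0 h1; rewrite -JH_nm.
have -> : JH g = opT m z g - (MH (fun x => m x - Jmx) (GH g) - z *: GH g).
  by rewrite /opT /opM -(addrA (JH g)) addrK.
apply: (sn_eq0 sn); apply: le_trans (snB sn _ _) _; rewrite h0 add0r.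
apply: le_trans (snB sn _ _) _; rewrite (snZ sn) h1 mulr0 addr0.
by apply: le_trans (MH_bdd (bmxJ bm) _) _; rewrite h1 mulr0.
Qed.

Lemma aeeq_sub z (g y : l2) : aeeq (fun x => opT m 0 g x - z *: GH g x) y <->
  NH (opT m z g - y) = 0.
Proof.
rewrite (opT0 z g); split=> [h|/NH_eqP]; last by rewrite hB hZ.
by apply/NH_eqP; rewrite hB hZ.
Qed.

Lemma regular_res z : regular z -> resolvent_set A z.
Proof.
move=> [inj ont [c c0 lb]]; split.
  move=> w v /lin_rep[g [Lw Lv ew ev]] e.
  have : NH (opT m z g - 0) = 0.
    apply/aeeq_sub; apply: aeS2 (aeS2 (fun x a b => conj a b) ew ev) e => x [<- <-] ->.
    by rewrite subrr h0.
  rewrite subr0 => /inj g0; apply: aeS2 ew (_ : aeeq (GH g) (fun=> 0)) => [x -> //|].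
  by apply/NH0P/(sn_eq0 sn); have := GH_bdd g; rewrite g0 mulr0.
exists c^-1 => y /inL2P Ly; have [g hg] := ont (l2of y).
exists (GH g), (opT m 0 g); split; first exact: lin_GH.
  by have /aeeq_sub := hg; rewrite hofK.
rewrite !L2normE//; last exact: hP.
rewrite -EFinM lee_fin -NHE mulrC ler_pdivlMr// mulrC.
by apply: le_trans (lb g) _; rewrite (sn_eq sn hg) NHE hofK.
Qed.

Lemma res_regular z : resolvent_set A z -> regular z.
Proof.
move=> [inj [c hc]].
have inj' : inj0 NH (opT m z).
  move=> g h; apply: (opT_ker h); apply/NH0P; apply: (inj _ _ (lin_GH g)).
  have : NH (opT m z g - 0) = 0 by rewrite subr0.
  by move/aeeq_sub; apply: aeS => x; rewrite h0 => /eqP; rewrite subr_eq0 => /eqP.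
have sol (y : l2) : exists2 g, NH (opT m z g - y) = 0 & NH (GH g) <= c * NH y.
  have [w [v [hA e le]]] := hc y (proj2 (inL2P _) (hP y)).
  have [g [Lw Lv ew ev]] := lin_rep hA; exists g.
    by apply/aeeq_sub; apply: aeS2 (aeS2 (fun x a b => conj a b) ew ev) e => x [<- <-].
  move: le; rewrite !L2normE//; last exact: hP.
  by rewrite -EFinM lee_fin !NHE (N2_ae Lw (hP _) ew).
split => //; first by move=> y; have [g] := sol y; exists g.
(* The constant in [resolvent_set] comes without a sign, so it is replaced by a positive one. *)
exists (`|c| + 1)^-1 => [|g]; first by rewrite invr_gt0 ltr_wpDl ?normr_ge0.
have [g' e le] := sol (opT m z g).
have e0 : NH (g' - g) = 0 by apply: inj'; rewrite (linB (opT_lin z)).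
have -> : NH (GH g) = NH (GH g').
  apply/esym/(sn_eq sn); rewrite -(linB (@GH_lin R)); apply: (sn_eq0 sn).
  by have := GH_bdd (g' - g); rewrite e0 mulr0.
rewrite mulrC ler_pdivrMr; last by rewrite ltr_wpDl ?normr_ge0.
apply: le_trans le _.
rewrite mulrC ler_wpM2l ?(sn_ge0 sn)//.
by apply: le_trans (ler_norm _) _; rewrite lerDl.
Qed.

End Resolvent.
End Link.

(** * Quadratic-form bounds for the potential, large imaginary parts, and the Fredholm results for
    one profile *)

Section Potential.
Variable R : realType.
Local Notation C := R[i].
Local Notation normc := (@Normc.normc R).
Local Notation mu := (@lebesgue_measure R).
Local Notation V := (R -> 'cV[C]_2).
Local Notation l2 := (l2 R).
Local Notation NH := (@NH R).
Local Notation rc := (real_complex R).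
Local Notation JH := (@JH R).
Local Notation GH := (@GH R).
Let sn := @NH_seminorm R.

Lemma rip_quad (M : 'M[R]_2) (p q : 'cV[C]_2) : rip (cplx M *m p) q =
  (M 0 0 * part true (p 0 0) + M 0 1 * part true (p 1 0)) * part true (q 0 0) +
  (M 0 0 * part false (p 0 0) + M 0 1 * part false (p 1 0)) * part false (q 0 0) +
  ((M 1 0 * part true (p 0 0) + M 1 1 * part true (p 1 0)) * part true (q 1 0) +
  (M 1 0 * part false (p 0 0) + M 1 1 * part false (p 1 0)) * part false (q 1 0)).
Proof.
have e b i : part b ((cplx M *m p) i 0) = M i 0 * part b (p 0 0) + M i 1 * part b (p 1 0).
  rewrite mxE big_ord_recl big_ord1 partD /cplx !mxE !part_real.
  by congr (M _ _ * part _ (p _ _) + M _ _ * part _ (p _ _)); exact: val_inj.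
by rewrite rip2 !e.
Qed.

Lemma quad_le (M : 'M[R]_2) c :
  (forall x y : R, M 0 0 * x ^+ 2 + (M 0 1 + M 1 0) * x * y + M 1 1 * y ^+ 2
     <= c * (x ^+ 2 + y ^+ 2)) ->
  forall p, rip (cplx M *m p) p <= c * rip p p.
Proof.
move=> h p; rewrite rip_quad rip2.
have := h (part true (p 0 0)) (part true (p 1 0)).
have := h (part false (p 0 0)) (part false (p 1 0)).
move: (part _ _) (part _ _) (part _ _) (part _ _) (M 0 0) (M 0 1) (M 1 0) (M 1 1).
move=> a b a' b' m00 m01 m10 m11; lra.
Qed.

Definition nice (u : R -> 'cV[R]_2) (M : R) :=
  (forall i, measurable_fun [set: R] (fun x => u x i 0)) /\
  forall x i, `|u x i 0| <= M.

Variables (zeta eps : R).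

(** The symmetric part of [mpot] is $-\varepsilon$ minus this matrix, whose eigenvalues are
    $\pm|a|^2$. Adding it back removes all growth. *)
Definition Smx (a : 'cV[R]_2) : 'M[R]_2 :=
  mx2 (2 * a 0 0 * a 1 0) (a 1 0 ^+ 2 - a 0 0 ^+ 2)
      (a 1 0 ^+ 2 - a 0 0 ^+ 2) (- 2 * a 0 0 * a 1 0).

Lemma abs_sqr_le (x M : R) : `|x| <= M -> 0 <= x ^+ 2 <= M ^+ 2.
Proof.
move=> h; rewrite sqr_ge0/= -(real_normK (num_real x)) ler_pXn2r// nnegrE//.
exact: le_trans h.
Qed.

Lemma abs_mul_le (x y M : R) : `|x| <= M -> `|y| <= M -> `|x * y| <= M ^+ 2.
Proof. by move=> h k; rewrite normrM expr2 ler_pM. Qed.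

Definition bigB (M : R) := `|zeta| + `|eps| + 4 * M ^+ 2.

Lemma mpot_le (a : 'cV[R]_2) (M : R) : (forall i, `|a i 0| <= M) -> forall i j, `|mpot zeta eps a i j| <= bigB M.
Proof.
move=> h; have := abs_sqr_le (h 0); have := abs_sqr_le (h 1); have := abs_mul_le (h 0) (h 1).
rewrite ler_norml /bigB => /andP[q1 q2] /andP[q3 q4] /andP[q5 q6].
have := ler_norm zeta; have := ler_norm (- zeta); rewrite normrN => z1 z2.
have := ler_norm eps; have := ler_norm (- eps); rewrite normrN => e1 e2.
move=> [[|[|//]] ?] [[|[|//]] ?]; rewrite mxE /= ler_norml; apply/andP; split; nra.
Qed.

Lemma Smx_le (a : 'cV[R]_2) (M : R) : (forall i, `|a i 0| <= M) -> forall i j, `|Smx a i j| <= 2 * M ^+ 2.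
Proof.
move=> h; have := abs_sqr_le (h 0); have := abs_sqr_le (h 1); have := abs_mul_le (h 0) (h 1).
rewrite ler_norml => /andP[q1 q2] /andP[q3 q4] /andP[q5 q6].
by move=> [[|[|//]] ?] [[|[|//]] ?]; rewrite mxE /= ler_norml; apply/andP; split; nra.
Qed.

Lemma mpot_bmx u M : nice u M -> bmx (fun x => mpot zeta eps (u x)) (bigB M).
Proof.
move=> [m h]; split; last by move=> x; exact: mpot_le.
have mZ c (f : R -> R) : measurable_fun [set: R] f -> measurable_fun [set: R] (fun x => c * f x).
  by move=> mf; apply: measurable_funM.
have ms i j : measurable_fun [set: R] (fun x => u x i 0 * u x j 0).
  by apply: measurable_funM.
move=> [[|[|//]] ?] [[|[|//]] ?]; under eq_fun do rewrite mxE /=;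
  rewrite /= ; repeat first [exact: measurable_cst | apply: measurable_funD | apply: measurable_funB
   | apply: measurable_funN | apply: measurable_funX | exact: m | apply: measurable_funM].
Qed.

Lemma Smx_bmx u M : nice u M -> bmx (fun x => Smx (u x)) (2 * M ^+ 2).
Proof.
move=> [m h]; split; last by move=> x; exact: Smx_le.
move=> [[|[|//]] ?] [[|[|//]] ?]; under eq_fun do rewrite mxE /=;
  rewrite /= ; repeat first [exact: measurable_cst | apply: measurable_funD | apply: measurable_funB
   | apply: measurable_funN | apply: measurable_funX | exact: m | apply: measurable_funM].
Qed.

Lemma mpot_quad a p : rip (cplx (mpot zeta eps a - Jmx) *m p) p <=
  (a 0 0 ^+ 2 + a 1 0 ^+ 2 - eps) * rip p p.
Proof.
apply: quad_le => x y; rewrite !mxE /=.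
(* This square is the quadratic form of $|a|^2+$ [Smx a]. *)
have := sqr_ge0 (x * (a 0 0 + a 1 0) + y * (a 1 0 - a 0 0)); lra.
Qed.

Lemma mpotS_quad a p : rip (cplx (mpot zeta eps a - Jmx + Smx a) *m p) p <= - eps * rip p p.
Proof. by apply: quad_le => x y; rewrite !mxE /=; lra. Qed.

Lemma GV_JV (w : V) : VL2 w -> GV (JV w) = JV (GV w).
Proof.
move=> h; apply/funext => x; apply/matrixP => i j; rewrite ord1 {j}.
have cE (z y : C) : part true z = part true y -> part false z = part false y -> z = y.
  by case: z => ? ?; case: y => ? ? /= -> ->.
have k b : cmp b (GV (JV w)) i x = cmp b (JV (GV w)) i x.
  rewrite cmp_GV !cmp_JV; case: (i == 0); first by rewrite cmp_GV.
  rewrite cmp_GV -mulN1r; apply: etrans (congr1 (fun f : R -> R => f x) (GZ (-1) (h b 0))).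
  by congr (G _ x); apply/funext => y; rewrite mulN1r.
by apply: cE; [exact: (k true)|exact: (k false)].
Qed.

Lemma IP_GV_ge0 (w : V) : VL2 w -> 0 <= IP w (GV w).
Proof.
move=> h; rewrite (IP_cmp h (VL2_GV h)); apply: sumr_ge0 => i _; rewrite !cmp_GV.
by rewrite addr_ge0//; apply: le_trans (G_pos (h _ _)); exact: ip_ge0.
Qed.

(** A multiplier for $s=\pm1$: it acts as $2is$ on the eigenspace $isJ=1$, which is the range of
    [Pv], and as $2$ on the eigenspace $isJ=-1$. On the first it turns $s\operatorname{Im}z$ into
    damping, on the second it keeps the damping $\varepsilon+\operatorname{Re}z$. *)
Definition Nv (s : R) (p : 'cV[C]_2) : 'cV[C]_2 := Complex 1 s *: (p - Jmx *m p).
Definition Pv (s : R) (p : 'cV[C]_2) : 'cV[C]_2 := p + Complex 0 s *: (Jmx *m p).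

Lemma J0 (p : 'cV[C]_2) : (Jmx *m p) 0 0 = p 1 0.
Proof. by rewrite -/(JV (fun=> p) 0) JV_comp mxE. Qed.

Lemma J1 (p : 'cV[C]_2) : (Jmx *m p) 1 0 = - p 0 0.
Proof. by rewrite -/(JV (fun=> p) 0) JV_comp mxE. Qed.

Lemma NvE (s : R) (p : 'cV[C]_2) b i : part b (Nv s p i 0) = if i == 0 then
   part b (Complex 1 s * (p 0 0 - p 1 0)) else part b (Complex 1 s * (p 1 0 + p 0 0)).
Proof.
rewrite /Nv mxE mxE [X in _ + X]mxE; case: i => [[|[|//]] hi] /=.
  by rewrite (_ : Ordinal hi = 0) ?J0//; exact: val_inj.
by rewrite (_ : Ordinal hi = 1) ?J1 ?opprK//; exact: val_inj.
Qed.

Lemma PvE (s : R) (p : 'cV[C]_2) b i : part b (Pv s p i 0) = if i == 0 then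
   part b (p 0 0 + Complex 0 s * p 1 0) else part b (p 1 0 - Complex 0 s * p 0 0).
Proof.
rewrite /Pv mxE [X in _ + X]mxE; case: i => [[|[|//]] hi] /=.
  by rewrite (_ : Ordinal hi = 0) ?J0//; exact: val_inj.
by rewrite (_ : Ordinal hi = 1) ?J1 ?mulrN//; exact: val_inj.
Qed.

(** On the range of [Pv], $J$ is $-is$ and the multiplier is $2is$, which leaves a negative form; on
    the other eigenspace $J$ is imaginary and the multiplier real, so the symmetrised pairing
    vanishes. *)
Lemma rip_JN (s : R) (p r : 'cV[C]_2) : s ^+ 2 = 1 ->
  rip (Jmx *m p) (Nv s r) + rip (Jmx *m r) (Nv s p) = - rip (Pv s p) (Pv s r).
Proof.
move=> s1; rewrite !rip2 !NvE !PvE /= !J0 !J1.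
case: (p 0 0) (p 1 0) (r 0 0) (r 1 0) => [a b] [c d] [a' b'] [c' d'] /=.
apply/eqP; rewrite -subr_eq0; apply/eqP.
transitivity ((s ^+ 2 - 1) * (b * b' + a * a' + c * c' + d * d')); first by ring.
by rewrite s1 subrr mul0r.
Qed.

(** As $G$ is symmetric and commutes with $J$, the pairing is half its symmetrisation, that is
    $-\frac12\langle Pg,GPg\rangle$, and $G$ is nonnegative. *)
Lemma IP_JN (s : R) (g : l2) : s ^+ 2 = 1 ->
  IP (JV g) (fun x => Nv s (GH g x)) <= 0.
Proof.
move=> s1; have Lg := hP g; have LG : VL2 (GV g) := VL2_GV Lg.
have LN (w : V) : VL2 w -> VL2 (fun x => Nv s (w x)).
  by move=> h; apply: VL2Z; apply: VL2B => //; exact: VL2_JV.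
have LP (w : V) : VL2 w -> VL2 (fun x => Pv s (w x)).
  by move=> h; apply: VL2D => //; apply: VL2Z; exact: VL2_JV.
have GN : (fun x => Nv s (GV g x)) = GV (fun x => Nv s (g x)).
  rewrite /Nv GVZ; last by apply: VL2B => //; exact: VL2_JV.
  have -> : (fun x => g x - Jmx *m g x) = (fun x => g x + (-1) *: JV g x).
    by apply/funext => x; rewrite scaleN1r.
  rewrite GVD//; last by apply: VL2Z; exact: VL2_JV.
  rewrite GVZ; last exact: VL2_JV.
  by rewrite GV_JV//; apply/funext => x; rewrite scaleN1r.
have GP : (fun x => Pv s (GV g x)) = GV (fun x => Pv s (g x)).
  rewrite /Pv GVD//; last by apply: VL2Z; exact: VL2_JV.
  rewrite (GVZ _ (VL2_JV Lg)); apply/funext => x; congr (_ + _ *: _).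
  by rewrite -/(JV _ x) -GV_JV.
have e : IP (JV g) (fun x => Nv s (GV g x)) = IP (JV (GV g)) (fun x => Nv s (g x)).
  by rewrite GN -GV_sym ?GV_JV//; [exact: VL2_JV|exact: LN].
have e2 : IP (JV g) (fun x => Nv s (GV g x)) + IP (JV (GV g)) (fun x => Nv s (g x)) =
    - IP (fun x => Pv s (g x)) (GV (fun x => Pv s (g x))).
  have i1 := rip_integ (VL2_JV Lg) (LN _ LG); have i2 := rip_integ (VL2_JV LG) (LN _ Lg).
  rewrite /IP -(intD i1 i2) -GP -intN; last exact: rip_integ (LP _ Lg) (LP _ LG).
  by apply: eq_int => x; exact: rip_JN.
have q := IP_GV_ge0 (LP _ Lg); rewrite GHE.
move: e e2 q; move: (IP _ _) (IP _ _) (IP _ _) => a b c -> e2 q; lra.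
Qed.

Lemma quad_young (k s X Y : R) : 0 < k -> `|s| * X * Y <= k * Y ^+ 2 + s ^+ 2 / (4 * k) * X ^+ 2.
Proof.
move=> k0; rewrite -[s ^+ 2]real_normK ?num_real//; set t := `|s|.
have -> : k * Y ^+ 2 + t ^+ 2 / (4 * k) * X ^+ 2 =
    t * X * Y + k * (Y - t * X / (2 * k)) ^+ 2 by field; rewrite gt_eqF.
by rewrite lerDl mulr_ge0 ?sqr_ge0// ltW.
Qed.

Lemma abs_combo (u v D E W s : R) : `|s| = 1 -> `|u| + `|v| <= W ->
  - ((u + v) * D + s * (u - v) * E) <= W * (`|D| + `|E|).
Proof.
move=> s1 hW; apply: le_trans (ler_norm _) _; rewrite normrN.
apply: le_trans (ler_normD _ _) _; rewrite !normrM s1 mul1r mulrDr.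
have h1 := ler_normD u v; have h2 := ler_normB u v.
by apply: lerD; rewrite ler_wpM2r//; apply: le_trans hW.
Qed.

Lemma abs_bilin (W k P1 P2 Q1 Q2 : R) : 0 <= W -> 0 < k ->
  W * (`|Q1 * P1 + Q2 * P2| + `|Q2 * P1 - Q1 * P2|) <=
  2 * k * (Q1 ^+ 2 + Q2 ^+ 2) + W ^+ 2 / (2 * k) * (P1 ^+ 2 + P2 ^+ 2).
Proof.
move=> W0 k0.
have h1 : `|Q1 * P1 + Q2 * P2| <= `|P1| * `|Q1| + `|P2| * `|Q2|.
  by apply: le_trans (ler_normD _ _) _; rewrite !normrM ![`|Q1| * _]mulrC ![`|Q2| * _]mulrC.
have h2 : `|Q2 * P1 - Q1 * P2| <= `|P1| * `|Q2| + `|P2| * `|Q1|.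
  by apply: le_trans (ler_normB _ _) _; rewrite !normrM ![`|Q1| * _]mulrC ![`|Q2| * _]mulrC.
have y X Y : W * (`|X| * `|Y|) <= k * Y ^+ 2 + W ^+ 2 / (4 * k) * X ^+ 2.
  have := quad_young W `|X| `|Y| k0; rewrite (ger0_norm W0) !real_normK ?num_real//.
  by move=> H; rewrite [leLHS]mulrA.
apply: le_trans (ler_wpM2l W0 (lerD h1 h2)) _.
have := y P1 Q1; have := y P2 Q2; have := y P1 Q2; have := y P2 Q1.
have -> : W ^+ 2 / (2 * k) = 2 * (W ^+ 2 / (4 * k)) by field; rewrite gt_eqF.
move: (W ^+ 2 / _) => Z; rewrite !mulrDr; lra.
Qed.

(* In the coordinates [P], [Q] of the two eigenspaces of [i J] the operator
   [J (- d^2 + c)] acts as [-+ i (- d^2 + c)], so that a large imaginary part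
   of the spectral parameter makes one of the two blocks invertible. *)
Lemma hf_point (a : 'cV[R]_2) (M s : R) (z : C) (p : 'cV[C]_2) : `|s| = 1 ->
  (forall i, `|a i 0| <= M) -> 0 < eps + complex.Re z ->
  1 + 4 * M ^+ 2 - zeta + 32 * M ^+ 4 / (eps + complex.Re z) + (eps + complex.Re z) / 2
    <= s * complex.Im z ->
  rip (cplx (mpot zeta eps a - Jmx) *m p - z *: p) (Nv s p)
    <= - (eps + complex.Re z) * rip p p.
Proof.
move=> s1 ha; case: z => x y /=; set al := eps + x => al0 hy.
rewrite ripBl rip_quad !rip2 !NvE !mxE /=.
case: (p 0 0) (p 1 0) => [x0 y0] [x1 y1] /=.
pose u := 2 * a 0 0 * a 1 0; pose v := a 1 0 ^+ 2 - a 0 0 ^+ 2.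
pose P1 := x0 - s * y1; pose P2 := y0 + s * x1.
pose Q1 := x0 + s * y1; pose Q2 := y0 - s * x1.
pose m2 := a 0 0 ^+ 2 + a 1 0 ^+ 2.
have ss : s = 1 \/ s = -1.
  by have := normr_ge0 s; case: (ger0P s) s1 => _ h _; [left|right]; lra.
have hPQ : 2 * (x0 ^+ 2 + y0 ^+ 2 + x1 ^+ 2 + y1 ^+ 2) = P1 ^+ 2 + P2 ^+ 2 + (Q1 ^+ 2 + Q2 ^+ 2).
  by rewrite /P1 /P2 /Q1 /Q2; case: ss => ->; ring.
have hm : 0 <= m2 <= 2 * M ^+ 2.
  have := abs_sqr_le (ha 0); have := abs_sqr_le (ha 1); rewrite /m2; lra.
have hW : `|u| + `|v| <= 4 * M ^+ 2.
  have h := abs_mul_le (ha 0) (ha 1).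
  have hu : `|u| <= 2 * M ^+ 2 by rewrite /u -mulrA normrM normr_nat ler_wpM2l.
  have : `|v| <= 2 * M ^+ 2.
    have := abs_sqr_le (ha 0); have := abs_sqr_le (ha 1).
    by rewrite /v ler_norml => /andP[? ?] /andP[? ?]; apply/andP; split; lra.
  lra.
have W0 : 0 <= 4 * M ^+ 2 by rewrite mulr_ge0// sqr_ge0.
(* Weight for Young's inequality: the coupling of the two blocks then uses up half of the damping
   [al] of the block [Q], and the rest falls on the block [P]. *)
have k0 : 0 < al / 4 by rewrite divr_gt0.
have B1 := abs_combo (Q1 * P1 + Q2 * P2) (Q2 * P1 - Q1 * P2) s1 hW.
have B2 := abs_bilin P1 P2 Q1 Q2 W0 k0.
have id : forall F, F = - (s * y + zeta - 2 * m2 - 1) * (P1 ^+ 2 + P2 ^+ 2)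
      - al * (Q1 ^+ 2 + Q2 ^+ 2)
      - ((u + v) * (Q1 * P1 + Q2 * P2) + s * (u - v) * (Q2 * P1 - Q1 * P2)) ->
   F <= - al * (x0 * x0 + y0 * y0 + (x1 * x1 + y1 * y1)).
  move=> F ->.
  have e1 : (4 * M ^+ 2) ^+ 2 / (2 * (al / 4)) = 32 * M ^+ 4 / al by field; rewrite gt_eqF.
  rewrite e1 in B2; move: hy B2; move: (32 * _ / al) => Z hy B2.
  have P0 : 0 <= P1 ^+ 2 + P2 ^+ 2 by rewrite addr_ge0 ?sqr_ge0.
  have c : 0 <= s * y + zeta - 2 * m2 - 1 - Z - al / 2 by lra.
  have := mulr_ge0 c P0; move: B1 B2 hPQ.
  move: (P1 ^+ 2 + P2 ^+ 2) (Q1 ^+ 2 + Q2 ^+ 2) (_ * (_ + `|_ - _|)) => PP QQ XX.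
  move: (- (_ + _)) => YY; nra.
apply: id; rewrite /al /P1 /P2 /Q1 /Q2 /u /v /m2; case: ss => ->; ring.
Qed.

(** Pairing the equation with the multiplier applied to $w$: by [IP_JN] the principal part has the
    good sign, and [hf_point] bounds the rest by $-(\varepsilon+\operatorname{Re}z)\|w\|^2$, so
    $w=0$. *)
Lemma hf_inj u M s z : `|s| = 1 -> nice u M -> 0 < eps + complex.Re z ->
  1 + 4 * M ^+ 2 - zeta + 32 * M ^+ 4 / (eps + complex.Re z) + (eps + complex.Re z) / 2
    <= s * complex.Im z ->
  inj0 NH (opT (fun x => mpot zeta eps (u x)) z).
Proof.
move=> s1 nu al0 hy g; pose m x := mpot zeta eps (u x); rewrite -/m => hg.
have bm : bmx m (bigB M) := mpot_bmx nu.
apply: (opT_ker bm hg).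
have ss : s ^+ 2 = 1 by rewrite -real_normK ?num_real// s1 expr1n.
set w := GH g; have Lw : VL2 w := hP _.
have LN : VL2 (fun x => Nv s (w x)).
  by apply: VL2Z; apply: VL2B => //; exact: VL2_JV.
have e0 : IP (opT m z g) (fun x => Nv s (w x)) = 0.
  apply/eqP; rewrite -normr_le0; apply: le_trans (IP_CS (hP _) LN) _.
  by rewrite -NHE hg mul0r.
pose Z : V := fun x => cplx (m x - Jmx) *m w x - z *: w x.
have LZ : VL2 Z by apply: VL2B; [exact: VL2_mulV (bmxJ bm) _|exact: VL2Z].
have e1 : IP (opT m z g) (fun x => Nv s (w x)) =
    IP (JV (g : l2)) (fun x => Nv s (w x)) + IP Z (fun x => Nv s (w x)).
  rewrite -IPDl; [|exact: VL2_JV (hP _)|exact: LZ|exact: LN].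
  apply: eq_int => x; congr (rip _ _).
  by rewrite /opT /opM hB hD hZ JHE (MHE _ (bmxJ bm)) /Z /mulV addrA.
have q1 := IP_JN g ss.
have q2 : IP Z (fun x => Nv s (w x)) <= - (eps + complex.Re z) * IP w w.
  rewrite {2}/IP -intZ; last exact: rip_integ.
  apply: int_le => [||x]; [exact: rip_integ|by apply: integZ; exact: rip_integ|].
  by apply: (@hf_point (u x) M s z _ s1) => // i; exact: nu.2.
have q3 := IP_ge0 w.
apply: (sn_eq0 sn); rewrite NHE -(@ler_pXn2r _ 2)// ?nnegrE ?N2_ge0// N2_sqr expr0n/=.
rewrite -(pmulr_rle0 _ al0); move: q1 q2; rewrite -/w.
move: e0; rewrite e1; move: (IP _ _) (IP _ _) (IP _ _) => A B D; lra.
Qed.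

Section Spectral.
Variables (u : R -> 'cV[R]_2) (M a g : R).
Hypotheses (nu : nice u M) (a0 : 0 < a) (g0 : 0 < g) (ge : g <= eps).
Hypothesis far : forall x, a < `|x| -> u x 0 0 ^+ 2 + u x 1 0 ^+ 2 <= eps - g.

Let m (x : R) : 'M[R]_2 := mpot zeta eps (u x).
Let ind (x : R) : R := (`|x| <= a)%R%:R.
Let mB (x : R) : 'M[R]_2 := - (ind x *: Smx (u x)).
(** On $|x|\le a$ the growth is removed by [Smx]; beyond, $|u|^2\le\varepsilon-g$ suffices. So this
    potential is dissipative with rate $g$ everywhere, and the difference [mB] has compact
    support. *)
Let mD (x : R) : 'M[R]_2 := (m x - Jmx) + ind x *: Smx (u x).
Let B := bigB M + 1 + 2 * M ^+ 2.

Let M0 : 0 <= M ^+ 2. Proof. exact: sqr_ge0. Qed.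

Let bS : bmx (fun x => ind x *: Smx (u x)) (2 * M ^+ 2).
Proof.
have [ms hs] := Smx_bmx nu; split=> [i j|x i j].
  under eq_fun do rewrite mxE; apply: measurable_funM => //.
  rewrite (_ : ind = \1_(`[- a, a] : set R)); first exact: measurable_indic.
  by apply/funext => x; rewrite indicE mem_setE in_itv/= -ler_norml.
rewrite mxE /ind; case: (`|x| <= a); first by rewrite mul1r.
by rewrite mul0r normr0 mulr_ge0.
Qed.

Let bA : bmx (fun x => m x - Jmx) B.
Proof.
have [ms hs] := bmxJ (mpot_bmx nu); split=> // x i j.
by apply: le_trans (hs x i j) _; rewrite /B lerDl mulr_ge0.
Qed.

Let bD : bmx mD B.
Proof.
have [ms hs] := bS; have [ms' hs'] := bmxJ (mpot_bmx nu); split=> [i j|x i j].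
  under eq_fun do rewrite mxE; exact: measurable_funD.
by rewrite mxE; apply: le_trans (ler_normD _ _) _; apply: lerD; [exact: hs'|exact: hs].
Qed.

Let bB : bmx mB B.
Proof.
have [ms hs] := bS; split=> [i j|x i j].
  under eq_fun do rewrite mxE; exact: measurable_funN.
rewrite mxE normrN; apply: le_trans (hs x i j) _; rewrite /B lerDr addr_ge0//.
by rewrite /bigB !addr_ge0// mulr_ge0.
Qed.

Let supp x : a < `|x| -> mB x = 0.
Proof. by move=> h; rewrite /mB /ind leNgt h scale0r oppr0. Qed.

Let mE x : m x - Jmx = mD x + mB x.
Proof. by rewrite /mD /mB addrK. Qed.

Let diss x p : rip (cplx (mD x) *m p) p <= - g * rip p p.
Proof.
have p0 := rip_ge0 p; rewrite /mD /ind; case: (leP `|x| a) => h.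
  by rewrite scale1r; apply: le_trans (mpotS_quad _ _) _; rewrite ler_wpM2r// lerN2.
rewrite scale0r addr0; apply: le_trans (mpot_quad _ _) _; rewrite ler_wpM2r//.
have := far h; lra.
Qed.

Let big x p : rip (cplx (m x - Jmx) *m p) p <= 2 * M ^+ 2 * rip p p.
Proof.
have p0 := rip_ge0 p; apply: le_trans (mpot_quad _ _) _; rewrite ler_wpM2r//.
have e0 := lt_le_trans g0 ge.
have /andP[_ h0] := abs_sqr_le (nu.2 x 0); have /andP[_ h1] := abs_sqr_le (nu.2 x 1).
move: (u x 0 0 ^+ 2) (u x 1 0 ^+ 2) (M ^+ 2) h0 h1 e0; move=> X Y Z; lra.
Qed.

Lemma inj_regular z : - g < complex.Re z -> inj0 NH (opT m z) -> regular zeta eps u z.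
Proof.
move=> hz inj; have [ont [c c0 bl]] := fred_reg bA bD bB a0 supp mE diss hz inj.
split => //; exists c => // y; apply: le_trans (bl y).
by rewrite ler_wpM2l ?(ltW c0)//; have := GH_bdd y; rewrite mul1r.
Qed.

Lemma inj_punctured z0 : - g < complex.Re z0 -> exists2 rho, 0 < rho &
  forall z, 0 < normc (z - z0) < rho -> inj0 NH (opT m z).
Proof. exact: (fred_punctured bA bD bB a0 supp mE diss big). Qed.

Lemma inj_right z : 2 * M ^+ 2 < complex.Re z -> inj0 NH (opT m z).
Proof. exact: (fred_right bA bB big). Qed.

End Spectral.
End Potential.

(** * Wide smooth cutoffs and their commutators with the operator *)

Section Cutoff.
Variable R : realType.
Local Notation C := R[i].
Local Notation normc := (@Normc.normc R).
Local Notation mu := (@lebesgue_measure R).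
Local Notation V := (R -> 'cV[C]_2).
Local Notation l2 := (l2 R).
Local Notation NH := (@NH R).
Local Notation rc := (real_complex R).
Local Notation JH := (@JH R).
Local Notation GH := (@GH R).
Let sn := @NH_seminorm R.
Implicit Types (chi : R -> R) (w v : V) (m : R -> 'M[R]_2).

Definition cutoff chi chi1 chi2 (B d : R) := [/\ (forall x : R, is_derive x 1 chi (chi1 x)),
  (forall x : R, is_derive x 1 chi1 (chi2 x)), continuous chi2 &
  forall x, [/\ `|chi x| <= B, `|chi1 x| <= d & `|chi2 x| <= d]].

Lemma cutoff_cst (c B : R) : `|c| <= B -> cutoff (fun=> c) (fun=> 0) (fun=> 0) B 0.
Proof.
move=> h; split=> [x|x||x]; [exact: der_cst|exact: der_cst|exact: cont_cst|].
by rewrite normr0.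
Qed.

Lemma cutoffB chi chi1 chi2 B d chi' chi1' chi2' B' d' :
  cutoff chi chi1 chi2 B d -> cutoff chi' chi1' chi2' B' d' ->
  cutoff (fun x => chi x - chi' x) (fun x => chi1 x - chi1' x) (fun x => chi2 x - chi2' x)
    (B + B') (d + d').
Proof.
move=> [h1 h2 h3 h4] [k1 k2 k3 k4]; split=> [x|x||x]; [exact: derB|exact: derB|exact: contB|].
have [? ? ?] := h4 x; have [? ? ?] := k4 x.
by split; apply: le_trans (ler_normB _ _) _; apply: lerD.
Qed.

(** A rational profile in place of a compactly supported one: its derivatives are explicit, of size
    at most $10/X$, and it vanishes nowhere, so that multiplication by it annihilates only the zero
    function. *)
Definition bell (X c x : R) := (1 + ((x - c) / X) ^+ 2)^-1.
Definition bell1 (X c x : R) := - (2 / X) * ((x - c) / X) * (bell X c x * bell X c x).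
Definition bell2 (X c x : R) := - (2 / X ^+ 2) * (bell X c x * bell X c x) +
  (8 / X ^+ 2) * (((x - c) / X) * ((x - c) / X) * (bell X c x * bell X c x * bell X c x)).

Lemma bell_itv (X c x : R) : 0 < bell X c x <= 1.
Proof.
have h : 0 < 1 + ((x - c) / X) ^+ 2 by rewrite ltr_wpDr// sqr_ge0.
by rewrite invr_gt0 h invf_le1// lerDl sqr_ge0.
Qed.

Lemma bell_der (X c x : R) : is_derive x 1 (bell X c) (bell1 X c x).
Proof.
have d1 : is_derive x 1 (fun y : R => (y - c) / X) (1 / X).
  apply: (is_derive_eq (derM (derB (der_id x) (der_cst c x)) (der_cst X^-1 x))).
  by rewrite subr0 mulr0 addr0.
pose f (y : R) : R := 1 + (y - c) / X * ((y - c) / X).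
have h : f x != 0 by rewrite /f gt_eqF// ltr_wpDr// -expr2 sqr_ge0.
have dF : is_derive x 1 f _ := derD (der_cst 1 x) (derM d1 d1).
have := is_deriveV h dF.
have -> : (fun y => (f y)^-1) = bell X c.
  by apply/funext => y; rewrite /bell /f expr2.
move=> H; apply: (is_derive_eq H).
rewrite -exprVn /bell1 /bell /f expr2 [(_ / X) ^+ 2]expr2.
move: ((1 + _)^-1) => k.
apply: (@etrans R _ (- (k * k) * (0 + (1 / X * ((x - c) / X) + (x - c) / X * (1 / X))))) => //.
ring.
Qed.

Lemma bell1_der (X c x : R) : is_derive x 1 (bell1 X c) (bell2 X c x).
Proof.
have d1 : is_derive x 1 (fun y : R => (y - c) / X) (1 / X).
  apply: (is_derive_eq (derM (derB (der_id x) (der_cst c x)) (der_cst X^-1 x))).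
  by rewrite subr0 mulr0 addr0.
have b := bell_der X c x.
apply: (is_derive_eq (derM (derM (der_cst _ x) d1) (derM b b))).
rewrite /bell1 /bell2 -[(X ^+ 2)^-1]exprVn; move: (bell X c x) (X^-1) => k Y; ring.
Qed.

Lemma bell_cont (X c : R) : continuous (bell X c).
Proof. by apply: der_continuous => x; exists (bell1 X c x); exact: bell_der. Qed.

Lemma bell2_cont (X c : R) : continuous (bell2 X c).
Proof.
have cb : continuous (bell X c) by exact: bell_cont.
have cl : continuous (fun y : R => (y - c) / X).
  by apply: contM; [apply: contB; [exact: cont_id|exact: cont_cst]|exact: cont_cst].
apply: contD.
  apply: contM; [exact: cont_cst|exact: contM].
apply: contM; [exact: cont_cst|apply: contM; [exact: contM|]].
by apply: contM => //; exact: contM.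
Qed.

Lemma bell_cutoff (X c : R) : 1 <= X -> cutoff (bell X c) (bell1 X c) (bell2 X c) 1 (10 / X).
Proof.
move=> X1; split=> [x|x||x]; [exact: bell_der|exact: bell1_der|exact: bell2_cont|].
have /andP[k0 k1] := bell_itv X c x.
have X0 : 0 < X by lra.
have i0 : 0 < X^-1 by rewrite invr_gt0.
have i1 : X^-1 <= 1 by rewrite invf_le1.
rewrite /bell1 /bell2 -[(X ^+ 2)^-1]exprVn.
have kt : bell X c x * (1 + ((x - c) / X) ^+ 2) = 1.
  by rewrite mulVf// gt_eqF// ltr_wpDr// sqr_ge0.
move: kt k0 k1; move: (bell X c x) => k; move: ((x - c) / X) => t.
move: (X^-1) i0 i1 => s s0 s1 kt k0 k1.
have h1 : k * t ^+ 2 = 1 - k by move: kt; rewrite mulrDr mulr1; lra.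
have h2 : `|t * k| <= 1.
  rewrite -(@ler_pXn2r _ 2)// ?nnegrE// real_normK ?num_real// expr1n.
  have -> : (t * k) ^+ 2 = k * (k * t ^+ 2) :> R by ring.
  rewrite h1; nra.
have kk : `|k| <= 1 by rewrite ger0_norm// ltW.
split => //.
  have -> : - (2 * s) * t * (k * k) = - (2 * s * (t * k) * k) :> R by ring.
  have q : `|t * k| * `|k| <= 1 by exact: mulr_ile1.
  rewrite normrN -[2 * s * _ * k]mulrA normrM [X in _ * X]normrM.
  rewrite ger0_norm ?mulr_ge0 ?(ltW s0)//.
  have := ler_wpM2l (ltW s0) q; lra.
have -> : - (2 * s ^+ 2) * (k * k) + 8 * s ^+ 2 * (t * t * (k * k * k)) =
  s ^+ 2 * (k ^+ 2 * (8 * (k * t ^+ 2) - 2)) :> R by ring.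
rewrite h1 normrM ger0_norm ?sqr_ge0//.
have -> : 10 * s = s * 10 by ring.
have q : `|k ^+ 2 * (8 * (1 - k) - 2)| <= 10.
  rewrite normrM (ger0_norm (sqr_ge0 _)).
  have : `|8 * (1 - k) - 2| <= 10 by rewrite ler_norml; apply/andP; split; lra.
  have : k ^+ 2 <= 1 by rewrite expr_le1// ltW.
  have := sqr_ge0 k; have := normr_ge0 (8 * (1 - k) - 2); nra.
have : s ^+ 2 <= s by rewrite expr2 ler_piMl// ltW.
have := sqr_ge0 s; have := normr_ge0 (k ^+ 2 * (8 * (1 - k) - 2)); nra.
Qed.

Definition smul chi w : V := fun x => rc (chi x) *: w x.

Lemma cmp_smul chi w b i : cmp b (smul chi w) i = (fun x => chi x * cmp b w i x).
Proof. by apply/funext => x; rewrite /cmp mxE part_real. Qed.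

Lemma VL2_smul chi w (B : R) : measurable_fun [set: R] chi -> (forall x, `|chi x| <= B) ->
  VL2 w -> VL2 (smul chi w).
Proof. by move=> mc h hw b i; rewrite cmp_smul; exact: L2_bounded_mul mc h (hw _ _). Qed.

Lemma N2_smul chi w (B : R) : measurable_fun [set: R] chi -> (forall x, `|chi x| <= B) ->
  VL2 w -> N2 (smul chi w) <= B * N2 w.
Proof.
move=> mc h hw; have B0 := le_trans (normr_ge0 _) (h 0).
have -> : B * N2 w = N2 (fun x => rc B *: w x) by rewrite N2Z// normc_real ger0_norm.
apply: N2_le => [||x]; [exact: VL2_smul mc h hw|exact: VL2Z|].
rewrite /smul !ripZ !normc_real ler_wpM2r ?rip_ge0// ler_pXn2r ?nnegrE//.
by rewrite (ger0_norm B0).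
Qed.

Lemma cut_H2v chi chi1 chi2 B d w w1 w2 : cutoff chi chi1 chi2 B d -> H2v w w1 w2 ->
  H2v (smul chi w) (fun x => smul chi1 w x + smul chi w1 x)
      (fun x => (smul chi2 w x + smul chi1 w1 x) + (smul chi1 w1 x + smul chi w2 x)).
Proof.
move=> [h1 h2 h3 h4] h b i; have [K0 K1 K2 d0 d1] := h b i.
rewrite !cmpD !cmp_smul.
have c1 : continuous chi1 by apply: der_continuous => x; exists (chi2 x).
have c0 : continuous chi by apply: der_continuous => x; exists (chi1 x).
have mc (f : R -> R) : continuous f -> measurable_fun [set: R] f.
  by move=> /continuous_measurable_fun.
have bb (f : R -> R) D g : continuous f -> (forall x, `|f x| <= D) -> L2 g ->
    L2 (fun x => f x * g x).
  by move=> cf hf hg; apply: L2_bounded_mul hf hg; exact: mc.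
have b0 x : `|chi x| <= B by case: (h4 x).
have b1 x : `|chi1 x| <= d by case: (h4 x).
have b2 x : `|chi2 x| <= d by case: (h4 x).
have m0 x : `|chi x| <= Num.max B d by rewrite le_max b0.
have m1 x : `|chi1 x| <= Num.max B d by rewrite le_max b1 orbT.
split.
- exact: bb c0 b0 K0.
- by apply: L2D; [exact: bb c1 b1 K0|exact: bb c0 b0 K1].
- apply: L2D; apply: L2D; [exact: bb h3 b2 K0|exact: bb c1 b1 K1|exact: bb c1 b1 K1|exact: bb c0 b0 K2].
- exact: wd_mul h1 c1 m0 m1 K0 K1 d0.
- apply: wdD.
  + exact: bb c1 b1 K0.
  + by apply: L2D; [exact: bb h3 b2 K0|exact: bb c1 b1 K1].
  + exact: bb c0 b0 K1.
  + by apply: L2D; [exact: bb c1 b1 K1|exact: bb c0 b0 K2].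
  + exact: wd_mul h2 h3 b1 b2 K0 K1 d0.
  + exact: wd_mul h1 c1 m0 m1 K1 K2 d1.
Qed.

Lemma N2N w : VL2 w -> N2 (fun x => - w x) = N2 w.
Proof.
move=> h; have -> : (fun x => - w x) = (fun x => (-1) *: w x).
  by apply/funext => x; rewrite scaleN1r.
by rewrite N2Z// normcN Normc.normc1 mul1r.
Qed.

(** Commuting the cutoff with $-J\partial_x^2$ costs $-J(\chi''w+2\chi'w')$, and changing the
    potential costs $\chi(m'-m)w$, assumed small where the cutoff matters. *)
Lemma cut_opL chi chi1 chi2 (B d e : R) m m' (Bm Bm' : R) z w w1 w2 :
  cutoff chi chi1 chi2 B d -> H2v w w1 w2 -> bmx m Bm -> bmx m' Bm' ->
  (forall x i j, `|chi x * (m' x i j - m x i j)| <= e) ->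
  N2 (opL m' z (smul chi w) (fun x => (smul chi2 w x + smul chi1 w1 x) +
                                      (smul chi1 w1 x + smul chi w2 x)))
  <= B * N2 (opL m z w w2) + (d + 2 * e) * N2 w + 2 * d * N2 w1.
Proof.
move=> cut h bm bm' he; have [h1 h2 h3 h4] := cut; have [L0 L1 L2] := H2v_VL2 h.
have c1 : continuous chi1 by apply: der_continuous => x; exists (chi2 x).
have c0 : continuous chi by apply: der_continuous => x; exists (chi1 x).
have mc (f : R -> R) : continuous f -> measurable_fun [set: R] f.
  by move=> /continuous_measurable_fun.
have b0 x : `|chi x| <= B by case: (h4 x).
have b1 x : `|chi1 x| <= d by case: (h4 x).
have b2 x : `|chi2 x| <= d by case: (h4 x).
pose E := fun x => chi x *: (m' x - m x).
have bE : bmx E e.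
  split=> [i j|x i j]; last by rewrite !mxE; exact: he.
  under eq_fun do rewrite !mxE; apply: measurable_funM; first exact: mc.
  by apply: measurable_funB; [exact: bm'.1|exact: bm.1].
have LO := VL2_opL z bm h.
pose a := smul chi (opL m z w w2).
pose bb := JV (smul chi2 w); pose cc := JV (smul chi1 w1); pose dd := mulV E w.
have La : VL2 a := VL2_smul (mc _ c0) b0 LO.
have Lb : VL2 (smul chi2 w) := VL2_smul (mc _ h3) b2 L0.
have Lc : VL2 (smul chi1 w1) := VL2_smul (mc _ c1) b1 L1.
have Ld : VL2 dd := VL2_mulV bE L0.
have -> : opL m' z (smul chi w) (fun x => (smul chi2 w x + smul chi1 w1 x) +
     (smul chi1 w1 x + smul chi w2 x)) = (fun x => (a x + dd x) + - (bb x + (cc x + cc x))).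
  apply/funext => x; rewrite /opL /a /bb /cc /dd /JV /mulV /smul /E /opL.
  have -> : cplx (chi x *: (m' x - m x)) = rc (chi x) *: (cplx (m' x) - cplx (m x)).
    by rewrite /cplx map_mxZ map_mxB.
  rewrite !mulmxDr -!scalemxAr -!scalemxAl mulmxBl.
  move: (rc (chi x)) (rc (chi1 x)) (rc (chi2 x)) (w x) (Jmx *m w x) (Jmx *m w1 x)
    (Jmx *m w2 x) (cplx (m x) *m w x) (cplx (m' x) *m w x) => k k1 k2 p0 p1 p2 p3 p4 p5.
  apply/matrixP => i j; rewrite !mxE; move: (p0 i j) (p1 i j) (p2 i j) (p3 i j) (p4 i j) (p5 i j).
  by move=> *; ring.
apply: le_trans (N2D _ _) _; [exact: VL2D|apply: VL2N; apply: VL2D; [exact: VL2_JV|apply: VL2D; exact: VL2_JV]|].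
have n1 : N2 (fun x => a x + dd x) <= B * N2 (opL m z w w2) + 2 * e * N2 w.
  apply: le_trans (N2D La Ld) _; apply: lerD; first exact: N2_smul (mc _ c0) b0 LO.
  exact: N2_mulV.
have n2 : N2 (fun x => - (bb x + (cc x + cc x))) <= d * N2 w + 2 * d * N2 w1.
  rewrite N2N; last by apply: VL2D; [exact: VL2_JV|apply: VL2D; exact: VL2_JV].
  apply: le_trans (N2D (VL2_JV Lb) (VL2D (VL2_JV Lc) (VL2_JV Lc))) _; rewrite N2_JV.
  have q1 := N2_smul (mc _ h3) b2 L0; have q2 := N2_smul (mc _ c1) b1 L1.
  have := N2D (VL2_JV Lc) (VL2_JV Lc); rewrite !N2_JV => q3.
  apply: lerD; first exact: q1.
  apply: le_trans q3 _; rewrite -mulrA mulr_natl mulr2n; apply: lerD; exact: q2.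
apply: le_trans (lerD n1 n2) _; rewrite [(d + _) * _]mulrDl -!addrA.
by rewrite lerD2l [leLHS]addrCA.
Qed.

(** A lower bound stated on $H^2$ and not in the variable $g$, because cutoffs and translations act
    on $w$; [LB_l2] translates. *)
Definition LB m z (c : R) := forall w w1 w2, H2v w w1 w2 -> c * N2 w <= N2 (opL m z w w2).

Lemma LB_l2 m (B : R) z c : bmx m B -> LB m z c <->
  forall g : l2, c * NH (GH g) <= NH (opT m z g).
Proof.
move=> bm; split=> [h g|h w w1 w2 hw]; last first.
  by have [-> ->] := N2_opL z bm hw; exact: h.
have := h _ _ _ (H2v_GH g); rewrite !NHE => q; apply: le_trans q _; rewrite le_eqVlt; apply/orP; left.
by apply/eqP; congr N2; apply/funext => x; rewrite (opT_E _ _ _ bm).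
Qed.

Lemma H2v_shift w w1 w2 (d : R) : H2v w w1 w2 ->
  H2v (fun x => w (x + d)) (fun x => w1 (x + d)) (fun x => w2 (x + d)).
Proof.
move=> h b i; have [L0 L1 L2 d0 d1] := h b i.
have sL := mpres_L2 (@shift_measurable R d) (@shift_oc R d).
by split; [exact: sL L0|exact: sL L1|exact: sL L2|exact: wd_shift L0 L1 d0|exact: wd_shift L1 L2 d1].
Qed.

Lemma N2_shift w (d : R) : VL2 w -> N2 (fun x => w (x + d)) = N2 w.
Proof.
move=> h; rewrite /N2; congr Num.sqrt.
exact: (mpres_int (@shift_measurable R d) (@shift_oc R d)) (integ_measurable (rip_integ h h)).
Qed.

Lemma LB_shift m (B : R) z c d : bmx m B -> LB m z c -> LB (fun x => m (x - d)) z c.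
Proof.
move=> bm h w w1 w2 hw; have q := h _ _ _ (H2v_shift d hw).
have [L0 _ _] := H2v_VL2 hw; have e1 := N2_shift d L0.
have bm' : bmx (fun x => m (x - d)) B.
  by split=> [i j|x]; [exact: measurableT_comp (bm.1 i j) (shift_measurable _)|exact: bm.2].
have e2 := N2_shift d (VL2_opL z bm' hw).
have e3 : (fun x => opL (fun x => m (x - d)) z w w2 (x + d)) =
    opL m z (fun x => w (x + d)) (fun x => w2 (x + d)).
  by apply/funext => x; rewrite /opL addrK.
rewrite e3 in e2; move: e1 e2 q; move: (N2 _) (N2 w) (N2 _) (N2 _) => a b c' d'.
by move=> -> ->.
Qed.

(** The representation $w=G(w-w'')$ gives $\|w'\|\le2\|w-w''\|$, and $w''$ is read off from the
    operator since $J$ is an isometry. *)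
Lemma N2_deriv m (B : R) z w w1 w2 : bmx m B -> H2v w w1 w2 ->
  N2 w1 <= 2 * (N2 (opL m z w w2) + (1 + 2 * B + normc z) * N2 w).
Proof.
move=> bm h; have [L0 L1 L2] := H2v_VL2 h; have [_ e1] := H2v_rep h.
have LO := VL2_opL z bm h.
set g := l2of _ in e1; have gE : g = (fun x => w x - w2 x) :> V by apply: hofK; exact: VL2B.
rewrite (N2_ae L1 _ e1); last by case: (H2v_VL2 (H2v_GH g)).
apply: le_trans (D1_nm g) _; rewrite NHE gE ler_wpM2l//.
have q1 := N2D L0 (VL2N L2); rewrite N2N// in q1; apply: le_trans q1 _.
have Lm := VL2_mulV bm L0.
have : N2 w2 <= N2 (opL m z w w2) + (2 * B * N2 w + normc z * N2 w).
  rewrite -N2_JV -N2N; last exact: VL2_JV.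
  have -> : (fun x => - JV w2 x) =
      (fun x => opL m z w w2 x + (- mulV m w x + z *: w x)).
    apply/funext => x; rewrite /opL /JV /mulV.
    move: (Jmx *m w2 x) (cplx (m x) *m w x) (z *: w x) => p q r.
    by apply/matrixP => i j; rewrite !mxE; ring.
  apply: le_trans (N2D LO (VL2D (VL2N Lm) (VL2Z z L0))) _; rewrite lerD2l.
  apply: le_trans (N2D (VL2N Lm) (VL2Z z L0)) _; rewrite N2N// N2Z// lerD2r.
  exact: N2_mulV.
by move: (N2 (opL _ _ _ _)) (N2 w2) (N2 w) => p q r; lra.
Qed.

End Cutoff.

(** * Gluing lower bounds, approximate eigenfunctions, and uniformity on discs *)

Section Localization.
Variable R : realType.
Local Notation C := R[i].
Local Notation normc := (@Normc.normc R).
Local Notation V := (R -> 'cV[C]_2).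
Local Notation l2 := (l2 R).
Local Notation NH := (@NH R).
Local Notation rc := (real_complex R).
Local Notation GH := (@GH R).
Let sn := @NH_seminorm R.
Implicit Types (w v : V) (m : R -> 'M[R]_2).

Lemma cutoff_rest (I : Type) (s : seq I) (chi chi1 chi2 : I -> R -> R) (d : R) :
  (forall j, cutoff (chi j) (chi1 j) (chi2 j) 1 d) ->
  cutoff (fun x => 1 - \sum_(j <- s) chi j x) (fun x => - \sum_(j <- s) chi1 j x)
    (fun x => - \sum_(j <- s) chi2 j x) (1 + (size s)%:R) ((size s)%:R * d).
Proof.
move=> h; elim: s => [|j s ih].
  rewrite mul0r addr0.
  have -> : (fun x : R => 1 - \sum_(j <- [::]) chi j x) = (fun=> 1).
    by apply/funext => x; rewrite big_nil subr0.
  have e (g : I -> R -> R) : (fun x : R => - \sum_(j <- [::]) g j x) = (fun=> 0).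
    by apply/funext => x; rewrite big_nil oppr0.
  by rewrite !e; apply: cutoff_cst; rewrite normr1.
have e (f : R) (g : I -> R -> R) x : f - \sum_(k <- j :: s) g k x = f - \sum_(k <- s) g k x - g j x.
  by rewrite big_cons opprD addrA addrAC.
have := cutoffB ih (h j).
have -> : (fun x => 1 - \sum_(k <- s) chi k x - chi j x) =
  (fun x => 1 - \sum_(k <- j :: s) chi k x) by apply/funext => x; rewrite e.
have -> : (fun x => - \sum_(k <- s) chi1 k x - chi1 j x) =
  (fun x => - \sum_(k <- j :: s) chi1 k x) by apply/funext => x; rewrite -[RHS]add0r e add0r.
have -> : (fun x => - \sum_(k <- s) chi2 k x - chi2 j x) =
  (fun x => - \sum_(k <- j :: s) chi2 k x) by apply/funext => x; rewrite -[RHS]add0r e add0r.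
by rewrite [size (j :: s)]/= -natr1 addrA mulrDl mul1r.
Qed.

Lemma N2_sum (I : Type) (s : seq I) (F : I -> V) : (forall j, VL2 (F j)) ->
  VL2 (fun x => \sum_(j <- s) F j x) /\
  N2 (fun x => \sum_(j <- s) F j x) <= \sum_(j <- s) N2 (F j).
Proof.
move=> h; elim: s => [|j s [ih1 ih2]].
  under eq_fun do rewrite big_nil; rewrite big_nil N2_0; split => //; exact: VL20.
under eq_fun do rewrite big_cons; rewrite big_cons; split; first exact: VL2D.
by apply: le_trans (N2D (h j) ih1) _; rewrite lerD2l.
Qed.

Lemma smul_sum (I : finType) (chi : I -> R -> R) w :
  w = (fun x => smul (fun y => 1 - \sum_j chi j y) w x + \sum_j smul (chi j) w x).
Proof.
apply/funext => x; rewrite /smul -scaler_suml -scalerDl -rmorph_sum -rmorphD subrK.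
by rewrite rmorph1 scale1r.
Qed.

(** The arithmetic of [localize]: the errors are proportional to [d] and are absorbed into half of
    [c0 * W]; the remaining multiple of [H] is at most $1+10n$, whence the constant $20n+2$. *)
Lemma loc_arith (n d W W1 H Hz K c0 S S0 : R) :
  0 <= n -> 0 <= d <= 1 -> 0 <= W -> 0 <= H -> 0 <= K ->
  d * (16 * (n + 1) * (1 + K)) <= c0 -> Hz <= H + d * W -> W1 <= 2 * (H + K * W) ->
  W <= S0 + S -> c0 * S <= n * (Hz + 3 * d * W + 2 * d * W1) ->
  c0 * S0 <= (1 + n) * Hz + (n * d + 2 * d) * W + 2 * (n * d) * W1 -> 0 < c0 ->
  c0 / (20 * n + 2) * W <= H.
Proof.
move=> n0 /andP[d0 d1] W0 H0 K0 hc hHz hW1 hW hS hS0 c00.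
have k0 : 0 < 20 * n + 2 by lra.
rewrite mulrAC ler_pdivrMr//.
have := ler_wpM2l (ltW c00) hW; rewrite mulrDr => q.
have a1 : (1 + 2 * n) * Hz <= (1 + 2 * n) * (H + d * W) by apply: ler_wpM2l => //; lra.
have nd : 0 <= n * d by rewrite mulr_ge0.
have a2 : (4 * (n * d)) * W1 <= (4 * (n * d)) * (2 * (H + K * W)).
  by apply: ler_wpM2l => //; rewrite mulr_ge0.
have a3 : c0 * W <= (1 + 2 * n) * Hz + (4 * (n * d) + 2 * d) * W + 4 * (n * d) * W1 by lra.
have a4 : d * (16 * (n + 1) * (1 + K)) * W <= c0 * W by apply: ler_wpM2r.
have a5 : 8 * (n * d) * H <= 8 * n * H.
  by apply: ler_wpM2r => //; have := ler_wpM2l n0 d1; lra.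
have dW : 0 <= d * W by rewrite mulr_ge0.
have a6 : 0 <= n * (d * W) by rewrite mulr_ge0.
have a7 : 0 <= K * (d * W) by rewrite mulr_ge0.
have a8 : 0 <= n * (K * (d * W)) by rewrite mulr_ge0.
lra.
Qed.

Let ar1 (a b c B d : R) : a <= b + c -> b <= d -> d <= 1 -> 1 + 2 * B + a <= 2 + 2 * B + c.
Proof. lra. Qed.

Let ar2 (d : R) : d + 2 * d <= 3 * d.
Proof. lra. Qed.

(** The function $w$ is split into the pieces $\chi_jw$ and the rest $(1-\sum_j\chi_j)w$. The
    operators of the pulses bound the former, that of the background the latter, and the pieces are
    added. *)
Lemma localize (I : finType) (mj : I -> R -> 'M[R]_2) mk minf (chi chi1 chi2 : I -> R -> R)
    (B c0 d : R) z0 z :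
  0 < c0 -> 0 <= d <= 1 ->
  bmx mk B -> (forall j, bmx (mj j) B) -> bmx minf B ->
  (forall j, cutoff (chi j) (chi1 j) (chi2 j) 1 d) ->
  (forall j x a b, `|chi j x * (mj j x a b - mk x a b)| <= d) ->
  (forall x a b, `|(1 - \sum_j chi j x) * (minf x a b - mk x a b)| <= d) ->
  (forall j, LB (mj j) z0 c0) -> LB minf z0 c0 -> normc (z - z0) <= d ->
  d * (16 * (#|I|%:R + 1) * (1 + (2 + 2 * B + normc z0))) <= c0 ->
  LB mk z (c0 / (20 * #|I|%:R + 2)).
Proof.
move=> c00 d01 bk bj binf cut hj hinf LBj LBinf hz hd w w1 w2 h.
have [L0 L1 L2'] := H2v_VL2 h; have B0 : 0 <= B := le_trans (normr_ge0 _) (bk.2 0 ord0 ord0).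
have /andP[d0 d1] := d01.
have cut0 := cutoff_rest (index_enum I) cut.
have sz : size (index_enum I) = #|I| by rewrite cardE enumT.
rewrite sz in cut0.
have Hz : N2 (opL mk z0 w w2) <= N2 (opL mk z w w2) + d * N2 w.
  have -> : opL mk z0 w w2 = (fun x => opL mk z w w2 x + (z - z0) *: w x).
    by apply/funext => x; rewrite /opL scalerBl addrA addrNK.
  apply: le_trans (N2D (VL2_opL z bk h) (VL2Z _ L0)) _; rewrite lerD2l N2Z//.
  by rewrite ler_wpM2r ?N2_ge0.
have hW1 : N2 w1 <= 2 * (N2 (opL mk z w w2) + (2 + 2 * B + normc z0) * N2 w).
  apply: le_trans (N2_deriv z bk h) _; rewrite ler_wpM2l// lerD2l ler_wpM2r ?N2_ge0//.
  by apply: ar1 hz d1; rewrite -{1}(subrK z0 z); exact: le_normcD.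
have mc (f f1 : R -> R) : (forall x : R, is_derive x 1 f (f1 x)) -> measurable_fun [set: R] f.
  by move=> hf; apply: continuous_measurable_fun; apply: der_continuous => x; exists (f1 x).
have Lj j : VL2 (smul (chi j) w).
  by have [e1 _ _ e4] := cut j; apply: (@VL2_smul R _ _ 1 (mc _ _ e1) _ L0) => x; case: (e4 x).
have [S1 S2] := N2_sum (index_enum I) Lj.
have Lr : VL2 (smul (fun y => 1 - \sum_j chi j y) w).
  by have [e1 _ _ e4] := cut0; apply: (@VL2_smul R _ _ _ (mc _ _ e1) _ L0) => x; case: (e4 x) => e5 _ _; exact: e5.
have qj j : c0 * N2 (smul (chi j) w) <= N2 (opL mk z0 w w2) + 3 * d * N2 w + 2 * d * N2 w1.
  have q := LBj j _ _ _ (cut_H2v (cut j) h); apply: le_trans q _.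
  apply: le_trans (cut_opL z0 (cut j) h bk (bj j) (hj j)) _.
  rewrite mul1r lerD2r lerD2l; apply: ler_wpM2r; first exact: N2_ge0.
  exact: ar2.
have q0 : c0 * N2 (smul (fun y => 1 - \sum_j chi j y) w) <=
   (1 + #|I|%:R) * N2 (opL mk z0 w w2) + (#|I|%:R * d + 2 * d) * N2 w + 2 * (#|I|%:R * d) * N2 w1.
  have q := LBinf _ _ _ (cut_H2v cut0 h); apply: le_trans q _.
  exact: (cut_opL z0 cut0 h bk binf hinf).
have qS : c0 * (\sum_j N2 (smul (chi j) w)) <=
    #|I|%:R * (N2 (opL mk z0 w w2) + 3 * d * N2 w + 2 * d * N2 w1).
  rewrite mulr_sumr; apply: le_trans (ler_sum _ (fun j _ => qj j)) _.
  by rewrite sumr_const [leRHS]mulr_natl.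
have K0 : 0 <= 2 + 2 * B + normc z0 by rewrite !addr_ge0 ?normc_ge0// mulr_ge0.
apply: (loc_arith _ d01 (N2_ge0 _) (N2_ge0 _) K0 hd Hz hW1 _ qS q0 c00); first exact: ler0n.
rewrite {1}(smul_sum chi w); apply: le_trans (N2D Lr S1) _.
by rewrite lerD2l.
Qed.

Lemma bell_le (X x : R) : 1 <= X -> bell 1 0 x <= bell X 0 x.
Proof.
move=> X1; rewrite /bell !subr0 divr1 lef_pV2 ?posrE ?ltr_wpDr ?sqr_ge0//.
rewrite lerD2l exprMn exprVn ler_pdivrMr ?exprn_gt0//; last lra.
rewrite ler_peMr ?sqr_ge0// expr_ge1//; lra.
Qed.

Let ar3 (c d A A' T N0 v v1 x x1 : R) : c * A' <= T -> T <= 1 * N0 + (d + 2 * d) * v + 2 * d * v1 ->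
  N0 = 0 -> v = x -> v1 = x1 -> A <= A' -> 0 <= c -> c * A <= 3 * d * x + 2 * d * x1.
Proof.
move=> q1 q2 e0 e1 e2 q3 c0; rewrite e0 e1 e2 in q2; have := ler_wpM2l c0 q3.
lra.
Qed.

(** A kernel function of the pulse operator at $z$, moved to the place of the pulse and cut off,
    nearly solves the equation of the glued operator, which contradicts a fixed lower bound when [d]
    is small. *)
Lemma approx_eigen mi mk (B c X d cen : R) z w w1 w2 :
  H2v w w1 w2 -> N2 (opL mi z w w2) = 0 -> bmx mi B -> bmx mk B -> LB mk z c ->
  0 <= c -> 1 <= X -> 10 / X <= d ->
  (forall x a b, `|bell X cen x * (mk x a b - mi (x - cen) a b)| <= d) ->
  c * N2 (smul (bell 1 0) w) <= 3 * d * N2 w + 2 * d * N2 w1.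
Proof.
move=> h e0 bi bk lb c0 X1 hX hd'; have [L0 L1 L2'] := H2v_VL2 h.
have hs := H2v_shift (- cen) h.
have bi' : bmx (fun x => mi (x - cen)) B.
  by split=> [i j|x]; [exact: measurableT_comp (bi.1 i j) (shift_measurable _)|exact: bi.2].
have [k1 k2 k3 k4] := bell_cutoff cen X1.
have cut : cutoff (bell X cen) (bell1 X cen) (bell2 X cen) 1 d.
  by split=> // x; have [? ? ?] := k4 x; split => //; exact: le_trans hX.
have q1 := lb _ _ _ (cut_H2v cut hs); have q2 := cut_opL z cut hs bi' bk hd'.
have e1 : N2 (opL (fun x => mi (x - cen)) z (fun x => w (x - cen)) (fun x => w2 (x - cen))) = 0.
  by rewrite -[RHS]e0 -(N2_shift (- cen) (VL2_opL z bi h)).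
have e2 := N2_shift (- cen) L0; have e3 := N2_shift (- cen) L1.
(* The left side is measured through the fixed window [bell 1 0], so that it depends neither on [X]
   nor on the position. *)
have q3 : N2 (smul (bell 1 0) w) <= N2 (smul (bell X cen) (fun x => w (x - cen))).
  have mb Y cc : measurable_fun [set: R] (bell Y cc).
    by apply: continuous_measurable_fun; exact: bell_cont.
  have bb Y cc x : `|bell Y cc x| <= 1 :> R.
    by have /andP[b0 b1] := bell_itv Y cc x; rewrite ger0_norm// ltW.
  have -> : smul (bell X cen) (fun x => w (x - cen)) = (fun x => smul (bell X 0) w (x - cen)).
    by apply/funext => x; rewrite /smul /bell subr0.
  rewrite (N2_shift (- cen) (VL2_smul (mb X 0) (bb X 0) L0)).
  apply: N2_le => [||x]; [exact: VL2_smul (mb _ _) (bb _ _) L0|exact: VL2_smul (mb _ _) (bb _ _) L0|].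
  rewrite /smul !ripZ !normc_real ler_wpM2r ?rip_ge0// ler_pXn2r ?nnegrE//.
  rewrite !ger0_norm; first exact: bell_le.
    by have /andP[/ltW] := bell_itv X 0 x.
  by have /andP[/ltW] := bell_itv 1 0 x.
exact: ar3 q1 q2 e1 e2 e3 q3 c0.
Qed.

(** Compactness of a square containing the disc. Points of the square outside the closed disc have a
    neighbourhood outside it, where nothing is claimed. *)
Lemma disc_unif (P : nat -> C -> Prop) (z0 : C) (r : R) :
  (forall z, normc (z - z0) <= r -> exists rho n0, 0 < rho /\
     forall n z', (n0 <= n)%N -> normc (z' - z) < rho -> P n z') ->
  exists n0, forall n z, (n0 <= n)%N -> normc (z - z0) <= r -> P n z.
Proof.
move=> h; pose a := complex.Re z0; pose b := complex.Im z0.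
have cK : compact (`[a - r, a + r] `*` `[b - r, b + r] : set (R * R)).
  by apply: compact_setX; exact: segment_compact.
have /compact_near_coveringP nc := cK.
have := nc nat \oo (fun n p => normc (Complex p.1 p.2 - z0) <= r -> P n (Complex p.1 p.2)) _.
case=> [p _|n0 _ H]; last first.
  exists n0 => n [x y] nn hz; apply: (H n nn (x, y)) => //=.
  have := Re_normc (Complex x y - z0); have : `|y - b| <= normc (Complex x y - z0).
    rewrite /a /b; case: z0 {h a b cK nc H hz} => u v /=; rewrite -sqrtr_sqr; apply: ler_wsqrtr.
    by rewrite lerDr sqr_ge0.
  rewrite ReB/= -/a => h1 h2; have := le_trans h1 hz; have := le_trans h2 hz.
  by rewrite !ler_norml !in_itv/= => /andP[? ?] /andP[? ?]; split; apply/andP; split; lra.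
set z := Complex p.1 p.2.
have [rho [n0 [rho0 hr]]] : exists rho n0, 0 < rho /\
    forall n z', (n0 <= n)%N -> normc (z' - z) < rho -> normc (z' - z0) <= r -> P n z'.
  case: (leP (normc (z - z0)) r) => hz.
    by have [rho [n0 [r0 hr]]] := h z hz; exists rho, n0; split => // n z' nn hz' _; exact: hr.
  exists (normc (z - z0) - r), 0%N; split; first by rewrite subr_gt0.
  move=> n z' _ h1 h2; exfalso.
  have := le_normcD (z - z') (z' - z0); rewrite addrA subrK -[z - z']opprB normcN; lra.
exists (ball p (rho / 2), [set n | (n0 <= n)%N]) => /=.
  by split; [apply: nbhsx_ballx; rewrite divr_gt0|exists n0].
move=> [q n] /= [[b1 b2] nn]; apply: hr => //.
have -> : Complex q.1 q.2 - z = rc (q.1 - p.1) + Complex 0 (q.2 - p.2).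
  by apply/eqP; rewrite eq_complex/= addr0 add0r !eqxx.
apply: le_lt_trans (le_normcD _ _) _; rewrite normc_real.
have -> : normc (Complex 0 (q.2 - p.2)) = `|q.2 - p.2|.
  by rewrite /Normc.normc expr0n/= add0r sqrtr_sqr.
by move: b1 b2; rewrite /ball/= => b1 b2; rewrite (distrC q.1) (distrC q.2); lra.
Qed.

(** * The maximum principle for the norm of the resolvent *)

Section MaxPrinciple.
Variables (m : R -> 'M[R]_2) (B : R) (z0 : C) (r c : R).
Hypotheses (bm : bmx m B) (r0 : 0 < r) (c0 : 0 < c).
Hypothesis ont : forall z, normc (z - z0) <= r -> onto NH (opT m z).
Hypothesis pos : forall z, normc (z - z0) <= r -> exists2 k, 0 < k &
  forall g, k * NH (GH g) <= NH (opT m z g).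
Hypothesis ring_bd : forall z, r / 2 <= normc (z - z0) <= r ->
  forall g, c * NH (GH g) <= NH (opT m z g).

Let T := opT m.
Let lT z : lin (T z). Proof. exact: opM_lin (bmxJ bm). Qed.
Let lG : lin (fun g : l2 => GH g). Proof. exact: GH_lin. Qed.

Let ar4 (a b d f k t : R) : a <= f * d + b -> k * d <= a -> t * d <= k / 2 * d ->
  f * d <= k / 2 * d -> t * d <= b.
Proof. lra. Qed.

(** A lower bound at one point persists nearby with half the constant, and the disc is compact. *)
Lemma unif_below : exists2 k, 0 < k & forall z, normc (z - z0) <= r ->
  forall g, k * NH (GH g) <= NH (T z g).
Proof.
have [|n0 hn] := @disc_unif (fun n z => forall g, n.+1%:R^-1 * NH (GH g) <= NH (T z g)) z0 r.
  move=> z hz; have [k k0 hk] := pos hz.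
  exists (k / 2), (Num.truncn (2 / k)); split; first by rewrite divr_gt0.
  move=> n z' hn hz' g.
  have q : n.+1%:R^-1 <= k / 2.
    rewrite invf_ple ?posrE ?ltr0n ?divr_gt0// invf_div.
    apply: ltW; apply: lt_le_trans (Num.Theory.truncnS_gt _) _.
    by rewrite ler_nat ltnS.
  have e : T z' g = T z g - (z' - z) *: GH g by rewrite /T /opT -opM_shift addrC subrK.
  have q1 : NH (T z g) <= normc (z' - z) * NH (GH g) + NH (T z' g).
    have -> : T z g = (z' - z) *: GH g + T z' g by rewrite e addrC subrK.
    by apply: le_trans (snD sn _ _) _; rewrite (snZ sn).
  have G0 := sn_ge0 sn (GH g).
  have := hk g; rewrite -/(T z g) => q2.
  have q3 := ler_wpM2r G0 q; have q4 := ler_wpM2r G0 (ltW hz').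
  exact: ar4 q1 q2 q3 q4.
exists n0.+1%:R^-1; first by rewrite invr_gt0 ltr0n.
by move=> z hz g; exact: hn.
Qed.

(** The four directions $\pm h$, $\pm ih$. The sums of their first and second powers vanish, so they
    serve as a discrete mean value; the default 0 beyond index 3 is harmless. *)
Let quad (h : R) (j : nat) : C := nth 0 [:: Complex h 0; Complex (- h) 0; Complex 0 h; Complex 0 (- h)] j.

Let vs1 (a b c' y : l2) : a + c' - (y + b) = a - b + c' - y.
Proof. by rewrite [a - b + c']addrAC opprD addrA addrAC. Qed.

Let vs2 (P Q S b0 b1 b2 b3 : l2) (q p : C) : p ^+ 2 = - q ^+ 2 ->
  (P + q *: Q + q ^+ 2 *: S + b0) + (P + - q *: Q + (- q) ^+ 2 *: S + b1) +
  ((P + p *: Q + p ^+ 2 *: S + b2) + (P + - p *: Q + (- p) ^+ 2 *: S + b3)) =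
  4 *: P + (b0 + b1 + (b2 + b3)).
Proof.
move=> pq.
have pr t : (P + t *: Q + t ^+ 2 *: S) + (P + - t *: Q + (- t) ^+ 2 *: S) =
    (P + P) + (t ^+ 2 *: S + t ^+ 2 *: S).
  by rewrite sqrrN scaleNr addrACA [P + _ + (P - _)]addrACA subrr addr0.
rewrite [X in X + _ = _]addrACA [X in _ + X = _]addrACA [LHS]addrACA !pr pq; congr (_ + _).
rewrite addrACA scaleNr -opprD subrr addr0.
by rewrite scaler_nat !mulrS mulr0n addr0 !addrA.
Qed.

Let vs3 (P a0 a1 a2 a3 b0 b1 b2 b3 : l2) (t : R) :
  NH (a0 + a1 + (a2 + a3)) = NH (P + (b0 + b1 + (b2 + b3))) ->
  NH b0 <= t -> NH b1 <= t -> NH b2 <= t -> NH b3 <= t ->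
  NH P <= NH a0 + NH a1 + (NH a2 + NH a3) + 4 * t.
Proof.
move=> e h0 h1 h2 h3.
have q := snB sn (P + (b0 + b1 + (b2 + b3))) (b0 + b1 + (b2 + b3)); rewrite addrK -e in q.
have D4 (x0 x1 x2 x3 : l2) : NH (x0 + x1 + (x2 + x3)) <= NH x0 + NH x1 + (NH x2 + NH x3).
  by apply: le_trans (snD sn _ _) _; apply: lerD; exact: (snD sn).
have := D4 a0 a1 a2 a3; have := D4 b0 b1 b2 b3; lra.
Qed.

Let ar5 (p0 p1 p2 p3 n0 n1 n2 n3 pz nz s e de h2 X : R) : s - e < pz + de * nz ->
  e <= de * h2 / 2 -> 4 * pz <= p0 + p1 + (p2 + p3) + 4 * X ->
  n0 + n1 + (n2 + n3) = 4 * nz + 4 * h2 -> X <= de * h2 / 2 ->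
  p0 + de * n0 <= s -> p1 + de * n1 <= s -> p2 + de * n2 <= s -> p3 + de * n3 <= s -> False.
Proof. by move=> h1 h3 h4 /(congr1 (fun t => de * t)) h5 h6 h7 h8 h9 h10; lra. Qed.

(** The function $\phi(z)=\|w_z\|$, with $w_z$ the solution for a fixed right side, is subharmonic
    up to a cubic error over the four points $z\pm h,z\pm ih$. If $\phi(z_0)$ exceeded the bound on
    the ring, $\phi+\delta|z-z_0|^2$ would have a near-maximum inside, and the gain $\delta h^2$ of
    the quadratic term would contradict the mean value inequality. *)
Lemma max_principle g : c * NH (GH g) <= NH (T z0 g).
Proof.
have [k k0 hk] := unif_below.
have D0 : normc (z0 - z0) <= r by rewrite subrr Normc.normc0 ltW.
have ex z y : exists x, normc (z - z0) <= r -> NH (T z x - y) = 0.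
  have [h|h] := pselect (normc (z - z0) <= r); last by exists 0.
  by have [x hx] := ont h y; exists x.
have [S hS] := choice (fun p : C * l2 => ex p.1 p.2).
pose A z y : l2 := GH (S (z, y)).
have Ab z y : normc (z - z0) <= r -> NH (A z y) <= k^-1 * NH y.
  move=> hz; rewrite mulrC ler_pdivlMr// mulrC; apply: le_trans (hk z hz _) _.
  by rewrite (sn_eq sn (hS (z, y) hz)).
have Au z y x : normc (z - z0) <= r -> NH (T z x - y) = 0 -> NH (GH x - A z y) = 0.
  move=> hz hx; rewrite -(linB lG); apply: (sn_eq0 sn).
  rewrite -(pmulr_rle0 _ k0); apply: le_trans (hk z hz _) _.
  rewrite (linB (@lT z)) (eqn_trans sn hx)// (sn_swap sn); exact: (hS (z, y) hz).
have res z h y : normc (z - z0) <= r -> normc (z + h - z0) <= r ->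
    NH (A (z + h) y - (A z y + h *: A (z + h) (A z y))) = 0.
  move=> hz hzh; rewrite (sn_swap sn).
  have -> : A z y + h *: A (z + h) (A z y) = GH (S (z, y) + h *: S (z + h, A z y)).
    by rewrite (linD lG) (linZ lG).
  apply: Au => //; rewrite (linD (@lT _)) (linZ (@lT _)).
  have -> : T (z + h) (S (z, y)) = T z (S (z, y)) - h *: A z y by exact: opM_shift.
  have e1 := hS (z, y) hz; have e2 := eqnZ sn h (hS (z + h, A z y) hzh).
  have := eqnD sn e1 e2; congr (NH _ = 0).
  by rewrite vs1.
pose y := T z0 g; pose phi z := NH (A z y).
have phi0 : phi z0 = NH (GH g).
  by apply/esym/(sn_eq sn); apply: Au => //; exact: eqn_refl.
rewrite -phi0 leNgt; apply/negP => hlt.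
pose b := NH y / c.
have hb : b < phi z0 by rewrite ltr_pdivrMr// mulrC.
have ringb z : r / 2 <= normc (z - z0) <= r -> phi z <= b.
  move=> hz; have /andP[_ hz2] := hz; rewrite ler_pdivlMr// mulrC.
  by apply: le_trans (ring_bd hz _) _; rewrite (sn_eq sn (hS (z, y) hz2)).
pose K := k^-1 ^+ 4 * NH y.
have ki0 : 0 <= k^-1 by rewrite invr_ge0 ltW.
have K0 : 0 <= K by rewrite mulr_ge0 ?exprn_ge0 ?(sn_ge0 sn).
(* On the ring the added term is at most half the gap [phi z0 - b], so no near-maximum lies
   there. *)
pose de := (phi z0 - b) / (2 * r ^+ 2).
have r2 : 0 < 2 * r ^+ 2 by rewrite mulr_gt0// exprn_gt0.
have de0 : 0 < de by rewrite divr_gt0// subr_gt0.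
have der : de * r ^+ 2 = (phi z0 - b) / 2 by rewrite /de; field; rewrite gt_eqF.
(* The four points stay in the disc, and the cubic error $Kh^3$ is at most half of the gain $\delta
   h^2$. *)
pose h := Num.min (r / 2) (de / (2 * (K + 1))).
have K1 : 0 < 2 * (K + 1) by lra.
have h0 : 0 < h.
  rewrite /h lt_min; apply/andP; split; [exact: divr_gt0 r0 (ltr0n _ 2)|exact: divr_gt0 de0 K1].
have hr : h <= r / 2 by rewrite ge_min lexx.
have hK : K * h <= de / 2.
  have : h <= de / (2 * (K + 1)) by rewrite ge_min lexx orbT.
  rewrite ler_pdivlMr// => q; have : 0 <= h := ltW h0; lra.
pose F z := phi z + de * normc (z - z0) ^+ 2.
pose E := [set F z | z in [set z | normc (z - z0) <= r]].
have Fub z : normc (z - z0) <= r -> F z <= k^-1 * NH y + de * r ^+ 2.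
  move=> hz; apply: lerD; first exact: Ab.
  by rewrite ler_pM2l// ler_pXn2r ?nnegrE ?normc_ge0// ltW.
have hsE : has_sup E.
  split; first by exists (F z0), z0.
  by exists (k^-1 * NH y + de * r ^+ 2) => _ [z hz <-]; exact: Fub.
(* The supremum need not be attained; a point within [e] of it suffices, the other half of the gain
   covering [e]. *)
pose e := Num.min (de * h ^+ 2 / 2) ((phi z0 - b) / 2).
have e0 : 0 < e.
  rewrite /e lt_min; apply/andP; split; apply: divr_gt0 (ltr0n _ 2); last by rewrite subr_gt0.
  by apply: mulr_gt0 => //; exact: exprn_gt0.
have [_ [z hz <-] hF] := sup_adherent e0 hsE.
have sF z' : normc (z' - z0) <= r -> F z' <= sup E.
  by move=> hz'; apply: (ub_le_sup hsE.2); exists z'.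
have F0 : phi z0 <= sup E.
  by have := sF _ D0; rewrite /F subrr Normc.normc0 expr0n/= mulr0 addr0.
have ee1 : e <= de * h ^+ 2 / 2 by rewrite ge_min lexx.
have ee2 : e <= (phi z0 - b) / 2 by rewrite ge_min lexx orbT.
have zin : normc (z - z0) < r / 2.
  rewrite ltNge; apply/negP => hz2.
  have q1 := ringb z (ltac:(by rewrite hz2)).
  have q2 : de * normc (z - z0) ^+ 2 <= de * r ^+ 2.
    by rewrite ler_pM2l// ler_pXn2r ?nnegrE ?normc_ge0// ltW.
  by move: hF; rewrite /F ltrBlDr; lra.
have nq j : normc (quad h j) <= h.
  have [hh hh'] : normc (Complex h 0) = h /\ normc (Complex 0 h) = h.
    by rewrite /Normc.normc expr0n/= addr0 add0r sqrtr_sqr gtr0_norm.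
  have nn a' b' : normc (Complex (- a') (- b')) = normc (Complex a' b').
    by rewrite /Normc.normc !sqrrN.
  have m1 : normc (Complex (- h) 0) = h by rewrite -[X in Complex _ X]oppr0 nn.
  have m2 : normc (Complex 0 (- h)) = h by rewrite -[X in Complex X _]oppr0 nn.
  case: j => [|[|[|[|j]]]].
  - by rewrite -[quad h 0]/(Complex h 0) hh.
  - by rewrite -[quad h 1]/(Complex (- h) 0) m1.
  - by rewrite -[quad h 2]/(Complex 0 h) hh'.
  - by rewrite -[quad h 3]/(Complex 0 (- h)) m2.
  - have -> : quad h j.+4 = 0 by case: j.
    by rewrite Normc.normc0 ltW.
have zq j : normc (z + quad h j - z0) <= r.
  by rewrite addrAC; apply: le_trans (le_normcD _ _) _; have := nq j; lra.
pose A3 := A z (A z (A z y)).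
have nA3 : NH A3 <= k^-1 ^+ 3 * NH y.
  have q1 := Ab _ y hz; have q2 := Ab _ (A z y) hz; have q3 := Ab _ (A z (A z y)) hz.
  apply: le_trans q3 _; rewrite exprS -mulrA ler_wpM2l//.
  by apply: le_trans q2 _; rewrite expr2 -mulrA ler_wpM2l.
(* Third-order expansion of the resolvent, from three uses of the resolvent identity. Summed over
   the four directions, the terms in $q$ and $q^2$ cancel. *)
have exq j (q := quad h j) : NH (A (z + q) y -
    (A z y + q *: A z (A z y) + q ^+ 2 *: A3 + q ^+ 3 *: A (z + q) A3)) = 0.
  have s1 := res z q y hz (zq j); have s2 := res z q (A z y) hz (zq j).
  have s3 := res z q (A z (A z y)) hz (zq j).
  apply: (eqn_trans sn s1).
  have t2 := eqnZ sn q (eqn_trans sn s2 (eqnD sn (eqn_refl sn (A z (A z y))) (eqnZ sn q s3))).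
  have := eqnD sn (eqn_refl sn (A z y)) t2; congr (NH (_ - _) = 0).
  by rewrite !scalerDr !scalerA -!addrA !exprS expr0 !mulr1 mulrA.
have i2 : quad h 2 ^+ 2 = - quad h 0 ^+ 2 by apply/eqP; rewrite eq_complex /=; apply/andP; split; apply/eqP; ring.
have sumq : NH (A (z + quad h 0) y + A (z + quad h 1) y + (A (z + quad h 2) y + A (z + quad h 3) y)
   - (4 *: A z y + (quad h 0 ^+ 3 *: A (z + quad h 0) A3 + quad h 1 ^+ 3 *: A (z + quad h 1) A3
   + (quad h 2 ^+ 3 *: A (z + quad h 2) A3 + quad h 3 ^+ 3 *: A (z + quad h 3) A3)))) = 0.
  have := eqnD sn (eqnD sn (exq 0%N) (exq 1%N)) (eqnD sn (exq 2%N) (exq 3%N)); congr (NH (_ - _) = 0).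
  have -> : quad h 1 = - quad h 0 by apply/eqP; rewrite eq_complex /= oppr0 !eqxx.
  have -> : quad h 3 = - quad h 2 by apply/eqP; rewrite eq_complex /= oppr0 !eqxx.
  by apply: vs2; rewrite i2.
have fin : 4 * phi z <= phi (z + quad h 0) + phi (z + quad h 1) + (phi (z + quad h 2) + phi (z + quad h 3))
    + 4 * (h ^+ 3 * K).
  have bq j : NH (quad h j ^+ 3 *: A (z + quad h j) A3) <= h ^+ 3 * K.
    rewrite (snZ sn) normcX; apply: ler_pM; rewrite ?exprn_ge0 ?normc_ge0 ?(sn_ge0 sn)//.
      by rewrite lerXn2r ?nnegrE ?normc_ge0// ltW.
    apply: le_trans (Ab _ A3 (zq j)) _; rewrite /K exprS -mulrA.
    by apply: ler_wpM2l.
  have r4 : (4 : C) = rc 4 by rewrite rmorph_nat.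
  have e4 : NH (4 *: A z y) = 4 * phi z by rewrite (snZ sn) r4 normc_real ger0_norm.
  rewrite -e4; move: (sn_eq sn sumq) (bq 0%N) (bq 1%N) (bq 2%N) (bq 3%N).
  rewrite /phi; exact: vs3.
have geo : normc (z + quad h 0 - z0) ^+ 2 + normc (z + quad h 1 - z0) ^+ 2 +
   (normc (z + quad h 2 - z0) ^+ 2 + normc (z + quad h 3 - z0) ^+ 2) =
   4 * normc (z - z0) ^+ 2 + 4 * h ^+ 2.
  have nE a' b' : normc (Complex a' b') ^+ 2 = a' ^+ 2 + b' ^+ 2.
    by rewrite /Normc.normc sqr_sqrtr// addr_ge0 ?sqr_ge0.
  rewrite !(addrAC z _ (- z0)); case: (z - z0) => a' b'.
  have cD (x1 x2 y1 y2 : R) : Complex x1 y1 + Complex x2 y2 = Complex (x1 + x2) (y1 + y2) by [].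
  rewrite -[quad h 0]/(Complex h 0) -[quad h 1]/(Complex (- h) 0).
  rewrite -[quad h 2]/(Complex 0 h) -[quad h 3]/(Complex 0 (- h)) !cD !nE; ring.
have := sF _ (zq 0%N); have := sF _ (zq 1%N); have := sF _ (zq 2%N); have := sF _ (zq 3%N).
have hh : h ^+ 3 * K <= de * h ^+ 2 / 2.
  have := ler_wpM2l (sqr_ge0 h) hK.
  by rewrite (_ : h ^+ 2 * (K * h) = h ^+ 3 * K); [lra|ring].
rewrite /F => t3 t2 t1 t0; exact: (ar5 hF ee1 fin geo hh t0 t1 t2 t3).
Qed.

End MaxPrinciple.
End Localization.

(** * End states and boundedness of homoclinic profiles *)

Section Pulses.
Variable R : realType.
Local Notation C := R[i].
Local Notation rc := (real_complex R).
Implicit Types (u : R -> 'cV[R]_2) (a b : 'cV[R]_2).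

Definition near_inf u a := forall eta : R, 0 < eta -> exists Y : R,
  forall x, Y <= `|x| -> forall i, `|u x i 0 - a i 0| <= eta.

Lemma derive_poly (F : 'cV[R]_4 -> 'cV[R]_4) (U v A B D : 'cV[R]_4) :
  (forall h : R, F (h *: v + U) = F U + h *: A + h ^+ 2 *: B + h ^+ 3 *: D) ->
  'D_v F U = A.
Proof.
move=> hF; apply: cvg_lim; first exact: norm_hausdorff.
have hc : A + h *: (B + h *: D) @[h --> (0:R)^'] --> A.
  have : A + h *: (B + h *: D) @[h --> (0:R)] --> A + 0 *: (B + 0 *: D).
    apply: cvgD; first exact: cvg_cst.
    apply: cvgZ; first exact: cvg_id.
    by apply: cvgD; [exact: cvg_cst|apply: cvgZ; [exact: cvg_id|exact: cvg_cst]].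
  by rewrite scale0r addr0 => q; apply: cvg_trans q; apply: cvg_app; exact: nbhs_dnbhs.
apply: cvg_trans hc; apply: near_eq_cvg.
near=> h; have h0 : h != 0 by near: h; exact: nbhs_dnbhs_neq.
rewrite /= hF -!addrA [F U + _]addrC -!addrA addNr addr0 !scalerDr !scalerA.
have -> : h^-1 * h ^+ 2 = h by field.
have -> : h^-1 * h ^+ 3 = h * h by field.
by rewrite mulVf// scale1r.
Unshelve. all: by end_near.
Qed.

Variables (zeta f eps : R).

Lemma vfield_derive (U v : 'cV[R]_4) : 'D_v (vfield zeta f eps) U =
  \col_(k < 4) nth 0 [:: v 2 0; v 3 0;
   zeta * v 0 0 + eps * v 1 0 - (2 * (U 0 0 * v 0 0 + U 1 0 * v 1 0) * U 0 0
     + (U 0 0 ^+ 2 + U 1 0 ^+ 2) * v 0 0);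
   zeta * v 1 0 - eps * v 0 0 - (2 * (U 0 0 * v 0 0 + U 1 0 * v 1 0) * U 1 0
     + (U 0 0 ^+ 2 + U 1 0 ^+ 2) * v 1 0)] k.
Proof.
pose p := U 0 0; pose q := U 1 0; pose s := v 0 0; pose t := v 1 0.
pose B : 'cV[R]_4 := \col_(k < 4) nth 0 [:: 0; 0;
   - (2 * (p * s + q * t) * s + (s ^+ 2 + t ^+ 2) * p);
   - (2 * (p * s + q * t) * t + (s ^+ 2 + t ^+ 2) * q)] k.
pose D : 'cV[R]_4 := \col_(k < 4) nth 0 [:: 0; 0; - ((s ^+ 2 + t ^+ 2) * s); - ((s ^+ 2 + t ^+ 2) * t)] k.
apply: (@derive_poly _ _ _ _ B D) => h; apply/matrixP => k l.
rewrite ord1 {l} !mxE -/p -/q -/s -/t; case: k => [[|[|[|[|//]]]] hk] /=; ring.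
Qed.

Lemma jac_vfield (U : 'cV[R]_4) (i j : 'I_4) :
  jac (vfield zeta f eps) U i j = nth 0 (nth [::]
   [:: [:: 0; 0; 1; 0]; [:: 0; 0; 0; 1];
       [:: zeta - 3 * U 0 0 ^+ 2 - U 1 0 ^+ 2; eps - 2 * U 0 0 * U 1 0; 0; 0];
       [:: - eps - 2 * U 0 0 * U 1 0; zeta - U 0 0 ^+ 2 - 3 * U 1 0 ^+ 2; 0; 0]] i) j.
Proof.
rewrite mxE vfield_derive mxE; move: (U 0 0) (U 1 0) => p q; rewrite !mxE.
by case: i => [[|[|[|[|//]]]] hi]; case: j => [[|[|[|[|//]]]] hj] /=; ring.
Qed.

(** With $m=U_1^2+U_2^2$ and $P=\zeta-2m$, an eigenvalue satisfies $(z^2-P)^2=m^2-\varepsilon^2$.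
    For $z=a+ib$ with $ab\ne0$ the imaginary part forces $a^2-b^2=P$, and the real part then gives
    $m^2-\varepsilon^2=-4a^2b^2<0$. *)
Lemma saddle_small (U : 'cV[R]_4) : 0 < eps -> saddle_focus zeta f eps U ->
  U 0 0 ^+ 2 + U 1 0 ^+ 2 < eps.
Proof.
move=> eps0 [_ [a [b [a0 b0 ev]]]].
have := ev (Complex a b); rewrite inE eqxx /= => /eigenvalueP[v vJ v0].
set z := Complex a b in vJ; set J := map_mx _ _ in vJ.
have col k : \sum_i v 0 i * J i k = z * v 0 k.
  by have := congr1 (fun w : 'rV[C]_4 => w 0 k) vJ; rewrite !mxE.
have JE i k : J i k = rc (jac (vfield zeta f eps) U i k) by rewrite mxE.
have c0 := col 0; have c1 := col 1; have c2 := col 2; have c3 := col 3.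
have S4 (F : 'I_4 -> C) : \sum_i F i = F 0 + F 1 + F 2 + F 3.
  rewrite !big_ord_recl big_ord0 addr0 !addrA.
  by congr (F _ + F _ + F _ + F _); exact: val_inj.
rewrite S4 !JE !jac_vfield /= !rmorph0 ?rmorph1 !mulr0 ?mulr1 ?add0r ?addr0 in c0.
rewrite S4 !JE !jac_vfield /= !rmorph0 ?rmorph1 !mulr0 ?mulr1 ?add0r ?addr0 in c1.
rewrite S4 !JE !jac_vfield /= !rmorph0 ?rmorph1 !mulr0 ?mulr1 ?add0r ?addr0 in c2.
rewrite S4 !JE !jac_vfield /= !rmorph0 ?rmorph1 !mulr0 ?mulr1 ?add0r ?addr0 in c3.
set p := U 0 0 in c0 c1 *; set q := U 1 0 in c0 c1 *.
set x := v 0 2 in c0 c1 c2 c3; set y := v 0 3 in c0 c1 c2 c3.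
rewrite c2 c3 in c0 c1.
have xy : (x != 0) || (y != 0).
  rewrite -negb_and; apply: contraNN v0 => /andP[/eqP x0 /eqP y0].
  apply/eqP/matrixP => i j; rewrite ord1 mxE.
  case: j => [[|[|[|[|//]]]] hj].
  - by rewrite (_ : Ordinal hj = 0) ?c2 ?x0 ?mulr0//; exact: val_inj.
  - by rewrite (_ : Ordinal hj = 1) ?c3 ?y0 ?mulr0//; exact: val_inj.
  - by rewrite (_ : Ordinal hj = 2) -/x ?x0//; exact: val_inj.
  - by rewrite (_ : Ordinal hj = 3) -/y ?y0//; exact: val_inj.
have [P' eP] : exists P' : R, P' = zeta - 2 * (p ^+ 2 + q ^+ 2) by eexists.
have [m em] : exists m : R, m = p ^+ 2 + q ^+ 2 by eexists.
pose P : C := rc P'; pose M := rc m.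
have key : (z ^+ 2 - P) ^+ 2 = M ^+ 2 - rc eps ^+ 2.
  pose k1 := rc (zeta - 3 * p ^+ 2 - q ^+ 2); pose k2 := rc (- eps - 2 * p * q).
  pose k3 := rc (eps - 2 * p * q); pose k4 := rc (zeta - p ^+ 2 - 3 * q ^+ 2).
  have e1 : (z ^+ 2 - k1) * x = k2 * y.
    by apply/eqP; rewrite -subr_eq0; apply/eqP; move: c0; rewrite -/k1 -/k2 => c0;
       transitivity (z * (z * x) - (x * k1 + y * k2)); [ring|rewrite c0 subrr].
  have e2 : (z ^+ 2 - k4) * y = k3 * x.
    by apply/eqP; rewrite -subr_eq0; apply/eqP; move: c1; rewrite -/k3 -/k4 => c1;
       transitivity (z * (z * y) - (x * k3 + y * k4)); [ring|rewrite c1 subrr].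
  have det0 : (z ^+ 2 - k1) * (z ^+ 2 - k4) - k2 * k3 = 0.
    have dx : ((z ^+ 2 - k1) * (z ^+ 2 - k4) - k2 * k3) * x = 0.
      transitivity ((z ^+ 2 - k4) * ((z ^+ 2 - k1) * x) - k2 * (k3 * x)); first by ring.
      by rewrite e1 -e2; ring.
    have dy : ((z ^+ 2 - k1) * (z ^+ 2 - k4) - k2 * k3) * y = 0.
      transitivity ((z ^+ 2 - k1) * ((z ^+ 2 - k4) * y) - k3 * (k2 * y)); first by ring.
      by rewrite e2 -e1; ring.
    case/orP: xy => n0; apply/eqP; [move/eqP: dx|move/eqP: dy];
      by rewrite mulf_eq0 (negbTE n0) orbF.
  apply/eqP; rewrite -subr_eq0 -det0 /k1 /k2 /k3 /k4 /P /M eP em; apply/eqP.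
  rewrite !(rmorphB, rmorphD, rmorphM, rmorphXn, rmorphN, rmorph_nat)/=; ring.
move: key; rewrite /z /P /M /=.
have m0 : 0 <= m by rewrite em addr_ge0 ?sqr_ge0.
rewrite -em.
move=> /eqP; rewrite !expr2 eq_complex /= => /andP[/eqP hr /eqP hi].
set X := a * a - b * b - P' in hr hi.
have ab : 0 < a * b by rewrite mulr_gt0.
have X0 : X = 0.
  have : X * (a * b) = 0 by move: hi; rewrite /X; lra.
  by move/eqP; rewrite mulf_eq0 (gt_eqF ab) orbF => /eqP.
have : m * m < eps * eps.
  have : m * m - eps * eps = X * X - 4 * (a * b) * (a * b) by move: hr; rewrite /X; lra.
  by rewrite X0; have := mulr_gt0 ab ab; lra.
by rewrite -!expr2 ltr_pXn2r// nnegrE// ltW.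
Qed.

Lemma cont_bounded (g : R -> R) (l Y : R) : continuous g ->
  (forall x, Y <= `|x| -> `|g x - l| <= 1) -> exists M, forall x, `|g x| <= M.
Proof.
move=> cg h; have cn : continuous (fun x => `|g x|) by apply: cont_comp cg; exact: cont_norm.
have [c _ hc] := @EVT_max R (fun x => `|g x|) (- `|Y|) `|Y|
  (ltac:(by apply: (@le_trans _ _ 0); rewrite ?oppr_le0)) (continuous_subspaceT cn).
exists (Num.max `|g c| (`|l| + 1)) => x; case: (leP `|x| `|Y|) => hx.
  by rewrite le_max hc// in_itv/= -ler_norml.
rewrite le_max; apply/orP; right.
have := h x (le_trans (ler_norm Y) (ltW hx)).
have := ler_normD (g x - l) l; rewrite subrK; lra.
Qed.

Definition upos (U : 'cV[R]_4) : 'cV[R]_2 := \col_(i < 2) U (lshift 2 i) 0.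

Lemma homoclinic_near u Uinf : homoclinic zeta f eps (phase u) Uinf ->
  near_inf u (upos Uinf).
Proof.
move=> [_ _ [h1 h2] _] eta eta0.
have E i x : u x i 0 = phase u x (lshift 2 i) 0 by exact: (esym (col_mxEu (u x) (derive1 u x) i 0)).
have cc (F : set_system R) (FF : Filter F) : phase u x @[x --> F] --> Uinf ->
    \forall x \near F, forall i, `|u x i 0 - upos Uinf i 0| <= eta.
  move=> hc.
  have q i : \forall x \near F, `|u x i 0 - upos Uinf i 0| <= eta.
    have : phase u x (lshift 2 i) 0 @[x --> F] --> Uinf (lshift 2 i) 0.
      by apply: (@cvg_comp _ _ _ _ (fun M : 'cV[R]_4 => M (lshift 2 i) 0) _ _ _ hc);
        exact: coord_continuous.
    move=> /cvgr_dist_le/(_ eta eta0); apply: filterS => x.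
    by move=> H; rewrite E distrC [upos _ _ _]mxE.
  by apply: filter_forall.
have [Y1 [_ hY1]] := cc _ _ h1; have [Y2 [_ hY2]] := cc _ _ h2.
exists (`|Y1| + `|Y2| + 1) => x hx i.
have n1 := ler_norm Y1; have n2 := ler_norm (- Y2); rewrite normrN in n2.
have p1 := normr_ge0 Y1; have p2 := normr_ge0 Y2.
case: (ger0P x) hx => x0 hx; first by apply: hY1; lra.
by apply: hY2; lra.
Qed.

Lemma stationary_cont u i : stationary zeta f eps u -> continuous (fun x => u x i 0).
Proof.
move=> [d _ _] x.
have cu : {for x, continuous u} by apply: differentiable_continuous; exact/derivable1_diffP.
exact: (@cvg_comp _ _ _ u (fun M : 'cV[R]_2 => M i 0) _ _ _ cu (@coord_continuous _ _ _ i 0 _)).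
Qed.

Lemma nice_of u a : stationary zeta f eps u -> near_inf u a -> exists M, nice u M.
Proof.
move=> st na; have [Y hY] := na 1 ltr01.
have b i := cont_bounded (@stationary_cont u i st) (fun x hx => hY x hx i).
have [M0 h0] := b 0; have [M1 h1] := b 1; exists (Num.max M0 M1); split.
  by move=> i; apply: continuous_measurable_fun; exact: stationary_cont.
move=> x [[|[|//]] hi]; rewrite le_max.
  by rewrite (_ : Ordinal hi = 0) ?h0//; exact: val_inj.
by rewrite (_ : Ordinal hi = 1) ?h1 ?orbT//; exact: val_inj.
Qed.

Lemma nice_bounded u M : nice u M -> [bounded u x | x in [set: R]].
Proof.
move=> [_ h]; exists M; split; first exact: num_real.
move=> M' MM' x _; change (mx_norm (u x) <= M'); rewrite mx_normrE.
apply: bigmax_le => [|[i j] _].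
  by apply: ltW; apply: le_lt_trans MM'; exact: le_trans (h 0 0).
by rewrite (ord1 j); apply: le_trans (h x i) (ltW MM').
Qed.

Lemma far_of u a (g : R) : near_inf u a -> 0 < g -> a 0 0 ^+ 2 + a 1 0 ^+ 2 + 2 * g <= eps ->
  exists2 Y, 0 < Y & forall x, Y < `|x| -> u x 0 0 ^+ 2 + u x 1 0 ^+ 2 <= eps - g.
Proof.
move=> na g0 ha; pose A := `|a 0 0| + `|a 1 0| + 1.
have A0 : 0 < A by rewrite ltr_wpDl.
pose t := Num.min 1 (g / (4 * A)).
have t0 : 0 < t by rewrite lt_min ltr01 divr_gt0// mulr_gt0.
have t1 : t <= 1 by rewrite ge_min lexx.
have t2 : t * (4 * A) <= g by rewrite -ler_pdivlMr ?mulr_gt0// ge_min lexx orbT.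
have [Y hY] := na t t0; exists (`|Y| + 1); first by rewrite ltr_wpDl.
move=> x hx; have hx' : Y <= `|x| by have := ler_norm Y; lra.
have sq (v w : R) : `|v - w| <= t -> `|w| <= A - 1 -> v ^+ 2 <= w ^+ 2 + t * (2 * `|w|) + t * t.
  move=> h1 _; have -> : v ^+ 2 = w ^+ 2 + 2 * (w * (v - w)) + (v - w) ^+ 2 by ring.
  have q1 : w * (v - w) <= `|w| * t.
    by apply: le_trans (ler_norm _) _; rewrite normrM ler_wpM2l.
  have q2 : (v - w) ^+ 2 <= t * t by rewrite -real_normK ?num_real// expr2 ler_pM.
  lra.
have := sq _ _ (hY x hx' 0) (ltac:(rewrite /A; have := normr_ge0 (a 1 0); lra)).
have := sq _ _ (hY x hx' 1) (ltac:(rewrite /A; have := normr_ge0 (a 0 0); lra)).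
have : t * t <= t by rewrite ler_piMr// ltW.
by move: t2; rewrite /A; lra.
Qed.

(* A function with a nonzero limit at infinity is not square integrable. *)
Lemma L2_limit u a b : near_inf u a -> (forall i, L2 (fun x => u x i 0 - b i 0)) -> a = b.
Proof.
move=> na hL; apply/matrixP => i j; rewrite (ord1 j); apply/eqP; apply/negPn/negP => ab.
pose d := `|a i 0 - b i 0|; have d0 : 0 < d by rewrite normr_gt0 subr_eq0.
have [Y hY] := na (d / 2) (ltac:(by rewrite divr_gt0)).
pose F x := u x i 0 - b i 0; have LF : L2 F := hL i.
have I0 : integ (fun x => F x * F x) := L2_mul LF LF.
pose n := 4 * ip F F / d ^+ 2 + 1.
have n0 : 0 <= n by rewrite addr_ge0 ?divr_ge0 ?sqr_ge0 ?mulr_ge0 ?ip_ge0.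
have [ii iv] := @int_indic_itv R `|Y| (`|Y| + n) (ltac:(by rewrite lerDl)).
have : d ^+ 2 / 4 * n <= ip F F.
  have -> : n = (`|Y| + n) - `|Y| by rewrite addrC addKr.
  rewrite -iv -intZ//; apply: int_le => [||x]; [exact: integZ|exact: I0|].
  rewrite indicE mem_setE in_itv/=; case: (boolP (_ && _)) => [/andP[hx _]|_]; last first.
    by rewrite mulr0 -expr2 sqr_ge0.
  rewrite mulr1 -expr2 -(real_normK (num_real (F x))).
  have -> : d ^+ 2 / 4 = (d / 2) ^+ 2 by field.
  rewrite ler_pXn2r ?nnegrE ?divr_ge0 ?(ltW d0)//.
  have := hY x (le_trans (ler_norm Y) (le_trans hx (ler_norm x))) i.
  have : d <= `|F x| + `|u x i 0 - a i 0|.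
    have -> : d = `|F x - (u x i 0 - a i 0)| by rewrite /d /F; congr (`|_|); ring.
    exact: ler_normB.
  lra.
rewrite /n mulrDr mulr1.
have -> : d ^+ 2 / 4 * (4 * ip F F / d ^+ 2) = ip F F by field; rewrite gt_eqF.
have : 0 < d ^+ 2 / 4 by rewrite divr_gt0// exprn_gt0.
by move: (ip F F) => w; lra.
Qed.

End Pulses.

(** * Superpositions of well separated pulses, seen through cutoffs *)

Section Superposition.
Variable R : realType.
Local Notation C := R[i].
Implicit Types (u : R -> 'cV[R]_2) (a b : 'cV[R]_2).

Lemma mpot_lip (zeta eps : R) a b (M t : R) :
  (forall i, `|a i 0| <= M) -> (forall i, `|b i 0| <= M) ->
  (forall i, `|a i 0 - b i 0| <= t) ->
  forall i j, `|mpot zeta eps a i j - mpot zeta eps b i j| <= 8 * M * t.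
Proof.
move=> ha hb hab.
have M0 : 0 <= M := le_trans (normr_ge0 _) (ha 0).
have pr i j : `|a i 0 * a j 0 - b i 0 * b j 0| <= 2 * (M * t).
  have -> : a i 0 * a j 0 - b i 0 * b j 0 = a i 0 * (a j 0 - b j 0) + (a i 0 - b i 0) * b j 0 by ring.
  apply: le_trans (ler_normD _ _) _; rewrite !normrM.
  have h1 : `|a i 0| * `|a j 0 - b j 0| <= M * t by apply: ler_pM.
  have h2 : `|a i 0 - b i 0| * `|b j 0| <= M * t by rewrite mulrC; apply: ler_pM.
  lra.
have := pr 0 0; have := pr 0 1; have := pr 1 1; rewrite !ler_norml.
move=> /andP[? ?] /andP[? ?] /andP[? ?].
move=> [[|[|//]] ?] [[|[|//]] ?]; rewrite !mxE /= ler_norml; apply/andP; split; lra.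
Qed.

Lemma bell_far (X c x be : R) : 0 < be -> X ^+ 2 <= be * (x - c) ^+ 2 -> 0 < X -> bell X c x <= be.
Proof.
move=> b0 h X0; rewrite /bell invf_ple ?posrE ?ltr_wpDr ?sqr_ge0//.
apply: le_trans (_ : ((x - c) / X) ^+ 2 <= _); last by rewrite lerDr.
by rewrite exprMn exprVn ler_pdivlMr ?exprn_gt0// ler_pdivrMl.
Qed.

Lemma bell_near (X c x : R) : 1 - bell X c x <= ((x - c) / X) ^+ 2.
Proof.
rewrite /bell; set q := ((x - c) / X) ^+ 2; have q0 : 0 <= q by exact: sqr_ge0.
have p0 : 0 < 1 + q by rewrite ltr_wpDr.
have -> : 1 - (1 + q)^-1 = q / (1 + q) by field; rewrite gt_eqF.
by rewrite ler_pdivrMr// mulrDr mulr1 lerDl mulr_ge0.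
Qed.

Variables (I : finType) (P : I -> R -> 'cV[R]_2) (a : 'cV[R]_2) (M : R).
Hypotheses (nP : forall j, nice (P j) M) (infP : forall j, near_inf (P j) a)
  (ha : forall i, `|a i 0| <= M).

Let n : R := #|I|%:R.
Let n0 : 0 <= n. Proof. exact: ler0n. Qed.
Let M0 : 0 <= M. Proof. exact: le_trans (ha 0). Qed.

Lemma unif_inf eta : 0 < eta -> exists2 Y, 0 <= Y &
  forall j x, Y <= `|x| -> forall i, `|P j x i 0 - a i 0| <= eta.
Proof.
move=> eta0; have [Y hY] := choice (fun j => infP j eta0).
exists (\sum_j `|Y j|) => [|j x hx i]; first by apply: sumr_ge0.
apply: hY; apply: le_trans (ler_norm _) _; apply: le_trans hx.
by rewrite (bigD1 j)//= lerDl sumr_ge0.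
Qed.

(** Within $L/2$ of a centre all other pulses are near their end state, so [u] is near that pulse;
    beyond, its bell is small. As for the background: within $Y$ of a centre the bells add up to
    nearly 1, and away from it that pulse is near [a]. *)
Lemma superpose_cmp (e : R) (X0 : R) : 0 < e -> 1 <= X0 -> exists X eta L, [/\ X0 <= X, 0 < eta, 0 <= L &
  forall (c : I -> R) (u : R -> 'cV[R]_2),
   (forall j k, j != k -> L <= `|c j - c k|) ->
   (forall x i, `|u x i 0 - a i 0 - \sum_j (P j (x - c j) i 0 - a i 0)| <= eta) ->
   forall x i, (forall j, bell X (c j) x * `|P j (x - c j) i 0 - u x i 0| <= e) /\
     `|1 - \sum_j bell X (c j) x| * `|a i 0 - u x i 0| <= e].
Proof.
move=> e0 X01; have nn : 0 <= n by exact: n0.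
have MM0 : 0 <= M by exact: M0.
pose eta := e / (4 * (n + 1) ^+ 2); pose be := e / (4 * (n + 1) ^+ 2 * (1 + 2 * M)).
have n1 : 0 < (n + 1) ^+ 2 by rewrite exprn_gt0// ltr_wpDl.
have m1 : 0 < 1 + 2 * M by rewrite ltr_wpDr// mulr_ge0.
have eta0 : 0 < eta by rewrite divr_gt0// mulr_gt0.
have be0 : 0 < be by rewrite divr_gt0// mulr_gt0// mulr_gt0.
have eE : eta * (4 * (n + 1) ^+ 2) = e by rewrite /eta divfK// gt_eqF// mulr_gt0.
have bE : be * (1 + 2 * M) = eta.
  by rewrite /be /eta; field; rewrite !gt_eqF// ltr_wpDl.
have [Y Y0 hY] := unif_inf eta0.
(* So wide that a bell is still within [be] of 1 at distance [Y] from its centre. *)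
pose X := X0 + Y ^+ 2 * (2 * M + 1) / be.
have X1 : X0 <= X.
  by rewrite /X lerDl divr_ge0 ?(ltW be0)// mulr_ge0 ?sqr_ge0// addr_ge0// mulr_ge0.
have XX : 0 < X by lra.
have YX : (Y / X) ^+ 2 <= be.
  rewrite exprMn exprVn ler_pdivrMr ?exprn_gt0//.
  have q1 : Y ^+ 2 * (2 * M + 1) <= be * X.
    rewrite -ler_pdivrMl// mulrC /X; lra.
  have q2 : Y ^+ 2 <= Y ^+ 2 * (2 * M + 1) by rewrite ler_peMr ?sqr_ge0// lerDr mulr_ge0.
  have q3 : be * X <= be * X ^+ 2.
    by rewrite ler_pM2l// expr2 ler_peMl//; lra.
  lra.
(* Separation by [L] has two effects: a bell is at most [be] at distance $L/2$, and a pulse is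
   within [eta] of its end state there. *)
pose L := 2 * Y + 1 + 4 * X ^+ 2 / be.
have L1 : 1 <= L.
  by have : 0 <= 4 * X ^+ 2 / be by [rewrite divr_ge0 ?(ltW be0)// mulr_ge0 ?sqr_ge0]; rewrite /L; lra.
have LY : Y <= L / 2.
  by have : 0 <= 4 * X ^+ 2 / be by [rewrite divr_ge0 ?(ltW be0)// mulr_ge0 ?sqr_ge0]; rewrite /L; lra.
have LX : 4 * X ^+ 2 <= be * L ^+ 2.
  have q : 4 * X ^+ 2 <= be * L.
    rewrite -ler_pdivrMl// mulrC /L; lra.
  apply: le_trans q _; rewrite ler_pM2l// expr2 ler_peMl//; lra.
exists X, eta, L; split => //; first lra.
move=> c u sep hu x i.
pose D j := `|P j (x - c j) i 0 - a i 0|.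
have D0 j : 0 <= D j by exact: normr_ge0.
have D2 j : D j <= 2 * M.
  have := (nP j).2 (x - c j) i; have := ha i; have := ler_normB (P j (x - c j) i 0) (a i 0).
  rewrite /D; lra.
have far_bell j : L / 2 <= `|x - c j| -> bell X (c j) x <= be.
  move=> hx; apply: bell_far => //; rewrite -[(x - c j) ^+ 2]real_normK ?num_real//.
  have q : (L / 2) ^+ 2 <= `|x - c j| ^+ 2 by rewrite ler_pXn2r ?nnegrE//; lra.
  have := ler_wpM2l (ltW be0) q; rewrite (_ : (L / 2) ^+ 2 = L ^+ 2 / 4); [lra|by field].
have sepx j k : j != k -> `|x - c j| <= L / 2 -> L / 2 <= `|x - c k|.
  move=> jk hx; have := sep _ _ jk.
  have := ler_normB (x - c k) (x - c j).
  rewrite (_ : x - c k - (x - c j) = c j - c k); [lra|ring].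
have ua : `|u x i 0 - a i 0| <= eta + \sum_j D j.
  have := hu x i; set s := \sum_j _ => hs.
  have := ler_normD (u x i 0 - a i 0 - s) s; rewrite subrK => q; apply: le_trans q _.
  by apply: lerD => //; exact: ler_norm_sum.
have ksum (J : I -> R) t : (forall j, 0 <= J j <= t) -> \sum_j J j <= n * t.
  move=> h; apply: le_trans (ler_sum _ (_ : forall j, true -> J j <= t)) _.
    by move=> j _; case/andP: (h j).
  by rewrite sumr_const [leRHS]mulr_natl.
have neta : eta * (4 * n) + 4 * (eta * n ^+ 2) <= e.
  by rewrite -eE sqrrD !mulrDr mulr1 expr1n; have := mulr_ge0 (ltW eta0) n0; lra.
have eta_e : eta <= e / 4.
  rewrite -eE; have h : 1 <= (n + 1) ^+ 2 by rewrite -[leLHS](expr1n _ 2) ler_pXn2r ?nnegrE ?lerDr ?addr_ge0.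
  by have := ler_wpM2l (ltW eta0) h; lra.
have b0 j : 0 <= bell X (c j) x by have /andP[/ltW] := bell_itv X (c j) x.
have b1 j : bell X (c j) x <= 1 by have /andP[] := bell_itv X (c j) x.
have n2 : 0 <= eta * n ^+ 2 by rewrite mulr_ge0 ?sqr_ge0// ltW.
have en : 0 <= eta * n by rewrite mulr_ge0// ltW.
split.
  move=> j.
  have uP : `|P j (x - c j) i 0 - u x i 0| <= eta + \sum_(k | k != j) D k.
    have := hu x i; rewrite (bigD1 j)//= => hs.
    set s := \sum_(k | _) _ in hs.
    have -> : P j (x - c j) i 0 - u x i 0 =
       - ((u x i 0 - a i 0 - (P j (x - c j) i 0 - a i 0 + s)) + s) by ring.
    rewrite normrN; apply: le_trans (ler_normD _ _) _; apply: lerD => //.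
    exact: ler_norm_sum.
  have sumD t : (forall k, k != j -> D k <= t) -> 0 <= t -> \sum_(k | k != j) D k <= n * t.
    move=> h t0; rewrite big_mkcond; apply: ksum => k.
    by case: eqP => [_|/eqP kj]; rewrite ?lexx ?t0// D0 h.
  have nn0 := normr_ge0 (P j (x - c j) i 0 - u x i 0).
  case: (leP `|x - c j| (L / 2)) => hx.
    have hD : \sum_(k | k != j) D k <= n * eta.
      apply: sumD (ltW eta0) => k kj; apply: hY; apply: le_trans LY _.
      by apply: sepx hx; rewrite eq_sym.
    have := ler_wpM2r nn0 (b1 j); rewrite mul1r; lra.
  have hD : \sum_(k | k != j) D k <= n * (2 * M).
    by apply: sumD => //; rewrite mulr_ge0.
  have fb := far_bell j (ltW hx).
  have q3 : be * (n * (2 * M)) <= eta * n.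
    rewrite mulrCA [eta * n]mulrC ler_wpM2l// -bE ler_pM2l//; lra.
  apply: le_trans (ler_wpM2l (b0 j) uP) _; rewrite mulrDr.
  have q1 := ler_wpM2r (ltW eta0) (b1 j).
  have q2 : bell X (c j) x * (\sum_(k | k != j) D k) <= be * (n * (2 * M)).
    by apply: ler_pM => //; apply: sumr_ge0.
  lra.
have S1 : `|1 - \sum_j bell X (c j) x| <= 1 + n.
  apply: le_trans (ler_normB _ _) _; rewrite normr1 lerD2l ger0_norm ?sumr_ge0//.
  by rewrite -[n]mulr1; apply: ksum => j; rewrite b0 b1.
have be2 : be * (2 * M) <= eta by rewrite -bE ler_pM2l//; lra.
(* Of the two factors, the second is small at distance at least [Y] from the centre, the first at
   smaller distance. *)
have Bk k : `|1 - \sum_j bell X (c j) x| * D k <= (1 + n) * eta.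
  case: (leP Y `|x - c k|) => hx; first by apply: ler_pM => //; exact: hY.
  have hx' : `|x - c k| <= L / 2 by apply: ltW; exact: lt_le_trans LY.
  have q : `|1 - \sum_j bell X (c j) x| <= (1 + n) * be.
    rewrite (bigD1 k)//= opprD addrA; apply: le_trans (ler_normB _ _) _.
    rewrite mulrDl mul1r; apply: lerD.
      rewrite ger0_norm ?subr_ge0//; apply: le_trans (bell_near _ _ _) _.
      apply: le_trans YX; rewrite exprMn [leRHS]exprMn ler_wpM2r ?sqr_ge0//.
      by rewrite -(real_normK (num_real (x - c k))) ler_pXn2r ?nnegrE// ltW.
    rewrite ger0_norm ?sumr_ge0// big_mkcond; apply: ksum => j.
    case: eqP => [_|/eqP jk]; first by rewrite lexx ltW.
    by rewrite b0; apply: far_bell; apply: sepx hx'; rewrite eq_sym.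
  apply: le_trans (ler_pM (normr_ge0 _) (D0 k) q (D2 k)) _.
  by rewrite -mulrA ler_wpM2l//; lra.
rewrite (distrC (a i 0)); apply: le_trans (ler_wpM2l (normr_ge0 _) ua) _.
rewrite mulrDr mulr_sumr.
have q1 := ler_wpM2r (ltW eta0) S1.
have q2 : \sum_j `|1 - \sum_k bell X (c k) x| * D j <= n * ((1 + n) * eta).
  by apply: ksum => j; rewrite Bk andbT mulr_ge0.
have : 4 * ((1 + n) * eta + n * ((1 + n) * eta)) = e by rewrite -eE; ring.
have : 0 <= (1 + n) * eta by rewrite mulr_ge0 ?(ltW eta0)//; lra.
have : 0 <= n * ((1 + n) * eta) by rewrite mulr_ge0// mulr_ge0 ?(ltW eta0)//; lra.
lra.
Qed.

(* The cutoffs select one pulse each, and [1 - \sum_j bell] the background. *)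
Lemma superpose (zeta eps M' d : R) : 0 < d -> M <= M' -> exists X eta L,
  [/\ 1 <= X, 10 / X <= d, 0 < eta & 0 <= L] /\
  forall (c : I -> R) (u : R -> 'cV[R]_2),
   (forall x i, `|u x i 0| <= M') ->
   (forall j k, j != k -> L <= `|c j - c k|) ->
   (forall x i, `|u x i 0 - a i 0 - \sum_j (P j (x - c j) i 0 - a i 0)| <= eta) ->
   (forall j x i k, `|bell X (c j) x *
      (mpot zeta eps (P j (x - c j)) i k - mpot zeta eps (u x) i k)| <= d) /\
   (forall x i k, `|(1 - \sum_j bell X (c j) x) *
      (mpot zeta eps a i k - mpot zeta eps (u x) i k)| <= d).
Proof.
move=> d0 MM; have M'0 : 0 <= M' := le_trans M0 MM.
pose K := 8 * M' + 1; have K0 : 0 < K by rewrite /K; lra.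
have [||X [eta [L [h1 h2 h3 h4]]]] := @superpose_cmp (d / K / 2) (1 + 10 / d).
- by rewrite !divr_gt0.
- by rewrite lerDl divr_ge0// ltW.
have i10 : 0 <= 10 / d by rewrite divr_ge0// ltW.
exists X, eta, L; split.
  split => //; first by lra.
  rewrite ler_pdivrMr; last by lra.
  by rewrite -ler_pdivrMl// mulrC; lra.
move=> c u hu sep he; have H x i := h4 c u sep he x i.
have dK : 8 * M' * (d / K / 2 + d / K / 2) <= d.
  rewrite -splitr mulrA ler_pdivrMr// mulrC ler_wpM2l ?(ltW d0)// /K; lra.
have fin (w t : R) (p q : 'cV[R]_2) : (forall i, `|p i 0| <= M') -> (forall i, `|q i 0| <= M') ->
    (forall i, `|w| * `|p i 0 - q i 0| <= d / K / 2) ->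
    forall i k, `|w * (mpot zeta eps p i k - mpot zeta eps q i k)| <= d.
  move=> hp hq hw i k; rewrite normrM.
  pose s := `|p 0 0 - q 0 0| + `|p 1 0 - q 1 0|.
  have hs l : `|p l 0 - q l 0| <= s.
    case: l => [[|[|//]] hl]; first by rewrite (_ : Ordinal hl = 0) ?lerDl//; exact: val_inj.
    by rewrite (_ : Ordinal hl = 1) ?lerDr//; exact: val_inj.
  apply: le_trans (ler_wpM2l (normr_ge0 w) (mpot_lip zeta eps hp hq hs i k)) _.
  apply: le_trans dK; rewrite mulrCA; apply: ler_wpM2l; first by rewrite mulr_ge0.
  by rewrite mulrDr; apply: lerD.
have hPM j x i : `|P j x i 0| <= M' := le_trans ((nP j).2 x i) MM.
split=> [j x|x].
  apply: (fin _ 0) => [i|i|i]; [exact: hPM|exact: hu|].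
  have /andP[b0 _] := bell_itv X (c j) x; rewrite (ger0_norm (ltW b0)).
  by have [q _] := H x i; exact: q.
apply: (fin _ 0) => [i|i|i]; [exact: le_trans (ha i) MM|exact: hu|].
by have [_ q] := H x i.
Qed.

End Superposition.

(** * Spectral consequences for families of glued pulses *)

Section Family.
Variable R : realType.
Local Notation C := R[i].
Local Notation normc := (@Normc.normc R).
Local Notation V := (R -> 'cV[C]_2).
Local Notation l2 := (l2 R).
Local Notation NH := (@NH R).
Local Notation GH := (@GH R).
Let sn := @NH_seminorm R.

Variables (zeta eps : R) (I : finType) (P : I -> R -> 'cV[R]_2) (a : 'cV[R]_2) (M M' g : R).
Local Notation mp u := (fun x : R => mpot zeta eps (u x)).
Hypotheses (nP : forall j, nice (P j) M) (infP : forall j, near_inf (P j) a)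
  (ha : forall i, `|a i 0| <= M) (MM : M <= M') (g0 : 0 < g)
  (hg : a 0 0 ^+ 2 + a 1 0 ^+ 2 + 2 * g <= eps).
(* [fam k u]: [u] is a member of the family all of whose indices are at least [k]. *)
Variable fam : nat -> (R -> 'cV[R]_2) -> Prop.
Hypotheses (famS : forall k k' u, (k <= k')%N -> fam k' u -> fam k u)
  (famN : forall u, fam 1 u -> nice u M' /\ exists2 Y, 0 < Y &
    forall x, Y < `|x| -> u x 0 0 ^+ 2 + u x 1 0 ^+ 2 <= eps - g)
  (famP : forall eta L : R, 0 < eta -> 0 <= L -> exists k, forall u, fam k u ->
    exists c : I -> R, (forall j k, j != k -> L <= `|c j - c k|) /\
     (forall x i, `|u x i 0 - a i 0 - \sum_j (P j (x - c j) i 0 - a i 0)| <= eta)).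

Let geps : g <= eps.
Proof. have := sqr_ge0 (a 0 0); have := sqr_ge0 (a 1 0); have := hg; have := g0; lra. Qed.

Let nM u (N N' : R) : N <= N' -> nice u N -> nice u N'.
Proof. by move=> h [m b]; split=> // x i; apply: le_trans h. Qed.

Let nP' j : nice (P j) M'. Proof. exact: nM (nP j). Qed.

Let nA : nice (fun=> a) M'.
Proof. by split=> [i|x i]; [exact: measurable_cst|exact: le_trans (ha i) MM]. Qed.

Let bmp u : nice u M' -> bmx (mp u) (bigB zeta eps M').
Proof. exact: mpot_bmx. Qed.

Let B0 : 0 <= bigB zeta eps M'.
Proof. by rewrite /bigB !addr_ge0// mulr_ge0// sqr_ge0. Qed.

Lemma LB_weak (m : R -> 'M[R]_2) z (c c' : R) : c' <= c -> LB m z c -> LB m z c'.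
Proof.
move=> h lb w w1 w2 hw; apply: le_trans (lb _ _ _ hw).
by apply: ler_wpM2r => //; exact: N2_ge0.
Qed.

(** The inverse of $1+\sum_j1/F_j$, which serves also for an empty index type. *)
Lemma common_pos (J : finType) (F : J -> R) : (forall j, 0 < F j) ->
  exists2 c, 0 < c & forall j, c <= F j.
Proof.
move=> h; have s0 : 0 <= \sum_j (F j)^-1 by apply: sumr_ge0 => j _; rewrite invr_ge0 ltW.
exists (1 + \sum_j (F j)^-1)^-1 => [|j]; first by rewrite invr_gt0 ltr_wpDr.
rewrite invf_ple ?posrE ?ltr_wpDr//.
rewrite (bigD1 j)//= addrCA lerDl addr_ge0//.
by apply: sumr_ge0 => k _; rewrite invr_ge0 ltW.
Qed.

(** For the constant end state the symmetric part is bounded by $-g$ at every point, so the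
    dissipative estimate applies without a compact perturbation. *)
Lemma LB_background z : - g < complex.Re z -> exists2 c, 0 < c & LB (mp (fun=> a)) z c.
Proof.
move=> hz; have d0 : 0 < g + complex.Re z by move: hz; lra.
have bm := bmp nA.
have q : forall (x : R) p, rip (cplx (mpot zeta eps a - Jmx) *m p) p - complex.Re z * rip p p
    <= - (g + complex.Re z) * rip p p.
  move=> x p; have := mpot_quad zeta eps a p; have p0 := rip_ge0 p.
  have e : a 0 0 ^+ 2 + a 1 0 ^+ 2 - eps <= - g by move: hg g0; lra.
  have := ler_wpM2r p0 e; lra.
have be := dissip (bmxJ bm) d0 (lexx _) q.
set c := (1 + _)^-1 in be; have c0 : 0 < c.
  rewrite invr_gt0 ltr_wpDr// divr_ge0 ?(ltW d0)// addr_ge0 ?normc_ge0// mulr_ge0// addr_ge0//.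
exists c => //; apply/(LB_l2 z c bm) => y; apply: le_trans (be y).
by rewrite ler_wpM2l ?(ltW c0)//; have := GH_bdd y; rewrite mul1r.
Qed.

Lemma LB_regular u z : nice u M' -> regular zeta eps u z -> exists2 c, 0 < c & LB (mp u) z c.
Proof. by move=> nu [_ _ [c c0 h]]; exists c => //; apply/(LB_l2 z c (bmp nu)). Qed.

Lemma LB_inj u z (c : R) : nice u M' -> 0 < c -> LB (mp u) z c -> inj0 NH (opT (mp u) z).
Proof.
move=> nu c0 /(LB_l2 z c (bmp nu)) h y hy; apply: (opT_ker (bmp nu) hy).
by apply: (sn_eq0 sn); have := h y; rewrite hy pmulr_rle0.
Qed.

Lemma family_bells (d : R) : 0 < d -> exists X k, [/\ 1 <= X, 10 / X <= d &
  forall u, fam k u -> nice u M' -> exists c : I -> R,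
   (forall j x i k, `|bell X (c j) x *
      (mpot zeta eps (P j (x - c j)) i k - mpot zeta eps (u x) i k)| <= d) /\
   (forall x i k, `|(1 - \sum_j bell X (c j) x) *
      (mpot zeta eps a i k - mpot zeta eps (u x) i k)| <= d)].
Proof.
move=> d0; have [X [eta [L [[h1 h2 h3 h4] h]]]] := superpose nP infP ha zeta eps d0 MM.
have [k hk] := famP h3 h4; exists X, k; split => // u /hk[c [sep err]] [_ hu].
by exists c; apply: h.
Qed.

(** [localize] with bells around the pulses: the constants depend on the pulses and on [z0] only, so
    one lower bound holds for all members with large indices and all [z] near [z0]. *)
Lemma family_LB z0 : - g < complex.Re z0 -> (forall j, regular zeta eps (P j) z0) ->
  exists rho k c, [/\ 0 < rho, 0 < c & forall u z, fam k.+1 u -> normc (z - z0) < rho ->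
    LB (mp u) z c].
Proof.
move=> hz reg; have [cb cb0 lbb] := LB_background hz.
have ex j : exists c, 0 < c /\ LB (mp (P j)) z0 c.
  by have [c c0 h] := LB_regular (nP' j) (reg j); exists c.
have [cj hcj] := choice ex.
have [c1 c10 hc1] := common_pos (fun j => (hcj j).1).
pose c0 := Num.min cb c1; have c00 : 0 < c0 by rewrite lt_min cb0.
pose K := 16 * (#|I|%:R + 1) * (1 + (2 + 2 * bigB zeta eps M' + normc z0)).
have nz := normc_ge0 z0.
have K0 : 0 < K.
  have b0 : 0 <= bigB zeta eps M' by exact: B0.
  have n0 : 0 <= #|I|%:R :> R by exact: ler0n.
  by rewrite /K; apply: mulr_gt0; [apply: mulr_gt0 => //|]; lra.
(* The tolerance at which [localize] absorbs its errors; it also serves as the radius around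
   [z0]. *)
pose d := Num.min 1 (c0 / K).
have d0 : 0 < d by rewrite lt_min ltr01 divr_gt0.
have d1 : d <= 1 by rewrite ge_min lexx.
have dK : d * K <= c0 by rewrite -ler_pdivlMr// ge_min lexx orbT.
have [X [k [X1 Xd hk]]] := family_bells d0.
exists d, k, (c0 / (20 * #|I|%:R + 2)); split; [exact: d0| |move=> u z fu hzz].
  by rewrite divr_gt0// ltr_wpDl ?mulr_ge0 ?ler0n.
have [nu _] := famN (famS (ltn0Sn k) fu).
have [c [e1 e2]] := hk u (famS (leqnSn k) fu) nu.
apply: (@localize R I (fun j x => mpot zeta eps (P j (x - c j))) (mp u) (mp (fun=> a))
   (fun j => bell X (c j)) (fun j => bell1 X (c j)) (fun j => bell2 X (c j))
   (bigB zeta eps M') c0 d z0 z).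
- exact: c00.
- by rewrite d1 ltW.
- exact: bmp.
- move=> j; have [b1 b2] := bmp (nP' j); split=> [i l|x]; last exact: b2.
  exact: measurableT_comp (b1 i l) (shift_measurable _).
- exact: bmp nA.
- move=> j; have [q1 q2 q3 q4] := bell_cutoff (c j) X1; split=> // x.
  by have [? ? ?] := q4 x; split => //; exact: le_trans Xd.
- exact: e1.
- exact: e2.
- move=> j; apply: (LB_shift (c j) (bmp (nP' j))); apply: LB_weak (hcj j).2.
  by apply: le_trans (hc1 j); rewrite ge_min lexx orbT.
- by apply: LB_weak lbb; rewrite ge_min lexx.
- exact: ltW.
- exact: dK.
Qed.

Lemma fam_inj_regular u z : fam 1 u -> - g < complex.Re z -> inj0 NH (opT (mp u) z) ->
  regular zeta eps u z.
Proof.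
move=> /famN[nu [Y Y0 far]] hz.
exact: (inj_regular nu Y0 geps far hz).
Qed.

(** On the bounded part of the region [family_LB] and compactness give one threshold for the
    indices; outside, either the real part exceeds $2M'^2$ ([inj_right]) or the imaginary part is
    large ([hf_inj]). Injectivity yields regularity by the Fredholm alternative. *)
Lemma family_regular (tau del : R) : 0 < tau -> tau < g -> 0 < del ->
  (forall j z, - tau <= complex.Re z -> z != 0 -> regular zeta eps (P j) z) ->
  exists k, forall u z, fam k.+1 u -> - tau <= complex.Re z -> del <= normc z ->
    regular zeta eps u z.
Proof.
move=> t0 tg del0 reg; pose al := eps - tau.
have al0 : 0 < al by rewrite subr_gt0; exact: lt_le_trans geps.
(* A bound for the threshold of [hf_inj] over the whole strip $-\tau\le\operatorname{Re}z\le2M'^2$.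
   The radius [r] forces $|\operatorname{Im}z|\ge K_1$ on the part of the strip outside the disc. *)
pose K1 := 1 + 4 * M' ^+ 2 + `|zeta| + 32 * M' ^+ 4 / al + (eps + 2 * M' ^+ 2) / 2.
pose r := 2 * M' ^+ 2 + tau + `|K1|.
have [|k hk] := @disc_unif R (fun n z => forall u, fam n.+1 u -> - tau <= complex.Re z ->
    del <= normc z -> inj0 NH (opT (mp u) z)) 0 r.
  move=> z _; case: (ltP (complex.Re z) (- tau)) => h1.
    exists (- tau - complex.Re z), 0%N; split; first by rewrite subr_gt0.
    move=> n z' _ hz' u _ hr _; exfalso.
    by have := Re_normc (z' - z); have := ler_norm (complex.Re (z' - z)); rewrite ReB; lra.
  case: (ltP (normc z) del) => h2.
    exists (del - normc z), 0%N; split; first by rewrite subr_gt0.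
    move=> n z' _ hz' u _ _ hr; exfalso.
    by have := le_normcD (z' - z) z; rewrite subrK; lra.
  have z0 : z != 0 by apply: contraTneq h2 => ->; rewrite Normc.normc0 -ltNge.
  have [||rho [k [c [rho0 c0 h]]]] := @family_LB z.
  - by apply: lt_le_trans h1; rewrite ltrN2.
  - by move=> j; exact: reg.
  exists rho, k; split; first exact: rho0.
  move=> n z' kn hz' u fu _ _.
  have [nu _] := famN (famS (ltn0Sn n) fu).
  by apply: (LB_inj nu c0); exact: h (famS _ fu) hz'.
exists k => u z fu hz hd; have fu1 := famS (ltn0Sn k) fu; have [nu _] := famN fu1.
apply: (fam_inj_regular fu1); first by apply: lt_le_trans hz; rewrite ltrN2.
case: (ltP (2 * M' ^+ 2) (complex.Re z)) => hM.
  exact: (inj_right 0 nu g0 geps hM).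
case: (leP (normc z) r) => hr; first by apply: (hk k z (leqnn k) _ u fu hz hd); rewrite subr0.
have al1 : al <= eps + complex.Re z by rewrite /al; lra.
have al2 : 0 < eps + complex.Re z := lt_le_trans al0 al1.
have hI : K1 <= `|complex.Im z|.
  have : normc z <= `|complex.Re z| + `|complex.Im z| by exact: normc_part.
  have : `|complex.Re z| <= 2 * M' ^+ 2 + tau.
    by have := sqr_ge0 M'; rewrite ler_norml => ?; apply/andP; split; lra.
  have := ler_norm K1; move: hr; rewrite /r; lra.
have hq : 1 + 4 * M' ^+ 2 - zeta + 32 * M' ^+ 4 / (eps + complex.Re z) +
    (eps + complex.Re z) / 2 <= K1.
  have q1 : 32 * M' ^+ 4 / (eps + complex.Re z) <= 32 * M' ^+ 4 / al.
    apply: ler_wpM2l; last by rewrite lef_pV2.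
    by rewrite mulr_ge0// (_ : 4 = 2 * 2)%N// exprM sqr_ge0.
  have := ler_norm (- zeta); rewrite normrN /K1; lra.
case: (ger0P (complex.Im z)) hI => _ hI.
  by apply: (@hf_inj R zeta eps u M' 1 z) => //; rewrite ?normr1// mul1r; exact: le_trans hI.
by apply: (@hf_inj R zeta eps u M' (-1) z) => //; rewrite ?normrN1// mulN1r; exact: le_trans hI.
Qed.

(** Were a member with large indices regular on the right half-plane, the lower bound on a ring
    around [zs] would extend to [zs] by [max_principle], against the approximate eigenfunction made
    from the pulse [i0]. *)
Lemma family_unstable i0 zs : 0 < complex.Re zs -> ~ regular zeta eps (P i0) zs ->
  exists k, forall u, fam k.+1 u -> exists2 z, 0 < complex.Re z & ~ regular zeta eps u z.
Proof.
move=> hzs nreg; have hzg : - g < complex.Re zs by move: g0; lra.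
have farP j : exists2 Y, 0 < Y & forall x, Y < `|x| -> P j x 0 0 ^+ 2 + P j x 1 0 ^+ 2 <= eps - g.
  exact: far_of (infP j) g0 hg.
have regP j z : - g < complex.Re z -> inj0 NH (opT (mp (P j)) z) -> regular zeta eps (P j) z.
  by have [Y Y0 far] := farP j; exact: (inj_regular (nP j) Y0 geps far).
have : ~ inj0 NH (opT (mp (P i0)) zs) by move=> h; apply: nreg; exact: regP.
move=> /existsNP[y /not_implyP[hy0 hy1]].
pose w : V := GH y; pose w1 : V := D1 (y : l2); pose w2 : V := fun x => GH y x - (y : l2) x.
have hw : H2v w w1 w2 by exact: H2v_GH.
have [Lw Lw1 Lw2] := H2v_VL2 hw.
have e0 : N2 (opL (mp (P i0)) zs w w2) = 0.
  rewrite -hy0 NHE; congr N2; apply/funext => x.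
  by rewrite (opT_E _ _ _ (bmp (nP' i0))).
pose S := N2 (smul (bell 1 0) w).
(* A bell vanishes nowhere, so the window does not annihilate the eigenfunction. *)
have S0 : 0 < S.
  rewrite lt_neqAle N2_ge0 andbT eq_sym; apply/eqP => S0; apply: hy1.
  apply: (opT_ker (bmp (nP' i0)) hy0); apply/NH0P.
  have Ls : VL2 (smul (bell 1 0) w).
    apply: (@VL2_smul R _ _ 1 _ _ Lw) => [|x].
      by apply: continuous_measurable_fun; exact: bell_cont.
    by have /andP[b0 b1] := bell_itv 1 0 x; rewrite ger0_norm// ltW.
  have := N2_eq0 Ls S0; apply: aeS => x /eqP.
  have /andP[b0 _] := bell_itv 1 0 x.
  by rewrite /smul scaler_eq0 fmorph_eq0 gt_eqF//= => /eqP.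
have pun j : exists rho, 0 < rho /\ forall z, 0 < normc (z - zs) < rho -> inj0 NH (opT (mp (P j)) z).
  have [Y Y0 far] := farP j.
  by have [rho r0 h] := inj_punctured zeta (nP j) Y0 g0 geps far hzg; exists rho.
have [rj hrj] := choice pun; have [r1 r10 hr1] := common_pos (fun j => (hrj j).1).
(* The closed disc lies in the open right half-plane, and all pulses are regular on it except
   possibly at [zs]. *)
pose r := Num.min r1 (complex.Re zs) / 2.
have r0 : 0 < r by rewrite divr_gt0// lt_min r10.
have rr1 : r < r1.
  by have : Num.min r1 (complex.Re zs) <= r1 by [rewrite ge_min lexx]; rewrite /r; lra.
have rrs : r < complex.Re zs.
  by have : Num.min r1 (complex.Re zs) <= complex.Re zs by [rewrite ge_min lexx orbT]; rewrite /r; lra.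
have Rez z : normc (z - zs) <= r -> 0 < complex.Re z.
  move=> hz; have := Re_normc (z - zs); rewrite ReB.
  by have := ler_norm (- (complex.Re z - complex.Re zs)); rewrite normrN; lra.
have [|n0 hn0] := @disc_unif R (fun n z => forall u, fam n.+1 u -> r / 2 <= normc (z - zs) ->
    LB (mp u) z n.+1%:R^-1) zs r.
  move=> z hz; case: (ltP (normc (z - zs)) (r / 2)) => h1.
    exists (r / 2 - normc (z - zs)), 0%N; split; first by rewrite subr_gt0.
    move=> n z' _ hz' u _ hr; exfalso.
    by have := le_normcD (z' - z) (z - zs); rewrite addrA subrK; lra.
  have z0 : 0 < normc (z - zs) by apply: lt_le_trans h1; rewrite divr_gt0.
  have hzg' : - g < complex.Re z by have := Rez z hz; move: g0; lra.
  have [|rho [k [c [rho0 c0 h]]]] := family_LB hzg'.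
    move=> j; apply: regP => //; apply: (hrj j).2; rewrite z0 /=.
    by apply: le_lt_trans hz _; exact: lt_le_trans rr1 (hr1 j).
  exists rho, (maxn k (Num.truncn c^-1)); split; first exact: rho0.
  move=> n z' kn hz' u fu _.
  rewrite geq_max in kn; have /andP[kn1 kn2] := kn.
  apply: (@LB_weak _ _ c); last exact: h (famS _ fu) hz'.
  rewrite invf_ple ?posrE ?ltr0n//; apply: ltW; apply: lt_le_trans (Num.Theory.truncnS_gt _) _.
  by rewrite ler_nat ltnS.
pose c : R := n0.+1%:R^-1; have c0 : 0 < c by rewrite invr_gt0 ltr0n.
pose Q := 3 * N2 w + 2 * N2 w1.
have Q0 : 0 <= Q by rewrite addr_ge0// mulr_ge0// N2_ge0.
(* Then $dQ<cS$, whereas [approx_eigen] will give $cS\le dQ$. *)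
pose d := c * S / (2 * (Q + 1)).
have Q1 : 0 < 2 * (Q + 1) by rewrite mulr_gt0// ltr_wpDl.
have d0 : 0 < d by rewrite divr_gt0// mulr_gt0.
have [X [k1 [X1 Xd hk]]] := family_bells d0.
exists (maxn n0 k1) => u fu; apply: contrapT => hno.
have reg z : 0 < complex.Re z -> regular zeta eps u z.
  by move=> hz; apply: contrapT => h; apply: hno; exists z.
have fu1 : fam n0.+1 u by apply: famS fu; rewrite ltnS leq_maxl.
have [nu _] := famN (famS (ltn0Sn n0) fu1).
have [cc [e1 _]] := hk u (famS (leq_trans (leq_maxr n0 k1) (leqnSn _)) fu) nu.
have bu := bmp nu.
have LBu : LB (mp u) zs c.
  apply/(LB_l2 zs c bu) => y'; apply: (@max_principle R (mp u) _ zs r c bu r0).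
  - exact: c0.
  - by move=> z /Rez/reg[].
  - by move=> z /Rez/reg[].
  - move=> z /andP[h1 h2]; apply/(LB_l2 z c bu).
    exact: (hn0 n0 z (leqnn _) h2 u fu1 h1).
have e1' x i l : `|bell X (cc i0) x *
    (mpot zeta eps (u x) i l - mpot zeta eps (P i0 (x - cc i0)) i l)| <= d.
  by have := e1 i0 x i l; rewrite -[X in _ * X]opprB mulrN normrN.
have := approx_eigen hw e0 (bmp (nP' i0)) bu LBu (ltW c0) X1 Xd e1'.
rewrite -/S; have -> : 3 * d * N2 w + 2 * d * N2 w1 = d * Q by rewrite /Q; ring.
apply/negP; rewrite -ltNge /d mulrAC ltr_pdivrMr//.
by rewrite ltr_pM2l ?mulr_gt0//; lra.
Qed.

End Family.

(** * Norm comparisons, index thresholds, counting of eigenvalues, and positions of the pulses *)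

Section Bookkeeping.
Variable R : realType.
Local Notation C := R[i].
Local Notation normc := (@Normc.normc R).

Lemma enorm_ge (v : 'cV[R]_2) i : `|v i 0| <= enorm v.
Proof.
rewrite /enorm -sqrtr_sqr; apply: ler_wsqrtr.
by rewrite (bigD1 i)//= lerDl; apply: sumr_ge0 => j _; exact: sqr_ge0.
Qed.

Lemma kmin_ge n (k : 'I_n -> nat) (k0 : nat) :
  (k0%:R%:E <= kmin R k)%E -> forall i, (k0 <= k i)%N.
Proof.
move=> h i; have : (kmin R k <= (k i)%:R%:E)%E.
  by rewrite /kmin (bigD1 i)//= ge_min lexx.
by move=> /(le_trans h); rewrite lee_fin ler_nat.
Qed.

Lemma kmin_lb n (k : 'I_n -> nat) (k0 : nat) :
  (forall i, (k0 <= k i)%N) -> (k0%:R%:E <= kmin R k)%E.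
Proof.
move=> h; rewrite /kmin; elim/big_rec: _ => [|i x _ ih]; first exact: leey.
by rewrite le_min ih andbT lee_fin ler_nat.
Qed.

(** The value [K = +oo] is the minimum over an empty index set; the quotient is then 0. *)
Lemma err_le (C0 X : R) (K : \bar R) (k0 : nat) : 0 < C0 -> (0 < k0)%N ->
  (k0%:R%:E <= K)%E -> (X%:E <= C0%:E / K)%E -> X <= C0 / k0%:R.
Proof.
move=> c0 k00; have kp : 0 < k0%:R :> R by rewrite ltr0n.
case: K => [r| |] //=.
- rewrite lee_fin => h; have r0 := lt_le_trans kp h.
  rewrite inver gt_eqF// -EFinM lee_fin => q; apply: le_trans q _.
  by rewrite ler_pM2l// lef_pV2.
- by move=> _; rewrite invey mule0 lee_fin => q; apply: le_trans q _; rewrite divr_ge0 ?ltW.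
Qed.

Lemma near_inf_tends (u : R -> 'cV[R]_2) (a : 'cV[R]_2) : near_inf u a -> tends_to u a.
Proof.
move=> h; have q (F : set_system R) (FF : Filter F) :
    (forall Y : R, \forall x \near F, Y <= `|x|) -> u x @[x --> F] --> a.
  move=> hF; apply/cvgrPdist_le => e e0; have [Y hY] := h e e0.
  have := hF Y; apply: filterS => x /hY hx; change (mx_norm (a - u x) <= e); rewrite mx_normrE.
  apply: bigmax_le => [|[i j] _]; first exact: ltW.
  by rewrite (ord1 j) /= !mxE distrC.
split; apply: q => Y.
  exists `|Y|; split; first exact: num_real.
  by move=> x hx; apply: le_trans (ler_norm _) (le_trans (ltW hx) (ler_norm _)).
exists (- `|Y|); split; first exact: num_real.
move=> x hx; have := ler_norm Y; have := ler_norm (- x); rewrite normrN; lra.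
Qed.

Lemma count_disjoint (T : Type) (p q r : pred T) (s : seq T) :
  (forall x, ~~ (p x && q x)) -> (forall x, ~~ (p x && r x)) -> (forall x, ~~ (q x && r x)) ->
  (count p s + count q s + count r s <= size s)%N.
Proof.
move=> pq pr qr; elim: s => //= x s ih.
rewrite (addnACA (p x)) (addnACA (p x + q x)%N) -[(size s).+1]add1n leq_add//.
by have := pq x; have := pr x; have := qr x; case: (p x); case: (q x); case: (r x).
Qed.

Lemma gap_of (s : seq C) : exists2 t : R, 0 < t &
  forall z, z \in s -> complex.Re z < 0 -> complex.Re z <= - t.
Proof.
elim: s => [|y s [t t0 ih]]; first by exists 1.
exists (if complex.Re y < 0 then Num.min t (- complex.Re y) else t).
  by case: ifP => // hy; rewrite lt_min t0 oppr_gt0.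
move=> z; rewrite inE => /orP[/eqP ->|/ih h] hz.
  by rewrite hz lerNr ge_min lexx orbT.
have := h hz; case: ifP => // _ q; apply: le_trans q _.
by rewrite lerN2 ge_min lexx.
Qed.

Lemma normC_lt (z : C) (d : R) : (`|z| < real_complex R d) = (normc z < d).
Proof. by rewrite -ltcR. Qed.

Section Shifts.
Variables (n : nat) (t : 'I_n -> R) (L : R).
Hypotheses (L0 : 0 <= L) (tL : forall i, L <= t i).
Let s (i : 'I_n) : R := \sum_(j < n | (j <= i)%N) t j.

Lemma shift_ge i : L <= s i.
Proof.
rewrite /s (bigD1 i)//=; apply: le_trans (tL i) _; rewrite lerDl.
by apply: sumr_ge0 => j _; exact: le_trans (tL j).
Qed.

Lemma shift_gap (i j : 'I_n) : (i < j)%N -> s i + L <= s j.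
Proof.
move=> ij; rewrite /s [leRHS](bigD1 j)//= addrC; apply: lerD => //.
rewrite big_mkcond [leRHS]big_mkcond; apply: ler_sum => m _.
case: (leqP m i) => mi.
  by rewrite (leq_trans mi (ltnW ij)) -val_eqE/= ltn_eqF// (leq_ltn_trans mi).
by case: ifP => // _; exact: le_trans (tL m).
Qed.

(** One index type for all pulses: the left summand is the possible central one, and the boolean
    chooses the side of a symmetric pair. This turns [superposition] into the single sum used for
    families. *)
Definition pulse_center (a0 : nat) (x : 'I_a0 + 'I_n * bool) : R :=
  match x with inl _ => 0 | inr (i, b) => if b then s i else - s i end.

Lemma pulse_center_sep a0 (x y : 'I_a0 + 'I_n * bool) : (a0 < 2)%N -> x != y ->
  L <= `|pulse_center x - pulse_center y|.
Proof.
move=> a2.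
have pos i : L <= `|s i| by apply: le_trans (shift_ge i) (ler_norm _).
have two i j : L <= `|s i + s j|.
  by apply: le_trans (ler_norm _); rewrite -[L]add0r lerD ?shift_ge//; exact: le_trans (shift_ge i).
have dif i j : i != j -> L <= `|s i - s j|.
  rewrite -val_eqE neq_ltn => /orP[] /shift_gap h; last first.
    by apply: le_trans (ler_norm _); rewrite lerBrDr addrC.
  by rewrite distrC; apply: le_trans (ler_norm _); rewrite lerBrDr addrC.
case: x y => [i|[i b]] [j|[j b']] /=.
- have -> : i = j; last by rewrite eqxx.
  have z (m : 'I_a0) : val m = 0%N.
    by apply/eqP; rewrite -leqn0 -ltnS; apply: leq_trans (ltn_ord m) _; rewrite -ltnS.
  by apply: val_inj; rewrite !z.
- by move=> _; rewrite sub0r normrN; case: b' => //; rewrite normrN.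
- by move=> _; rewrite subr0; case: b => //; rewrite normrN.
move=> ne; case: b b' ne => [] [] ne.
- by apply: dif; apply: contraNneq ne => ->.
- by rewrite opprK.
- by rewrite -opprD normrN.
- rewrite opprK addrC distrC -normrN opprB; rewrite distrC; apply: dif.
  by apply: contraNneq ne => ->.
Qed.

Lemma superposition_center a0 (p : 'I_(n + a0) -> R -> 'cV[R]_2) (a : 'cV[R]_2) x i :
  superposition p a s x i 0 = a i 0 +
   \sum_(y : 'I_a0 + 'I_n * bool)
     (p (match y with inl j => rshift n j | inr (j, _) => lshift a0 j end) (x - pulse_center y) i 0 - a i 0).
Proof.
rewrite /superposition !mxE -addrA; congr (_ + _).
rewrite big_sumType /=; congr (_ + _).
  by rewrite summxE; apply: eq_bigr => j _; rewrite !mxE subr0.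
rewrite summxE.
pose F (j : 'I_n) (b : bool) := p (lshift a0 j) (x - (if b then s j else - s j)) i 0 - a i 0.
transitivity (\sum_(q : 'I_n * bool) F q.1 q.2); last by apply: eq_bigr => [[j b]] _.
rewrite -(pair_bigA _ F) /=.
apply: eq_bigr => j _; rewrite big_bool /F /= opprK !mxE; move: (p _ _ _ _) (p _ _ _ _) (a i 0) => X Y Z; ring.
Qed.

End Shifts.
End Bookkeeping.

(** * Assembly of the theorem *)

Section Main.
Variable R : realType.
Variables (zeta eps : R) (u : R -> 'cV[R]_2).

Lemma spectrum_regular M (nu : nice u M) z :
  spectrum (linearization zeta eps u) z <-> ~ regular zeta eps u z.
Proof.
have bm := mpot_bmx zeta eps nu.
by split=> h k; apply: h; [apply: (@regular_res R zeta eps u _ bm z k)|apply: (@res_regular R zeta eps u _ bm z k)].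
Qed.

(** The limit of the homoclinic orbit is identified with the prescribed end state through square
    integrability of the difference. *)
Lemma pulse_end (uinf : 'cV[R]_2) (b : 'cV[R]_2) : near_inf u b ->
  inH2 (fun x => cplx (u x - uinf)) -> b = uinf.
Proof.
move=> nb [w2 [w1 [/inL2P h _ _ _ _]]]; apply: (L2_limit nb) => i.
have := h true i; congr L2; apply/funext => x.
by rewrite /cmp /cplx !mxE.
Qed.

Lemma upos_small (f : R) Uinf : 0 < eps -> saddle_focus zeta f eps Uinf ->
  upos Uinf 0 0 ^+ 2 + upos Uinf 1 0 ^+ 2 < eps.
Proof.
move=> e0 /(saddle_small e0).
have -> : upos Uinf 0 0 = Uinf 0 0 by rewrite mxE; congr (Uinf _ _); exact: val_inj.
by have -> : upos Uinf 1 0 = Uinf 1 0 by rewrite mxE; congr (Uinf _ _); exact: val_inj.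
Qed.

End Main.

Theorem theorem5 (R : realType) (zeta f eps : R)
    (* the fixed families of primary 1-pulses, indexed by the angle *)
    (Cst epsst : R -> R) (uinf : R -> R -> 'cV[R]_2)
    (u : R -> R -> R -> 'cV[R]_2)
    (N l : nat) (theta : 'I_(N %/ 2 + N %% 2) -> R) (u_end : 'cV[R]_2)
    (* the fixed family of N-pulses *)
    (delta0 C0 : R) (T : 'I_(N %/ 2) -> nat -> R)
    (U : ('I_(N %/ 2) -> nat) -> R -> 'cV[R]_2) :
  0 < zeta -> 0 < f -> 0 < eps ->
  (forall th, admissible_angle zeta f th ->
     primary_family zeta f th (Cst th) (epsst th) (uinf th) (u th)) ->
  (0 < N)%N -> (l < N)%N ->
  (forall i, [/\ admissible_angle zeta f (theta i), eps < epsst (theta i) &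
                 uinf (theta i) eps = u_end]) ->
  Npulse_family zeta f eps N l (fun i => u (theta i) eps) u_end delta0 C0 T U ->
  ((forall i, spectrally_stable zeta f eps (u (theta i) eps)) ->
   exists k0 : nat, (0 < k0)%N /\
     forall k : 'I_(N %/ 2) -> nat, (forall i, (0 < k i)%N) ->
       (k0%:R%:E <= kmin R k)%E ->
       (l = (N - 1)%N -> spectrally_stable zeta f eps (U k)) /\
       (l <> (N - 1)%N -> spectrally_unstable zeta f eps (U k)))
  /\
  ((exists i, spectrally_unstable zeta f eps (u (theta i) eps)) ->
   exists k0 : nat, (0 < k0)%N /\
     forall k : 'I_(N %/ 2) -> nat, (forall i, (0 < k i)%N) ->
       (k0%:R%:E <= kmin R k)%E ->
       spectrally_unstable zeta f eps (U k)).
Proof.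
move=> hz hf he hfam hN hl hth [del0 C00 hT hU].
set n := (N %/ 2)%N in theta T U hth hT hU *; set a0 := (N %% 2)%N in theta hth hU *.
have a02 : (a0 < 2)%N by rewrite ltn_mod.
pose p i := u (theta i) eps.
have pf i : [/\ stationary zeta f eps (p i), near_inf (p i) u_end &
    u_end 0 0 ^+ 2 + u_end 1 0 ^+ 2 < eps].
  have [ad le ue] := hth i; have [c0 [es0 h]] := hfam _ ad.
  have [|[_ _ st] [_ _ h2] _ _ [Uinf [ho _ sf]]] := h eps; first by rewrite he.
  have ni := homoclinic_near ho; rewrite ue in h2.
  by have e := pulse_end ni h2; split => //; rewrite -e //; exact: upos_small sf.
have na0 : (0 < n + a0)%N.
  rewrite lt0n; apply: contraTneq hN => /eqP; rewrite addn_eq0 => /andP[/eqP h1 /eqP h2].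
  by rewrite (divn_eq N 2) -/n -/a0 h1 h2.
have hm : u_end 0 0 ^+ 2 + u_end 1 0 ^+ 2 < eps by case: (pf (Ordinal na0)).
(* A quarter of the gap leaves room for the end states of the $N$-pulses, which are only close to
   [u_end]. *)
pose g := (eps - (u_end 0 0 ^+ 2 + u_end 1 0 ^+ 2)) / 4.
have g0 : 0 < g by rewrite divr_gt0// subr_gt0.
have hg4 : u_end 0 0 ^+ 2 + u_end 1 0 ^+ 2 + 4 * g = eps by rewrite /g; field.
have nice_ex i : exists M, nice (p i) M.
  by have [st ni _] := pf i; exact: nice_of st ni.
have [Mi hMi] := choice nice_ex.
pose A := `|u_end 0 0| + `|u_end 1 0|.
have hA i : `|u_end i 0| <= A.
  case: i => [[|[|//]] hi]; first by rewrite (_ : Ordinal hi = 0) ?lerDl//; exact: val_inj.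
  by rewrite (_ : Ordinal hi = 1) ?lerDr//; exact: val_inj.
have A0 : 0 <= A by rewrite addr_ge0.
pose M := A + \sum_i `|Mi i|.
have S0 : 0 <= \sum_i `|Mi i| by apply: sumr_ge0.
have M0 : 0 <= M by rewrite addr_ge0.
have nM i : nice (p i) M.
  have [m b] := hMi i; split => // x j; apply: le_trans (b x j) _.
  apply: le_trans (ler_norm _) _; rewrite /M (bigD1 i)//= addrCA lerDl addr_ge0//.
  by apply: sumr_ge0.
have ha i : `|u_end i 0| <= M by apply: le_trans (hA i) _; rewrite lerDl.
pose I : finType := ('I_a0 + 'I_n * bool)%type.
pose ix (y : I) : 'I_(n + a0) := match y with inl j => rshift n j | inr (j, _) => lshift a0 j end.
pose P (y : I) := p (ix y).
pose cen (k : 'I_n -> nat) (y : I) : R := @pulse_center R n (fun i => T i (k i)) a0 y.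
have err k x i : (forall i, (0 < k i)%N) -> forall k0, (0 < k0)%N -> (forall i, (k0 <= k i)%N) ->
    `|U k x i 0 - u_end i 0 - \sum_y (P y (x - cen k y) i 0 - u_end i 0)| <= C0 / k0%:R.
  move=> kp k0 k00 hk; have [_ /(_ x) hx _ _] := hU k kp.
  have := err_le C00 k00 (kmin_lb R hk) hx; apply: le_trans.
  apply: le_trans (enorm_ge _ i); rewrite mxE [X in _ <= `|_ + X|]mxE.
  have -> := @superposition_center R n (fun i => T i (k i)) a0 p u_end x i.
  by rewrite opprD addrA.
(* A common bound for all $N$-pulses: the superposition is at most $M+2M\cdot$ [#|I|], and the error
   at most [C0] since all indices are at least 1. *)
pose M' := 3 * M * (1 + #|I|%:R) + C0.
have I0 : 0 <= #|I|%:R :> R by exact: ler0n.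
have MM : M <= M'.
  by rewrite /M'; have := mulr_ge0 M0 I0; move: M0 C00; lra.
have D2 y x i : `|P y x i 0 - u_end i 0| <= 2 * M.
  have := (nM (ix y)).2 x i; have := ha i; have := ler_normB (P y x i 0) (u_end i 0).
  rewrite /P; lra.
have Ustat k : (forall i, (0 < k i)%N) -> [/\ stationary zeta f eps (U k),
    exists2 V, near_inf (U k) V & V 0 0 ^+ 2 + V 1 0 ^+ 2 < eps & nice (U k) M'].
  move=> kp; have [[_ _ st] _ _ [Uinf [ho _ sf]]] := hU k kp.
  split => //; first by exists (upos Uinf); [exact: homoclinic_near ho|exact: upos_small sf].
  split=> [i|x i].
    by apply: continuous_measurable_fun; exact: stationary_cont st.
  have e1 := err k x i kp 1%N isT kp; rewrite divr1 in e1.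
  have e2 : `|\sum_y (P y (x - cen k y) i 0 - u_end i 0)| <= #|I|%:R * (2 * M).
    apply: le_trans (ler_norm_sum _ _ _) _.
    apply: le_trans (ler_sum _ (fun y _ => D2 y (x - cen k y) i)) _.
    by rewrite sumr_const [leRHS]mulr_natl.
  move: e1 e2; set s := \sum_y _ => e1 e2.
  have -> : U k x i 0 = (U k x i 0 - u_end i 0 - s) + (u_end i 0 + s) by ring.
  apply: le_trans (ler_normD _ _) _.
  have := ler_normD (u_end i 0) s; have := ha i; have := mulr_ge0 M0 I0.
  by rewrite /M'; move: M0; lra.
(* A state within [tt] of [u_end] in each component has squared length at most that of [u_end] plus
   $2g$. *)
pose tt := Num.min 1 (g / (2 * A + 1)).
have A1 : 0 < 2 * A + 1 by lra.
have tt0 : 0 < tt by rewrite lt_min ltr01 divr_gt0.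
have tt1 : tt <= 1 by rewrite ge_min lexx.
have tt2 : tt * (2 * A + 1) <= g by rewrite -ler_pdivlMr// ge_min lexx orbT.
pose k1 := (Num.truncn (2 * C0 / tt)).+1.
have k1C : C0 / k1%:R <= tt / 2.
  have := Num.Theory.truncnS_gt (2 * C0 / tt); rewrite -/k1 ltr_pdivrMr// => h.
  by rewrite ler_pdivrMr ?ltr0n//; move: h; lra.
have infP y : near_inf (P y) u_end by case: (pf (ix y)).
(* The hypotheses provide some saddle-focus as end state of an $N$-pulse, not its position.
   Evaluating the superposition far beyond all centres locates it near [u_end]. *)
have close k V : (forall i, (k1 <= k i)%N) -> near_inf (U k) V -> forall i, `|V i 0 - u_end i 0| <= tt.
  move=> hk nV i; have kp j : (0 < k j)%N by apply: leq_trans (hk j).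
  pose t := tt / (2 * (1 + #|I|%:R)).
  have I1 : 0 < 2 * (1 + #|I|%:R) :> R by lra.
  have t0 : 0 < t by rewrite divr_gt0.
  have tE : t * (1 + #|I|%:R) = tt / 2 by rewrite /t; field; rewrite gt_eqF//; lra.
  have [Y hY] := nV t t0; have [Z Z0 hZ] := unif_inf infP t0.
  pose cs := \sum_y `|cen k y|; pose x := `|Y| + Z + cs.
  have cs0 : 0 <= cs by apply: sumr_ge0.
  have e1 := err k x i kp k1 isT hk.
  have x0 : 0 <= x by rewrite !addr_ge0.
  have e2 : `|\sum_y (P y (x - cen k y) i 0 - u_end i 0)| <= #|I|%:R * t.
    apply: le_trans (ler_norm_sum _ _ _) _.
    apply: (@le_trans _ _ (\sum_(y : I) t)); last by rewrite sumr_const [leRHS]mulr_natl.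
    apply: ler_sum => y _; apply: hZ.
    have q : cen k y <= cs.
      apply: le_trans (ler_norm _) _; rewrite /cs (bigD1 y)//= lerDl.
      by apply: sumr_ge0.
    by apply: le_trans (ler_norm _); have := normr_ge0 Y; rewrite /x; lra.
  have e3 : `|U k x i 0 - V i 0| <= t.
    by apply: hY; rewrite (ger0_norm x0); have := ler_norm Y; rewrite /x; lra.
  move: e1 e2; set s := \sum_y _ => e1 e2.
  have -> : V i 0 - u_end i 0 = (U k x i 0 - u_end i 0 - s) + s - (U k x i 0 - V i 0) by ring.
  apply: le_trans (ler_normB _ _) _.
  have := ler_normD (U k x i 0 - u_end i 0 - s) s; move: k1C tE; rewrite mulrDr mulr1; lra.
(* The shift by [k1] guarantees that every member has its end state within [tt] of [u_end]. *)
pose fam m v := exists2 k : 'I_n -> nat, (forall i, (m + k1 <= k i)%N) & v = U k.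
have famS k k' v : (k <= k')%N -> fam k' v -> fam k v.
  by move=> kk [k2 h ->]; exists k2 => // i; apply: leq_trans (h i); rewrite leq_add2r.
have famN v : fam 1%N v -> nice v M' /\ exists2 Y, 0 < Y &
    forall x, Y < `|x| -> v x 0 0 ^+ 2 + v x 1 0 ^+ 2 <= eps - g.
  move=> [k hk ->]; have kp i : (0 < k i)%N by apply: leq_trans (hk i).
  have hk1 i : (k1 <= k i)%N by apply: leq_trans (hk i); rewrite leq_addl.
  have [_ [V nV _] nU] := Ustat k kp; split => //; apply: (far_of nV g0).
  have cl := close k V hk1 nV.
  have sq i : V i 0 ^+ 2 <= u_end i 0 ^+ 2 + tt * (2 * `|u_end i 0|) + tt * tt.
    have -> : V i 0 ^+ 2 = u_end i 0 ^+ 2 + 2 * (u_end i 0 * (V i 0 - u_end i 0))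
       + (V i 0 - u_end i 0) ^+ 2 by ring.
    have q1 : u_end i 0 * (V i 0 - u_end i 0) <= `|u_end i 0| * tt.
      by apply: le_trans (ler_norm _) _; rewrite normrM ler_wpM2l.
    have q2 : (V i 0 - u_end i 0) ^+ 2 <= tt * tt.
      by rewrite -real_normK ?num_real// expr2 ler_pM.
    lra.
  have q : tt * tt <= tt by rewrite ler_piMr// ltW.
  have := mulr_ge0 (ltW tt0) A0; have := sq 0; have := sq 1; move: tt2 hg4 g0 tt0 q; rewrite /A.
  move: (g) (tt) (tt * tt) => g' t' t2; lra.
have famP (eta L : R) : 0 < eta -> 0 <= L -> exists k, forall v, fam k v ->
    exists c : I -> R, (forall j l, j != l -> L <= `|c j - c l|) /\
     (forall x i, `|v x i 0 - u_end i 0 - \sum_j (P j (x - c j) i 0 - u_end i 0)| <= eta).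
  move=> eta0 L0.
  have [K hK] : exists K : nat, forall m, (K <= m)%N -> forall i, L <= T i m.
    have ev i : \forall m \near \oo, L <= T i m.
      by have [_ _ /cvgryPge/(_ L)] := hT i.
    have [K _ h] : \forall m \near \oo, forall i, L <= T i m by apply: filter_forall.
    by exists K => m Km; exact: h.
  pose k0 := (Num.truncn (C0 / eta)).+1.
  have k0C : C0 / k0%:R <= eta.
    rewrite ler_pdivrMr ?ltr0n// mulrC -ler_pdivrMr//.
    exact/ltW/Num.Theory.truncnS_gt.
  exists (maxn K k0) => v [k hk ->]; exists (cen k).
  have hK' i : (K <= k i)%N.
    by apply: leq_trans (hk i); apply: leq_trans (leq_addr _ _); exact: leq_maxl.
  have hk0 i : (k0 <= k i)%N.
    by apply: leq_trans (hk i); apply: leq_trans (leq_addr _ _); exact: leq_maxr.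
  have kp i : (0 < k i)%N by apply: leq_trans (hk0 i).
  split=> [j j' jl|x i]; last by apply: le_trans (err k x i kp k0 isT hk0) k0C.
  by apply: pulse_center_sep => // i; exact: hK.
have hg2 : u_end 0 0 ^+ 2 + u_end 1 0 ^+ 2 + 2 * g <= eps by move: hg4 g0; lra.
have nPM y : nice (P y) M := nM (ix y).
have toFam (k : 'I_n -> nat) (m : nat) : ((m + k1)%:R%:E <= kmin R k)%E -> fam m (U k).
  by move=> /kmin_ge hk; exists k.
split=> [stab|[i unst]]; last first.
  have [y iy] : exists y, ix y = i.
    case: (split_ordP i) => j ->; last by exists (inl j).
    by exists (inr (j, true)).
  have [_ _ [zs [sp rz]]] := unst.
  have nreg : ~ regular zeta eps (P y) zs by apply: (spectrum_regular zeta eps (nPM y) zs).1; rewrite /P iy.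
  have [k hk] := family_unstable nPM infP ha MM g0 hg2 famS famN famP rz nreg.
  exists (k.+1 + k1)%N; split; first by rewrite addSn.
  move=> kk kp /toFam fk; have [st _ nU] := Ustat kk kp.
  split; [exact: st|exact: nice_bounded nU|].
  have [z z0 hzr] := hk _ fk; exists z; split; last exact: z0.
  exact: (spectrum_regular zeta eps nU z).2 hzr.
have stP j : exists t, 0 < t /\ forall z, - t < complex.Re z -> z != 0 -> regular zeta eps (p j) z.
  have [_ _ [t [t0 ht]] _] := stab j; exists t; split; first exact: t0.
  move=> z hz1 z0; apply: contrapT => nr.
  have [h|h] := ht z ((spectrum_regular zeta eps (nM j) z).2 nr); last by rewrite h eqxx in z0.
  by move: h; rewrite leNgt hz1.
have [tj htj] := choice stP; have [t t0 ht] := common_pos (fun j => (htj j).1).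
(* Strictly below the spectral gaps of all pulses and below the rate [g] of the background. *)
pose tau := Num.min t g / 2.
have tau0 : 0 < tau by rewrite divr_gt0// lt_min t0.
have taut : tau < t by have : Num.min t g <= t by [rewrite ge_min lexx]; rewrite /tau; lra.
have taug : tau < g by have : Num.min t g <= g by [rewrite ge_min lexx orbT]; rewrite /tau; lra.
have regP j z : - tau <= complex.Re z -> z != 0 -> regular zeta eps (P j) z.
  move=> hz1; apply: (htj (ix j)).2; apply: lt_le_trans hz1.
  by rewrite ltrN2; exact: lt_le_trans (ht _).
have [k hk] := family_regular nPM infP ha MM g0 hg2 famS famN famP tau0 taug del0 regP.
exists (k.+1 + k1)%N; split; first by rewrite addSn.
move=> kk kp /toFam fk; have [st [V nV _] nU] := Ustat kk kp.
have [_ _ [s [hs hmul ssz [cneg cpos] c0]] _] := hU kk kp.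
(* If [l = N - 1], the ball of radius [delta0] contributes only 0 and finitely many eigenvalues of
   negative real part, which have a gap. Otherwise one of the $N-1-\ell>0$ eigenvalues of positive
   real part gives instability. *)
split=> hlN.
  have cp0 : count (fun z => 0 < complex.Re z) s = 0%N by rewrite cpos hlN subnn.
  have [gp gp0 hgap] := gap_of s.
  split; [exact: st|by exists V; exact: near_inf_tends| |]; last first.
    have h := hmul 0; rewrite c0 in h; apply: h.
    by rewrite -has_pred1 has_count c0.
  exists (Num.min tau gp); split; first by rewrite lt_min tau0.
  move=> z sz; have nr := (spectrum_regular zeta eps nU z).1 sz.
  have mt : Num.min tau gp <= tau by rewrite ge_min lexx.
  have mg : Num.min tau gp <= gp by rewrite ge_min lexx orbT.
  case: (ltP (complex.Re z) (- tau)) => h1.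
    by left; apply: le_trans (ltW h1) _; rewrite lerN2.
  case: (ltP (Normc.normc z) delta0) => h2; last by case: nr; exact: (hk _ z fk h1 h2).
  have zs : z \in s by apply/hs; split; [exact: sz|rewrite normC_lt].
  case: (ltgtP (complex.Re z) 0) => hz0.
  - by left; apply: le_trans (hgap z zs hz0) _; rewrite lerN2.
  - have : has (fun z => 0 < complex.Re z) s by apply/hasP; exists z.
    by rewrite has_count cp0.
  right; apply/eqP; apply/negPn/negP => z0.
  (* A nonzero eigenvalue on the imaginary axis would be one too many: $N-1$ negative ones and the
     simple 0 already exhaust the list of length $N$. *)
  have d1 (y : R[i]) : ~~ ((complex.Re y < 0) && (y == 0)).
    by apply/negP => /andP[h /eqP hy]; rewrite hy ltxx in h.
  have d2 (y : R[i]) : ~~ ((complex.Re y < 0) && (y == z)).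
    by apply/negP => /andP[h /eqP hy]; rewrite hy hz0 ltxx in h.
  have d3 (y : R[i]) : ~~ ((y == 0) && (y == z)).
    by apply/negP => /andP[/eqP -> /eqP h]; rewrite -h eqxx in z0.
  have hc := @count_disjoint _ (fun y => complex.Re y < 0) (pred1 0) (pred1 z) s d1 d2 d3.
  have cz : (0 < count_mem z s)%N by rewrite -has_count has_pred1.
  rewrite cneg c0 hlN ssz subnK// in hc.
  by move: hc; rewrite leqNgt -[X in (X < _)%N]addn0 ltn_add2l cz.
have : has (fun z => 0 < complex.Re z) s.
  rewrite has_count cpos subn_gt0 ltn_neqAle; apply/andP; split; first exact/eqP.
  by rewrite subn1 -ltnS prednK.
move=> /hasP[z zs z0]; split; [exact: st|exact: nice_bounded nU|].
by exists z; split; last exact: z0; have /hs[] := zs.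
Qed.
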